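(* Let $n\ge 1$ be an integer, let $0<\alpha<1$, and let $\psi:\mathbb{R}_+\to\mathbb{R}$ be such that the vector field $b(x)=-\frac{x}{|x|}\psi(|x|)$ belongs to $C^{\alpha}(\mathbb{R}^n)$. Assume that $$\liminf_{r\to\infty}\frac{1}{\log r}\int_0^r\psi(\rho)\,d\rho>n.$$ Let $u_0\in C^{2+\alpha}(\mathbb{R}^n)$ satisfy $u_0\ge 0$ and $u_0\not\equiv 0$, and assume in addition that $u_0$ is rotationally symmetric and monotonically decreasing in radial direction. Then there is a unique positive solution $u\in C^{2+\alpha,\,1+\alpha/2}(\mathbb{R}^n\times\mathbb{R}_+)$ of $$\begin{cases}\dot u=\Delta u-\left\langle\frac{x}{|x|}\psi(|x|),\,\nabla u\right\rangle&\text{in }\mathbb{R}^n\times\mathbb{R}_+,\\ u(\cdot,0)=u_0&\text{in }\mathbb{R}^n,\end{cases}$$ and this $u$ is rotationally symmetric (in $x$, for every $t$) and satisfies $$\lim_{t\to\infty}\sup_{x\in\mathbb{R}^n}u(x,t)=\inf_{x\in\mathbb{R}^n}\lim_{t\to\infty}u(x,t)>0.$$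
   Context: $\mathbb{R}_+=[0,\infty)$; $\dot u$ denotes the time derivative, and $\Delta$, $\nabla$ are taken in the spatial variable $x\in\mathbb{R}^n$. $C^{\alpha}(\mathbb{R}^n)$ denotes the space of uniformly bounded functions (or vector fields) on $\mathbb{R}^n$ having bounded Hölder semi-norm with exponent $\alpha$; the vector field $b(x)=-\frac{x}{|x|}\psi(|x|)$ is understood as extended continuously to $x=0$. $C^{2+\alpha}(\mathbb{R}^n)$ denotes the functions that are bounded together with their derivatives up to order two, and whose second derivatives have bounded Hölder semi-norm with exponent $\alpha$. $C^{2+\alpha,1+\alpha/2}(\mathbb{R}^n\times\mathbb{R}_+)$ is the corresponding parabolic Hölder space: $u$, $\nabla u$, $D^2u$, $\dot u$ are uniformly bounded on $\mathbb{R}^n\times\mathbb{R}_+$, and $D^2u$, $\dot u$ have globally bounded Hölder semi-norm with exponent $\alpha$ in $x$ and $\alpha/2$ in $t$. A function $f$ on $\mathbb{R}^n$ is rotationally symmetric if $f(Rx)=f(x)$ for all orthogonal $R$ and all $x$; it is monotonically decreasing in radial direction if $[0,\infty)\ni\lambda\mapsto f(\lambda x)$ is monotonically decreasing (not necessarily strictly) for every $x\in\mathbb{R}^n$. A positive solution means a solution with $u(x,t)>0$ for all $x\in\mathbb{R}^n$, $t>0$. *)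

(* Defs.v *)
From HB Require Import structures.
From mathcomp Require Export all_boot all_order all_algebra.
From mathcomp Require Export all_classical all_reals all_analysis.

Set Implicit Arguments.
Unset Strict Implicit.
Unset Printing Implicit Defensive.

Export Order.TTheory GRing.Theory Num.Theory.
Export numFieldNormedType.Exports.

Local Open Scope classical_set_scope.
Local Open Scope ring_scope.

Definition dotv (R : realType) (n : nat) (x y : 'rV[R]_n) : R :=
  \sum_(i < n) x 0 i * y 0 i.

(* The library norm `|x| on 'rV[R]_n is the max norm, hence this one. *)
Definition enorm (R : realType) (n : nat) (x : 'rV[R]_n) : R :=
  Num.sqrt (dotv x x).

Definition partial (R : realType) (n : nat) (i : 'I_n) (f : 'rV[R]_n -> R) :
    'rV[R]_n -> R :=
  fun x => 'D_(delta_mx 0 i) f x.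

Definition gradient (R : realType) (n : nat) (f : 'rV[R]_n -> R)
    (x : 'rV[R]_n) : 'rV[R]_n :=
  \row_i partial i f x.

Definition hessian (R : realType) (n : nat) (f : 'rV[R]_n -> R)
    (x : 'rV[R]_n) : 'M[R]_n :=
  \matrix_(i, j) partial j (partial i f) x.

Definition laplacian (R : realType) (n : nat) (f : 'rV[R]_n -> R)
    (x : 'rV[R]_n) : R :=
  \sum_(i < n) partial i (partial i f) x.

(* Existence of all first and second order partial derivatives; continuity
   comes from the Hoelder bounds imposed on the Hessian below. *)
Definition has_partials2 (R : realType) (n : nat) (f : 'rV[R]_n -> R) : Prop :=
  forall (i : 'I_n) (x : 'rV[R]_n),
    derivable f x (delta_mx 0 i) /\
    forall j : 'I_n, derivable (partial i f) x (delta_mx 0 j).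

(* W is R, 'rV[R]_n or 'M[R]_n below; the norm on the latter two is the
   maximum of the absolute values of the entries. *)
Definition hoelder (R : realType) (n : nat) (W : normedModType R) (a : R)
    (f : 'rV[R]_n -> W) : Prop :=
  exists C : R, forall x y, `|f x - f y| <= C * enorm (x - y) `^ a.

Definition C_alpha (R : realType) (n : nat) (W : normedModType R) (a : R)
    (f : 'rV[R]_n -> W) : Prop :=
  bounded_fun f /\ hoelder a f.

Definition C_2alpha (R : realType) (n : nat) (a : R)
    (f : 'rV[R]_n -> R) : Prop :=
  [/\ has_partials2 f, bounded_fun f, bounded_fun (gradient f),
      bounded_fun (hessian f) & hoelder a (hessian f)].

(* Functions on R^n x [0, +oo[ are total functions u : 'rV[R]_n -> R -> R of
   which only the values at times t >= 0 matter: increments of time are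
   restricted to t + h >= 0, so that the time derivative at t = 0 is the
   right derivative. *)
Definition time_quotient (R : realType) (n : nat) (u : 'rV[R]_n -> R -> R)
    (x : 'rV[R]_n) (t : R) : set_system R :=
  (h^-1 * (u x (t + h) - u x t))
    @[h --> within [set h : R | 0 <= t + h] (dnbhs (0 : R))].

Definition time_derivable (R : realType) (n : nat) (u : 'rV[R]_n -> R -> R)
    (x : 'rV[R]_n) (t : R) : Prop :=
  cvg (time_quotient u x t).

Definition time_derive (R : realType) (n : nat) (u : 'rV[R]_n -> R -> R)
    (x : 'rV[R]_n) (t : R) : R :=
  lim (time_quotient u x t).

Definition bounded_xt (R : realType) (n : nat) (W : normedModType R)
    (f : 'rV[R]_n -> R -> W) : Prop :=
  exists M : R, forall x t, 0 <= t -> `|f x t| <= M.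

Definition hoelder_xt (R : realType) (n : nat) (W : normedModType R) (a : R)
    (f : 'rV[R]_n -> R -> W) : Prop :=
  exists C : R, forall x y s t, 0 <= s -> 0 <= t ->
    `|f x s - f y t| <= C * (enorm (x - y) `^ a + `|s - t| `^ (a / 2)).

Definition C_2alpha_parabolic (R : realType) (n : nat) (a : R)
    (u : 'rV[R]_n -> R -> R) : Prop :=
  let Du := fun x t => gradient (u ^~ t) x in
  let D2u := fun x t => hessian (u ^~ t) x in
  [/\ forall t, 0 <= t -> has_partials2 (u ^~ t),
      forall x t, 0 <= t -> time_derivable u x t,
      [/\ bounded_xt u, bounded_xt Du, bounded_xt D2u
        & bounded_xt (time_derive u)],
      hoelder_xt a D2u
    & hoelder_xt a (time_derive u)].

(* The field (x / |x|) psi(|x|). Its value at x = 0 is 0 here; since the field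
   is odd, this is the only value a continuous extension to 0 can take. *)
Definition radial_field (R : realType) (n : nat) (psi : R -> R)
    (x : 'rV[R]_n) : 'rV[R]_n :=
  psi (enorm x) *: ((enorm x)^-1 *: x).

Definition rot_symmetric (R : realType) (n : nat) (f : 'rV[R]_n -> R) : Prop :=
  forall (Q : 'M[R]_n) (x : 'rV[R]_n), Q *m Q^T = 1%:M -> f (x *m Q) = f x.

Definition radially_decreasing (R : realType) (n : nat)
    (f : 'rV[R]_n -> R) : Prop :=
  forall (x : 'rV[R]_n) (l m : R), 0 <= l -> l <= m -> f (m *: x) <= f (l *: x).

Definition positive_solution (R : realType) (n : nat) (a : R) (psi : R -> R)
    (u0 : 'rV[R]_n -> R) (u : 'rV[R]_n -> R -> R) : Prop :=
  [/\ C_2alpha_parabolic a u,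
      forall x t, 0 < t -> 0 < u x t,
      forall x t, 0 <= t ->
        time_derive u x t = laplacian (u ^~ t) x
          - dotv (radial_field psi x) (gradient (u ^~ t) x)
    & forall x, u x 0 = u0 x].

(* Main.v *)
Require Import Defs.
From mathcomp Require Import ring lra measurable_realfun.

Set Implicit Arguments.
Unset Strict Implicit.
Unset Printing Implicit Defensive.

Local Open Scope classical_set_scope.
Local Open Scope ring_scope.

(** Existence. For large [lam] the gradient of [exp (- lam t) (u - u0)] is the fixed point of a contraction built from the potential [V] of the heat semigroup damped by [exp (- lam t)]; all derivatives are moved onto products of one-dimensional Gaussian kernels, and Hölder bounds of the source make the second derivatives of [V] converge. The maximum principle bounds [u] uniformly in time, and rewriting [u - u0] itself as a potential turns this into uniform bounds for its derivatives.

Asymptotics. Uniqueness makes [u] rotation invariant, and comparing [u x] with [u y] on [|y| < |x|] makes it radially decreasing, so that [sup u = u 0 t], which is nonincreasing by comparison; let [l] be its limit. A subsolution supported in a growing ball shows that [u 0 t - u] cannot stay away from zero near any point, hence [u x t] tends to [l] for all [x].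

Positivity of [l]. Along an axis the elliptic operator, multiplied by the weight [r^(n-1) exp (- int_0^r psi)], is an exact derivative: the weighted mass of [u] on [[1, r]] has time derivative equal to the flux at [r], small for suitable [r], minus the flux at [1], which is nonpositive. As the liminf exceeds [n], the weight is integrable, so the mass bounds [u 0 t] from below. *)

(** The drift is merely Hölder continuous and cannot be differentiated, so second derivatives come
    from the cancellation in the kernels alone. With w = exp (- lam t) (u - u0) and f = Delta u0 + b
    . grad u0 the equation reads w_t = Delta w - lam w + b . grad w + exp (- lam t) f. The system
    for grad w is closed, and one derivative of the semigroup costs s^(-1/2), whose damped integral
    is of order lam^(-1/2): sup bounds alone give the contraction, on all times at once. Undoing the
    damping costs exp (lam t). Hence the second representation of u - u0, with the source lam (u -
    u0) + b . grad (u - u0) + f, which the maximum principle and an absorption argument bound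
    independently of time.

    Integrals over R^n do not occur: the heat kernel is a product, integrals are iterated one
    coordinate at a time, and Hölder conditions are imposed along the axes. The mass is likewise
    one-dimensional. It starts at radius 1, away from the singular coefficient (n - 1) / r, and at
    time 1, when u is already positive. *)

(** * Mean value and Taylor inequalities in one variable *)

Section calculus.
Context {R : realType}.
Implicit Types f g df : R -> R.

Lemma is_derive_continuous f (x d : R) : is_derive x 1 f d -> {for x, continuous f}.
Proof. by move=> H; apply/differentiable_continuous/derivable1_diffP. Qed.

Lemma mvt_le f df (a b M : R) : a <= b ->
  (forall x, a <= x <= b -> is_derive x 1 f (df x)) ->
  (forall x, a <= x <= b -> `|df x| <= M) ->
  `|f b - f a| <= M * (b - a).
Proof.
move=> ab H HM.
have [||c] := @MVT_segment R f df a b ab.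
- by move=> x; rewrite in_itv /= => /andP[ax xb]; apply: H; rewrite !ltW.
- apply: continuous_in_subspaceT => x; rewrite inE /= in_itv /= => abx.
  exact: is_derive_continuous (H _ abx).
rewrite in_itv /= => abc ->; rewrite normrM (ger0_norm (x := b - a)) ?subr_ge0//.
by rewrite ler_wpM2r ?subr_ge0// HM.
Qed.

Lemma mvt_norm f df (h M : R) :
  (forall x : R, `|x| <= `|h| -> is_derive x 1 f (df x)) ->
  (forall x : R, `|x| <= `|h| -> `|df x| <= M) ->
  `|f h - f 0| <= M * `|h|.
Proof.
move=> H HM; case: (leP 0 h) => h0.
  rewrite (ger0_norm h0) -{2}(subr0 h); apply: (@mvt_le _ df) => // x /andP[x0 xh];
  by (apply: H || apply: HM); rewrite !ger0_norm.
rewrite (ltr0_norm h0) distrC -(sub0r h); apply: (@mvt_le _ df); first exact: ltW.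
all: by move=> x /andP[x0 xh]; (apply: H || apply: HM); rewrite (ltr0_norm h0) ler0_norm// lerN2.
Qed.

Lemma taylor2 f df (ddf : R -> R) (h M : R) :
  (forall x : R, `|x| <= `|h| -> is_derive x 1 f (df x)) ->
  (forall x : R, `|x| <= `|h| -> is_derive x 1 df (ddf x)) ->
  (forall x : R, `|x| <= `|h| -> `|ddf x| <= M) ->
  `|f h - f 0 - h * df 0| <= M * h ^+ 2.
Proof.
move=> H1 H2 HM.
pose g x := f x - x * df 0.
have -> : f h - f 0 - h * df 0 = g h - g 0 by rewrite /g; ring.
have -> : M * h ^+ 2 = M * `|h| * `|h| by rewrite -mulrA -expr2 real_normK ?num_real.
apply: (@mvt_norm g (fun x => df x - df 0)) => x xh.
  have := H1 _ xh => ?.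
  by apply: is_derive_eq; rewrite /GRing.scale /=; ring.
apply: (le_trans (y := M * `|x|)).
  apply: (@mvt_norm df ddf) => y yx; first by apply: H2; exact: le_trans xh.
  by apply: HM; exact: le_trans xh.
apply: ler_wpM2l => //; apply: le_trans (HM 0 _) => //.
by rewrite normr0.
Qed.

End calculus.

(** * Hermite functions and the one-dimensional heat kernel *)

Section kernels.
Context {R : realType}.
Local Notation mu := (@lebesgue_measure R).

(** Pairs of consecutive terms, because the Hermite recurrence has two predecessors. [hk k] is the
    k-th derivative of the Gaussian density exp (- y^2) / sqrt pi, that is, up to sign, the k-th
    Hermite polynomial times this density. *)
Fixpoint hpair (k : nat) (y : R) : R * R :=
  if k is k'.+1 then
    let p := hpair k' y in (p.2, - 2 * y * p.2 - 2 * k'.+1%:R * p.1)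
  else (expR (- y ^+ 2) / Num.sqrt pi, - 2 * y * (expR (- y ^+ 2) / Num.sqrt pi)).

Definition hk k y := (hpair k y).1.

Lemma hkSS k y : hk k.+2 y = - 2 * y * hk k.+1 y - 2 * k.+1%:R * hk k y.
Proof. by []. Qed.

Lemma hk0 y : hk 0 y = expR (- y ^+ 2) / Num.sqrt pi. Proof. by []. Qed.

Lemma hk1 y : hk 1 y = - 2 * y * hk 0 y. Proof. by []. Qed.

Global Instance is_derive_hk k (y : R) : is_derive y 1 (hk k) (hk k.+1 y).
Proof.
suff: is_derive y 1 (hk k) (hk k.+1 y) /\ is_derive y 1 (hk k.+1) (hk k.+2 y) by case.
elim: k => [|k [IH1 IH2]].
  have H0 : is_derive y 1 (hk 0) (hk 1 y).
    rewrite (_ : hk 0 = fun y => expR (- y ^+ 2) * (Num.sqrt pi)^-1); last exact/funext.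
    by apply: is_derive_eq; rewrite hk1 hk0 /GRing.scale /=; ring.
  split => //; rewrite (_ : hk 1 = fun y => - 2 * y * hk 0 y); last exact/funext.
  by apply: is_derive_eq; rewrite hkSS /GRing.scale /=; ring.
split => //; rewrite (_ : hk k.+2 = fun y => - 2 * y * hk k.+1 y - 2 * k.+1%:R * hk k y); last exact/funext.
apply: is_derive_eq; rewrite (hkSS k.+1) /GRing.scale /=.
by rewrite -(natr1 k.+1); ring.
Qed.

(** exp (y^2) is the m-th power of exp (y^2 / m) >= 1 + y^2 / m, and 1 + y^2 <= (m + 1) (1 + y^2 /
    m); this is where (m + 1)^m comes from. *)
Lemma expR_sqr_ge (m : nat) : exists2 C : R, 0 < C &
  forall y : R, (1 + y ^+ 2) ^+ m * expR (- y ^+ 2) <= C.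
Proof.
exists (m.+1%:R ^+ m) => [|y]; first by rewrite exprn_gt0// ltr0n.
rewrite expRN ler_pdivrMr ?expR_gt0//.
have [->|m0] := eqVneq m 0%N.
  rewrite !expr0 mul1r; apply: le_trans (expR_ge1Dx _).
  by rewrite lerDl sqr_ge0.
have -> : y ^+ 2 = m%:R * (y ^+ 2 / m%:R) by rewrite mulrC divfK// pnatr_eq0.
rewrite expRM_natl -exprMn; apply: lerXn2r; rewrite ?nnegrE.
- by rewrite addr_ge0// mulr_ge0// divr_ge0// sqr_ge0.
- by rewrite mulr_ge0// expR_ge0.
apply: le_trans (ler_wpM2l _ (expR_ge1Dx _)) => //.
have := sqr_ge0 y; set Y := y ^+ 2 => Y0.
rewrite mulrC divfK ?pnatr_eq0// mulrDr mulr1 lerD//.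
  by rewrite -natr1 lerDr.
rewrite mulrA ler_pdivlMr; last by rewrite ltr0n lt0n.
by rewrite mulrC ler_wpM2r// ler_nat.
Qed.

Lemma hk_poly k : exists2 C : R, 0 < C &
  forall y, `|hk k y| <= C * (1 + y ^+ 2) ^+ k * expR (- y ^+ 2).
Proof.
suff: (exists2 C : R, 0 < C & forall y, `|hk k y| <= C * (1 + y ^+ 2) ^+ k * expR (- y ^+ 2))
  /\ (exists2 C : R, 0 < C & forall y, `|hk k.+1 y| <= C * (1 + y ^+ 2) ^+ k.+1 * expR (- y ^+ 2)) by case.
have Y2 (y : R) : 2 * `|y| <= 1 + y ^+ 2.
  rewrite -[y ^+ 2]real_normK ?num_real//; have := sqr_ge0 (1 - `|y|); lra.
have sp : 0 < (Num.sqrt pi)^-1 :> R by rewrite invr_gt0 sqrtr_gt0 pi_gt0.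
elim: k => [|k [IH1 [C2 C20 H2]]].
  split.
    exists (Num.sqrt pi)^-1 => // y; rewrite hk0 expr0 mulr1 mulrC ger0_norm//.
  exists (Num.sqrt pi)^-1 => // y; rewrite hk1 hk0 normrM mulrC.
  rewrite ger0_norm ?mulr_ge0 ?expR_ge0 ?(ltW sp)// expr1 -!mulrA mulrC -!mulrA.
  rewrite ler_wpM2l ?(ltW sp)// ler_wpM2r ?expR_ge0//.
  by rewrite normrM normrN normr_nat; exact: Y2.
split; first by exists C2.
case: IH1 => C1 C10 H1.
exists (C2 + 2 * k.+1%:R * C1) => [|y]; first by rewrite addr_gt0// !mulr_gt0// ltr0n.
rewrite hkSS; apply: le_trans (ler_normB _ _) _.
have E := expR_ge0 (- y ^+ 2).
have Z1 : 1 <= 1 + y ^+ 2 by rewrite lerDl sqr_ge0.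
have Z0 : 0 <= 1 + y ^+ 2 by lra.
rewrite -[leRHS]mulrA [leRHS]mulrDl lerD//.
  rewrite normrM normrM normrN normr_nat exprS.
  apply: (le_trans (ler_pM _ _ (Y2 y) (H2 y))); rewrite ?normr_ge0 ?(mulr_ge0 _ (normr_ge0 _))//.
  by rewrite le_eqVlt; apply/orP; left; apply/eqP; ring.
rewrite normrM (ger0_norm (x := _ * _)) ?mulr_ge0// -[leRHS]mulrA ler_wpM2l ?mulr_ge0//.
apply: le_trans (H1 y) _; rewrite -[leLHS]mulrA ler_wpM2l ?(ltW C10)//.
rewrite ler_wpM2r//; apply: ler_weXn2l => //.
by rewrite -addn2 leq_addr.
Qed.

(** The exponent 2 leaves one factor 1 + y^2 to absorb a Hölder weight |y|^a, and the other one to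
    integrate. *)
Lemma hk_decay k : exists2 C : R, 0 < C & forall y, `|hk k y| <= C / (1 + y ^+ 2) ^+ 2.
Proof.
have [C C0 H] := hk_poly k; have [D D0 HD] := expR_sqr_ge (k + 2).
exists (C * D) => [|y]; first exact: mulr_gt0.
have Z0 : 0 < 1 + y ^+ 2 by rewrite ltr_pwDl// sqr_ge0.
rewrite ler_pdivlMr ?exprn_gt0//.
apply: le_trans (ler_wpM2r _ (H y)) _; first by rewrite exprn_ge0 ?ltW.
have := ler_wpM2l (ltW C0) (HD y); rewrite exprD; apply: le_trans.
by rewrite le_eqVlt; apply/orP; left; apply/eqP; ring.
Qed.

Definition hC k : R := projT1 (cid2 (hk_decay k)).

Lemma hC_gt0 k : 0 < hC k. Proof. by rewrite /hC; case: cid2. Qed.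

Lemma hk_le k y : `|hk k y| <= hC k / (1 + y ^+ 2) ^+ 2.
Proof. by rewrite /hC; case: cid2. Qed.

End kernels.

(** * The majorant 1 / (1 + z^2) and affine substitution *)

Section decay.
Context {R : realType}.
Local Notation mu := (@lebesgue_measure R).

Lemma continuous_decay : continuous (fun z : R => (1 + z ^+ 2)^-1).
Proof. exact: continuous_oneDsqrV. Qed.

Lemma decay_ge0 (z : R) : 0 <= (1 + z ^+ 2)^-1.
Proof. by rewrite invr_ge0 addr_ge0// sqr_ge0. Qed.

Lemma integral_decay : (\int[mu]_z ((1 + z ^+ 2)^-1)%:E = pi%:E)%E.
Proof.
rewrite ge0_symfun_integralT.
- rewrite -set_itvcy; have := @integral0y_oneDsqr R; rewrite /oneDsqr => ->.
  by rewrite -EFinM mulrC divfK.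
- exact: decay_ge0.
- exact: continuous_decay.
- by move=> z /=; rewrite sqrrN.
Qed.

Lemma integrable_decay : mu.-integrable setT (EFin \o (fun z : R => (1 + z ^+ 2)^-1)).
Proof.
apply/integrableP; split.
  by apply/measurable_EFinP; apply: continuous_measurable_fun; exact: continuous_decay.
under eq_integral do rewrite /= ger0_norm ?decay_ge0//.
by rewrite integral_decay ltry.
Qed.

Lemma integrable_le_decay (f : R -> R) (C : R) : measurable_fun setT f ->
  (forall z, `|f z| <= C / (1 + z ^+ 2)) -> mu.-integrable setT (EFin \o f).
Proof.
move=> mf H; apply: (@le_integrable _ _ _ mu setT measurableT _
  (EFin \o (fun z : R => C * (1 + z ^+ 2)^-1))).
- exact/measurable_EFinP.
- move=> z _ /=; rewrite lee_fin (le_trans (H z))// ler_norm //.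
- rewrite (_ : EFin \o _ = (fun z => C%:E * ((1 + z ^+ 2)^-1)%:E)%E).
    exact: integrableZl integrable_decay.
  by apply/funext => z /=; rewrite EFinM.
Qed.

(** The substitution rule is used for the increasing map z |-> r (z - x), so the reflection stays in
    the integrand. *)
Lemma Rint_affine (G : R -> R) (r x : R) : 0 < r -> continuous G -> (forall z, 0 <= G z) ->
  (\int[mu]_z (r * G (r * (x - z)))%:E = \int[mu]_z (G (- z))%:E)%E.
Proof.
move=> r0 cG G0.
have dF (y : R) : is_derive y 1 (fun z : R => r * (z - x)) r.
  by apply: is_derive_eq; rewrite /GRing.scale /=; ring.
have dE : derive1 (fun z : R => r * (z - x)) = cst r.
  by apply/funext => y; rewrite derive1E; apply: derive_val.
rewrite [RHS](@increasing_ge0_integration_by_substitutionT R (fun z => r * (z - x))).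
- apply: eq_integral => z _; rewrite /= dE /= mulrC; congr (_ * _)%:E.
  by congr (G _); ring.
- by move=> y z yz; rewrite ltr_pM2l// ltrD2r.
- rewrite dE; exact: cst_continuous.
- rewrite dE; exact: is_cvg_cst.
- rewrite dE; exact: is_cvg_cst.
- by move=> y; apply: ex_derive.
- apply/cvgrNyPle => A; near=> z.
  have : z <= A / r + x by near: z; apply: nbhs_ninfty_le; rewrite num_real.
  by rewrite -lerBlDr ler_pdivlMr// mulrC.
- apply/cvgryPge => A; near=> z.
  have : A / r + x <= z by near: z; apply: nbhs_pinfty_ge; rewrite num_real.
  by rewrite -lerBrDr ler_pdivrMr// mulrC.
- move=> z; apply: continuous_comp; first exact: opp_continuous.
  exact: cG.
- by move=> z.
Unshelve. all: by end_near. Qed.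

End decay.

Section heat_kernel.
Context {R : realType}.
Local Notation mu := (@lebesgue_measure R).
Implicit Types (k : nat) (s z x : R).

Definition rho s : R := (2 * Num.sqrt s)^-1.

(** As rho s = 1 / (2 sqrt s), [q 0 s] is the heat kernel exp (- z^2 / (4 s)) / sqrt (4 pi s), and
    [q k s] is its k-th derivative in z. *)
Definition q k s z := rho s ^+ k.+1 * hk k (rho s * z).

Lemma rho_gt0 s : 0 < s -> 0 < rho s.
Proof. by move=> s0; rewrite invr_gt0 mulr_gt0// sqrtr_gt0. Qed.

Lemma is_derive_rho s : 0 < s -> is_derive s 1 rho (- 2 * rho s ^+ 3).
Proof.
move=> s0; have S0 : 0 < Num.sqrt s by rewrite sqrtr_gt0.
have := is_derive1_sqrt s0 => H1.
have H2 : is_derive s 1 (fun s => 2 * Num.sqrt s) ((Num.sqrt s)^-1).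
  by apply: is_derive_eq; rewrite /GRing.scale /=; field; rewrite gt_eqF.
rewrite /rho; have := @is_deriveV R (fun s => 2 * Num.sqrt s) s _ 1 (mulf_neq0 (negbT (pnatr_eq0 R 2)) (lt0r_neq0 S0)) H2.
by move=> H3; apply: is_derive_eq; rewrite /GRing.scale /=; field; rewrite gt_eqF.
Qed.

Lemma is_derive_q k s z : is_derive z 1 (q k s) (q k.+1 s z).
Proof.
rewrite /q; apply: is_derive_eq; rewrite /GRing.scale /= [in RHS]exprS; ring.
Qed.

(** The heat equation; after the chain rule it is exactly the Hermite recurrence [hkSS]. *)
Lemma is_derive_q_time k s z : 0 < s -> is_derive s 1 (q k ^~ z) (q k.+2 s z).
Proof.
move=> s0; have := is_derive_rho s0 => H.
rewrite (_ : q k ^~ z = fun s => rho s ^+ k.+1 * hk k (rho s * z)); last exact/funext.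
have H1 : is_derive s 1 (fun s => rho s * z) (- 2 * rho s ^+ 3 * z).
  by apply: is_derive_eq; rewrite /GRing.scale /=; ring.
have H2 := @is_derive1_comp R (hk k) (fun s => rho s * z) s _ _ (is_derive_hk k (rho s * z)) H1.
have H3 : is_derive s 1 (fun s => rho s ^+ k.+1) (k.+1%:R * rho s ^+ k * (- 2 * rho s ^+ 3)).
  elim: k {H2} => [|k IH]; first by rewrite expr0 !mul1r.
  rewrite (_ : (fun s => rho s ^+ k.+2) = fun s => rho s * rho s ^+ k.+1).
    apply: is_derive_eq; rewrite /GRing.scale /= -(natr1 k.+1) !exprS; ring.
  by apply/funext => t; rewrite exprS.
apply: is_derive_eq (is_deriveM H3 H2) _; rewrite /GRing.scale /= /q hkSS !exprS.
ring.
Qed.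

(** One majorant, centred at 0, for all times and centres in a bounded range: it dominates the
    Taylor remainders when the kernels are differentiated in x or s under the integral. *)
Lemma q_sub_decay k (r1 r2 X : R) : 0 < r1 -> 0 <= X -> exists2 C : R, 0 < C &
  forall s x z, r1 <= rho s <= r2 -> `|x| <= X -> `|q k s (x - z)| <= C / (1 + z ^+ 2).
Proof.
move=> r10 X0.
(* From z^2 <= 2 x^2 + 2 (x - z)^2 one gets 1 + z^2 <= A (1 + (rho s (x - z))^2). *)
pose A := 1 + 2 * X ^+ 2 + 2 / r1 ^+ 2.
have A0 : 1 <= A.
  by rewrite /A -addrA lerDl addr_ge0 ?mulr_ge0 ?invr_ge0 ?exprn_ge0 ?(ltW r10).
exists (`|r2| ^+ k.+1 * hC k * A + 1).
  by rewrite ltr_pwDr// !mulr_ge0 ?(ltW (hC_gt0 _)) ?exprn_ge0//; lra.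
move=> s x z /andP[rl ru] xX; rewrite /q normrM normrX.
set r := rho s in rl ru *.
have r0 : 0 < r by lra.
have Z0 : 0 < 1 + z ^+ 2 by rewrite ltr_pwDl// sqr_ge0.
have Y0 : 0 < 1 + (r * (x - z)) ^+ 2 by rewrite ltr_pwDl// sqr_ge0.
have H1 : `|hk k (r * (x - z))| <= hC k * A / (1 + z ^+ 2).
  apply: le_trans (hk_le _ _) _; rewrite -mulrA ler_wpM2l ?(ltW (hC_gt0 _))//.
  apply: (@le_trans _ _ (1 + (r * (x - z)) ^+ 2)^-1).
    rewrite lef_pV2 ?posrE ?exprn_gt0//.
    by apply: ler_eXnr => //; rewrite lerDl sqr_ge0.
  rewrite ler_pdivlMr// mulrC ler_pdivrMr//.
  have x2 : x ^+ 2 <= X ^+ 2.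
    by rewrite -[x ^+ 2]real_normK ?num_real// lerXn2r ?nnegrE.
  have H2 : (x - z) ^+ 2 = r ^- 2 * (r * (x - z)) ^+ 2.
    by rewrite exprMn mulKf// expf_neq0// gt_eqF.
  have H3 : r ^- 2 <= r1 ^- 2.
    by rewrite lef_pV2 ?posrE ?exprn_gt0// lerXn2r ?nnegrE ?(ltW r0) ?(ltW r10).
  have H4 : z ^+ 2 <= 2 * x ^+ 2 + 2 * (x - z) ^+ 2.
    by have := sqr_ge0 (2 * x - z); rewrite !expr2; lra.
  have H5 := sqr_ge0 (r * (x - z)).
  have H6 : (x - z) ^+ 2 <= r1 ^- 2 * (r * (x - z)) ^+ 2 by rewrite H2 ler_wpM2r.
  rewrite /A; set Y := (r * (x - z)) ^+ 2 in H5 H6 *.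
  have H7 : 0 <= r1 ^- 2 by rewrite invr_ge0 exprn_ge0// ltW.
  have H8 : 0 <= X ^+ 2 * Y by rewrite mulr_ge0// sqr_ge0.
  nra.
apply: (le_trans (y := `|r2| ^+ k.+1 * hC k * A / (1 + z ^+ 2))).
  rewrite -!mulrA ler_pM// ?exprn_ge0//.
    by rewrite lerXn2r ?nnegrE ?(ltW r0)// ger0_norm ?(ltW r0)// (le_trans ru)// ler_norm.
  by rewrite mulrA.
by rewrite ler_pM2r ?invr_gt0// lerDl.
Qed.

Lemma continuous_q_sub k s x : continuous (fun z => q k s (x - z)).
Proof.
move=> z; apply: (@is_derive_continuous _ _ _ (q k.+1 s (x - z) * - 1)).
have H1 : is_derive (z : R) 1 (fun z => x - z) (- 1).
  by apply: is_derive_eq; ring.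
exact: (@is_derive1_comp R (q k s) (fun z => x - z) z _ _ (is_derive_q k s (x - z)) H1).
Qed.

Lemma powR_le1D (a y : R) : 0 <= a <= 1 -> 0 <= y -> y `^ a <= 1 + y ^+ 2.
Proof.
move=> /andP[a0 a1] y0; case: (leP y 1) => y1.
  apply: (@le_trans _ _ (1 `^ a)); first by rewrite ge0_ler_powR// nnegrE.
  by rewrite powR1 lerDl sqr_ge0.
apply: (@le_trans _ _ (y `^ 1)); first by apply: ler_powR => //; exact: ltW.
rewrite powRr1//; have := sqr_ge0 (1 - y); rewrite expr2; nra.
Qed.

(** By scaling, each derivative costs a factor rho and the weight gains rho^(-a), of order s^(a/2).
    For a = 0 this bounds the L1 norm; for a > 0 the gain makes the singularity of second
    derivatives integrable in time. *)
Lemma q_powR_integrable k (a s x : R) : 0 <= a <= 1 -> 0 < s ->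
  mu.-integrable setT (EFin \o (fun z => `|q k s (x - z)| * `|x - z| `^ a)) /\
  \int[mu]_z (`|q k s (x - z)| * `|x - z| `^ a)
    <= hC k * pi * rho s ^+ k / rho s `^ a.
Proof.
move=> a01 s0; have r0 := rho_gt0 s0; set r := rho s in r0 *.
have ra : 0 < r `^ a by exact: powR_gt0.
pose K := hC k * r ^+ k / r `^ a.
have K0 : 0 <= K by rewrite !mulr_ge0 ?(ltW (hC_gt0 _)) ?exprn_ge0 ?invr_ge0 ?(ltW r0) ?(ltW ra).
pose D z := K * (r * (1 + (r * (x - z)) ^+ 2)^-1).
have H z : `|q k s (x - z)| * `|x - z| `^ a <= D z.
  rewrite /q -/r normrM normrX gtr0_norm//.
  set y := r * (x - z).
  have -> : `|x - z| = `|y| / r by rewrite normrM gtr0_norm// mulrC mulKf// gt_eqF.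
  rewrite powRM ?invr_ge0 ?(ltW r0)// -powR_inv1 ?(ltW r0)// powRAC powR_inv1 ?(ltW ra)//.
  have Y0 : 0 < 1 + y ^+ 2 by rewrite ltr_pwDl// sqr_ge0.
  have H1 : `|hk k y| * `|y| `^ a <= hC k / (1 + y ^+ 2).
    apply: (le_trans (ler_pM _ _ (hk_le k y) (powR_le1D a01 (normr_ge0 y)))) => //.
    rewrite real_normK ?num_real// expr2 invfM -!mulrA mulVf ?gt_eqF// mulr1.
    exact: lexx.
  rewrite /D /K exprS.
  have -> : r * r ^+ k * `|hk k y| * (`|y| `^ a * (r `^ a)^-1) =
    (r * r ^+ k * (r `^ a)^-1) * (`|hk k y| * `|y| `^ a) by ring.
  have -> : hC k * r ^+ k / r `^ a * (r * (1 + y ^+ 2)^-1) =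
    (r * r ^+ k * (r `^ a)^-1) * (hC k * (1 + y ^+ 2)^-1) by ring.
  by rewrite ler_wpM2l// !mulr_ge0 ?exprn_ge0 ?invr_ge0 ?(ltW r0) ?(ltW ra).
have iD0 : (\int[mu]_z (r * (1 + (r * (x - z)) ^+ 2)^-1)%:E = pi%:E)%E.
  rewrite (@Rint_affine R (fun y => (1 + y ^+ 2)^-1)) => //.
  - by under eq_integral do rewrite sqrrN; exact: integral_decay.
  - exact: continuous_decay.
  - exact: decay_ge0.
have cD0 : continuous (fun z => r * (1 + (r * (x - z)) ^+ 2)^-1).
  move=> z; apply: cvgMl_tmp; apply: (continuous_comp (f := fun z => r * (x - z)) (g := fun y => (1 + y ^+ 2)^-1)); last exact: continuous_decay.
  apply: (@is_derive_continuous _ _ _ (- r)).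
  by apply: is_derive_eq; rewrite /GRing.scale /=; ring.
have D0_ge0 z : 0 <= r * (1 + (r * (x - z)) ^+ 2)^-1 by rewrite mulr_ge0 ?(ltW r0) ?decay_ge0.
have ID0 : mu.-integrable setT (EFin \o (fun z => r * (1 + (r * (x - z)) ^+ 2)^-1)).
  apply/integrableP; split.
    by apply/measurable_EFinP; apply: continuous_measurable_fun.
  under eq_integral do rewrite /= ger0_norm ?D0_ge0//.
  by rewrite iD0 ltry.
have ID : mu.-integrable setT (EFin \o D).
  rewrite (_ : EFin \o D = (fun z => K%:E * (r * (1 + (r * (x - z)) ^+ 2)^-1)%:E)%E).
    exact: integrableZl.
  by apply/funext => z /=; rewrite EFinM.
have mf : measurable_fun setT (fun z => `|q k s (x - z)| * `|x - z| `^ a).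
  apply: measurable_funM.
    apply: measurableT_comp => //; apply: continuous_measurable_fun.
    exact: continuous_q_sub.
  apply: (measurableT_comp (f := fun y => y `^ a)) => //.
  apply: measurableT_comp => //; apply: measurable_funB => //.
have If : mu.-integrable setT (EFin \o (fun z => `|q k s (x - z)| * `|x - z| `^ a)).
  apply: (le_integrable measurableT _ _ ID); first exact/measurable_EFinP.
  move=> z _ /=; rewrite lee_fin; apply: le_trans (ler_norm _).
  by rewrite [`|_ * _|]ger0_norm ?mulr_ge0 ?powR_ge0//; exact: H.
split=> //.
apply: (le_trans (le_Rintegral measurableT If ID _)); first by move=> z _; exact: H.
rewrite /D RintegralZl// /Rintegral iD0 /= /K le_eqVlt; apply/orP; left.
by apply/eqP; ring.
Qed.

Lemma q0_mass s x : 0 < s -> \int[mu]_z q 0 s (x - z) = 1.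
Proof.
move=> s0; have r0 := rho_gt0 s0; rewrite /Rintegral.
have sp : 0 < Num.sqrt (@pi R) by rewrite sqrtr_gt0 pi_gt0.
under eq_integral do rewrite /q expr1.
rewrite (@Rint_affine R (hk 0) _ _ r0).
- under eq_integral do rewrite hk0 sqrrN mulrC EFinM.
  rewrite ge0_integralZl//=.
  + have := @integralT_gauss R; rewrite /gauss_fun => ->.
    by rewrite -EFinM mulVf// gt_eqF.
  + by apply/measurable_EFinP; exact: measurable_gauss_fun.
- by move=> z; exact: is_derive_continuous (is_derive_hk 0 z).
- by move=> z; rewrite hk0 divr_ge0 ?expR_ge0// ltW.
Qed.

Lemma rho_powR s : 0 < s -> rho s = 2^-1 * s `^ (- 2^-1).
Proof. by move=> s0; rewrite /rho invfM powRN powR12_sqrt// ltW. Qed.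

Lemma rhoX_le k s : 0 < s -> rho s ^+ k <= s `^ (- (k%:R / 2)).
Proof.
move=> s0; apply: (@le_trans _ _ ((s `^ (- 2^-1)) ^+ k)).
  rewrite lerXn2r ?nnegrE ?powR_ge0 ?(ltW (rho_gt0 s0))// rho_powR//.
  by rewrite ler_piMl ?powR_ge0//; lra.
by rewrite -powR_mulrn ?powR_ge0// -powRrM mulNr mulrC.
Qed.

Lemma rhoX_powR_le k (a s : R) : 0 <= a <= 1 -> 0 < s ->
  rho s ^+ k / rho s `^ a <= 2 * s `^ (a / 2 - k%:R / 2).
Proof.
move=> /andP[a0 a1] s0; rewrite powRD; last by rewrite (negbT (gt_eqF s0)) implybT.
rewrite [leLHS]mulrC mulrA; apply: ler_pM; rewrite ?invr_ge0 ?powR_ge0 ?exprn_ge0 ?(ltW (rho_gt0 s0))//; last exact: rhoX_le.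
rewrite rho_powR// powRM ?powR_ge0// invfM; apply: ler_pM; rewrite ?invr_ge0 ?powR_ge0//.
  rewrite -powRN -[2^-1]powR_inv1// -powRrM mulN1r opprK.
  by rewrite -[leRHS]powRr1// ler_powR// ler1n.
by rewrite -powRN -!powRrM (_ : - 2^-1 * - a = a / 2)//; ring.
Qed.

End heat_kernel.

(** * Products of kernels and the heat semigroup *)

Section decaying_functions.
Context {R : realType}.
Local Notation mu := (@lebesgue_measure R).
Implicit Types f g : R -> R.

(** A class of integrable functions that is stable under sums and under bounded continuous factors,
    and whose pointwise bounds integrate to the explicit constant C pi. *)
Definition decaying f := measurable_fun setT f /\
  exists C : R, forall z, `|f z| <= C / (1 + z ^+ 2).

Lemma decaying_integrable f : decaying f -> mu.-integrable setT (EFin \o f).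
Proof. by case=> mf [C H]; exact: (integrable_le_decay mf H). Qed.

Lemma decayingD f g : decaying f -> decaying g -> decaying (fun z => f z + g z).
Proof.
move=> [mf [C H]] [mg [D HD]]; split; first exact: measurable_funD.
exists (C + D) => z; rewrite mulrDl; apply: le_trans (ler_normD _ _) _.
exact: lerD.
Qed.

Lemma decayingZ (c : R) f : decaying f -> decaying (fun z => c * f z).
Proof.
move=> [mf [C H]]; split; first exact: measurable_funM.
by exists (`|c| * C) => z; rewrite normrM -mulrA ler_wpM2l.
Qed.

Lemma decayingB f g : decaying f -> decaying g -> decaying (fun z => f z - g z).
Proof.
move=> df /(decayingZ (-1)) dg; have := decayingD df dg.
by congr decaying; apply/funext => z; rewrite mulN1r.
Qed.

Lemma decaying_norm f : decaying f -> decaying (fun z => `|f z|).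
Proof.
move=> [mf [C H]]; split; first exact: measurableT_comp.
by exists C => z; rewrite normr_id.
Qed.

Lemma decayingM f g (N : R) : decaying f -> continuous g -> (forall z, `|g z| <= N) ->
  decaying (fun z => f z * g z).
Proof.
move=> [mf [C H]] cg gN; split.
  by apply: measurable_funM => //; exact: continuous_measurable_fun.
exists (C * N) => z; rewrite normrM.
apply: le_trans (ler_pM _ _ (H z) (gN z)) _ => //.
by rewrite le_eqVlt; apply/orP; left; apply/eqP; ring.
Qed.

Lemma decaying0 : decaying (fun _ : R => 0).
Proof. by split => //; exists 0 => z; rewrite normr0 mul0r. Qed.

Lemma decaying_sum (I : Type) (s : seq I) (f : I -> R -> R) : (forall i, decaying (f i)) ->
  decaying (fun z => \sum_(i <- s) f i z).
Proof.
move=> H; elim: s => [|i s IH].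
  by rewrite (_ : (fun z => _) = fun _ => 0); [exact: decaying0 | apply/funext => z; rewrite big_nil].
have := decayingD (H i) IH; congr decaying.
by apply/funext => z; rewrite big_cons.
Qed.

Lemma RintD f g : decaying f -> decaying g ->
  \int[mu]_z (f z + g z) = \int[mu]_z f z + \int[mu]_z g z.
Proof. by move=> /decaying_integrable If /decaying_integrable Ig; rewrite RintegralD. Qed.

Lemma RintB f g : decaying f -> decaying g ->
  \int[mu]_z (f z - g z) = \int[mu]_z f z - \int[mu]_z g z.
Proof. by move=> /decaying_integrable If /decaying_integrable Ig; rewrite RintegralB. Qed.

Lemma RintZ (c : R) f : decaying f -> \int[mu]_z (c * f z) = c * \int[mu]_z f z.
Proof. by move=> /decaying_integrable If; rewrite RintegralZl. Qed.

Lemma Rint0 : \int[mu]_z (0 : R) = 0.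
Proof. by rewrite Rintegral_cst// mul0r. Qed.

Lemma Rint_sum (I : Type) (s : seq I) (f : I -> R -> R) : (forall i, decaying (f i)) ->
  \int[mu]_z (\sum_(i <- s) f i z) = \sum_(i <- s) \int[mu]_z f i z.
Proof.
move=> H; elim: s => [|i s IH].
  by under eq_Rintegral do rewrite big_nil; rewrite Rint0 big_nil.
under eq_Rintegral do rewrite big_cons.
by rewrite RintD ?IH ?big_cons//; exact: decaying_sum.
Qed.

Lemma Rint_le f g : decaying f -> decaying g -> (forall z, f z <= g z) ->
  \int[mu]_z f z <= \int[mu]_z g z.
Proof.
move=> /decaying_integrable If /decaying_integrable Ig H.
by apply: le_Rintegral => // z _.
Qed.

Lemma Rint_norm f : decaying f -> `|\int[mu]_z f z| <= \int[mu]_z `|f z|.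
Proof. by move=> /decaying_integrable If; apply: le_normr_Rintegral. Qed.

Lemma Rint_norm_le f g : decaying f -> decaying g -> (forall z, `|f z| <= g z) ->
  `|\int[mu]_z f z| <= \int[mu]_z g z.
Proof.
move=> df dg H; apply: le_trans (Rint_norm df) _.
by apply: Rint_le => //; exact: decaying_norm.
Qed.

Lemma Rint_decay_le f (C : R) : decaying f -> (forall z, `|f z| <= C / (1 + z ^+ 2)) ->
  `|\int[mu]_z f z| <= C * pi.
Proof.
move=> df H.
have d1 : decaying (fun z : R => (1 + z ^+ 2)^-1).
  split; first by apply: continuous_measurable_fun; exact: continuous_decay.
  by exists 1 => z; rewrite mul1r ger0_norm// decay_ge0.
apply: (le_trans (@Rint_norm_le f (fun z => C * (1 + z ^+ 2)^-1) df _ H)).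
  exact: decayingZ.
by rewrite RintZ// /Rintegral integral_decay.
Qed.

Lemma hoelder_continuous (f : R -> R) (H a : R) : 0 < a ->
  (forall x y, `|f x - f y| <= H * `|x - y| `^ a) -> continuous f.
Proof.
move=> a0 Hf x; apply/cvgrPdist_lt => e e0.
have H1 : 0 < `|H| + 1 by rewrite ltr_wpDl.
pose d := (e / (`|H| + 1)) `^ a^-1.
have d0 : 0 < d by rewrite powR_gt0// divr_gt0.
near=> y.
have xy : `|x - y| <= d by near: y; exact: cvgr_dist_le.
apply: le_lt_trans (Hf _ _) _.
apply: (@le_lt_trans _ _ (`|H| * (e / (`|H| + 1)))).
  apply: (@le_trans _ _ (`|H| * `|x - y| `^ a)); first by rewrite ler_wpM2r ?powR_ge0// ler_norm.
  rewrite ler_wpM2l//.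
  have -> : e / (`|H| + 1) = d `^ a.
    by rewrite /d -powRrM mulVf ?gt_eqF// powRr1// divr_ge0// ltW.
  by apply: ge0_ler_powR => //; rewrite ?nnegrE ?ltW.
by rewrite mulrA ltr_pdivrMr// mulrC ltr_pM2l// ltrDl.
Unshelve. all: by end_near. Qed.

End decaying_functions.

Section small_remainder.
Context {R : realType} {V : normedModType R}.

(** A remainder of order |h|^(1 + th) is what the kernel and Hölder estimates produce, so
    derivatives of integrals are established in this form, without a theorem on differentiation
    under the integral. *)
Lemma remainder_is_derive (f : V -> R) (x v : V) (d C h0 th : R) : 0 < h0 -> 0 < th ->
  (forall h : R, `|h| <= h0 -> `|f (x + h *: v) - f x - h * d| <= C * (`|h| * `|h| `^ th)) ->
  is_derive x v f d.
Proof.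
move=> h00 th0 H.
have cv : h^-1 *: ((f \o shift x) (h *: v) - f x) @[h --> (0 : R)^'] --> d.
  apply/cvgrPdist_le => e e0.
  have C1 : 0 < `|C| + 1 by rewrite ltr_wpDl.
  pose r := (e / (`|C| + 1)) `^ th^-1.
  have r0 : 0 < r by rewrite powR_gt0// divr_gt0.
  near=> h.
  have hn : h != 0 by near: h; exact: nbhs_dnbhs_neq.
  have hr : `|h| <= r by near: h; apply: dnbhs0_le.
  have hh : `|h| <= h0 by near: h; apply: dnbhs0_le.
  have h1 : 0 < `|h| by rewrite normr_gt0.
  have := H h hh; rewrite /= [h *: v + x]addrC => H1.
  rewrite -(ler_pM2l h1) -normrM.
  have -> : h * (d - h^-1 *: (f (x + h *: v) - f x)) = - (f (x + h *: v) - f x - h * d).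
    by rewrite /GRing.scale /=; field.
  rewrite normrN; apply: le_trans H1 _; rewrite mulrCA ler_wpM2l//.
  apply: (@le_trans _ _ (`|C| * `|h| `^ th)); first by rewrite ler_wpM2r ?powR_ge0// ler_norm.
  apply: (@le_trans _ _ (`|C| * (e / (`|C| + 1)))).
    rewrite ler_wpM2l//.
    have -> : e / (`|C| + 1) = r `^ th.
      by rewrite /r -powRrM mulVf ?gt_eqF// powRr1// divr_ge0// ltW.
    by apply: ge0_ler_powR => //; rewrite ?nnegrE ?ltW.
  by rewrite mulrA ler_pdivrMr// mulrC ler_pM2l// lerDl.
apply: DeriveDef; first by apply/cvg_ex; exists d.
exact: cvg_lim cv.
Unshelve. all: by end_near. Qed.

End small_remainder.

(** * Iterated integrals against product kernels *)

Section iterated_kernels.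
Context {R : realType} {n : nat}.
Local Notation mu := (@lebesgue_measure R).
Implicit Types (x y : 'rV[R]_n) (F G : 'rV[R]_n -> R) (K : 'I_n -> R -> R) (s : seq 'I_n).

Definition ei (i : 'I_n) : 'rV[R]_n := delta_mx 0 i.

Definition upd x i (z : R) : 'rV[R]_n := x + (z - x 0 i) *: ei i.

Lemma updE x i z j : upd x i z 0 j = if j == i then z else x 0 j.
Proof.
rewrite !mxE eqxx /=; case: eqP => [->|_]; rewrite /= ?mulr1 ?mulr0 ?addr0//.
by rewrite addrC subrK.
Qed.

Lemma upd_shift_same x i h z : upd (x + h *: ei i) i z = upd x i z.
Proof. by apply/rowP => k; rewrite !updE !mxE eqxx /=; case: eqP => //= _; rewrite mulr0 addr0. Qed.

Lemma upd_shift x i j h z : i != j -> upd (x + h *: ei i) j z = upd x j z + h *: ei i.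
Proof.
move=> ij; apply/rowP => k; rewrite [RHS]mxE !updE !mxE eqxx /=; case: eqP => //= ->.
by rewrite eq_sym (negbTE ij) mulr0 addr0.
Qed.

Lemma shift_updE x i z z' : upd x i z = upd x i z' + (z - z') *: ei i.
Proof.
by apply/rowP => k; rewrite [RHS]mxE !updE !mxE eqxx /=; case: eqP => //= _; rewrite ?mulr1 ?mulr0 ?addr0// addrC subrK.
Qed.

(** Hölder continuity along the coordinate axes only: the iterated integrals move one coordinate at
    a time, and [chol_dist] recovers arbitrary increments at the cost of a factor n. *)
Definition chol (a H : R) F := forall x i (h : R), `|F (x + h *: ei i) - F x| <= H * `|h| `^ a.

Definition adm (a N H : R) F := (forall x, `|F x| <= N) /\ chol a H F.

Definition kerd (k : R -> R) := continuous k /\ exists C : R, forall z, `|k z| <= C / (1 + z ^+ 2).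

Lemma kerd_decaying k : kerd k -> decaying k.
Proof. by move=> [ck H]; split => //; exact: continuous_measurable_fun. Qed.

Definition L1 (k : R -> R) := \int[mu]_z `|k z|.

Lemma L1_ge0 k : 0 <= L1 k. Proof. exact: Rintegral_ge0. Qed.

(** The coordinates in the list [s] are integrated out in a fixed order, which is never exchanged,
    so no Fubini theorem enters; the other coordinates of [x] are parameters. *)
Fixpoint J K s F x : R :=
  if s is i :: s' then \int[mu]_z (K i z * J K s' F (upd x i z)) else F x.

Variable a : R.
Hypothesis a0 : 0 < a.

Lemma adm_continuous N H F x i : adm a N H F -> continuous (fun z => F (upd x i z)).
Proof.
move=> [_ HF]; apply: (@hoelder_continuous R _ H a a0) => z w.
by rewrite (shift_updE x i z w); exact: HF.
Qed.

Lemma kerd_adm_decaying k N H F x i : kerd k -> adm a N H F ->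
  decaying (fun z => k z * F (upd x i z)).
Proof.
move=> /kerd_decaying dk HF; apply: (@decayingM _ k _ N) => //.
- exact: adm_continuous HF.
- by move=> z; case: HF.
Qed.

Lemma Rint_kerd_le k G (N : R) x i : decaying (fun z => k z * G (upd x i z)) ->
  kerd k -> (forall z, `|G (upd x i z)| <= N) ->
  `|\int[mu]_z (k z * G (upd x i z))| <= L1 k * N.
Proof.
move=> d dk H; rewrite mulrC /L1 -RintZ; last exact/decaying_norm/kerd_decaying.
apply: Rint_norm_le => //; first exact/decayingZ/decaying_norm/kerd_decaying.
by move=> z; rewrite normrM mulrC ler_wpM2r.
Qed.

(** A translation in an unintegrated coordinate commutes with the integral; in the coordinate just
    integrated the result is constant. *)
Lemma adm_J K s N H F : (forall i, kerd (K i)) -> adm a N H F ->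
  adm a ((\prod_(i <- s) L1 (K i)) * N) ((\prod_(i <- s) L1 (K i)) * H) (J K s F).
Proof.
move=> dK HF; elim: s => [|j s IH]; first by rewrite big_nil !mul1r.
rewrite big_cons; set P := \prod_(i <- s) _ in IH *.
split => [x|x i h] /=.
  rewrite -mulrA; apply: Rint_kerd_le => //; first exact: kerd_adm_decaying IH.
  by move=> z; case: IH.
have [<-|ij] := eqVneq i j.
  under eq_Rintegral do rewrite upd_shift_same.
  rewrite subrr normr0 !mulr_ge0 ?powR_ge0 ?L1_ge0//.
    by rewrite /P; apply: prodr_ge0 => k _; exact: L1_ge0.
  by case: HF => _ /(_ 0 i 1); rewrite normr1 powR1 mulr1; exact: le_trans.
under eq_Rintegral do rewrite upd_shift//.
have admT : adm a (P * N) (P * H) (fun y => J K s F (y + h *: ei i)).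
  case: IH => I1 I2; split => // y k e.
  by rewrite addrAC; exact: I2.
rewrite -RintB; last 2 first.
- exact: (kerd_adm_decaying x j (dK j) admT).
- exact: kerd_adm_decaying IH.
under eq_Rintegral do rewrite -mulrBr.
rewrite -!mulrA (mulrA P).
apply: (@Rint_kerd_le (K j) (fun y => J K s F (y + h *: ei i) - J K s F y)) => //.
  have := decayingB (kerd_adm_decaying x j (dK j) admT) (kerd_adm_decaying x j (dK j) IH).
  by congr decaying; apply/funext => z; rewrite mulrBr.
by move=> z; case: IH => _; exact.
Qed.

Lemma J_eqK K K' s F : {in s, K =1 K'} -> J K s F =1 J K' s F.
Proof.
elim: s => // i s IH H x /=.
apply: eq_Rintegral => z _; rewrite H ?mem_head// IH// => j js.
by apply: H; rewrite inE js orbT.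
Qed.

Lemma J_sub K s N H N' H' F G x : (forall i, kerd (K i)) -> adm a N H F -> adm a N' H' G ->
  J K s (fun y => F y - G y) x = J K s F x - J K s G x.
Proof.
move=> dK HF HG; elim: s x => // i s IH x /=.
rewrite -RintB; last 2 first.
- exact: kerd_adm_decaying (adm_J s dK HF).
- exact: kerd_adm_decaying (adm_J s dK HG).
by apply: eq_Rintegral => z _; rewrite IH mulrBr.
Qed.

Lemma J_base K s F x y : (forall i, i \notin s -> x 0 i = y 0 i) -> J K s F x = J K s F y.
Proof.
elim: s x y => [|i s IH] x y H /=.
  by congr F; apply/rowP => j; apply: H.
apply: eq_Rintegral => z _; congr (_ * _); apply: IH => j js.
by rewrite !updE; case: eqP => // /eqP ji; apply: H; rewrite inE negb_or ji.
Qed.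

Lemma J_zero K s i F x : i \in s -> K i = (fun=> 0) -> J K s F x = 0.
Proof.
move=> + Ki; elim: s x => // j s IH x; rewrite inE => /orP[/eqP <-|js] /=.
  by under eq_Rintegral do rewrite Ki mul0r; exact: Rint0.
by under eq_Rintegral do rewrite IH// mulr0; exact: Rint0.
Qed.

(** Subtracting the constant [G x] under the integral trades the sup norm of [G] for its Hölder
    constant and puts the weight on the kernel. *)
Lemma Rint_kerd_osc_le k (W N H : R) G x i : kerd k -> adm a N H G ->
  decaying (fun z => `|k z| * `|x 0 i - z| `^ a) ->
  \int[mu]_z (`|k z| * `|x 0 i - z| `^ a) <= W ->
  `|\int[mu]_z (k z * G (upd x i z)) - (\int[mu]_z k z) * G x| <= W * H.
Proof.
move=> dk HG dW HW.
have H0 : 0 <= H by case: HG => _ /(_ 0 i 1); rewrite normr1 powR1 mulr1; exact: le_trans.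
have d1 := kerd_adm_decaying x i dk HG.
have d2 := kerd_decaying dk.
rewrite mulrC -RintZ// -RintB//; last exact: decayingZ.
apply: (@le_trans _ _ (\int[mu]_z (H * (`|k z| * `|x 0 i - z| `^ a)))).
  apply: Rint_norm_le.
  - by apply: decayingB => //; exact: decayingZ.
  - exact: decayingZ.
  move=> z; rewrite (mulrC (G x)) -mulrBr normrM mulrCA ler_wpM2l//.
  case: HG => _ HG; rewrite distrC.
  by have := HG x i (z - x 0 i); rewrite distrC (distrC z).
by rewrite RintZ// mulrC ler_wpM2r.
Qed.

(** A single coordinate with a kernel of zero mass gives the cancellation; the other coordinates
    contribute only their L1 norms. *)
Lemma J_hoelder_le K s i N H F x (A : 'I_n -> R) : uniq s -> i \in s ->
  (forall j, kerd (K j)) -> adm a N H F -> \int[mu]_z K i z = 0 ->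
  (forall j, j != i -> L1 (K j) <= A j) ->
  decaying (fun z => `|K i z| * `|x 0 i - z| `^ a) ->
  \int[mu]_z (`|K i z| * `|x 0 i - z| `^ a) <= A i ->
  `|J K s F x| <= (\prod_(j <- s) A j) * H.
Proof.
move=> us si dK HF Ki0 HA dW HW.
have H0 : 0 <= H by case: HF => _ /(_ 0 i 1); rewrite normr1 powR1 mulr1; exact: le_trans.
have A0 j : 0 <= A j.
  have [->|/HA] := eqVneq j i; last exact/le_trans/L1_ge0.
  apply: le_trans HW; apply: Rintegral_ge0 => z _.
  by rewrite mulr_ge0// powR_ge0.
elim: s x us si dW HW => // j s IH x /= /andP[js us]; rewrite inE => + dW HW.
rewrite big_cons; set P := \prod_(j <- s) A j in IH *.
have P0 : 0 <= P by apply: prodr_ge0 => k _.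
have admF := adm_J s dK HF.
have [eij _|ij /= si] := eqVneq i j.
  rewrite -eij in js *.
  have := Rint_kerd_osc_le (dK i) admF dW HW; rewrite Ki0 mul0r subr0 -mulrA => /le_trans; apply.
  rewrite ler_wpM2l// ler_wpM2r// /P.
  rewrite big_seq [leRHS]big_seq; apply: ler_prod => k ks.
  by rewrite L1_ge0 HA//; apply: contraNneq js => <-.
apply: (@le_trans _ _ (L1 (K j) * (P * H))); last first.
  by rewrite -mulrA ler_wpM2r ?mulr_ge0// HA// eq_sym.
apply: Rint_kerd_le => //; first exact: kerd_adm_decaying admF.
by move=> z; have := IH (upd x j z) us si; rewrite updE (negbTE ij); apply.
Qed.

(** Telescoping over the coordinates: each kernel is a probability density, so each integration
    moves the value by at most W H. *)
Lemma J_dist_le K s (W N H : R) F x : uniq s -> (forall j, kerd (K j)) -> adm a N H F ->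
  (forall j z, 0 <= K j z) -> (forall j, \int[mu]_z K j z = 1) ->
  (forall j, j \in s -> decaying (fun z => `|K j z| * `|x 0 j - z| `^ a)) ->
  (forall j, j \in s -> \int[mu]_z (`|K j z| * `|x 0 j - z| `^ a) <= W) ->
  `|J K s F x - F x| <= (size s)%:R * (W * H).
Proof.
move=> us dK HF K0 K1.
elim: s x us => [|i s IH] x /=; first by rewrite subrr normr0 mul0r.
move=> /andP[is_ us] dW HW.
have admF := adm_J s dK HF.
have d1 := kerd_adm_decaying x i (dK i) admF.
have d2 := kerd_adm_decaying x i (dK i) HF.
have H1 := Rint_kerd_osc_le (dK i) HF (dW i (mem_head _ _)) (HW i (mem_head _ _)).
rewrite K1 mul1r in H1.
have H2 : `|\int[mu]_z (K i z * J K s F (upd x i z)) - \int[mu]_z (K i z * F (upd x i z))|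
    <= (size s)%:R * (W * H).
  rewrite -RintB//; under eq_Rintegral do rewrite -mulrBr.
  have L1i : L1 (K i) = 1.
    by rewrite /L1 -(K1 i); apply: eq_Rintegral => z _; rewrite ger0_norm.
  rewrite -[leRHS]mul1r -[X in X * _]L1i.
  apply: (@Rint_kerd_le (K i) (fun y => J K s F y - F y)) => //.
    have := decayingB d1 d2; congr decaying.
    by apply/funext => z; rewrite mulrBr.
  move=> z; apply: (IH (upd x i z) us) => j js;
    have ji : (j == i) = false by [apply: contraNF is_ => /eqP <-].
  - by rewrite updE ji; apply: dW; rewrite inE js orbT.
  - by rewrite updE ji; apply: HW; rewrite inE js orbT.
rewrite -natr1 mulrDl mul1r.
apply: le_trans (ler_distD (\int[mu]_z (K i z * F (upd x i z))) _ _) _.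
exact: lerD.
Qed.

Definition setK K i k : 'I_n -> R -> R := fun j => if j == i then k else K j.

Lemma kerd_setK K i k : (forall j, kerd (K j)) -> kerd k -> forall j, kerd (setK K i k j).
Proof. by move=> dK dk j; rewrite /setK; case: eqP. Qed.

(* The iterated integral is multilinear and bounded in its kernels, so a
   second-order expansion of the kernels, uniform in the weighted sup norm,
   gives the product rule. *)
Lemma J_expansion (Kh : R -> 'I_n -> R -> R) K K' s (N H h0 C : R) F : uniq s -> 0 < h0 -> 0 <= C ->
  (forall j, kerd (K j)) -> (forall j, kerd (K' j)) ->
  (forall h, `|h| <= h0 -> forall j, kerd (Kh h j)) -> adm a N H F ->
  (forall h, `|h| <= h0 -> forall j z,
    `|Kh h j z - K j z - h * K' j z| <= C * h ^+ 2 / (1 + z ^+ 2)) ->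
  exists2 D : R, 0 <= D & forall h, `|h| <= h0 -> forall x,
    `|J (Kh h) s F x - J K s F x - h * \sum_(i <- s) J (setK K i (K' i)) s F x| <= D * h ^+ 2.
Proof.
move=> us h00 C0 dK dK' dKh HF HC.
have N0 : 0 <= N by case: HF => /(_ 0) + _; exact: le_trans.
elim: s us => [|i s IH] us /=.
  by exists 0 => // h _ x; rewrite big_nil mulr0 subrr subr0 normr0 mul0r.
have /andP[is_ us'] := us.
have [D D0 HD] := IH us'.
pose B := fun y => \sum_(j <- s) J (setK K j (K' j)) s F y.
have [M M0 HM] : exists2 M : R, 0 <= M & forall y, `|B y| <= M.
  exists (\sum_(j <- s) (\prod_(i <- s) L1 (setK K j (K' j) i) * N)).
    by apply: sumr_ge0 => j _; rewrite mulr_ge0//; apply: prodr_ge0 => k _; exact: L1_ge0.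
  move=> y; apply: le_trans (ler_norm_sum _ _ _) _; apply: ler_sum => j _.
  by case: (adm_J s (@kerd_setK K j _ dK (dK' j)) HF) => + _; exact.
have [P P0 HP] : exists2 P : R, 0 <= P & forall y, `|J K s F y| <= P.
  exists (\prod_(i <- s) L1 (K i) * N).
    by rewrite mulr_ge0//; apply: prodr_ge0 => k _; exact: L1_ge0.
  by case: (adm_J s dK HF).
have [c0 c00 Hc0] : exists2 c : R, 0 <= c & forall z, `|K i z| <= c / (1 + z ^+ 2).
  case: (dK i) => _ [c Hc]; exists c => //.
  by have := Hc 0; rewrite expr0n addr0 divr1; exact: le_trans.
have [c1 c10 Hc1] : exists2 c : R, 0 <= c & forall z, `|K' i z| <= c / (1 + z ^+ 2).
  case: (dK' i) => _ [c Hc]; exists c => //.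
  by have := Hc 0; rewrite expr0n addr0 divr1; exact: le_trans.
(* A bound of the perturbed inner integral, uniform in |h| <= h0: value, first-order term and
   remainder. *)
pose Q := P + h0 * M + D * h0 ^+ 2.
have Q0 : 0 <= Q by rewrite !addr_ge0 ?mulr_ge0 ?sqr_ge0 ?(ltW h00).
exists ((C * Q + c0 * D + c1 * (M + D * h0)) * pi).
  by rewrite mulr_ge0 ?pi_ge0// !addr_ge0 ?mulr_ge0// addr_ge0// mulr_ge0// ltW.
move=> h hh x.
have hH y := HD h hh y.
set A := J (Kh h) s F; set E := J K s F.
have hE y : `|A y - E y| <= `|h| * (M + D * h0).
  have -> : A y - E y = (A y - E y - h * B y) + h * B y by rewrite subrK.
  apply: le_trans (ler_normD _ _) _.
  apply: le_trans (lerD (hH y) (lexx _)) _.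
  rewrite normrM -[h ^+ 2]real_normK ?num_real// expr2 mulrDr [leRHS]addrC lerD ?ler_wpM2l//.
  by rewrite mulrCA ler_wpM2l// ler_wpM2l.
have hA y : `|A y| <= Q.
  have -> : A y = E y + (A y - E y) by rewrite addrC subrK.
  apply: le_trans (ler_normD _ _) _.
  rewrite /Q -addrA lerD//; apply: le_trans (hE y) _.
  apply: (@le_trans _ _ (h0 * (M + D * h0))).
    by rewrite ler_wpM2r// addr_ge0// mulr_ge0// ltW.
  by rewrite mulrDr expr2 mulrCA.
have aA := adm_J s (dKh h hh) HF.
have aE := adm_J s dK HF.
have dBj j : adm a _ _ (J (setK K j (K' j)) s F) := adm_J s (@kerd_setK K j _ dK (dK' j)) HF.
have d1 := kerd_adm_decaying x i (dKh h hh i) aA.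
have d2 := kerd_adm_decaying x i (dK i) aE.
have d3 := kerd_adm_decaying x i (dK' i) aE.
have d4 : decaying (fun z => K i z * B (upd x i z)).
  rewrite (_ : (fun z => _) = fun z => \sum_(j <- s) (K i z * J (setK K j (K' j)) s F (upd x i z))).
    by apply: decaying_sum => j; exact: kerd_adm_decaying (dBj j).
  by apply/funext => z; rewrite mulr_sumr.
have -> : \sum_(j <- i :: s) \int[mu]_z (setK K j (K' j) i z * J (setK K j (K' j)) s F (upd x i z))
  = \int[mu]_z (K' i z * E (upd x i z) + K i z * B (upd x i z)).
  rewrite big_cons RintD//; congr (_ + _).
    apply: eq_Rintegral => z _; rewrite {1}/setK eqxx; congr (_ * _).
    apply: J_eqK => j js; rewrite /setK; case: eqP => // ji.
    by move: is_; rewrite -ji js.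
  rewrite (_ : (fun z => K i z * B (upd x i z)) = fun z => \sum_(j <- s) (K i z * J (setK K j (K' j)) s F (upd x i z))); last first.
    by apply/funext => z; rewrite mulr_sumr.
  rewrite Rint_sum; last by move=> j; exact: kerd_adm_decaying (dBj j).
  rewrite big_seq [RHS]big_seq; apply: eq_bigr => j js.
  apply: eq_Rintegral => z _; rewrite {1}/setK; case: eqP => // ij.
  by move: is_; rewrite ij js.
rewrite -RintZ; last exact: decayingD.
rewrite -!RintB//; last 2 first.
- exact: decayingB.
- by apply: decayingZ; exact: decayingD.
apply: (le_trans (@Rint_decay_le _ _ (((C * Q + c0 * D + c1 * (M + D * h0)) * h ^+ 2)) _ _)); last first.
- by rewrite le_eqVlt; apply/orP; left; apply/eqP; ring.
- move=> z; set y := upd x i z.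
  (* Product rule: the remainder of the kernel in coordinate i, the remainder of the inner integral,
     and a cross term of two first-order increments; each is of order h^2. *)
  have -> : Kh h i z * A y - K i z * E y - h * (K' i z * E y + K i z * B y) =
    (Kh h i z - K i z - h * K' i z) * A y + K i z * (A y - E y - h * B y) + h * K' i z * (A y - E y).
    by ring.
  have z0 : 0 < 1 + z ^+ 2 by rewrite ltr_pwDl// sqr_ge0.
  apply: le_trans (ler_normD _ _) _; apply: le_trans (lerD (ler_normD _ _) (lexx _)) _.
  rewrite !normrM.
  have h2 : h ^+ 2 = `|h| * `|h| by rewrite -expr2 real_normK ?num_real.
  have -> : (C * Q + c0 * D + c1 * (M + D * h0)) * h ^+ 2 / (1 + z ^+ 2) =
    C * h ^+ 2 / (1 + z ^+ 2) * Q + c0 / (1 + z ^+ 2) * (D * h ^+ 2)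
    + `|h| * (c1 / (1 + z ^+ 2)) * (`|h| * (M + D * h0)) by rewrite h2; ring.
  apply: lerD; first apply: lerD; apply: ler_pM; rewrite ?mulr_ge0//.
  - exact: HC.
  - by rewrite ler_wpM2l.
- by apply: decayingB; [exact: decayingB | apply: decayingZ; exact: decayingD].
Qed.

End iterated_kernels.

(** * Expansions and masses of the one-dimensional kernels *)

Section kernel_expansions.
Context {R : realType}.
Local Notation mu := (@lebesgue_measure R).
Implicit Types (k : nat) (s x z : R).

Lemma kerd_q k s x : 0 < s -> kerd (fun z => q k s (x - z)).
Proof.
move=> s0; split; first exact: continuous_q_sub.
have [C _ HC] := @q_sub_decay R k (rho s) (rho s) `|x| (rho_gt0 s0) (normr_ge0 x).
by exists C => z; apply: HC; rewrite ?lexx.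
Qed.

Lemma L1_q_le k s x : 0 < s -> L1 (fun z => q k s (x - z)) <= hC k * pi * rho s ^+ k.
Proof.
move=> s0; have a01 : 0 <= (0 : R) <= 1 by rewrite lexx ler01.
have [_] := q_powR_integrable k x a01 s0.
rewrite powRr0 divr1; apply: le_trans; rewrite le_eqVlt; apply/orP; left; apply/eqP.
by apply: eq_Rintegral => z _; rewrite powRr0 mulr1.
Qed.

Lemma q_shift_expansion k s y : 0 < s -> exists2 C : R, 0 <= C &
  forall h z, `|h| <= 1 ->
  `|q k s (y + h - z) - q k s (y - z) - h * q k.+1 s (y - z)| <= C * h ^+ 2 / (1 + z ^+ 2).
Proof.
move=> s0; have X0 : 0 <= `|y| + 1 by rewrite addr_ge0.
have [C C0 HC] := @q_sub_decay R k.+2 (rho s) (rho s) (`|y| + 1) (rho_gt0 s0) X0.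
exists C => [|h z h1]; first exact: ltW.
rewrite mulrAC.
have dq m (t : R) : is_derive t 1 (fun t => q m s (y + t - z)) (q m.+1 s (y + t - z)).
  have H1 : is_derive t 1 (fun t : R => y + t - z) 1 by apply: is_derive_eq; ring.
  have := @is_derive1_comp R (q m s) (fun t => y + t - z) t _ _ (is_derive_q m s _) H1.
  by rewrite mulr1.
have := @taylor2 R (fun t => q k s (y + t - z)) (fun t => q k.+1 s (y + t - z))
  (fun t => q k.+2 s (y + t - z)) h (C / (1 + z ^+ 2)) (fun t _ => dq k t) (fun t _ => dq k.+1 t).
rewrite /= addr0; apply => t th; apply: HC; rewrite ?lexx//.
by apply: le_trans (ler_normD _ _) _; rewrite lerD2l (le_trans th).
Qed.

(** The restriction |h| <= s / 2 keeps s + h in [s / 2, 3 s / 2], away from the singularity at time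
    0, so that [q_sub_decay] bounds the second time derivative. *)
Lemma q_time_expansion k s y : 0 < s -> exists2 C : R, 0 <= C &
  forall h z, `|h| <= s / 2 ->
  `|q k (s + h) (y - z) - q k s (y - z) - h * q k.+2 s (y - z)| <= C * h ^+ 2 / (1 + z ^+ 2).
Proof.
move=> s0.
have s32 : 0 < s + s / 2 by rewrite addr_gt0// divr_gt0.
have [C C0 HC] := @q_sub_decay R k.+4 (rho (s + s / 2)) (rho (s / 2)) `|y| (rho_gt0 s32) (normr_ge0 y).
exists C => [|h z h1]; first exact: ltW.
rewrite mulrAC.
have st t : `|t| <= `|h| -> s / 2 <= s + t <= s + s / 2.
  by move=> th; have := le_trans th h1; rewrite ler_norml; lra.
have st0 t : `|t| <= `|h| -> 0 < s + t by move=> /st; lra.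
have dq m (t : R) : `|t| <= `|h| ->
    is_derive t 1 (fun t => q m (s + t) (y - z)) (q m.+2 (s + t) (y - z)).
  move=> /st0 th.
  have H1 : is_derive t 1 (fun t : R => s + t) 1 by apply: is_derive_eq; ring.
  have := @is_derive1_comp R (q m ^~ (y - z)) (fun t => s + t) t _ _ (is_derive_q_time m _ th) H1.
  by rewrite mulr1.
have := @taylor2 R (fun t => q k (s + t) (y - z)) (fun t => q k.+2 (s + t) (y - z))
  (fun t => q k.+4 (s + t) (y - z)) h (C / (1 + z ^+ 2)) (dq k) (dq k.+2).
rewrite /= addr0; apply => t th; apply: HC; rewrite ?lexx//.
have := st0 _ th; have /andP[] := st _ th => a1 a2 a3; rewrite /rho.
have p u : 0 < u -> 2 * Num.sqrt u \is Num.pos by move=> u0; rewrite posrE mulr_gt0// sqrtr_gt0.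
have s20 : 0 < s / 2 by rewrite divr_gt0.
by apply/andP; split; rewrite lef_pV2 ?p// ler_pM2l// ler_wsqrtr.
Qed.

(** The mass of [q k.+1] is the derivative, with respect to the centre, of the mass of [q k], which
    is constant. *)
Lemma Rint_q_shift k s x (c : R) : 0 < s -> (forall y, \int[mu]_z q k s (y - z) = c) ->
  \int[mu]_z q k.+1 s (x - z) = 0.
Proof.
move=> s0 cst.
have dk m y : decaying (fun z => q m s (y - z)) by exact/kerd_decaying/kerd_q.
have [C C0 HC] := q_shift_expansion k x s0.
have H h : `|h| <= 1 -> `|h * \int[mu]_z q k.+1 s (x - z)| <= C * pi * h ^+ 2.
  move=> h1; rewrite -normrN -[X in `|X|]add0r -(subrr c) -{1}(cst (x + h)) -(cst x).
  rewrite -RintZ// -!RintB//; [|exact: decayingB|exact: decayingZ].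
  apply: le_trans (Rint_decay_le _ (fun z => HC h z h1)) _.
    by apply: decayingB; [exact: decayingB|exact: decayingZ].
  by rewrite mulrAC.
set I := Rintegral _ _ _ in H *; apply/eqP; rewrite -normr_le0 leNgt; apply/negP => I0.
have P0 : 0 <= C * pi by rewrite mulr_ge0// pi_ge0.
have E0 : 0 < C * pi + `|I| by rewrite ltr_wpDl.
(* The bound |h I| <= C pi h^2 gives |I| <= C pi h; this [h] makes the right side at most |I| /
   2. *)
pose h := `|I| / (C * pi + `|I|) / 2.
have h0 : 0 < h by rewrite !divr_gt0.
have hE : (C * pi + `|I|) * (2 * h) = `|I|.
  by rewrite /h [2 * _]mulrC divfK ?pnatr_eq0// mulrC divfK// gt_eqF.
have h1 : `|h| <= 1 by rewrite gtr0_norm//; nra.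
have := H h h1; rewrite normrM gtr0_norm// expr2 mulrCA ler_pM2l//; nra.
Qed.

Lemma Rint_q_eq0 k s x : 0 < s -> \int[mu]_z q k.+1 s (x - z) = 0.
Proof.
move=> s0; elim: k x => [|k IH] x; last exact: (Rint_q_shift x s0 IH).
by apply: (@Rint_q_shift 0 s x 1 s0) => y; exact: q0_mass.
Qed.

End kernel_expansions.

Section weighted_decay.
Context {R : realType}.
Local Notation mu := (@lebesgue_measure R).

Lemma q_powR_decaying k (a s x : R) : 0 <= a <= 1 -> 0 < s ->
  decaying (fun z => `|q k s (x - z)| * `|x - z| `^ a).
Proof.
move=> a01 s0; have r0 := rho_gt0 s0; split.
  apply: measurable_funM.
    by apply: measurableT_comp => //; apply: continuous_measurable_fun; exact: continuous_q_sub.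
  apply: (@measurableT_comp _ _ _ _ _ _ (fun y => y `^ a)); first exact: measurable_powR.
  by apply: measurableT_comp => //; exact: measurable_funB.
rewrite /q; set r := rho s in r0 *.
exists (r ^+ k.+1 * hC k * (1 + r ^- 2) * (1 + 2 * x ^+ 2 + 2 / r ^+ 2)) => z.
set w := x - z; set Y := r * w.
have Y2 : w ^+ 2 = r ^- 2 * Y ^+ 2 by rewrite exprMn mulKf// expf_neq0// gt_eqF.
have Z0 : 0 < 1 + z ^+ 2 by rewrite ltr_pwDl// sqr_ge0.
have Y0 : 0 < 1 + Y ^+ 2 by rewrite ltr_pwDl// sqr_ge0.
have rr : 0 < r ^- 2 by rewrite invr_gt0 exprn_gt0.
rewrite normrM normr_id normrM (ger0_norm (powR_ge0 _ _)) normrX (gtr0_norm r0).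
rewrite -!mulrA ler_wpM2l ?exprn_ge0 ?(ltW r0)//.
apply: le_trans (ler_pM _ _ (hk_le k Y) (powR_le1D a01 (normr_ge0 w))) _ => //.
rewrite -!mulrA ler_wpM2l ?(ltW (hC_gt0 _))// real_normK ?num_real//.
apply: (@le_trans _ _ ((1 + r ^- 2) / (1 + Y ^+ 2))).
  rewrite expr2 invfM -mulrA [leRHS]mulrC ler_wpM2l ?invr_ge0 ?(ltW Y0)//.
  by rewrite mulrC ler_pdivrMr// Y2; have := sqr_ge0 Y; nra.
rewrite ler_wpM2l ?addr_ge0 ?(ltW rr)// ler_pdivlMr// mulrC ler_pdivrMr//.
have z2 : z ^+ 2 <= 2 * x ^+ 2 + 2 * w ^+ 2.
  by have := sqr_ge0 (2 * x - z); rewrite /w !expr2; lra.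
have := sqr_ge0 Y; have := mulr_ge0 (sqr_ge0 x) (sqr_ge0 Y).
by move: z2; rewrite Y2; nra.
Qed.

End weighted_decay.

(** * The heat semigroup and its spatial derivatives *)

Section heat_semigroup.
Context {R : realType} {n : nat}.
Local Notation mu := (@lebesgue_measure R).
Implicit Types (x y : 'rV[R]_n) (f g : 'rV[R]_n -> R) (l : seq 'I_n) (s t : R) (i j : 'I_n).

(* The kernel of the heat semigroup at time [s], differentiated once in the
   direction of each entry of [l]. *)
Definition DK l s x : 'I_n -> R -> R := fun i z => q (count_mem i l) s (x 0 i - z).

(** All coordinates are integrated, so the base point is irrelevant ([J_base]). With base point 0
    the variable [x] occurs in the kernels only, and differentiating in [x] means expanding kernels,
    never [f]. *)
Definition D l s f x : R := J (DK l s x) (enum 'I_n) f 0.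

(** The sum bounds the kernel constants of every order up to p, and the power n accounts for the n
    coordinates. The factor 2 is that of [rhoX_powR_le]. Locking keeps the constant opaque in later
    arithmetic. *)
Definition DC (p : nat) : R := locked (2 * (\sum_(k < p.+1) hC k * pi) ^+ n).

Variable a : R.
Hypothesis a01 : 0 < a < 1.
Let a0 : 0 < a. Proof. by case/andP: a01. Qed.
Let a1 : 0 <= a <= 1. Proof. by case/andP: a01 => *; rewrite !ltW. Qed.

Lemma D_base l s f x : D l s f x = J (DK l s x) (enum 'I_n) f x.
Proof. by apply: J_base => i; rewrite mem_enum. Qed.

Lemma kerd_DK l s x : 0 < s -> forall i, kerd (DK l s x i).
Proof. by move=> s0 i; exact: kerd_q. Qed.

Let A p : R := \sum_(k < p.+1) hC k * pi.

Lemma hC_le_sum k p : (k <= p)%N -> hC k * pi <= A p.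
Proof.
move=> kp; rewrite /A -ltnS in kp *.
rewrite (bigD1 (Ordinal kp))//= lerDl; apply: sumr_ge0 => j _.
by rewrite mulr_ge0 ?pi_ge0// ltW// hC_gt0.
Qed.

Lemma DC_gt0 p : 0 < DC p.
Proof.
rewrite /DC -lock mulr_gt0// exprn_gt0// (lt_le_trans _ (hC_le_sum (leqnn p)))//.
by rewrite mulr_gt0// ?hC_gt0 ?pi_gt0.
Qed.

Lemma sum_count l : \sum_(i <- enum 'I_n) count_mem i l = size l.
Proof.
rewrite big_enum /=; elim: l => [|j l IH] /=; first by rewrite big1.
by rewrite big_split /= IH (bigD1 j)//= eqxx big1// => i /negbTE; rewrite eq_sym => ->.
Qed.

Lemma prod_DK l (r : R) : \prod_(i <- enum 'I_n) (A (size l) * r ^+ (count_mem i l)) = A (size l) ^+ n * r ^+ size l.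
Proof.
rewrite big_split /= -expr_sum sum_count; congr (_ * _).
by rewrite big_enum /= prodr_const card_ord.
Qed.

Lemma D_le l s f x N H : 0 < s -> adm a N H f ->
  `|D l s f x| <= DC (size l) * s `^ (- ((size l)%:R / 2)) * N.
Proof.
move=> s0 Hf; have N0 : 0 <= N by case: Hf => /(_ 0) + _; exact: le_trans.
rewrite /D; case: (adm_J a0 (enum 'I_n) (kerd_DK l x s0) Hf) => /(_ 0) + _.
move=> /le_trans; apply; rewrite ler_wpM2r//.
apply: (@le_trans _ _ (\prod_(i <- enum 'I_n) (A (size l) * rho s ^+ (count_mem i l)))).
  apply: ler_prod => i _; rewrite L1_ge0 /=; apply: le_trans (L1_q_le _ _ s0) _.
  apply: ler_wpM2r; first by rewrite exprn_ge0// ltW// rho_gt0.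
  by apply: hC_le_sum; exact: count_size.
rewrite prod_DK /DC -lock -/(A _) -mulrA mulrA.
have A0 : 0 <= A (size l) ^+ n.
  by rewrite exprn_ge0//; apply: sumr_ge0 => k _; rewrite mulr_ge0 ?pi_ge0// ltW// hC_gt0.
apply: (@le_trans _ _ (A (size l) ^+ n * s `^ (- ((size l)%:R / 2)))).
  by rewrite ler_wpM2l// rhoX_le.
by rewrite ler_wpM2r ?powR_ge0//; lra.
Qed.

(** The head of [l] is a coordinate whose kernel is differentiated at least once, hence of zero
    mass: [J_hoelder_le] applies there and improves the singularity by s^(a/2). *)
Lemma D_hoelder_le l s f x N H : 0 < s -> adm a N H f -> l != [::] ->
  `|D l s f x| <= DC (size l) * s `^ (a / 2 - (size l)%:R / 2) * H.
Proof.
move=> s0 Hf; case: l => // i l _; set l' := i :: l.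
have H0 : 0 <= H by case: Hf => _ /(_ 0 i 1); rewrite normr1 powR1 mulr1; exact: le_trans.
have r0 := rho_gt0 s0.
(* Only the coordinate [i] with the cancellation carries the gain rho^(-a). *)
pose B j := A (size l') * rho s ^+ (count_mem j l') / (if j == i then rho s `^ a else 1).
have sz j : (count_mem j l' <= size l')%N by exact: count_size.
have rX m : 0 <= rho s ^+ m by rewrite exprn_ge0// ltW.
have [dW HW] := q_powR_integrable (count_mem i l') (x 0 i) a1 s0.
rewrite D_base.
apply: (@le_trans _ _ ((\prod_(j <- enum 'I_n) B j) * H)).
  apply: (J_hoelder_le (a := a) a0 (i := i) (N := N)) => //.
  - exact: enum_uniq.
  - by rewrite mem_enum.
  - exact: kerd_DK.
  - by rewrite /DK /l' /= eqxx add1n; exact: Rint_q_eq0.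
  - move=> j ji; rewrite /B (negbTE ji) divr1; apply: le_trans (L1_q_le _ _ s0) _.
    by rewrite ler_wpM2r// hC_le_sum.
  - exact: q_powR_decaying.
  - rewrite /B eqxx; apply: le_trans HW _.
    by rewrite ler_wpM2r ?invr_ge0 ?powR_ge0// ler_wpM2r// hC_le_sum.
rewrite ler_wpM2r// /B big_split prod_DK.
rewrite (bigD1_seq i) ?mem_enum ?enum_uniq//= eqxx big1 ?mulr1; last first.
  by move=> j /negbTE ->; rewrite invr1.
rewrite -mulrA /DC -lock -/(A _) [2 * _]mulrC -!mulrA ler_wpM2l//; last exact: rhoX_powR_le.
by rewrite exprn_ge0//; apply: sumr_ge0 => k _; rewrite mulr_ge0 ?pi_ge0// ltW// hC_gt0.
Qed.

Lemma D_dist_le s f x N H : 0 < s -> adm a N H f ->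
  `|D [::] s f x - f x| <= n%:R * DC 0 * s `^ (a / 2) * H.
Proof.
move=> s0 Hf; rewrite D_base.
(* In dimension 0 there is no coordinate increment from which to read off 0 <= H. *)
case: (posnP n) => [n0|n0].
  have -> : enum 'I_n = [::] by apply/size0nil; rewrite size_enum_ord n0.
  by rewrite /= subrr normr0 n0 !mul0r.
have H0 : 0 <= H.
  by case: Hf => _ /(_ 0 (Ordinal n0) 1); rewrite normr1 powR1 mulr1; exact: le_trans.
have q0 z : 0 <= q 0 s z.
  by rewrite /q mulr_ge0 ?exprn_ge0 ?(ltW (rho_gt0 s0))// hk0 divr_ge0 ?expR_ge0.
have := @J_dist_le R n a a0 (DK [::] s x) (enum 'I_n) (hC 0 * pi * rho s ^+ 0 / rho s `^ a) N H f x
  (enum_uniq _) (kerd_DK [::] x s0) Hf.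
move=> /(_ _ _ _ _)/le_trans; apply.
- by move=> j z; exact: q0.
- by move=> j; exact: q0_mass.
- by move=> j _; exact: q_powR_decaying.
- by move=> j _; case: (q_powR_integrable 0 (x 0 j) a1 s0).
rewrite size_enum_ord -!mulrA ler_wpM2l// !mulrA ler_wpM2r//.
have := @rhoX_powR_le R 0 a s a1 s0; rewrite mul0r subr0 => H1.
rewrite -mulrA; apply: (@le_trans _ _ (hC 0 * pi * (2 * s `^ (a / 2)))).
  by rewrite ler_wpM2l// mulr_ge0 ?pi_ge0// ltW// hC_gt0.
rewrite mulrA ler_wpM2r ?powR_ge0// mulrC /DC -lock ler_wpM2l//.
rewrite big_ord1; case: n n0 => // m _.
(* The L1 norm of the heat kernel is at least its mass 1. This lets the power n in [DC 0] dominate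
   the first power. *)
have h1 : 1 <= hC (R := R) 0 * pi.
  have := L1_q_le 0 0 s0; rewrite expr0 mulr1; apply: le_trans.
  rewrite -(q0_mass 0 s0) /L1; apply: Rint_le; first exact/kerd_decaying/kerd_q.
    exact/decaying_norm/kerd_decaying/kerd_q.
  by move=> z; exact: ler_norm.
by rewrite -[leLHS]expr1 ler_weXn2l.
Qed.

Lemma D_sub l s f g x N H N' H' : 0 < s -> adm a N H f -> adm a N' H' g ->
  D l s (fun y => f y - g y) x = D l s f x - D l s g x.
Proof. by move=> s0 Hf Hg; exact: (@J_sub R n a a0 (DK l s x) (enum 'I_n) N H N' H' f g 0 (kerd_DK l x s0) Hf Hg). Qed.

Lemma is_derive_D l s f x i N H (t : R) : 0 < s -> adm a N H f ->
  is_derive t 1 (fun h : R => D l s f (x + h *: ei i)) (D (i :: l) s f (x + t *: ei i)).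
Proof.
move=> s0 Hf; set y := x + t *: ei i.
have HC := @q_shift_expansion R (count_mem i l) s (y 0 i) s0; case: HC => C C0 HC.
pose K' j := if j == i then (fun z => q (count_mem i l).+1 s (y 0 i - z)) else (fun=> 0).
have kerd0 : kerd (fun=> 0 : R) by split; [exact: cst_continuous|exists 0 => z; rewrite mul0r normr0].
have yE h j : (y + h *: ei i) 0 j = y 0 j + (if j == i then h else 0).
  by rewrite !mxE eqxx /=; case: (j == i); rewrite /= ?mulr1 ?mulr0.
have [||E E0 HE] := @J_expansion R n a a0 (fun h => DK l s (y + h *: ei i)) (DK l s y) K' (enum 'I_n)
  N H 1 C f (enum_uniq _) ltr01 C0 (kerd_DK l y s0) _ (fun h _ => kerd_DK l _ s0) Hf _.
- by move=> j; rewrite /K'; case: eqP => // _; exact: kerd_q.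
- move=> h h1 j z; rewrite /DK /K' yE; case: eqP => [->|_]; first exact: HC.
  rewrite addr0 subrr mulr0 subr0 normr0; apply: mulr_ge0; last exact: decay_ge0.
  by rewrite mulr_ge0 ?sqr_ge0.
apply: (@remainder_is_derive R R _ t 1 _ E 1 1) => // h h1.
have := HE h h1 0; rewrite (bigD1_seq i) ?mem_enum ?enum_uniq//= big1 => [|j ji]; last first.
  by rewrite (J_zero (i := j)) ?mem_enum// /setK eqxx /K' (negbTE ji).
rewrite addr0 powRr1// -expr2 real_normK ?num_real//.
have -> : J (setK (DK l s y) i (K' i)) (enum 'I_n) f 0 = D (i :: l) s f y.
  rewrite /D; apply: J_eqK => j _; apply/funext => z; rewrite /setK /DK /K' /= eqxx.
  by case: eqP => [->|/nesym/eqP/negbTE ->]; rewrite ?eqxx ?add1n ?add0n.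
by rewrite (_ : h%:A = h) ?scalerDl ?addrA //; exact: mulr1.
Qed.

(** Each one-dimensional factor satisfies the heat equation, so the product rule of [J_expansion]
    sums to the Laplacian. *)
Lemma is_derive_D_time l s f x N H : 0 < s -> adm a N H f ->
  is_derive s 1 (fun s => D l s f x) (\sum_i D [:: i, i & l] s f x).
Proof.
move=> s0 Hf.
have HC k (y : R) := @q_time_expansion R k s y s0.
have /choice [C HC'] : forall j : 'I_n, exists C : R, 0 <= C /\ forall h z, `|h| <= s / 2 ->
  `|q (count_mem j l) (s + h) (x 0 j - z) - q (count_mem j l) s (x 0 j - z) - h * q (count_mem j l).+2 s (x 0 j - z)|
   <= C * h ^+ 2 / (1 + z ^+ 2).
  by move=> j; have [C C0 HC1] := HC (count_mem j l) (x 0 j); exists C.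
pose C1 := \sum_j C j.
have CC j : C j <= C1.
  by rewrite /C1 (bigD1 j)//= lerDl; apply: sumr_ge0 => k _; case: (HC' k).
have C10 : 0 <= C1 by apply: sumr_ge0 => k _; case: (HC' k).
have s20 : 0 < s / 2 by rewrite divr_gt0.
have sh h : `|h| <= s / 2 -> 0 < s + h by rewrite ler_norml; lra.
pose K' j z := q (count_mem j l).+2 s (x 0 j - z).
have [||E E0 HE] := @J_expansion R n a a0 (fun h => DK l (s + h) x) (DK l s x) K' (enum 'I_n)
  N H (s / 2) C1 f (enum_uniq _) s20 C10 (kerd_DK l x s0) _ (fun h hh => kerd_DK l x (sh h hh)) Hf _.
- by move=> j; exact: kerd_q.
- move=> h h1 j z; case: (HC' j) => _ /(_ h z h1) /le_trans; apply.
  by rewrite ler_wpM2r ?decay_ge0// ler_wpM2r ?sqr_ge0.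
apply: (@remainder_is_derive R R _ s 1 _ E (s / 2) 1) => // h h1.
have := HE h h1 0; rewrite big_enum /= powRr1// -expr2 real_normK ?num_real//.
have -> : \sum_(i : 'I_n) J (setK (DK l s x) i (K' i)) (enum 'I_n) f 0 = \sum_i D [:: i, i & l] s f x.
  apply: eq_bigr => i _; rewrite /D; apply: J_eqK => j _; apply/funext => z; rewrite /setK /DK /K' /=.
  by case: eqP => [->|/nesym/eqP/negbTE ->]; rewrite ?eqxx ?add1n ?add0n.
by rewrite (_ : h%:A = h) //; exact: mulr1.
Qed.

End heat_semigroup.

(** * Potentials of the damped heat semigroup *)

Section singular_integrals.
Context {R : realType}.
Local Notation mu := (@lebesgue_measure R).
Implicit Types (c d s t p th A B b : R) (f : R -> R).

Lemma FTC2_segment (f F : R -> R) c d : c < d ->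
  (forall s, c <= s <= d -> {for s, continuous f}) ->
  (forall s, c <= s <= d -> is_derive s 1 F (f s)) ->
  (\int[mu]_(s in `[c, d]) (f s)%:E = (F d - F c)%:E)%E.
Proof.
move=> cd cf dF.
have cF s : c <= s <= d -> {for s, continuous F} by move=> /dF; exact: is_derive_continuous.
rewrite (@continuous_FTC2 _ f F c d cd) ?EFinB//.
- by apply: continuous_in_subspaceT => s; rewrite inE /= in_itv /=; exact: cf.
- split.
  + by move=> s; rewrite in_itv /= => /andP[cs sd]; apply: ex_derive; apply: dF; rewrite !ltW.
  + by apply: cvg_at_right_filter; apply: cF; rewrite lexx ltW.
  + by apply: cvg_at_left_filter; apply: cF; rewrite lexx ltW.
- move=> s; rewrite in_itv /= => /andP[cs sd]; rewrite derive1E.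
  by apply: derive_val; apply: dF; rewrite !ltW.
Qed.

Lemma is_derive_powR_sub t p s : s < t ->
  is_derive s 1 (fun s => - ((t - s) `^ p)) (p * (t - s) `^ (p - 1)).
Proof.
move=> st; have ts : 0 < t - s by rewrite subr_gt0.
have H1 : is_derive s 1 (fun s => t - s) (- 1) by apply: is_derive_eq; ring.
have H2 := @is_derive1_comp R (@powR R ^~ p) (fun s => t - s) s _ _ (@is_derive1_powR R p _ ts) H1.
have H3 : is_derive s 1 (fun s => - (((@powR R ^~ p) \o (fun s => t - s)) s)) (- (p * (t - s) `^ (p - 1) * - 1)).
  exact: is_deriveN.
by rewrite mulrN1 opprK in H3.
Qed.

Lemma continuous_powR_sub t p s : s < t -> {for s, continuous (fun s => (t - s) `^ p)}.
Proof.
move=> st; have ts : 0 < t - s by rewrite subr_gt0.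
apply: (@continuous_comp _ _ _ (fun s => t - s) (@powR R ^~ p)).
  by apply: continuousB; [exact: cst_continuous|move=> ?; exact: cvg_id].
exact: is_derive_continuous (@is_derive1_powR R p _ ts).
Qed.

Lemma integral_powR_sub c d t p : c < d -> d < t -> p != 0 ->
  (\int[mu]_(s in `[c, d]) ((t - s) `^ (p - 1))%:E = (((t - c) `^ p - (t - d) `^ p) / p)%:E)%E.
Proof.
move=> cd dt p0.
apply: etrans (@FTC2_segment (fun s => (t - s) `^ (p - 1)) (fun s => p^-1 * - ((t - s) `^ p)) c d cd _ _) _.
- by move=> s /andP[_ sd]; apply: continuous_powR_sub; exact: le_lt_trans dt.
- move=> s /andP[_ sd]; have st : s < t by exact: le_lt_trans dt.
  have H := is_derive_powR_sub p st.
  by apply: is_derive_eq; rewrite /GRing.scale /=; field.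
- by congr EFin; ring.
Qed.

Lemma measurable_powR_sub t p (D : set R) : measurable D -> measurable_fun D (fun s => (t - s) `^ p).
Proof.
move=> mD; apply: measurable_funTS.
apply: (@measurableT_comp _ _ _ _ _ _ (fun y => y `^ p)); first exact: measurable_powR.
exact: measurable_funB.
Qed.

(** For th < 1 the integrand is unbounded at [t]: the interval is exhausted by segments on which the
    primitive is available, and monotone convergence gives the bound. *)
Lemma integral_powR_sub_le c t th : c < t -> 0 < th ->
  (\int[mu]_(s in `]c, t[) ((t - s) `^ (th - 1))%:E <= ((t - c) `^ th / th)%:E)%E.
Proof.
move=> ct th0.
(* The denominator k + 2 >= 2 puts every right end strictly between [c] and [t]. *)
pose I (k : nat) : set (measurableTypeR R) := `[c, t - (t - c) / k.+2%:R]%classic.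
have kk k : c < t - (t - c) / k.+2%:R < t.
  have tc : 0 < t - c by rewrite subr_gt0.
  rewrite ltrBlDr ltrDl divr_gt0// andbT ltrBrDl -ltrBrDr ltr_pdivrMr//.
  by rewrite -[ltLHS]mulr1 ltr_pM2l// ltr1n.
have mI k : measurable (I k) by exact: measurable_itv.
have ndI : nondecreasing_seq I.
  apply/nondecreasing_seqP => k; rewrite subsetEset => s; rewrite /I /= !in_itv /= => /andP[-> /=].
  move=> /le_trans; apply; rewrite lerD2l lerN2 ler_wpM2l//; first by rewrite subr_ge0 ltW.
  by rewrite lef_pV2 ?posrE// ler_nat.
have sub : `]c, t[%classic `<=` \bigcup_k I k.
  move=> s /=; rewrite in_itv /= => /andP[cs st].
  have [k Hk] : exists k : nat, (t - c) / (t - s) < k%:R.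
    exists (Num.bound ((t - c) / (t - s))); apply: archi_boundP.
    by rewrite divr_ge0// subr_ge0 ltW// (lt_trans cs).
  exists k => //; rewrite /I /= in_itv /= (ltW cs) /= lerBrDr addrC -lerBrDr.
  rewrite ler_pdivrMr// mulrC -ler_pdivrMr ?subr_gt0//.
  by apply: le_trans (ltW Hk) _; rewrite ler_nat -addn2 leq_addr.
have f0 s : (0 <= ((t - s) `^ (th - 1))%:E)%E by rewrite lee_fin powR_ge0.
apply: (@le_trans _ _ (\int[mu]_(s in \bigcup_k I k) ((t - s) `^ (th - 1))%:E)%E).
  apply: ge0_subset_integral => //.
  - exact: bigcupT_measurable.
  - by apply/measurable_EFinP; apply: measurable_powR_sub; exact: bigcupT_measurable.
apply: (cvge_to_le (@ge0_nondecreasing_set_cvg_integral _ _ _ I _ _ ndI mI _ _)).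
- move=> i; apply/measurable_EFinP.
  exact: (@measurable_powR_sub t (th - 1) _ (measurable_itv `[c, t - (t - c) / i.+2%:R])).
- by move=> i s _; exact: f0.
- apply: nearW => k; rewrite /I; have /andP[k1 k2] := kk k.
  rewrite integral_powR_sub ?gt_eqF// lee_fin ler_pM2r ?invr_gt0// lerBlDr lerDl.
  exact: powR_ge0.
Qed.

Lemma continuous_oo_measurable c t f : (forall s, c < s < t -> {for s, continuous f}) ->
  measurable_fun `]c, t[ f.
Proof.
move=> cf; apply: open_continuous_measurable_fun; first exact: interval_open.
by move=> s; rewrite inE /= in_itv /=; exact: cf.
Qed.

Lemma dominated_Rint (D : set (measurableTypeR R)) (f g : measurableTypeR R -> R) M : measurable D -> measurable_fun D f -> measurable_fun D g ->
  (forall s, D s -> `|f s| <= g s) -> (\int[mu]_(s in D) (g s)%:E <= M%:E)%E ->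
  mu.-integrable D (EFin \o f) /\ `|\int[mu]_(s in D) f s| <= M.
Proof.
move=> mD mf mg fg gM.
have g0 s : D s -> 0 <= g s by move=> /fg; exact: le_trans.
have Ig : mu.-integrable D (EFin \o g).
  apply/integrableP; split; first exact/measurable_EFinP.
  rewrite (@eq_integral _ _ _ mu D (fun s => (g s)%:E)) ?(le_lt_trans gM) ?ltry// => s; rewrite inE => Ds.
  by rewrite /= ger0_norm ?g0.
have If : mu.-integrable D (EFin \o f).
  apply: (@le_integrable _ _ _ mu D mD (EFin \o f) (EFin \o g) _ _ Ig); first exact/measurable_EFinP.
  by move=> s Ds /=; rewrite lee_fin (le_trans (fg s Ds))// ler_norm.
split; first exact: If.
apply: le_trans (le_normr_Rintegral mD If) _.
apply: (@le_trans _ _ (\int[mu]_(s in D) g s)).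
  by apply: le_Rintegral => //; exact: integrable_norm.
by rewrite /Rintegral -lee_fin fineK//; exact: integrable_fin_num.
Qed.

Lemma near_Rint c t th A f : c < t -> 0 < th ->
  (forall s, c < s < t -> {for s, continuous f}) ->
  (forall s, c < s < t -> `|f s| <= A * (t - s) `^ (th - 1)) ->
  mu.-integrable `]c, t[ (EFin \o f) /\
  `|\int[mu]_(s in `]c, t[) f s| <= A * ((t - c) `^ th / th).
Proof.
move=> ct th0 cf fA.
have A0 : 0 <= A.
  have cm : c < (c + t) / 2 < t by rewrite midf_lt// midf_lt.
  have := le_trans (normr_ge0 _) (fA _ cm).
  by rewrite pmulr_lge0// powR_gt0// subr_gt0; case/andP: cm.
apply: (@dominated_Rint _ _ (fun s => A * (t - s) `^ (th - 1))) => //.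
- exact: continuous_oo_measurable.
- by apply: measurable_funM => //; exact: measurable_powR_sub.
under eq_integral do rewrite EFinM.
rewrite ge0_integralZl//=.
- by rewrite EFinM lee_wpmul2l ?lee_fin//; exact: integral_powR_sub_le.
- by apply/measurable_EFinP; exact: measurable_powR_sub.
- by move=> s _; rewrite lee_fin powR_ge0.
Qed.

(* Near the singularity [s = t] the first bound is integrated, at distance
   more than [b] from it the second one. *)
Lemma near_far_Rint c t b th1 th2 A B f : c < t -> 0 < b -> 0 < th1 -> 0 < th2 -> 0 <= A -> 0 <= B ->
  (forall s, c < s < t -> {for s, continuous f}) ->
  (forall s, c < s < t -> `|f s| <= A * (t - s) `^ (th1 - 1)) ->
  (forall s, c < s < t -> `|f s| <= B * (t - s) `^ (- th2 - 1)) ->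
  `|\int[mu]_(s in `]c, t[) f s| <= A * (b `^ th1 / th1) + B * (b `^ (- th2) / th2).
Proof.
move=> ct b0 th10 th20 A0 B0 cf fA fB.
have [If H] := near_Rint ct th10 cf fA.
have P2 : 0 <= B * (b `^ (- th2) / th2) by rewrite mulr_ge0// divr_ge0 ?powR_ge0// ltW.
have [tcb|ctb] := leP (t - c) b.
  apply: le_trans H _; apply: ler_wpDr => //.
  rewrite ler_wpM2l// ler_wpM2r ?invr_ge0 ?(ltW th10)//.
  by apply: ge0_ler_powR; rewrite ?nnegrE ?subr_ge0 ?(ltW th10) ?(ltW ct) ?(ltW b0).
have cd : c < t - b by lra.
have dt : t - b < t by lra.
have split : `]c, t[%classic = `]c, t - b] `|` `]t - b, t[.
  rewrite -itv_bndbnd_setU//= bnd_simp; lra.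
have I1 : mu.-integrable `]c, t - b] (EFin \o f).
  by apply: integrableS If => //; rewrite split => s; left.
have I2 : mu.-integrable `]t - b, t[ (EFin \o f).
  by apply: integrableS If => //; rewrite split => s; right.
rewrite split Rintegral_setU//; last 2 first.
- by rewrite -split.
- apply/disj_setPS => s [] /=; rewrite !in_itv /= => /andP[_ s1] /andP[s2 _].
  by move: s1; rewrite leNgt s2.
rewrite addrC; apply: le_trans (ler_normD _ _) _; apply: lerD.
  have := @near_Rint (t - b) t th1 A f dt th10.
  rewrite opprB addrCA subrr addr0; case => // s /andP[sb st]; [apply: cf|apply: fA];
  by rewrite st andbT; lra.
have sb s : c < s <= t - b -> c < s < t by move=> /andP[-> /le_lt_trans]; apply.
have H2 : (\int[mu]_(s in `]c, (t - b)%R]) (B * (t - s) `^ (- th2 - 1))%:E <= (B * (b `^ (- th2) / th2))%:E)%E.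
  have mP (D : set R) : measurable D -> measurable_fun D (fun s => ((t - s) `^ (- th2 - 1))%:E).
    by move=> mD; apply/measurable_EFinP; exact: measurable_powR_sub.
  under eq_integral do rewrite EFinM.
  rewrite ge0_integralZl//=; [|exact: mP|by move=> s _; rewrite lee_fin powR_ge0].
  rewrite EFinM lee_wpmul2l ?lee_fin//.
  apply: (@le_trans _ _ (\int[mu]_(s in `[c, (t - b)%R]) ((t - s) `^ (- th2 - 1))%:E)%E).
    apply: ge0_subset_integral => //; [exact: mP|by move=> s _; rewrite lee_fin powR_ge0|].
    by move=> s /=; rewrite !in_itv /= => /andP[/ltW -> ->].
  rewrite integral_powR_sub ?oppr_eq0 ?gt_eqF// lee_fin opprB addrCA subrr addr0.
  rewrite invrN mulrN -mulNr opprB ler_pM2r ?invr_gt0// lerBlDr lerDl.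
  exact: powR_ge0.
have [] // := @dominated_Rint `]c, (t - b)%R]%classic f (fun s => B * (t - s) `^ (- th2 - 1)) _ _ _ _ _ H2.
- by move/integrableP: I1 => [/measurable_EFinP].
- by apply: measurable_funM => //; exact: measurable_powR_sub.
- by move=> s /=; rewrite in_itv /= => /sb; exact: fB.
Qed.

Lemma Rintegral_split c d t f : c <= d -> d < t -> mu.-integrable `]c, t[ (EFin \o f) ->
  \int[mu]_(s in `]c, t[) f s = \int[mu]_(s in `]c, d[) f s + \int[mu]_(s in `]d, t[) f s.
Proof.
move=> cd dt If.
have split : `]c, t[%classic = `]c, d] `|` `]d, t[ by rewrite -itv_bndbnd_setU.
have I1 : mu.-integrable `]c, d] (EFin \o f).
  by apply: integrableS If => //; rewrite split => s; left.
rewrite split Rintegral_setU//; last 2 first.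
- by rewrite -split.
- apply/disj_setPS => s [] /=; rewrite !in_itv /= => /andP[_ s1] /andP[s2 _].
  by move: s1; rewrite leNgt s2.
congr (_ + _); rewrite Rintegral_itv_bndo_bndc//.
by apply: integrableS I1 => //; apply: subset_itvl; rewrite bnd_simp.
Qed.

Section real_integrable.
Variable D : set (measurableTypeR R).
Hypothesis mD : measurable D.
Implicit Types u v : measurableTypeR R -> R.

Lemma integrableB_real u v : mu.-integrable D (EFin \o u) -> mu.-integrable D (EFin \o v) ->
  mu.-integrable D (EFin \o (fun s => u s - v s)).
Proof. by move=> Iu Iv; exact: (integrableB mD Iu Iv). Qed.

Lemma integrableD_real u v : mu.-integrable D (EFin \o u) -> mu.-integrable D (EFin \o v) ->
  mu.-integrable D (EFin \o (fun s => u s + v s)).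
Proof. by move=> Iu Iv; exact: (integrableD mD Iu Iv). Qed.

Lemma integrableZ_real k u : mu.-integrable D (EFin \o u) ->
  mu.-integrable D (EFin \o (fun s => k * u s)).
Proof. by move=> Iu; exact: (integrableZl mD k Iu). Qed.

Lemma Rintegral_sum_real (I : Type) (r : seq I) (u : I -> measurableTypeR R -> R) :
  (forall i, mu.-integrable D (EFin \o u i)) ->
  mu.-integrable D (EFin \o (fun s => \sum_(i <- r) u i s)) /\
  \int[mu]_(s in D) (\sum_(i <- r) u i s) = \sum_(i <- r) \int[mu]_(s in D) u i s.
Proof.
move=> Iu; elim: r => [|i r [IH1 IH2]].
  rewrite (_ : (fun s => _) = fun=> 0); last by apply/funext => s; rewrite big_nil.
  rewrite big_nil; split; last by rewrite /Rintegral integral0.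
  exact: integrable0.
have E : (fun s => \sum_(j <- i :: r) u j s) = (fun s => u i s + \sum_(j <- r) u j s).
  by apply/funext => s; rewrite big_cons.
rewrite E big_cons -IH2 RintegralD//; split=> //; exact: integrableD_real.
Qed.

End real_integrable.

End singular_integrals.

Section exp_bounds.
Context {R : realType}.
Implicit Types (y g s t lam p q : R).

(** Applied to y = lam s it converts the damping into the small factor lam^(-g), at the price of a
    singularity stronger by s^(-g). *)
Lemma expRN_le_powR y g : 0 < y -> 0 <= g <= 1 -> expR (- y) <= y `^ (- g).
Proof.
move=> y0 /andP[g0 g1]; rewrite expRN powRN lef_pV2 ?posrE ?expR_gt0 ?powR_gt0//.
apply: le_trans (expR_ge1Dx _); case: (leP y 1) => y1.
  apply: (@le_trans _ _ (1 `^ g)); first by rewrite ge0_ler_powR// nnegrE ltW.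
  by rewrite powR1 lerDl ltW.
apply: (@le_trans _ _ (y `^ 1)); first by apply: ler_powR => //; exact: ltW.
by rewrite powRr1 ?lerDr// ltW.
Qed.

Lemma expRN_le1 y : 0 <= y -> expR (- y) <= 1.
Proof. by move=> y0; rewrite -expR0 ler_expR oppr_le0. Qed.

Lemma mul_expRN_le1 y : 0 <= y -> y * expR (- y) <= 1.
Proof.
move=> y0; rewrite expRN ler_pdivrMr ?expR_gt0// mul1r.
by apply: le_trans (expR_ge1Dx _); rewrite lerDr.
Qed.

Lemma powRDgt0 s p q : 0 < s -> s `^ (p + q) = s `^ p * s `^ q.
Proof. by move=> s0; rewrite powRD// (negbT (gt_eqF s0)) implybT. Qed.

Lemma powR_decr s t p : 0 < s -> s <= t -> p <= 0 -> t `^ p <= s `^ p.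
Proof.
move=> s0 st p0; have t0 := lt_le_trans s0 st; rewrite -[p]opprK.
rewrite (powRN s) (powRN t) lef_pV2 ?posrE ?powR_gt0//.
by apply: ge0_ler_powR; rewrite ?nnegrE ?oppr_ge0 ?(ltW s0) ?(ltW t0).
Qed.

End exp_bounds.

(** * The semigroup damped by exp (- lam s) *)

Section damped_semigroup.
Context {R : realType} {n : nat}.
Local Notation DCn := (@DC R n).
Variables (a lam : R).
Hypothesis a01 : 0 < a < 1.
Hypothesis lam0 : 0 < lam.
Implicit Types (x y : 'rV[R]_n) (f : 'rV[R]_n -> R) (l : seq 'I_n) (s t h M e g : R) (i j : 'I_n) (p : nat).

Definition S l s f x : R := expR (- (lam * s)) * D l s f x.

Lemma is_derive_S l s f x i N H t : 0 < s -> adm a N H f ->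
  is_derive t 1 (fun h : R => S l s f (x + h *: ei i)) (S (i :: l) s f (x + t *: ei i)).
Proof.
move=> s0 Hf; have dD := is_derive_D a01 l x i t s0 Hf.
by apply: is_derive_eq; rewrite /S /GRing.scale /=; ring.
Qed.

Lemma is_derive_S_time l s f x N H : 0 < s -> adm a N H f ->
  is_derive s 1 (fun s => S l s f x) (\sum_i S [:: i, i & l] s f x - lam * S l s f x).
Proof.
move=> s0 Hf; have dD := is_derive_D_time a01 l x s0 Hf.
have dE : is_derive s 1 (fun s => expR (- (lam * s))) (- lam * expR (- (lam * s))).
  have H1 : is_derive s 1 (fun s => - (lam * s)) (- lam).
    by apply: is_derive_eq; rewrite /GRing.scale /= mulr1.
  have := @is_derive1_comp R expR (fun s => - (lam * s)) s _ _ (is_derive_expR _) H1.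
  by rewrite mulrC.
rewrite /S; apply: is_derive_eq; rewrite /GRing.scale /= -mulr_sumr; ring.
Qed.

(* The two instances are [e = 0], [M] a bound of [f], and
   [e = a / 2], [M] a Hoelder constant of [f]. *)
Definition Dbd e M p f := 0 <= M /\ forall l, (p <= size l)%N -> forall s x, 0 < s ->
  `|D l s f x| <= DCn (size l) * M * s `^ (e - (size l)%:R / 2).

Lemma adm_Dbd_sup f N H : adm a N H f -> Dbd 0 N 0 f.
Proof.
move=> Hf; split; first by case: Hf => /(_ 0) + _; exact: le_trans.
move=> l _ s x s0; apply: le_trans (D_le a01 l x s0 Hf) _.
by rewrite sub0r mulrAC.
Qed.

Lemma adm_Dbd_hoelder f N H : 0 <= H -> adm a N H f -> Dbd (a / 2) H 1 f.
Proof.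
move=> H0 Hf; split => // l l1 s x s0; apply: le_trans (D_hoelder_le a01 x s0 Hf _) _.
  by case: l l1.
by rewrite mulrAC.
Qed.

Lemma S_le e M p f l s x : Dbd e M p f -> (p <= size l)%N -> 0 < s ->
  `|S l s f x| <= DCn (size l) * M * s `^ (e - (size l)%:R / 2).
Proof.
move=> [M0 Hf] pl s0; rewrite /S normrM ger0_norm ?expR_ge0//.
apply: le_trans (Hf l pl s x s0); rewrite ler_piMl//.
by apply: expRN_le1; rewrite mulr_ge0// ltW.
Qed.

Lemma S_damped_le e M p f l s x g : Dbd e M p f -> (p <= size l)%N -> 0 < s -> 0 <= g <= 1 ->
  `|S l s f x| <= lam `^ (- g) * (DCn (size l) * M) * s `^ (e - (size l)%:R / 2 - g).
Proof.
move=> [M0 Hf] pl s0 g01; rewrite /S normrM ger0_norm ?expR_ge0//.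
apply: le_trans (ler_pM _ _ (expRN_le_powR (mulr_gt0 lam0 s0) g01) (Hf l pl s x s0)) _ => //.
rewrite (powRDgt0 (e - (size l)%:R / 2) (- g) s0) powRM ?(ltW lam0) ?(ltW s0)//.
set u := s `^ (_ - _); set v := DCn _.
by rewrite le_eqVlt; apply/orP; left; apply/eqP; ring.
Qed.

(** Two bounds for one increment. The first, without a gain in h, serves near the singularity; the
    second pays one more derivative for a factor |h| and serves away from it. The exponent g adjusts
    the second to a prescribed power of time. *)
Lemma S_diff_x_le e M p f l s x i h N H : adm a N H f -> Dbd e M p f -> (p <= size l)%N -> 0 < s ->
  `|S l s f (x + h *: ei i) - S l s f x| <= 2 * (DCn (size l) * M) * s `^ (e - (size l)%:R / 2)
  /\ forall g, 0 <= g <= 1 -> `|S l s f (x + h *: ei i) - S l s f x|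
    <= `|h| * (lam `^ (- g) * (DCn (size l).+1 * M)) * s `^ (e - (size l).+1%:R / 2 - g).
Proof.
move=> Hf Hb pl s0; split.
  apply: le_trans (ler_normB _ _) _.
  by rewrite -[leRHS]mulrA [leRHS]mulr_natl mulr2n; apply: lerD; exact: (S_le _ Hb pl s0).
move=> g g01.
have := @mvt_norm R (fun h => S l s f (x + h *: ei i)) (fun h => S (i :: l) s f (x + h *: ei i)) h _
  (fun t _ => is_derive_S l x i t s0 Hf)
  (fun t _ => @S_damped_le e M p f (i :: l) s (x + t *: ei i) g Hb (leqW pl) s0 g01).
by rewrite scale0r addr0 => /le_trans; apply; rewrite [leLHS]mulrC [leLHS]mulrA.
Qed.

Lemma S_taylor_x_le e M p f l s x i h N H : adm a N H f -> Dbd e M p f -> (p <= (size l).+1)%N -> 0 < s ->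
  `|S l s f (x + h *: ei i) - S l s f x - h * S (i :: l) s f x|
    <= `|h| * (2 * (DCn (size l).+1 * M)) * s `^ (e - (size l).+1%:R / 2)
  /\ forall g, 0 <= g <= 1 -> `|S l s f (x + h *: ei i) - S l s f x - h * S (i :: l) s f x|
    <= `|h| * (`|h| * (lam `^ (- g) * (DCn (size l).+2 * M))) * s `^ (e - (size l).+2%:R / 2 - g).
Proof.
move=> Hf Hb pl s0.
have K c : (forall t, `|t| <= `|h| -> `|S (i :: l) s f (x + t *: ei i) - S (i :: l) s f x| <= c) ->
  `|S l s f (x + h *: ei i) - S l s f x - h * S (i :: l) s f x| <= `|h| * c.
  move=> Hc; rewrite [leRHS]mulrC.
  have := @mvt_norm R (fun h => S l s f (x + h *: ei i) - h * S (i :: l) s f x)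
    (fun h => S (i :: l) s f (x + h *: ei i) - S (i :: l) s f x) h c _ Hc.
  rewrite scale0r mul0r subr0 addr0 addrAC; apply => t _.
  have H1 := is_derive_S l x i t s0 Hf.
  by apply: is_derive_eq; rewrite /GRing.scale /=; ring.
split; first rewrite -mulrA; last (move=> g g01; rewrite -mulrA).
  by apply: K => t _; have [] := @S_diff_x_le e M p f (i :: l) s x i t N H Hf Hb pl s0.
apply: K => t th; have [_ /(_ g g01)] := @S_diff_x_le e M p f (i :: l) s x i t N H Hf Hb pl s0.
move=> /le_trans; apply; rewrite ler_wpM2r ?powR_ge0// ler_wpM2r//.
by rewrite mulr_ge0 ?powR_ge0// mulr_ge0 ?(ltW (DC_gt0 _))//; case: Hb.
Qed.

(** The zero-order term is no worse than the Laplacian because lam s exp (- lam s) <= 1; the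
    constant is therefore independent of [lam]. *)
Lemma dS_le e M p f l s x : Dbd e M p f -> (p <= size l)%N -> 0 < s ->
  `|\sum_i S [:: i, i & l] s f x - lam * S l s f x| <=
  (n%:R * DCn (size l).+2 + DCn (size l)) * M * s `^ (e - (size l)%:R / 2 - 1).
Proof.
move=> Hb pl s0; apply: le_trans (ler_normB _ _) _; rewrite mulrDl mulrDl; apply: lerD.
  apply: le_trans (ler_norm_sum _ _ _) _.
  apply: (@le_trans _ _ (\sum_(i < n) DCn (size l).+2 * M * s `^ (e - (size l).+2%:R / 2))).
    by apply: ler_sum => i _; apply: (@S_le e M p f [:: i, i & l]) => //; rewrite (leq_trans pl)//= leqW.
  have -> : e - (size l).+2%:R / 2 = e - (size l)%:R / 2 - 1.
    by rewrite -(natr1 (size l).+1) -(natr1 (size l)); field.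
  set u := s `^ _; set v := DCn _; rewrite sumr_const card_ord -[leLHS]mulr_natl.
  by rewrite !mulrA.
case: Hb => M0 /(_ l pl s x s0) H1.
rewrite powRDgt0// powR_inv1 ?(ltW s0)//.
rewrite /S !normrM (gtr0_norm lam0) (ger0_norm (expR_ge0 _)).
apply: (@le_trans _ _ (s^-1 * `|D l s f x|)).
  rewrite mulrA ler_wpM2r// -[s^-1]mul1r ler_pdivlMr// mulrAC.
  by apply: mul_expRN_le1; rewrite mulr_ge0// ltW.
by rewrite mulrC [leRHS]mulrA ler_wpM2r// invr_ge0 ltW.
Qed.

Lemma S_diff_time_le e M p f l s x h N H : adm a N H f -> Dbd e M p f -> (p <= size l)%N -> 0 < s -> 0 <= h ->
  e - (size l)%:R / 2 <= 0 ->
  `|S l (s + h) f x - S l s f x| <= 2 * (DCn (size l) * M) * s `^ (e - (size l)%:R / 2)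
  /\ `|S l (s + h) f x - S l s f x|
    <= h * ((n%:R * DCn (size l).+2 + DCn (size l)) * M) * s `^ (e - (size l)%:R / 2 - 1).
Proof.
move=> Hf Hb pl s0 h0 el; have sh : s <= s + h by rewrite lerDl.
have D0 q : 0 <= DCn q by exact/ltW/DC_gt0.
have M0 : 0 <= M by case: Hb.
split.
  apply: le_trans (ler_normB _ _) _.
  rewrite -[leRHS]mulrA [leRHS]mulr_natl mulr2n; apply: lerD; last exact: (S_le _ Hb pl s0).
  apply: le_trans (S_le _ Hb pl _) _; first exact: lt_le_trans sh.
  by apply: ler_wpM2l; [rewrite mulr_ge0|exact: powR_decr].
have := @mvt_le R (fun s => S l s f x) (fun s => \sum_i S [:: i, i & l] s f x - lam * S l s f x)
  s (s + h) ((n%:R * DCn (size l).+2 + DCn (size l)) * M * s `^ (e - (size l)%:R / 2 - 1)) sh.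
rewrite (addrAC s h) subrr add0r [X in _ <= X]mulrC [in X in _ -> _ -> X]mulrA; apply.
- by move=> r /andP[sr _]; apply: (is_derive_S_time _ _ _ Hf); exact: lt_le_trans sr.
- move=> r /andP[sr _]; apply: le_trans (dS_le _ Hb pl _) _; first exact: lt_le_trans sr.
  apply: ler_wpM2l; first by apply: mulr_ge0 => //; apply: addr_ge0 => //; exact: mulr_ge0.
  by apply: powR_decr => //; lra.
Qed.

End damped_semigroup.

Ltac nonneg := repeat first [assumption | exact: powR_ge0 | exact/ltW/DC_gt0
  | by apply: ltW | by [] | apply: addr_ge0 | apply: divr_ge0 | apply: mulr_ge0].

Lemma continuous_sum_at (R : realType) (T : topologicalType) (I : Type) (r : seq I) (f : I -> T -> R) (s : T) :
  (forall i, {for s, continuous (f i)}) -> {for s, continuous (fun u => \sum_(i <- r) f i u)}.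
Proof.
move=> cf; elim: r => [|i r IH].
  rewrite (_ : (fun u => _) = fun=> 0); first exact: cst_continuous.
  by apply/funext => u; rewrite big_nil.
rewrite (_ : (fun u => _) = fun u => f i u + \sum_(j <- r) f j u); first exact: continuousD.
by apply/funext => u; rewrite big_cons.
Qed.

(** * Duhamel potentials *)

Section duhamel.
Context {R : realType} {n : nat}.
Local Notation mu := (@lebesgue_measure R).
Local Notation DCn := (@DC R n).
Variables (a lam : R).
Hypothesis a01 : 0 < a < 1.
Hypothesis lam0 : 0 < lam.
Implicit Types (x y : 'rV[R]_n) (g : 'rV[R]_n -> R -> R) (l : seq 'I_n) (s t h M e N H L : R) (i j : 'I_n) (p : nat).

(** Parabolic Hölder sources, with sup bound N, spatial constant H and temporal constant L kept
    apart: which of the three enters an estimate decides whether the fixed-point and absorption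
    arguments close. *)
Definition src N H L g := (forall s, 0 <= s -> adm a N H (g ^~ s)) /\
  forall x s s', 0 <= s -> 0 <= s' -> `|g x s - g x s'| <= L * `|s - s'| `^ (a / 2).

(** For empty [l] the solution of w_t = Delta w - lam w + g with zero initial value; for other [l]
    the integrals that turn out to be its derivatives. The open interval leaves out the singular
    endpoint s = t. *)
Definition V l g x t : R := \int[mu]_(s in `]0, t[) S lam l (t - s) (g ^~ s) x.

Lemma DCn_ge0 p : 0 <= DCn p. Proof. exact/ltW/DC_gt0. Qed.

Lemma S_sub l s (f k : 'rV[R]_n -> R) x N H N' H' : 0 < s -> adm a N H f -> adm a N' H' k ->
  S lam l s (fun y => f y - k y) x = S lam l s f x - S lam l s k x.
Proof. by move=> s0 Hf Hk; rewrite /S (D_sub a01 l x s0 Hf Hk) mulrBr. Qed.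

Lemma adm_sub (f k : 'rV[R]_n -> R) N H N' H' (c : R) : adm a N H f -> adm a N' H' k ->
  (forall x, `|f x - k x| <= c) -> adm a c (H + H') (fun y => f y - k y).
Proof.
move=> [_ Hf] [_ Hk] Hc; split => // x i h.
rewrite mulrDl.
have -> : f (x + h *: ei i) - k (x + h *: ei i) - (f x - k x) =
  (f (x + h *: ei i) - f x) - (k (x + h *: ei i) - k x) by ring.
by apply: le_trans (ler_normB _ _) _; apply: lerD.
Qed.

(** The variable occurs both in the semigroup and in the source: first the source is frozen, then
    the change of the source is controlled by its Hölder continuity in time. *)
Lemma continuous_integrand N H L g l x t s : src N H L g -> 0 < s < t ->
  {for s, continuous (fun s => S lam l (t - s) (g ^~ s) x)}.
Proof.
move=> [Ha Ht] /andP[s0 st]; have ts : 0 < t - s by rewrite subr_gt0.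
have a20 : 0 < a / 2 by rewrite divr_gt0//; case/andP: a01.
have c1 : {for s, continuous (fun r => S lam l (t - r) (g ^~ s) x)}.
  apply: (@continuous_comp _ _ _ (fun r => t - r) (fun u => S lam l u (g ^~ s) x)).
    by apply: continuousB; [exact: cst_continuous|move=> ?; exact: cvg_id].
  exact: is_derive_continuous (is_derive_S_time lam a01 l x ts (Ha s (ltW s0))).
pose r0 := (t - s) / 2; have r00 : 0 < r0 by rewrite divr_gt0.
pose C := DCn (size l) * `|L| * r0 `^ (0 - (size l)%:R / 2).
have C0 : 0 <= C by rewrite /C mulr_ge0 ?powR_ge0// mulr_ge0// DCn_ge0.
apply/cvgrPdist_lt => e e0; near=> r.
have rr : `|s - r| <= r0 by near: r; apply: cvgr_dist_le.
have r0t : r0 <= t - r by move: rr; rewrite ler_norml /r0; lra.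
have rt : 0 < t - r by exact: lt_le_trans r0t.
have rp : 0 <= r.
  have : `|s - r| <= s by near: r; apply: cvgr_dist_le.
  by rewrite ler_norml; lra.
have A : `|S lam l (t - s) (g ^~ s) x - S lam l (t - r) (g ^~ s) x| < e / 2.
  by near: r; have /cvgrPdist_lt := c1; apply; rewrite divr_gt0.
have B : `|s - r| <= (e / 2 / (C + 1)) `^ (a / 2)^-1.
  by near: r; apply: cvgr_dist_le => //; rewrite powR_gt0// !divr_gt0// ltr_wpDl.
have Hd : adm a (`|L| * `|s - r| `^ (a / 2)) (H + H) (fun y => g y s - g y r).
  apply: adm_sub; [apply: Ha; exact: ltW|exact: Ha|].
  move=> y; apply: le_trans (Ht y s r (ltW s0) rp) _.
  by rewrite ler_wpM2r ?powR_ge0// ler_norm.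
have D1 : `|S lam l (t - r) (g ^~ s) x - S lam l (t - r) (g ^~ r) x| < e / 2.
  rewrite -(S_sub l x rt (Ha s (ltW s0)) (Ha r rp)).
  apply: le_lt_trans (S_le lam0 x (adm_Dbd_sup a01 Hd) (leq0n _) rt) _.
  apply: (@le_lt_trans _ _ (C * `|s - r| `^ (a / 2))).
    rewrite /C mulrA [leRHS]mulrAC; apply: ler_wpM2l.
      by rewrite mulr_ge0 ?powR_ge0// mulr_ge0// DCn_ge0.
    by apply: powR_decr => //; rewrite sub0r oppr_le0 divr_ge0.
  apply: (@le_lt_trans _ _ (C * (e / 2 / (C + 1)))).
    rewrite ler_wpM2l//; have C1 : 0 < C + 1 by rewrite ltr_wpDl.
    have -> : e / 2 / (C + 1) = ((e / 2 / (C + 1)) `^ (a / 2)^-1) `^ (a / 2).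
      by rewrite -powRrM mulVf ?gt_eqF// powRr1// !divr_ge0// ltW.
    by apply: ge0_ler_powR; rewrite ?nnegrE ?powR_ge0// ltW.
  have C1 : 0 < C + 1 by rewrite ltr_wpDl.
  by rewrite mulrA ltr_pdivrMr// mulrC ltr_pM2l ?divr_gt0// ltrDl.
rewrite [e]splitr; apply: le_lt_trans (ler_distD (S lam l (t - r) (g ^~ s) x) _ _) _.
exact: ltrD.
Unshelve. all: by end_near. Qed.

(* [th - 1] is the exponent of the singularity of the integrand. *)
Lemma integrable_integrand N H L g l x c t e M p : src N H L g -> 0 <= c -> c < t ->
  (forall s, 0 <= s -> Dbd e M p (g ^~ s)) -> (p <= size l)%N -> 0 < 1 + e - (size l)%:R / 2 ->
  mu.-integrable `]c, t[ (EFin \o (fun s => S lam l (t - s) (g ^~ s) x)) /\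
  `|\int[mu]_(s in `]c, t[) S lam l (t - s) (g ^~ s) x|
    <= DCn (size l) * M * ((t - c) `^ (1 + e - (size l)%:R / 2) / (1 + e - (size l)%:R / 2)).
Proof.
move=> Hg c0 ct Hb pl th0; apply: near_Rint => // s /andP[cs st].
  apply: (@continuous_integrand N H L g l x t s Hg); by rewrite st (le_lt_trans c0).
have := S_le lam0 x (Hb s (ltW (le_lt_trans c0 cs))) pl (_ : 0 < t - s).
by rewrite subr_gt0 => /(_ st) /le_trans; apply; rewrite (_ : _ - 1 = e - (size l)%:R / 2)//; ring.
Qed.

Lemma V0 l g x : V l g x 0 = 0.
Proof. by rewrite /V set_itv_ge ?bnd_simp// Rintegral_set0. Qed.

Lemma V_le N H L g l x t e M p : src N H L g -> 0 <= t ->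
  (forall s, 0 <= s -> Dbd e M p (g ^~ s)) -> (p <= size l)%N ->
  0 < 1 + e - (size l)%:R / 2 < 1 ->
  `|V l g x t| <= DCn (size l) * M * lam `^ (- (1 + e - (size l)%:R / 2)) *
     ((1 + e - (size l)%:R / 2)^-1 + (1 - (1 + e - (size l)%:R / 2))^-1).
Proof.
move=> Hg t0 Hb pl /andP[]; set th := 1 + e - _ => th0 th1.
have M0 : 0 <= M by case: (Hb 0 (lexx _)).
have K0 : 0 <= DCn (size l) * M by rewrite mulr_ge0 ?DCn_ge0.
have [->|tn0] := eqVneq t 0.
  rewrite V0 normr0; apply: mulr_ge0; first by rewrite mulr_ge0 ?powR_ge0.
  by apply: addr_ge0; rewrite invr_ge0; lra.
have {}t0 : 0 < t by rewrite lt_neqAle eq_sym tn0.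
have th' : 0 < 1 - th by lra.
(* Splitting at distance 1 / lam from the singularity makes both contributions of order lam^(- th);
   this power is the source of all smallness. *)
have := @near_far_Rint R 0 t lam^-1 th (1 - th) (DCn (size l) * M) (lam `^ (- 1) * (DCn (size l) * M))
  (fun s => S lam l (t - s) (g ^~ s) x) t0.
rewrite invr_gt0 => /(_ lam0 th0 th' K0 _ _ _ _)/le_trans; apply.
- by rewrite mulr_ge0 ?powR_ge0.
- by move=> s st; exact: (@continuous_integrand N H L g l x t s Hg st).
- move=> s /andP[s0 st]; have ts : 0 < t - s by rewrite subr_gt0.
  apply: le_trans (S_le lam0 x (Hb s (ltW s0)) pl ts) _.
  by rewrite (_ : th - 1 = e - (size l)%:R / 2)// /th; ring.
- move=> s /andP[s0 st]; have ts : 0 < t - s by rewrite subr_gt0.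
  have g01 : 0 <= (1 : R) <= 1 by rewrite ler01 lexx.
  apply: le_trans (S_damped_le lam0 x (Hb s (ltW s0)) pl ts g01) _.
  by rewrite (_ : - (1 - th) - 1 = e - (size l)%:R / 2 - 1)// /th; ring.
rewrite -[lam^-1]powR_inv1 ?(ltW lam0)// -!powRrM !mulN1r opprK.
rewrite le_eqVlt; apply/orP; left; apply/eqP.
have -> : lam `^ (1 - th) = lam `^ (- th) * lam by rewrite addrC powRDgt0// powRr1// ltW.
rewrite powR_inv1 ?(ltW lam0)//; field; rewrite gt_eqF// gt_eqF// gt_eqF//.
Qed.

(** Parabolic scaling: for a spatial increment h the time integral is split at distance h^2. The far
    part gives |h| (h^2)^(a/2 - 1/2) = |h|^a. *)
Lemma near_far_square t h th A B (f : R -> R) : 0 <= t -> 0 < `|h| <= 1 -> a / 2 <= th -> 0 <= A -> 0 <= B ->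
  (forall s, 0 < s < t -> {for s, continuous f}) ->
  (forall s, 0 < s < t -> `|f s| <= A * (t - s) `^ (th - 1)) ->
  (forall s, 0 < s < t -> `|f s| <= `|h| * B * (t - s) `^ (- (1 / 2 - a / 2) - 1)) ->
  `|\int[mu]_(s in `]0, t[) f s| <= (A / th + B / (1 / 2 - a / 2)) * `|h| `^ a.
Proof.
move=> t0 /andP[h0 h1] ath A0 B0 cf fA fB; have /andP[a0 a1] := a01.
have th0 : 0 < th by lra.
have th2 : 0 < 1 / 2 - a / 2 by lra.
have [->|tn0] := eqVneq t 0.
  rewrite set_itv_ge ?bnd_simp// Rintegral_set0 normr0 mulr_ge0 ?powR_ge0//.
  by rewrite addr_ge0// divr_ge0// ltW.
have {}t0 : 0 < t by rewrite lt_neqAle eq_sym tn0.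
have b0 : 0 < `|h| `^ 2 by rewrite powR_gt0.
have hB0 : 0 <= `|h| * B by rewrite mulr_ge0.
apply: le_trans (near_far_Rint t0 b0 th0 th2 A0 hB0 cf fA fB) _.
rewrite -!powRrM [leRHS]mulrDl; apply: lerD.
  rewrite -!mulrA ler_wpM2l// mulrC ler_wpM2l ?invr_ge0 ?(ltW th0)//.
  by apply: ger_powR; [rewrite h0|lra].
rewrite le_eqVlt; apply/orP; left; apply/eqP.
have -> : `|h| `^ a = `|h| * `|h| `^ (2 * - (1 / 2 - a / 2)).
  by rewrite -{2}[`|h|]powRr1 ?(ltW h0)// -powRDgt0//; congr powR; field.
by ring.
Qed.

(** With at most one derivative, the sup bounds of the sources already make both integrals
    converge. *)
Lemma V_sub N H L N' H' L' g k l x t : src N H L g -> src N' H' L' k -> 0 <= t -> (size l <= 1)%N ->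
  V l (fun y s => g y s - k y s) x t = V l g x t - V l k x t.
Proof.
move=> Hg Hk t0 sl.
have th0 : 0 < 1 + 0 - (size l)%:R / 2 :> R.
  by case: (size l) sl => [|[|//]] _; lra.
have [->|tn0] := eqVneq t 0; first by rewrite !V0 subr0.
have {}t0 : 0 < t by rewrite lt_neqAle eq_sym tn0.
have Bg s : 0 <= s -> Dbd 0 N 0 (g ^~ s) by move=> s0; apply: (adm_Dbd_sup a01 (H := H)); case: Hg => + _; exact.
have Bk s : 0 <= s -> Dbd 0 N' 0 (k ^~ s) by move=> s0; apply: (adm_Dbd_sup a01 (H := H')); case: Hk => + _; exact.
have [I1 _] := integrable_integrand x Hg (lexx 0) t0 Bg (leq0n _) th0.
have [I2 _] := integrable_integrand x Hk (lexx 0) t0 Bk (leq0n _) th0.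
rewrite /V -RintegralB//; apply: eq_Rintegral => s; rewrite inE /= in_itv /= => /andP[s0 st].
by apply: (@S_sub l (t - s) (g ^~ s) (k ^~ s) x N H N' H'); [rewrite subr_gt0|case: Hg => + _; apply; exact: ltW|case: Hk => + _; apply; exact: ltW].
Qed.

Section estimates.
Variables (N H L e M : R) (p : nat) (g : 'rV[R]_n -> R -> R).
Hypothesis Hg : src N H L g.
Hypothesis Hb : forall s, 0 <= s -> Dbd e M p (g ^~ s).

Let Ha s : 0 <= s -> adm a N H (g ^~ s). Proof. by case: Hg => + _; exact. Qed.

Let M0 : 0 <= M. Proof. by case: (Hb (lexx 0)). Qed.

Let DM q : 0 <= DCn q * M. Proof. by rewrite mulr_ge0 ?DCn_ge0. Qed.

Let theta l := 1 + e - (size l)%:R / 2.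

Definition KX (q : nat) (th : R) : R :=
  2 * DCn q / th + lam `^ (- (th - a / 2)) * DCn q.+1 / (1 / 2 - a / 2).

Lemma KX_ge0 q (th : R) : 0 < th -> 0 <= KX q th.
Proof.
move=> th0; have /andP[a0 a1] := a01; have th2 : 0 < 1 / 2 - a / 2 by lra.
by rewrite /KX; nonneg.
Qed.

Lemma V_incr_x_le l x t i h : 0 <= t -> (p <= size l)%N -> a / 2 <= theta l <= 1 -> `|h| <= 1 ->
  `|V l g (x + h *: ei i) t - V l g x t| <= KX (size l) (theta l) * M * `|h| `^ a.
Proof.
move=> t0 pl /andP[th1 th2] h1; have /andP[a0 a1] := a01.
have th0 : 0 < theta l by lra.
have KX0 : 0 <= KX (size l) (theta l) * M by rewrite mulr_ge0// KX_ge0.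
have [->|hn0] := eqVneq h 0.
  by rewrite scale0r addr0 subrr normr0 mulr_ge0// powR_ge0.
have [->|tn0] := eqVneq t 0.
  by rewrite !V0 subrr normr0 mulr_ge0// powR_ge0.
have {}t0 : 0 < t by rewrite lt_neqAle eq_sym tn0.
have hh : 0 < `|h| <= 1 by rewrite normr_gt0 hn0.
have [I1 _] := integrable_integrand x Hg (lexx 0) t0 Hb pl th0.
have [I2 _] := integrable_integrand (x + h *: ei i) Hg (lexx 0) t0 Hb pl th0.
rewrite /V -RintegralB//.
apply: le_trans (@near_far_square t h (theta l) (2 * (DCn (size l) * M))
  (lam `^ (- (theta l - a / 2)) * (DCn (size l).+1 * M)) _ (ltW t0) hh th1 _ _ _ _ _) _.
- by rewrite mulr_ge0.
- by rewrite mulr_ge0 ?powR_ge0.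
- by move=> s st; apply: continuousB; exact: (@continuous_integrand N H L g _ _ t s Hg st).
- move=> s /andP[s0 st]; have ts : 0 < t - s by rewrite subr_gt0.
  have [+ _] := S_diff_x_le a01 lam0 x i h (Ha (ltW s0)) (Hb (ltW s0)) pl ts.
  by move/le_trans; apply; rewrite (_ : theta l - 1 = e - (size l)%:R / 2)// /theta; ring.
- move=> s /andP[s0 st]; have ts : 0 < t - s by rewrite subr_gt0.
  (* This damping exponent brings the far bound to the power of time required by [near_far_square],
     whatever the order of [l]. *)
  have g01 : 0 <= theta l - a / 2 <= 1 by lra.
  have [_ /(_ _ g01)] := S_diff_x_le a01 lam0 x i h (Ha (ltW s0)) (Hb (ltW s0)) pl ts.
  move/le_trans; apply; rewrite (_ : - (1 / 2 - a / 2) - 1 = e - (size l).+1%:R / 2 - (theta l - a / 2))//.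
  by rewrite /theta -natr1; field.
rewrite le_eqVlt; apply/orP; left; apply/eqP; rewrite /KX; ring.
Qed.

Lemma V_taylor_x_le l x t i h : 0 <= t -> (p <= (size l).+1)%N -> a / 2 <= theta (i :: l) <= 1 -> `|h| <= 1 ->
  (size l <= 1)%N ->
  `|V l g (x + h *: ei i) t - V l g x t - h * V (i :: l) g x t|
    <= KX (size l).+1 (theta (i :: l)) * M * (`|h| * `|h| `^ a).
Proof.
move=> t0 pl /andP[th1 th2] h1 sl; have /andP[a0 a1] := a01.
have th0 : 0 < theta (i :: l) by lra.
have thl : 0 < 1 + 0 - (size l)%:R / 2 :> R.
  by case: (size l) sl => [|[|//]] _; lra.
have KX0 : 0 <= KX (size l).+1 (theta (i :: l)) * M by rewrite mulr_ge0// KX_ge0.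
have [->|hn0] := eqVneq h 0.
  by rewrite scale0r addr0 subrr mul0r subr0 normr0 mul0r mulr0.
have [->|tn0] := eqVneq t 0.
  by rewrite !V0 subrr mulr0 subr0 normr0 mulr_ge0// mulr_ge0// powR_ge0.
have {}t0 : 0 < t by rewrite lt_neqAle eq_sym tn0.
have hh : 0 < `|h| <= 1 by rewrite normr_gt0 hn0.
have Hs s : 0 <= s -> Dbd 0 N 0 (g ^~ s) by move=> s0; exact: (adm_Dbd_sup a01 (Ha s0)).
have [I1 _] := integrable_integrand x Hg (lexx 0) t0 Hs (leq0n _) thl.
have [I2 _] := integrable_integrand (x + h *: ei i) Hg (lexx 0) t0 Hs (leq0n _) thl.
have [I3 _] := @integrable_integrand N H L g (i :: l) x 0 t e M p Hg (lexx 0) t0 Hb pl th0.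
rewrite /V -RintegralZl// -!RintegralB//; last 2 first.
- exact: integrableB_real.
- exact: integrableZ_real.
apply: le_trans (@near_far_square t h (theta (i :: l)) (`|h| * (2 * (DCn (size l).+1 * M)))
  (`|h| * (lam `^ (- (theta (i :: l) - a / 2)) * (DCn (size l).+2 * M))) _ (ltW t0) hh th1 _ _ _ _ _) _.
- by nonneg.
- by nonneg.
- move=> s st; apply: continuousB; first apply: continuousB.
  + exact: (@continuous_integrand N H L g _ _ t s Hg st).
  + exact: (@continuous_integrand N H L g _ _ t s Hg st).
  + by apply: cvgMl_tmp; exact: (@continuous_integrand N H L g _ _ t s Hg st).
- move=> s /andP[s0 st]; have ts : 0 < t - s by rewrite subr_gt0.
  have [+ _] := S_taylor_x_le a01 lam0 x i h (Ha (ltW s0)) (Hb (ltW s0)) pl ts.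
  by move/le_trans; apply; rewrite (_ : theta (i :: l) - 1 = e - (size l).+1%:R / 2)// /theta /=; ring.
- move=> s /andP[s0 st]; have ts : 0 < t - s by rewrite subr_gt0.
  have g01 : 0 <= theta (i :: l) - a / 2 <= 1 by lra.
  have [_ /(_ _ g01)] := S_taylor_x_le a01 lam0 x i h (Ha (ltW s0)) (Hb (ltW s0)) pl ts.
  move/le_trans; apply; rewrite (_ : - (1 / 2 - a / 2) - 1 = e - (size l).+2%:R / 2 - (theta (i :: l) - a / 2))//.
  by rewrite /theta /= -(natr1 (size l).+1); field.
rewrite le_eqVlt; apply/orP; left; apply/eqP; rewrite /KX; ring.
Qed.

(** The semigroup ages by h on the old interval, and the sources of the last h units of time are
    added. *)
Lemma V_time_split l x t h : 0 <= t -> 0 < h -> (p <= size l)%N -> 0 < theta l ->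
  V l g x (t + h) - V l g x t =
  \int[mu]_(s in `]0, t[) (S lam l (t - s + h) (g ^~ s) x - S lam l (t - s) (g ^~ s) x)
  + \int[mu]_(s in `]t, t + h[) S lam l (t + h - s) (g ^~ s) x.
Proof.
move=> t0 h0 pl th0.
have th : t < t + h by rewrite ltrDl.
have [I1 _] := integrable_integrand x Hg (lexx 0) (le_lt_trans t0 th) Hb pl th0.
rewrite {1}/V (Rintegral_split t0 th I1) addrAC; congr (_ + _).
have E s : t + h - s = t - s + h by rewrite addrAC.
under [in LHS]eq_Rintegral do rewrite E.
have [->|tn0] := eqVneq t 0.
  by rewrite /V set_itv_ge ?bnd_simp// !Rintegral_set0 subr0.
have {}t0 : 0 < t by rewrite lt_neqAle eq_sym tn0.
have [I2 _] := integrable_integrand x Hg (lexx 0) t0 Hb pl th0.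
rewrite /V RintegralB//.
rewrite (_ : (fun s => S lam l (t - s + h) (g ^~ s) x) = (fun s => S lam l (t + h - s) (g ^~ s) x)); last first.
  by apply/funext => s; rewrite E.
by apply: integrableS I1 => //; apply: subset_itvl; rewrite bnd_simp ltW.
Qed.

Definition KT (q : nat) (th : R) : R :=
  DCn q / th + (2 * DCn q / th + (n%:R * DCn q.+2 + DCn q) / (1 - th)).

Lemma KT_ge0 q (th : R) : 0 < th < 1 -> 0 <= KT q th.
Proof.
move=> /andP[th0 th1]; have th2 : 0 < 1 - th by lra.
by rewrite /KT; nonneg.
Qed.

(** For an increment in time the near and far parts are separated at distance h itself. *)
Lemma V_incr_time_le l x t h : 0 <= t -> 0 <= h -> (p <= size l)%N -> 0 < theta l < 1 ->
  `|V l g x (t + h) - V l g x t| <= KT (size l) (theta l) * M * h `^ (theta l).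
Proof.
move=> t0 h0 pl /andP[th0 th1].
have KT0 : 0 <= KT (size l) (theta l) * M by rewrite mulr_ge0// KT_ge0// th0.
have [->|hn0] := eqVneq h 0.
  by rewrite addr0 subrr normr0 mulr_ge0// powR_ge0.
have {}h0 : 0 < h by rewrite lt_neqAle eq_sym hn0.
have th : t < t + h by rewrite ltrDl.
rewrite (V_time_split x t0 h0 pl th0).
apply: le_trans (ler_normD _ _) _; rewrite /KT mulrDl mulrDl addrC; apply: lerD.
  have [_] := integrable_integrand x Hg t0 th Hb pl th0.
  rewrite -/(theta l) addrAC subrr add0r; move/le_trans; apply.
  by rewrite le_eqVlt; apply/orP; left; apply/eqP; ring.
have K2 : 0 <= (n%:R * DCn (size l).+2 + DCn (size l)) * M.
  by nonneg.
have [->|tn0] := eqVneq t 0.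
  rewrite set_itv_ge ?bnd_simp// Rintegral_set0 normr0 mulr_ge0 ?powR_ge0// mulr_ge0//.
  have th2 : 0 < 1 - theta l by lra.
  by nonneg.
have {}t0 : 0 < t by rewrite lt_neqAle eq_sym tn0.
have th2 : 0 < 1 - theta l by lra.
apply: le_trans (@near_far_Rint R 0 t h (theta l) (1 - theta l) (2 * (DCn (size l) * M))
  (h * ((n%:R * DCn (size l).+2 + DCn (size l)) * M)) _ t0 h0 th0 th2 _ _ _ _ _) _.
- by rewrite mulr_ge0.
- by rewrite mulr_ge0// ltW.
- move=> s st; apply: continuousB; last exact: (@continuous_integrand N H L g _ _ t s Hg st).
  rewrite (_ : (fun s => S lam l (t - s + h) (g ^~ s) x) = (fun s => S lam l (t + h - s) (g ^~ s) x)); last first.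
    by apply/funext => r; rewrite addrAC.
  apply: (@continuous_integrand N H L g _ _ (t + h) s Hg); case/andP: st => -> /= st; exact: lt_trans th.
- move=> s /andP[s0 st]; have ts : 0 < t - s by rewrite subr_gt0.
  have el : e - (size l)%:R / 2 <= 0 by rewrite /theta in th1; lra.
  have [+ _] := S_diff_time_le a01 lam0 x (Ha (ltW s0)) (Hb (ltW s0)) pl ts (ltW h0) el.
  by move/le_trans; apply; rewrite (_ : theta l - 1 = e - (size l)%:R / 2)// /theta; ring.
- move=> s /andP[s0 st]; have ts : 0 < t - s by rewrite subr_gt0.
  have el : e - (size l)%:R / 2 <= 0 by rewrite /theta in th1; lra.
  have [_] := S_diff_time_le a01 lam0 x (Ha (ltW s0)) (Hb (ltW s0)) pl ts (ltW h0) el.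
  by move/le_trans; apply; rewrite (_ : - (1 - theta l) - 1 = e - (size l)%:R / 2 - 1)// /theta; ring.
have -> : h `^ (- (1 - theta l)) = h `^ theta l / h.
  by rewrite opprB powRDgt0// powR_inv1// ltW.
rewrite le_eqVlt; apply/orP; left; apply/eqP; field.
by rewrite !gt_eqF.
Qed.

End estimates.

Lemma near_far_linear t h th A B (f : R -> R) : 0 <= t -> 0 < h -> 0 < th < 1 -> 0 <= A -> 0 <= B ->
  (forall s, 0 < s < t -> {for s, continuous f}) ->
  (forall s, 0 < s < t -> `|f s| <= A * (t - s) `^ (th - 1)) ->
  (forall s, 0 < s < t -> `|f s| <= h * B * (t - s) `^ (th - 2)) ->
  `|\int[mu]_(s in `]0, t[) f s| <= (A / th + B / (1 - th)) * h `^ th.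
Proof.
move=> t0 h0 /andP[th0 th1] A0 B0 cf fA fB.
have th2 : 0 < 1 - th by lra.
have [->|tn0] := eqVneq t 0.
  by rewrite set_itv_ge ?bnd_simp// Rintegral_set0 normr0; nonneg.
have {}t0 : 0 < t by rewrite lt_neqAle eq_sym tn0.
have hB0 : 0 <= h * B by nonneg.
have fB' s : 0 < s < t -> `|f s| <= h * B * (t - s) `^ (- (1 - th) - 1).
  by move=> /fB; rewrite (_ : - (1 - th) - 1 = th - 2)//; ring.
apply: le_trans (near_far_Rint t0 h0 th0 th2 A0 hB0 cf fA fB') _.
have -> : h `^ (- (1 - th)) = h `^ th / h.
  by rewrite opprB powRDgt0// powR_inv1// ltW.
rewrite le_eqVlt; apply/orP; left; apply/eqP; field.
by rewrite !gt_eqF.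
Qed.

Section time_derivative.
Variables (N H L : R) (g : 'rV[R]_n -> R -> R).
Hypothesis Hg : src N H L g.
Hypothesis H0 : 0 <= H.
Hypothesis L0 : 0 <= L.

Let Ha s : 0 <= s -> adm a N H (g ^~ s). Proof. by case: Hg => + _; exact. Qed.
Let N0 : 0 <= N. Proof. by case: (Ha (lexx 0)) => /(_ 0) + _; exact: le_trans. Qed.
Let Hs s : 0 <= s -> Dbd 0 N 0 (g ^~ s). Proof. by move=> s0; exact: (adm_Dbd_sup a01 (Ha s0)). Qed.
Let Hh s : 0 <= s -> Dbd (a / 2) H 1 (g ^~ s). Proof. by move=> s0; exact: (adm_Dbd_hoelder a01 H0 (Ha s0)). Qed.

Definition dS (s : R) f x := \sum_i S lam [:: i; i] s f x - lam * S lam [::] s f x.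

Lemma is_derive_dS s (f : 'rV[R]_n -> R) x : 0 < s -> adm a N H f ->
  is_derive s 1 (fun s => dS s f x)
   (\sum_i (\sum_j S lam [:: j; j; i; i] s f x - lam * S lam [:: i; i] s f x) - lam * dS s f x).
Proof.
move=> s0 Hf.
have d0 := is_derive_S_time lam a01 [::] x s0 Hf.
have d1 i : is_derive s 1 (S lam [:: i; i] ^~ f ^~ x) _ := is_derive_S_time lam a01 [:: i; i] x s0 Hf.
have d2 := is_derive_sum d1.
rewrite /dS (_ : (fun s => _) = fun s => (\sum_(i < n) (S lam [:: i; i] ^~ f ^~ x)) s - lam * S lam [::] s f x).
  by apply: is_derive_eq.
by apply/funext => r; rewrite fct_sumE.
Qed.

(** The right-hand side of the equation for the potential, hence the candidate for its time
    derivative. *)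
Definition VW x t := \sum_i V [:: i; i] g x t - lam * V [::] g x t + g x t.

(** On the old interval the semigroup is expanded to first order in time; on the new one the
    integrand is replaced by its limit [g x t]. The constant may depend on [tm], since the expansion
    only serves to identify the derivative. *)
Lemma V_time_taylor x tm : 0 <= tm -> exists2 C : R, 0 <= C & forall t h, 0 <= t <= tm -> 0 <= h <= 1 ->
  `|V [::] g x (t + h) - V [::] g x t - h * VW x t| <= C * (h * h `^ (a / 2)).
Proof.
move=> tm0; have /andP[a0 a1] := a01.
pose T := tm + 1; have T0 : 0 < T by rewrite ltr_wpDl.
have lam0' := ltW lam0; have T0' := ltW T0.
(* [K1] and [K2] bound the first and second time derivatives of the semigroup by s^(a/2 - 1) and
   s^(a/2 - 2). The terms with [lam] are less singular and are raised to these powers by s <= T. *)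
pose K1 := n%:R * (DCn 2 * H) + lam * (DCn 0 * N) * T `^ (1 - a / 2).
pose K2 := n%:R * ((n%:R * DCn 4 + DCn 2) * H) + lam * K1 * T.
have K10 : 0 <= K1 by rewrite /K1; nonneg.
have K20 : 0 <= K2 by rewrite /K2; nonneg.
have dSle s r : 0 <= r -> 0 < s <= T -> `|dS s (g ^~ r) x| <= K1 * s `^ (a / 2 - 1).
  move=> r0 /andP[s0 sT]; apply: le_trans (ler_normB _ _) _; rewrite mulrDl; apply: lerD.
    apply: le_trans (ler_norm_sum _ _ _) _.
    rewrite -mulrA mulr_natl -[X in _ *+ X]card_ord -sumr_const; apply: ler_sum => i _.
    have := @S_le R n lam lam0 (a / 2) H 1 (g ^~ r) [:: i; i] s x (Hh r0) isT s0.
    by rewrite /= divff.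
  rewrite normrM gtr0_norm// -!mulrA ler_wpM2l//.
  have := @S_le R n lam lam0 0 N 0 (g ^~ r) [::] s x (Hs r0) isT s0.
  rewrite mul0r subr0 powRr0 mulr1 => /le_trans; apply.
  rewrite !mulrA -[leRHS]mulrA ler_peMr ?mulr_ge0 ?DCn_ge0//.
  rewrite -[1 in leLHS](_ : s `^ (1 - a / 2) * s `^ (a / 2 - 1) = 1); last first.
    by rewrite -powRDgt0// (_ : _ + _ = 0) ?powRr0//; ring.
  rewrite ler_wpM2r ?powR_ge0//; apply: ge0_ler_powR; rewrite ?nnegrE ?(ltW s0)//; lra.
have ddSle s r : 0 <= r -> 0 < s <= T ->
  `|\sum_i (\sum_j S lam [:: j; j; i; i] s (g ^~ r) x - lam * S lam [:: i; i] s (g ^~ r) x) - lam * dS s (g ^~ r) x|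
    <= K2 * s `^ (a / 2 - 2).
  move=> r0 sT; have /andP[s0 s1] := sT.
  apply: le_trans (ler_normB _ _) _; rewrite mulrDl; apply: lerD.
    apply: le_trans (ler_norm_sum _ _ _) _.
    rewrite -mulrA mulr_natl -[X in _ *+ X]card_ord -sumr_const; apply: ler_sum => i _.
    have := @dS_le R n lam lam0 (a / 2) H 1 (g ^~ r) [:: i; i] s x (Hh r0) isT s0.
    by rewrite /= divff// (_ : a / 2 - 1 - 1 = a / 2 - 2)//; ring.
  rewrite normrM gtr0_norm// -!mulrA ler_wpM2l//.
  apply: le_trans (dSle s r r0 sT) _; rewrite ler_wpM2l//.
  rewrite (_ : a / 2 - 1 = a / 2 - 2 + 1); last by ring.
  by rewrite powRDgt0// powRr1 ?(ltW s0)// mulrC ler_wpM2r ?powR_ge0.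
exists (2 * K1 / (a / 2) + K2 / (1 - a / 2) + (n%:R * DCn 0 * H + lam * N + L)).
  have a2' : 0 < 1 - a / 2 by lra.
  have a2 : 0 < a / 2 by lra.
  by nonneg.
move=> t h /andP[t0 tT] /andP[h0 h1].
have [->|hn0] := eqVneq h 0.
  by rewrite addr0 subrr !mul0r subr0 normr0 mulr0.
have {}h0 : 0 < h by rewrite lt_neqAle eq_sym hn0.
have th : t < t + h by rewrite ltrDl.
have th1 : 0 < 1 + 0 - (@size 'I_n [::])%:R / 2 :> R by rewrite mul0r subr0 addr0.
rewrite (V_time_split Hg Hs x t0 h0 (leq0n _) th1).
pose I1 := \int[mu]_(s in `]0, t[) (S lam [::] (t - s + h) (g ^~ s) x - S lam [::] (t - s) (g ^~ s) x - h * dS (t - s) (g ^~ s) x).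
pose I2 := \int[mu]_(s in `]t, t + h[) (S lam [::] (t + h - s) (g ^~ s) x - g x t).
have cS l s u : 0 < s < u -> {for s, continuous (fun s => S lam l (u - s) (g ^~ s) x)}.
  by move=> su; exact: (@continuous_integrand N H L g l x u s Hg).
have [IS _] := @integrable_integrand N H L g [::] x 0 (t + h) 0 N 0 Hg (lexx 0) (le_lt_trans t0 th) Hs (leq0n _) th1.
have E2 s : t - s + h = t + h - s by rewrite addrAC.
have E1 : I1 = \int[mu]_(s in `]0, t[) (S lam [::] (t - s + h) (g ^~ s) x - S lam [::] (t - s) (g ^~ s) x)
   - h * (\sum_i V [:: i; i] g x t - lam * V [::] g x t).
  rewrite /I1; have [->|tn0] := eqVneq t 0.
    rewrite set_itv_ge ?bnd_simp// !Rintegral_set0 V0 mulr0 subr0 big1 ?mulr0 ?subr0// => i _.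
    by rewrite V0.
  have {}t0 : 0 < t by rewrite lt_neqAle eq_sym tn0.
  have IV i : mu.-integrable `]0, t[ (EFin \o (fun s => S lam [:: i; i] (t - s) (g ^~ s) x)).
    have th2 : 0 < 1 + a / 2 - (size [:: i; i])%:R / 2 by rewrite /= divff//; lra.
    by have [] := @integrable_integrand N H L g [:: i; i] x 0 t (a / 2) H 1 Hg (lexx 0) t0 Hh isT th2.
  have [I0 _] := @integrable_integrand N H L g [::] x 0 t 0 N 0 Hg (lexx 0) t0 Hs (leq0n _) th1.
  have Ish : mu.-integrable `]0, t[ (EFin \o (fun s => S lam [::] (t - s + h) (g ^~ s) x)).
    rewrite (_ : (fun s => S lam [::] (t - s + h) (g ^~ s) x) = (fun s => S lam [::] (t + h - s) (g ^~ s) x)).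
      by apply: integrableS IS => //; apply: subset_itvl; rewrite bnd_simp ltW.
    by apply/funext => s; rewrite E2.
  have [Isum Esum] := Rintegral_sum_real (measurable_itv `]0, t[) (index_enum 'I_n) IV.
  rewrite /V -Esum -RintegralZl// -RintegralB//; last exact: integrableZ_real.
  rewrite -RintegralZl//; last by apply: integrableB_real => //; exact: integrableZ_real.
  rewrite -RintegralB//; first exact: integrableB_real.
  by apply: integrableZ_real => //; apply: integrableB_real => //; exact: integrableZ_real.
have Icst : mu.-integrable `]t, (t + h)[ (EFin \o (fun=> g x t)).
  have [||//] := @near_Rint R t (t + h) 1 `|g x t| (fun=> g x t) th ltr01.
    by move=> s _; exact: cst_continuous.
  by move=> s _; rewrite subrr powRr0 mulr1.
have E3 : I2 = \int[mu]_(s in `]t, t + h[) S lam [::] (t + h - s) (g ^~ s) x - h * g x t.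
  have IS2 : mu.-integrable `]t, (t + h)[ (EFin \o (fun s => S lam [::] (t + h - s) (g ^~ s) x)).
    by apply: integrableS IS => //; apply: subset_itvr; rewrite bnd_simp.
  rewrite /I2 RintegralB//; congr (_ - _).
  rewrite Rintegral_cst// [X in fine X](_ : _ = h%:E) ?[g x t * _]mulrC//.
  by apply: etrans (lebesgue_measure_itv _) _; rewrite /= lte_fin th -EFinD (addrC t) addrK.
have -> : \int[mu]_(s in `]0, t[) (S lam [::] (t - s + h) (g ^~ s) x - S lam [::] (t - s) (g ^~ s) x) +
  \int[mu]_(s in `]t, (t + h)%R[) S lam [::] (t + h - s) (g ^~ s) x - h * VW x t = I1 + I2.
  by rewrite E1 E3 /VW; ring.
apply: le_trans (ler_normD _ _) _; rewrite mulrDl; apply: lerD.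
  rewrite mulrA (mulrC _ h) -mulrA.
  have th3 : 0 < a / 2 < 1 by lra.
  have sT s : 0 < s < t -> 0 < t - s <= T by rewrite /T; lra.
  have sT' s u : 0 < s < t -> t - s <= u <= t - s + h -> 0 < u <= T by rewrite /T; lra.
  apply: le_trans (@near_far_linear t h (a / 2) (h * (2 * K1)) (h * K2) _ t0 h0 th3 _ _ _ _ _) _.
  - by nonneg.
  - by nonneg.
  - move=> s st; have su : 0 < s < t + h by case/andP: st => -> /= st; exact: lt_trans th.
    apply: continuousB; first apply: continuousB.
    + rewrite (_ : (fun s => S lam [::] (t - s + h) (g ^~ s) x) = (fun s => S lam [::] (t + h - s) (g ^~ s) x)); first exact: cS.
      by apply/funext => r; rewrite E2.
    + exact: cS.
    + have c1 : {for s, continuous (fun s => dS (t - s) (g ^~ s) x)}.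
        rewrite /dS; apply: continuousB; last by apply: cvgMl_tmp; exact: cS.
        by apply: continuous_sum_at => i; exact: cS.
      by apply: cvgMl_tmp; exact: c1.
  - move=> s st; have s0 : 0 <= s by case/andP: st => /ltW.
    have tsh : t - s <= t - s + h by rewrite lerDl ltW.
    have := @mvt_le R (fun u => S lam [::] u (g ^~ s) x) (fun u => dS u (g ^~ s) x) (t - s) (t - s + h)
      (K1 * (t - s) `^ (a / 2 - 1)) tsh.
    rewrite [t - s + h]addrC addrK => HM.
    apply: le_trans (ler_normB _ _) _; rewrite -[leRHS]mulrA -[2 * K1 * _]mulrA mulr_natl mulr2n [leRHS]mulrDr.
    apply: lerD.
      rewrite [leRHS]mulrC; apply: HM.
      + move=> u us; have uT := sT' s u st; rewrite (addrC _ h) in uT.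
        by have /andP[u0 _] := uT us; exact: is_derive_S_time (Ha s0).
      + move=> u us; have uT := sT' s u st; rewrite (addrC _ h) in uT.
        apply: le_trans (dSle u s s0 (uT us)) _; rewrite ler_wpM2l//.
        by apply: powR_decr; [case/andP: (sT s st)|case/andP: us|lra].
    by rewrite normrM gtr0_norm// ler_wpM2l ?(ltW h0)//; apply: dSle => //; exact: sT.
  - move=> s st; have s0 : 0 <= s by case/andP: st => /ltW.
    have ts0 : 0 < t - s by case/andP: (sT s st).
    have tsh : t - s <= t - s + h by rewrite lerDl ltW.
    pose c := K2 * (t - s) `^ (a / 2 - 2).
    have uT u : t - s <= u <= t - s + h -> 0 < u <= T by exact: sT'.
    have HdS u : t - s <= u <= t - s + h -> `|dS u (g ^~ s) x - dS (t - s) (g ^~ s) x| <= h * c.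
      move=> us; have /andP[us1 us2] := us.
      apply: le_trans (@mvt_le R (fun u => dS u (g ^~ s) x) _ (t - s) u c us1 _ _) _.
      + move=> v /andP[v1 v2]; apply: (is_derive_dS x _ (Ha s0)); exact: lt_le_trans v1.
      + move=> v /andP[v1 v2]; apply: le_trans (ddSle v s s0 (uT v _)) _.
          by rewrite v1 (le_trans v2).
        by rewrite /c ler_wpM2l//; apply: powR_decr => //; lra.
      have c0 : 0 <= c by rewrite /c; nonneg.
      by rewrite mulrC ler_wpM2r// lerBlDl.
    have := @mvt_le R (fun u => S lam [::] u (g ^~ s) x - u * dS (t - s) (g ^~ s) x)
      (fun u => dS u (g ^~ s) x - dS (t - s) (g ^~ s) x) (t - s) (t - s + h) (h * c) tsh _ HdS.
    have -> : t - s + h - (t - s) = h by ring.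
    have -> : S lam [::] (t - s + h) (g ^~ s) x - (t - s + h) * dS (t - s) (g ^~ s) x -
      (S lam [::] (t - s) (g ^~ s) x - (t - s) * dS (t - s) (g ^~ s) x) =
      S lam [::] (t - s + h) (g ^~ s) x - S lam [::] (t - s) (g ^~ s) x - h * dS (t - s) (g ^~ s) x by ring.
    have -> : h * (h * K2) * (t - s) `^ (a / 2 - 2) = h * c * h by rewrite /c; ring.
    apply => u /uT/andP[u0 _].
    have d1 := is_derive_S_time lam a01 [::] x u0 (Ha s0).
    by apply: is_derive_eq; rewrite /dS /GRing.scale /=; ring.
  rewrite le_eqVlt; apply/orP; left; apply/eqP; rewrite !mulrA; field.
  by rewrite !gt_eqF//; lra.
have Pk : 0 <= n%:R * DCn 0 * H + lam * N + L by nonneg.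
rewrite /I2; have [||_] := @near_Rint R t (t + h) 1 ((n%:R * DCn 0 * H + lam * N + L) * h `^ (a / 2))
  (fun s => S lam [::] (t + h - s) (g ^~ s) x - g x t) th ltr01.
- move=> s /andP[s1 s2]; apply: continuousB; last exact: cst_continuous.
  by apply: cS; rewrite s2 (le_lt_trans t0).
- move=> s /andP[s1 s2]; rewrite subrr powRr0 mulr1.
  have s0 : 0 <= s by exact: le_trans (ltW s1).
  set v := t + h - s; have v0 : 0 < v by rewrite subr_gt0.
  have vh : v <= h by rewrite /v; lra.
  have hp : h <= h `^ (a / 2).
    by rewrite -[leLHS]powRr1 ?(ltW h0)//; apply: ger_powR; [rewrite h0|lra].
  have vp : v `^ (a / 2) <= h `^ (a / 2).
    by apply: ge0_ler_powR; rewrite ?nnegrE ?(ltW v0) ?(ltW h0)//; lra.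
  have e1 : expR (- (lam * v)) <= 1 by apply: expRN_le1; nonneg.
  have e2 : 1 - expR (- (lam * v)) <= lam * v.
    by have := expR_ge1Dx (- (lam * v)); lra.
  (* Three errors: the heat semigroup against the identity, the damping factor against 1, and the
     source at time s against time t. *)
  have -> : S lam [::] v (g ^~ s) x - g x t = expR (- (lam * v)) * (D [::] v (g ^~ s) x - g x s)
    + (- (1 - expR (- (lam * v))) * g x s + (g x s - g x t)) by rewrite /S; ring.
  apply: le_trans (ler_normD _ _) _; rewrite 2!mulrDl -[leRHS]addrA; apply: lerD.
    rewrite normrM ger0_norm ?expR_ge0//.
    apply: (@le_trans _ _ `|D [::] v (g ^~ s) x - g x s|); first by rewrite ler_piMl.
    apply: le_trans (D_dist_le a01 x v0 (Ha s0)) _.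
    rewrite -!mulrA ler_wpM2l// ler_wpM2l ?DCn_ge0// mulrC ler_wpM2l//.
  apply: le_trans (ler_normD _ _) _; apply: lerD.
    rewrite normrM normrN (@ger0_norm _ (1 - _)) ?subr_ge0//.
    apply: (@le_trans _ _ (lam * v * N)).
      by apply: ler_pM => //; [rewrite subr_ge0|case: (Ha s0)].
    rewrite mulrAC -!mulrA ler_wpM2l// ler_wpM2l//; exact: le_trans hp.
  case: Hg => _ HL; apply: le_trans (HL x s t s0 t0) _; rewrite ler_wpM2l//.
  apply: ge0_ler_powR; rewrite ?nnegrE ?(ltW h0)//; first lra.
  by rewrite gtr0_norm ?subr_gt0//; lra.
move=> /le_trans; apply; rewrite (addrC t) addrK powRr1 ?(ltW h0)// divr1.
by rewrite -mulrA [h `^ _ * h]mulrC.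
Qed.

End time_derivative.

End duhamel.

Lemma is_derive_line (R : realType) (V W : normedModType R) (f : V -> W) (x v : V) (r : R) (d : W) :
  is_derive r 1 (fun r : R => f (x + r *: v)) d <-> is_derive (x + r *: v) v f d.
Proof.
have E : (fun h : R => h^-1 *: (((fun r : R => f (x + r *: v)) \o shift r) (h *: 1) - f (x + r *: v)))
  = (fun h : R => h^-1 *: ((f \o shift (x + r *: v)) (h *: v) - f (x + r *: v))).
  apply/funext => h /=; congr (_ *: (f _ - _)).
  by rewrite [h *: (1 : R)]mulr1 scalerDl addrCA.
have E1 : derivable (fun r : R => f (x + r *: v)) r 1 = derivable f (x + r *: v) v.
  exact: (congr1 (fun q : R -> W => cvg (q @ (0 : R)^')) E).
have E2 : 'D_1 (fun r : R => f (x + r *: v)) r = 'D_v f (x + r *: v).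
  exact: (congr1 (fun q : R -> W => lim (q @ (0 : R)^')) E).
by split=> -[H1 H2]; apply: DeriveDef; rewrite ?E1 ?E2 in H1 H2 *.
Qed.

(** * Sources and time quotients *)

Section source_algebra.
Context {R : realType} {n : nat}.
Variable a : R.
Hypothesis a01 : 0 < a < 1.
Implicit Types (x y : 'rV[R]_n) (f : 'rV[R]_n -> R) (g k : 'rV[R]_n -> R -> R) (s t h M N H L : R) (i j : 'I_n).

Lemma src_ge0 N H L g : src a N H L g -> 0 <= N.
Proof. by case=> /(_ 0 (lexx _)) [/(_ 0) + _] _; exact: le_trans. Qed.

Lemma src_le N H L N' H' L' g : src a N H L g -> N <= N' -> H <= H' -> L <= L' -> src a N' H' L' g.
Proof.
move=> [Ha Ht] NN HH LL; split=> [s s0|x s s' s0 s'0].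
  have [A B] := Ha s s0; split=> [x|x i h]; first exact: le_trans (A x) NN.
  by apply: le_trans (B x i h) _; rewrite ler_wpM2r ?powR_ge0.
by apply: le_trans (Ht x s s' s0 s'0) _; rewrite ler_wpM2r ?powR_ge0.
Qed.

Lemma src_add N H L N' H' L' g k : src a N H L g -> src a N' H' L' k ->
  src a (N + N') (H + H') (L + L') (fun x t => g x t + k x t).
Proof.
move=> [Ha Ht] [Ha' Ht']; split=> [s s0|x s s' s0 s'0].
  have [A B] := Ha s s0; have [A' B'] := Ha' s s0; split=> [x|x i h].
    by apply: le_trans (ler_normD _ _) _; exact: lerD.
  by rewrite opprD addrACA mulrDl; apply: le_trans (ler_normD _ _) _; exact: lerD.
rewrite opprD addrACA mulrDl; apply: le_trans (ler_normD _ _) _; apply: lerD; [exact: Ht|exact: Ht'].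
Qed.

Lemma src_mul N H L N' H' L' g k : src a N H L g -> src a N' H' L' k ->
  src a (N * N') (N * H' + H * N') (N * L' + L * N') (fun x t => g x t * k x t).
Proof.
move=> Hg Hk; have N0 := src_ge0 Hg; have N'0 := src_ge0 Hk.
have key (u v u' v' p q : R) : `|u'| <= N -> `|v| <= N' -> `|u' - u| <= p -> `|v' - v| <= q ->
    `|u' * v' - u * v| <= N * q + p * N'.
  move=> hu hv hp hq; have -> : u' * v' - u * v = u' * (v' - v) + (u' - u) * v by ring.
  apply: le_trans (ler_normD _ _) _; rewrite !normrM; apply: lerD; exact: ler_pM.
case: Hg Hk => Ha Ht [Ha' Ht']; split=> [s s0|x s s' s0 s'0].
  have [A B] := Ha s s0; have [A' B'] := Ha' s s0; split=> [x|x i h].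
    by rewrite normrM; exact: ler_pM.
  by apply: le_trans (key _ _ _ _ _ _ (A _) (A' _) (B x i h) (B' x i h)) _; rewrite mulrDl -!mulrA (mulrC N' (_ `^ _)).
have [A B] := Ha s s0; have [A' B'] := Ha' s' s'0.
by apply: le_trans (key _ _ _ _ _ _ (A _) (A' _) (Ht x s s' s0 s'0) (Ht' x s s' s0 s'0)) _; rewrite mulrDl -!mulrA (mulrC N' (_ `^ _)).
Qed.

Lemma src_sum (N H L : R) (g : 'I_n -> 'rV[R]_n -> R -> R) : (forall i, src a N H L (g i)) ->
  src a (n%:R * N) (n%:R * H) (n%:R * L) (fun x t => \sum_i g i x t).
Proof.
move=> Hg; have key (F : 'I_n -> R) (c : R) : (forall i, `|F i| <= c) -> `|\sum_i F i| <= n%:R * c.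
  move=> Hc; apply: le_trans (ler_norm_sum _ _ _) _.
  by rewrite mulr_natl -[X in _ *+ X]card_ord -sumr_const; exact: ler_sum.
split=> [s s0|x s s' s0 s'0].
  split=> [x|x i h]; first by apply: key => i; case: (Hg i) => /(_ s s0)[].
  by rewrite -sumrB -mulrA; apply: key => j; case: (Hg j) => /(_ s s0)[].
by rewrite -sumrB -mulrA; apply: key => j; case: (Hg j) => _; exact.
Qed.

Lemma src_static N H f : adm a N H f -> src a N H 0 (fun x _ => f x).
Proof. by move=> Hf; split=> // x s s' _ _; rewrite subrr normr0 mul0r. Qed.

Lemma src_time N L (c : R -> R) : (forall t, 0 <= t -> `|c t| <= N) ->
  (forall s t, 0 <= s -> 0 <= t -> `|c s - c t| <= L * `|s - t| `^ (a / 2)) ->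
  src a N 0 L (fun (_ : 'rV[R]_n) t => c t).
Proof.
move=> cN cL; split=> [s s0|x s s' s0 s'0]; last exact: cL.
by split=> [x|x i h]; [exact: cN|rewrite subrr normr0 mul0r].
Qed.

(** A local Hölder estimate becomes global, and with a smaller exponent, because for h > 1 the sup
    bound is already weaker than N h^q. *)
Lemma powR_interp (d K N h q p : R) : 0 <= h -> 0 <= K -> 0 <= N -> 0 < q -> q <= p ->
  (h <= 1 -> d <= K * h `^ p) -> d <= N -> d <= (K + N) * h `^ q.
Proof.
move=> h0 K0 N0 q0 qp dK dN; rewrite mulrDl; case: (leP h 1) => h1.
  apply: le_trans (dK h1) _; apply: (@le_trans _ _ (K * h `^ q)); last by rewrite lerDl mulr_ge0 ?powR_ge0.
  rewrite ler_wpM2l//; have [->|hn0] := eqVneq h 0; first by rewrite !powR0 ?gt_eqF ?(lt_le_trans q0).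
  by apply: ger_powR => //; rewrite lt_neqAle eq_sym hn0 h0.
apply: (@le_trans _ _ (N * h `^ q)); last by rewrite lerDr mulr_ge0 ?powR_ge0.
apply: le_trans dN _; rewrite ler_peMr//.
by rewrite -[leLHS](powRr0 h); apply: ler_powR; exact: ltW.
Qed.

(** Freezing at time [T] turns control on [0, T] into a source on all times, so that the potential
    estimates apply to functions controlled only on bounded intervals. *)
Lemma src_freeze N H L g T : 0 <= T -> src a N H L g -> src a N H L (fun x t => g x (Num.min t T)).
Proof.
move=> T0 [Ha Ht]; have /andP[a0 _] := a01.
have m0 t : 0 <= t -> 0 <= Num.min t T by move=> t0; rewrite le_min t0.
split=> [s s0|x s s' s0 s'0]; first exact/Ha/m0.
have L0 : 0 <= L.
  by have := Ht 0 0 1 (lexx _) ler01; rewrite sub0r normrN normr1 powR1 mulr1; exact: le_trans.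
apply: le_trans (Ht _ _ _ (m0 s s0) (m0 s' s'0)) _; rewrite ler_wpM2l//.
apply: ge0_ler_powR; rewrite ?nnegrE//; first by rewrite divr_ge0// ltW.
rewrite !minElt; case: (ltP s T) => h1; case: (ltP s' T) => h2.
- by [].
- by rewrite !ler0_norm; lra.
- by rewrite !ger0_norm; lra.
- by rewrite subrr normr0.
Qed.

Lemma adm_of_le1 N K f : 0 <= K -> (forall x, `|f x| <= N) ->
  (forall x i h, `|h| <= 1 -> `|f (x + h *: ei i) - f x| <= K * `|h| `^ a) -> adm a N (K + 2 * N) f.
Proof.
move=> K0 fN fK; split=> // x i h; have /andP[a0 _] := a01.
have N0 : 0 <= N by exact: le_trans (fN 0).
apply: (@powR_interp _ _ _ _ _ a) => //; first by rewrite mulr_ge0.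
  exact: fK.
by apply: le_trans (ler_normB _ _) _; rewrite mulr_natl mulr2n; exact: lerD.
Qed.

Lemma adm_of_derive N G f (f' : 'I_n -> 'rV[R]_n -> R) : (forall x, `|f x| <= N) ->
  (forall i x, is_derive x (ei i) f (f' i x)) -> (forall i x, `|f' i x| <= G) -> 0 <= G ->
  adm a N (G + 2 * N) f.
Proof.
move=> fN fd fG G0; have /andP[a0 a1] := a01.
apply: adm_of_le1 => // x i h h1.
have d1 (r : R) : is_derive r 1 (fun r => f (x + r *: ei i)) (f' i (x + r *: ei i)).
  by apply/is_derive_line.
have := @mvt_norm R (fun r => f (x + r *: ei i)) (fun r => f' i (x + r *: ei i)) h G.
rewrite scale0r addr0 => /(_ _ _)/le_trans; apply => //.
rewrite ler_wpM2l//; have [->|hn0] := eqVneq h 0; first by rewrite normr0 powR_ge0.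
by rewrite -[leLHS]powRr1//; apply: ger_powR; [rewrite normr_gt0 hn0|exact: ltW].
Unshelve. all: by end_near. Qed.

End source_algebra.

Section time_quotients.
Context {R : realType} {n : nat}.
Implicit Types (x : 'rV[R]_n) (u v : 'rV[R]_n -> R -> R) (t d e : R).

Lemma dnbhs_at_right (P : set R) : (\forall h \near (0 : R)^', P h) -> \forall h \near 0^'+, P h.
Proof.
rewrite !near_withinE => H; near=> h => h0.
have : h != 0 -> P h by near: h.
by apply; rewrite gt_eqF.
Unshelve. all: by end_near. Qed.

Lemma time_filter_proper t : 0 <= t -> ProperFilter (within [set h : R | 0 <= t + h] (dnbhs (0 : R))).
Proof.
move=> t0; apply: Build_ProperFilter_ex => P; rewrite /within /= => HP.
have : \forall h \near 0^'+, P h.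
  have H : \forall h \near 0^'+, 0 <= t + h -> P h by exact: (dnbhs_at_right HP).
  near=> h; have h0 : 0 < h by near: h; exact: nbhs_right_gt.
  have : 0 <= t + h -> P h by near: h.
  by apply; rewrite addr_ge0// ltW.
by move=> H; exact: (@filter_ex _ (0 : R)^'+ _ _ H).
Unshelve. all: by end_near. Qed.

Lemma is_derive_quotient (f : R -> R) t d : is_derive t 1 f d ->
  h^-1 * (f (t + h) - f t) @[h --> (0 : R)^'] --> d.
Proof.
move=> [H1 H2]; rewrite -H2; have : cvg (_ @ _) := H1; apply: cvg_trans.
by apply: near_eq_cvg; near=> h; rewrite /= /GRing.scale /= mulr1 (addrC h).
Unshelve. all: by end_near. Qed.

Lemma quotient_is_derive (f : R -> R) t d :
  h^-1 * (f (t + h) - f t) @[h --> (0 : R)^'] --> d -> is_derive t 1 f d.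
Proof.
move=> H; have H' : h^-1 *: ((f \o shift t) (h *: 1) - f t) @[h --> (0 : R)^'] --> d.
  apply: cvg_trans H; apply: near_eq_cvg; near=> h.
  by rewrite /= /GRing.scale /= mulr1 (addrC h).
by apply: DeriveDef; [apply/cvg_ex; exists d|exact: cvg_lim].
Unshelve. all: by end_near. Qed.

Lemma is_derive_time_quotient u x t d : is_derive t 1 (u x) d -> time_quotient u x t --> d.
Proof. by move=> /is_derive_quotient H; exact: cvg_within_filter. Qed.

Lemma time_quotient_is_derive u x t d : 0 < t -> time_quotient u x t --> d -> is_derive t 1 (u x) d.
Proof.
move=> t0 H; apply: quotient_is_derive => A /H; rewrite /nbhs/= /within /=.
move=> H1; have H2 : \forall h \near (0 : R)^', 0 <= t + h.
  near=> h; have : `|h| <= t by near: h; apply: dnbhs0_le.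
  by rewrite ler_norml; lra.
by apply: (@filterS2 _ (0 : R)^' _ _ _ _ _ H1 H2) => h /[swap] h0 /(_ h0).
Unshelve. all: by end_near. Qed.

Lemma time_quotient_remainder u x t d C h0 th : 0 < h0 -> 0 < th ->
  (forall h, `|h| <= h0 -> 0 <= t + h -> `|u x (t + h) - u x t - h * d| <= C * (`|h| * `|h| `^ th)) ->
  time_quotient u x t --> d.
Proof.
move=> h00 th0 H.
(* The increment is continued linearly to the inadmissible h, so that the two-sided criterion
   applies also at t = 0. *)
pose f h := if 0 <= t + h then u x (t + h) - u x t else h * d.
have C0 : 0 <= `|C| by [].
have : is_derive (0 : R) (1 : R) f d.
  apply: (@remainder_is_derive R R f 0 1 d `|C| h0 th) => // h hh.
  have -> : f 0 = 0 by rewrite /f addr0 subrr mul0r; case: ifP.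
  rewrite add0r subr0 /GRing.scale /= mulr1 /f; case: ifP => h1.
    apply: le_trans (H h hh h1) _.
    by rewrite ler_wpM2r ?ler_norm// mulr_ge0// powR_ge0.
  by rewrite subrr normr0 !mulr_ge0// powR_ge0.
move=> /is_derive_quotient /(cvg_within_filter [set h : R | 0 <= t + h]) => H1.
have : time_quotient u x t `=>` (h^-1 * (f (0 + h) - f 0) @[h --> within [set h : R | 0 <= t + h] (0 : R)^']).
  apply: near_eq_cvg; rewrite /= !nearE /within /=; near=> h => h1.
  by rewrite /f add0r h1 addr0 subrr mul0r; case: ifP => _; rewrite subr0.
by move=> H2; exact: cvg_trans H2 H1.
Unshelve. all: by end_near. Qed.

Lemma time_quotientD u v x t d e : 0 <= t -> time_quotient u x t --> d -> time_quotient v x t --> e ->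
  time_quotient (fun y s => u y s + v y s) x t --> d + e.
Proof.
move=> t0 Hu Hv; have PF := time_filter_proper t0.
apply: cvg_trans (cvgD Hu Hv); apply: near_eq_cvg; near=> h.
by rewrite -[LHS]mulrDr opprD addrACA.
Unshelve. all: by end_near. Qed.

Lemma time_quotientM u v x t d e : 0 <= t -> {for t, continuous (u x)} ->
   time_quotient u x t --> d -> time_quotient v x t --> e ->
  time_quotient (fun y s => u y s * v y s) x t --> u x t * e + d * v x t.
Proof.
move=> t0 cu Hu Hv; have PF := time_filter_proper t0.
have cu' : u x (t + h) @[h --> within [set h : R | 0 <= t + h] (0 : R)^'] --> u x t.
  have H : u x (t + h) @[h --> (0 : R)] --> u x t.
    rewrite -[in X in _ --> X](addr0 t).
    apply: (@continuous_comp _ _ _ (fun h => t + h) (u x)); last by rewrite /= addr0.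
    by apply: continuousD; [exact: cst_continuous|move=> ?; exact: cvg_id].
  apply: cvg_within_filter.
  exact: (@cvg_within_filter _ _ _ (nbhs (0 : R)) _ _ (fun y => y != 0) H).
have Hc : (fun=> v x t) @ within [set h : R | 0 <= t + h] (0 : R)^' --> v x t by exact: cvg_cst.
apply: cvg_trans (cvgD (cvgM cu' Hv) (cvgM Hu Hc)); apply: near_eq_cvg; near=> h.
have -> : h^-1 * (u x (t + h) * v x (t + h) - u x t * v x t) =
  u x (t + h) * (h^-1 * (v x (t + h) - v x t)) + h^-1 * (u x (t + h) - u x t) * v x t by ring.
by [].
Unshelve. all: by end_near. Qed.

Lemma time_quotient_cst x t (f : 'rV[R]_n -> R) : 0 <= t -> time_quotient (fun y _ => f y) x t --> (0 : R).
Proof.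
move=> t0; apply: is_derive_time_quotient; exact: is_derive_cst.
Qed.

Lemma time_derive_eq u x t d : 0 <= t -> time_quotient u x t --> d -> time_derive u x t = d.
Proof. by move=> t0 H; have PF := time_filter_proper t0; exact: cvg_lim. Qed.

(** At t = 0 only a right derivative is given. The mean value inequality is used between positive
    times, and convergence of the quotient at 0 supplies the continuity needed to reach 0. *)
Lemma time_lipschitz u x (d : R -> R) G T : 0 <= G ->
  (forall t, 0 <= t <= T -> time_quotient u x t --> d t) -> (forall t, 0 <= t <= T -> `|d t| <= G) ->
  forall s t, 0 <= s <= T -> 0 <= t <= T -> `|u x s - u x t| <= G * `|s - t|.
Proof.
move=> G0 Hd HG.
have pos s t : 0 < s -> s <= t -> t <= T -> `|u x t - u x s| <= G * (t - s).
  move=> s0 st tT; apply: (@mvt_le R (u x) d) => // r /andP[sr rt].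
    by apply: time_quotient_is_derive; [exact: lt_le_trans sr|apply: Hd; lra].
  by apply: HG; lra.
have zero t : 0 < t -> t <= T -> `|u x t - u x 0| <= G * t.
  move=> t0 tT; apply/ler_addgt0Pr => e e0.
  have H0 := Hd 0; rewrite lexx (le_trans (ltW t0) tT) in H0.
  have PF := @time_filter_proper 0 (lexx 0).
  have /cvgrPdist_le/(_ 1 ltr01) := H0 isT.
  rewrite nearE /= /nbhs /= /within /= => H1.
  have H2 : \forall h \near 0^'+, 0 <= 0 + h -> `|d 0 - h^-1 * (u x (0 + h) - u x 0)| <= 1.
    exact: (dnbhs_at_right H1).
  have e1 : 0 < e / (1 + `|d 0|) by rewrite divr_gt0// ltr_pwDl.
  near (0 : R)^'+ => s.
  have s0 : 0 < s by near: s; exact: nbhs_right_gt.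
  have st : s <= t by near: s; exact: nbhs_right_le.
  have se : s <= e / (1 + `|d 0|) by near: s; exact: nbhs_right_le.
  have : 0 <= 0 + s -> `|d 0 - s^-1 * (u x (0 + s) - u x 0)| <= 1 by near: s.
  rewrite !add0r => /(_ (ltW s0)) H3.
  have H4 : `|u x s - u x 0| <= e.
    have -> : u x s - u x 0 = s * (s^-1 * (u x s - u x 0)) by rewrite mulVKf// gt_eqF.
    rewrite normrM gtr0_norm//; apply: (@le_trans _ _ (s * (1 + `|d 0|))).
      rewrite ler_wpM2l ?(ltW s0)//.
      have -> : s^-1 * (u x s - u x 0) = - (d 0 - s^-1 * (u x s - u x 0)) + d 0 by ring.
      by apply: le_trans (ler_normD _ _) _; rewrite normrN lerD2r.
    by rewrite -ler_pdivlMr// ltr_pwDl.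
  have -> : u x t - u x 0 = (u x t - u x s) + (u x s - u x 0) by ring.
  apply: le_trans (ler_normD _ _) _; apply: lerD => //.
  apply: le_trans (pos s t s0 st tT) _; rewrite ler_wpM2l//; lra.
have key s t : 0 <= s -> s <= t -> t <= T -> `|u x t - u x s| <= G * (t - s).
  rewrite le_eqVlt => /orP[/eqP<-|s0 st tT]; last exact: pos.
  rewrite le_eqVlt => /orP[/eqP<-|t0 tT]; first by rewrite !subrr normr0 mulr0.
  by rewrite subr0; exact: zero.
move=> s t /andP[s0 sT] /andP[t0 tT]; case: (leP s t) => st.
  by rewrite distrC (distrC s) [X in _ <= _ * X]ger0_norm ?subr_ge0//; exact: key.
by rewrite [X in _ <= _ * X]gtr0_norm ?subr_gt0//; apply: key => //; exact: ltW.
Unshelve. all: by end_near. Qed.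

End time_quotients.

(** * Regularity of potentials *)

Section potential_regularity.
Context {R : realType} {n : nat}.
Variables (a lam : R).
Hypothesis a01 : 0 < a < 1.
Hypothesis lam0 : 0 < lam.
Implicit Types (x y : 'rV[R]_n) (g : 'rV[R]_n -> R -> R) (l : seq 'I_n) (s t h M e N H L th : R) (i j : 'I_n) (p q : nat).

Definition KV q th : R := @DC R n q * lam `^ (- th) * (th^-1 + (1 - th)^-1).

Lemma KV_ge0 q th : 0 < th < 1 -> 0 <= KV q th.
Proof. move=> /andP[th0 th1]; have th2 : 0 < 1 - th by lra.
by rewrite /KV mulr_ge0 ?addr_ge0 ?invr_ge0 ?(ltW th0) ?(ltW th2)//; nonneg. Qed.

Definition KH q th : R := @KX R n a lam q th + @KT R n q th + 2 * KV q th.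

Lemma KH_ge0 q th : 0 < th < 1 -> 0 <= KH q th.
Proof.
move=> th01; have /andP[th0 th1] := th01; rewrite /KH.
by have := KV_ge0 q th01; have := @KX_ge0 R n a lam a01 q th th0; have := @KT_ge0 R n q th th01; lra.
Qed.

(** All constants of the potential are multiples of the one number [M]; the instances below take for
    it a sup bound or a Hölder constant of the source. *)
Lemma src_V N H L e M p th g l : src a N H L g -> (forall s, 0 <= s -> Dbd e M p (g ^~ s)) ->
  (p <= size l)%N -> th = 1 + e - (size l)%:R / 2 -> a / 2 <= th < 1 ->
  src a (KV (size l) th * M) (KH (size l) th * M) (KH (size l) th * M) (V lam l g).
Proof.
move=> Hg Hb pl eth /andP[th0 th1]; have /andP[a0 a1] := a01.
have th01 : 0 < th < 1 by lra.
have th01' : 0 < 1 + e - (size l)%:R / 2 < 1 by rewrite -eth.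
have tha : a / 2 <= 1 + e - (size l)%:R / 2 <= 1 by rewrite -eth; lra.
have M0 : 0 <= M by case: (Hb 0 (lexx _)).
have V0' := KV_ge0 (size l) th01.
have X0 := @KX_ge0 R n a lam a01 (size l) th (proj1 (andP th01)).
have T0 := @KT_ge0 R n (size l) th th01.
have B x t : 0 <= t -> `|V lam l g x t| <= KV (size l) th * M.
  move=> t0; apply: le_trans (V_le a01 lam0 x Hg t0 Hb pl th01') _.
  by rewrite -eth /KV le_eqVlt; apply/orP; left; apply/eqP; ring.
have BB x y t t' : 0 <= t -> 0 <= t' -> `|V lam l g x t - V lam l g y t'| <= 2 * KV (size l) th * M.
  by move=> t0 t'0; apply: le_trans (ler_normB _ _) _; have := B x t t0; have := B y t' t'0; lra.
split=> [t t0|x t t' t0 t'0].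
  split=> [x|x i h]; first exact: B.
  apply: le_trans (_ : (@KX R n a lam (size l) th * M + 2 * KV (size l) th * M) * `|h| `^ a <= _); last first.
    by rewrite ler_wpM2r ?powR_ge0// -mulrDl ler_wpM2r// /KH; lra.
  apply: (@powR_interp R _ _ _ _ _ a) => //; [by nonneg|by nonneg| |exact: BB].
  by move=> h1; have := V_incr_x_le a01 lam0 Hg Hb x i t0 pl tha h1; rewrite /= -eth.
wlog tt : t t' t0 t'0 / t' <= t.
  move=> W; case: (leP t' t) => [|/ltW] tt; first exact: W.
  by rewrite distrC (distrC t); exact: W.
rewrite (ger0_norm (_ : 0 <= t - t')) ?subr_ge0//.
apply: le_trans (_ : (@KT R n (size l) th * M + 2 * KV (size l) th * M) * (t - t') `^ (a / 2) <= _); last first.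
  by rewrite ler_wpM2r ?powR_ge0// -mulrDl ler_wpM2r// /KH; lra.
have tt0 : 0 <= t - t' by rewrite subr_ge0.
have a20 : 0 < a / 2 by lra.
apply: (@powR_interp R _ _ _ _ _ th) => //; [by nonneg|by nonneg| |exact: BB].
move=> _; have := V_incr_time_le a01 lam0 Hg Hb x t'0 tt0 pl th01'.
by rewrite /= -eth (addrC t') subrK.
Qed.

Section source.
Variables (N H L : R) (g : 'rV[R]_n -> R -> R).
Hypothesis Hg : src a N H L g.
Hypothesis H0 : 0 <= H.
Hypothesis L0 : 0 <= L.

Let Hs s : 0 <= s -> Dbd 0 N 0 (g ^~ s).
Proof. by case: Hg => Ha _ s0; exact: (adm_Dbd_sup a01 (Ha s s0)). Qed.

Let Hh s : 0 <= s -> Dbd (a / 2) H 1 (g ^~ s).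
Proof. by case: Hg => Ha _ s0; exact: (adm_Dbd_hoelder a01 H0 (Ha s s0)). Qed.

(** Only the sup bound of the source enters, even in the Hölder constants. The Picard iteration and
    the absorption in [gradw_le] rest on this. *)
Lemma src_V1 i : src a (KV 1 (1 / 2) * N) (KH 1 (1 / 2) * N) (KH 1 (1 / 2) * N) (V lam [:: i] g).
Proof.
have /andP[a0 a1] := a01.
apply: (src_V (l := [:: i]) (th := 1 / 2) Hg Hs) => //=; first by field.
by apply/andP; split; lra.
Qed.

(** The Schauder estimate: with two derivatives the exponent of the sup bound is 0 and the integral
    would diverge; the Hölder constant improves the exponent to a / 2. *)
Lemma src_V2 i j : src a (KV 2 (a / 2) * H) (KH 2 (a / 2) * H) (KH 2 (a / 2) * H) (V lam [:: i; j] g).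
Proof.
have /andP[a0 a1] := a01.
apply: (src_V (l := [:: i; j]) (th := a / 2) Hg Hh) => //=; first by field.
by apply/andP; split; lra.
Qed.

Lemma is_derive_V l x t i : (size l <= 1)%N -> 0 <= t ->
  is_derive x (ei i) (V lam l g ^~ t) (V lam (i :: l) g x t).
Proof.
have /andP[a0 a1] := a01; case: l => [|j [|//]] _ t0.
  have tha : (a / 2 <= 1 + 0 - 1 / 2) && (1 + 0 - 1 / 2 <= 1 :> R) by apply/andP; split; lra.
  apply: (@remainder_is_derive R _ (V lam [::] g ^~ t) x (ei i) (V lam [:: i] g x t) _ 1 a ltr01 a0) => h hh.
  exact: (@V_taylor_x_le R n a lam a01 lam0 N H L 0 N 0 g Hg Hs [::] x t i h t0 isT tha hh isT).
have tha : (a / 2 <= 1 + a / 2 - 2 / 2) && (1 + a / 2 - 2 / 2 <= 1) by apply/andP; split; lra.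
apply: (@remainder_is_derive R _ (V lam [:: j] g ^~ t) x (ei i) (V lam [:: i; j] g x t) _ 1 a ltr01 a0) => h hh.
exact: (@V_taylor_x_le R n a lam a01 lam0 N H L (a / 2) H 1 g Hg Hh [:: j] x t i h t0 isT tha hh isT).
Qed.

(** Without derivatives the exponent is 1, where the constant of [V_le] degenerates. A bound linear
    in time suffices, as it is used on bounded time intervals. *)
Lemma V_nil_le x t : 0 <= t -> `|V lam [::] g x t| <= @DC R n 0 * N * t.
Proof.
rewrite le_eqVlt => /orP[/eqP<-|t0]; first by rewrite V0 normr0 mulr0.
have th1 : 0 < 1 + 0 - (@size 'I_n [::])%:R / 2 :> R by rewrite mul0r subr0 addr0.
have [_] := integrable_integrand a01 lam0 x Hg (lexx 0) t0 Hs isT th1.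
by rewrite (_ : 1 + 0 - _ = 1) ?subr0 ?(powRr1 (ltW t0)) ?divr1//= mul0r subr0 addr0.
Qed.

Definition CW T : R := n%:R * (KV 2 (a / 2) * H) + lam * (@DC R n 0 * N * T) + N.

Lemma VW_le T x t : 0 <= t <= T -> `|VW lam g x t| <= CW T.
Proof.
move=> /andP[t0 tT]; apply: le_trans (ler_normD _ _) _; apply: lerD; last first.
  by case: Hg => /(_ t t0)[+ _] _; exact.
apply: le_trans (ler_normB _ _) _; apply: lerD.
  apply: le_trans (ler_norm_sum _ _ _) _.
  rewrite mulr_natl -[X in _ *+ X]card_ord -sumr_const; apply: ler_sum => i _.
  by case: (src_V2 i i) => /(_ t t0)[+ _] _; exact.
have N0 := src_ge0 Hg.
rewrite normrM (@gtr0_norm _ lam)// ler_wpM2l ?(ltW lam0)//; apply: le_trans (V_nil_le x t0) _.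
by rewrite ler_wpM2l//; nonneg.
Qed.

Lemma CW_ge0 T : 0 <= T -> 0 <= CW T.
Proof.
by move=> T0; apply: le_trans (@VW_le T 0 0 _) => //; rewrite lexx.
Qed.

(** [V_time_taylor] expands forwards only. A backward increment is read as a forward one from t + h,
    which costs the Hölder continuity of [VW] in time. *)
Lemma V_time_quotient x t : 0 <= t -> time_quotient (V lam [::] g) x t --> VW lam g x t.
Proof.
move=> t0; have /andP[a0 a1] := a01.
have [C C0 HC] := V_time_taylor a01 lam0 Hg H0 L0 x t0.
have W0 := CW_ge0 t0.
have a20 : 0 < a / 2 by rewrite divr_gt0.
pose B := n%:R * (KH 2 (a / 2) * H) + lam * (CW t + C) + L.
have HB s h : 0 <= s -> s <= t -> 0 <= h <= 1 -> s + h <= t -> `|VW lam g x (s + h) - VW lam g x s| <= B * h `^ (a / 2).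
  move=> s0 st h01 sht; have /andP[h0 h1] := h01; have sh0 : 0 <= s + h by exact: addr_ge0.
  have nh : `|s + h - s| = h by rewrite addrAC subrr add0r ger0_norm.
  have hp : h <= h `^ (a / 2).
    have [->|hn0] := eqVneq h 0; first by rewrite powR_ge0.
    by rewrite -[leLHS]powRr1//; apply: ger_powR; [rewrite lt_neqAle eq_sym hn0 h0|lra].
  have hp1 : h `^ (a / 2) <= 1.
    by apply: (@le_trans _ _ (1 `^ (a / 2))); [apply: ge0_ler_powR; rewrite ?nnegrE//; lra|rewrite powR1].
  have -> : VW lam g x (s + h) - VW lam g x s =
     (\sum_i (V lam [:: i; i] g x (s + h) - V lam [:: i; i] g x s))
      - lam * (V lam [::] g x (s + h) - V lam [::] g x s) + (g x (s + h) - g x s).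
    have E (A A1 c A' A1' c' : R) : A - lam * A1 + c - (A' - lam * A1' + c') = A - A' - lam * (A1 - A1') + (c - c') by ring.
    by rewrite sumrB; exact: E.
  apply: le_trans (ler_normD _ _) _; rewrite mulrDl; apply: lerD; last first.
    by case: Hg => _ /(_ x _ _ sh0 s0); rewrite nh.
  apply: le_trans (ler_normB _ _) _; rewrite mulrDl; apply: lerD.
    apply: le_trans (ler_norm_sum _ _ _) _.
    rewrite -mulrA mulr_natl -[X in _ *+ X]card_ord -sumr_const; apply: ler_sum => i _.
    by case: (src_V2 i i) => _ /(_ x _ _ sh0 s0); rewrite nh.
  rewrite normrM gtr0_norm// -!mulrA ler_wpM2l ?(ltW lam0)//.
  rewrite -[V lam [::] g x (s + h) - V lam [::] g x s](subrK (h * VW lam g x s)).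
  apply: le_trans (ler_normD _ _) _; rewrite mulrDl addrC; apply: lerD.
    rewrite normrM ger0_norm// mulrC; apply: ler_pM => //; apply: VW_le; rewrite s0//.
  apply: le_trans (HC s h _ h01) _; first by rewrite s0.
  by rewrite mulrA [leLHS]mulrAC ler_piMr// ?mulr_ge0 ?powR_ge0//.
have B0 : 0 <= B.
  rewrite /B; have := KH_ge0 2 (_ : 0 < a / 2 < 1); rewrite a20 => /(_ _) K0.
  have {}K0 : 0 <= KH 2 (a / 2) by apply: K0; lra.
  by have lam0' := ltW lam0; nonneg.
apply: (@time_quotient_remainder R n _ x t _ (C + B) 1 (a / 2)) => // h h1 th0.
have [h0|h0] := leP 0 h.
  have h01 : 0 <= h <= 1 by rewrite h0; move: h1; rewrite ger0_norm.
  rewrite (ger0_norm h0) mulrDl; apply: (@le_trans _ _ (C * (h * h `^ (a / 2)))).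
    by apply: HC => //; rewrite t0 lexx.
  by rewrite lerDl !mulr_ge0// powR_ge0.
pose k := - h; have k0 : 0 < k by rewrite oppr_gt0.
have k01 : 0 <= k <= 1 by rewrite (ltW k0); move: h1; rewrite ltr0_norm.
pose s := t + h; have st : s <= t by rewrite gerDl ltW.
have es : t = s + k by rewrite /s /k addrK.
rewrite (ltr0_norm h0) -/k -/s.
have -> : V lam [::] g x s - V lam [::] g x t - h * VW lam g x t =
  - (V lam [::] g x (s + k) - V lam [::] g x s - k * VW lam g x s) + k * (VW lam g x (s + k) - VW lam g x s).
  have E (A A1 c d k' : R) : A - A1 - (- k') * c = - (A1 - A - k' * d) + k' * (c - d) by ring.
  by rewrite -es -[in LHS](opprK h); exact: E.
apply: le_trans (ler_normD _ _) _; rewrite normrN mulrDl; apply: lerD.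
  by apply: HC => //; rewrite th0.
rewrite normrM gtr0_norm// mulrCA ler_wpM2l ?(ltW k0)//; apply: HB => //.
by rewrite -es.
Qed.

Lemma V_nil_adm T t : 0 <= t <= T -> adm a (@DC R n 0 * N * T) (KV 1 (1 / 2) * N + 2 * (@DC R n 0 * N * T)) (V lam [::] g ^~ t).
Proof.
move=> /andP[t0 tT]; have N0 := src_ge0 Hg.
have K0 : 0 <= KV 1 (1 / 2) by apply: KV_ge0; lra.
apply: (adm_of_derive a01 (f' := fun i x => V lam [:: i] g x t)) => //.
- by move=> x; apply: le_trans (V_nil_le x t0) _; rewrite ler_wpM2l//; nonneg.
- by move=> i x; exact: is_derive_V.
- by move=> i x; case: (src_V1 i) => /(_ t t0)[+ _] _; exact.
- by nonneg.
Qed.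

Lemma V_nil_lipschitz T x s t : 0 <= s <= T -> 0 <= t <= T ->
  `|V lam [::] g x s - V lam [::] g x t| <= CW T * `|s - t|.
Proof.
move=> sT tT; have T0 : 0 <= T by case/andP: sT; exact: le_trans.
apply: (@time_lipschitz R n _ x (VW lam g x) (CW T) T (CW_ge0 T0)) => // r rT.
  by case/andP: rT => r0 _; exact: V_time_quotient.
exact: VW_le.
Qed.

End source.
End potential_regularity.

Section continuity.
Context {R : realType} {T : topologicalType}.
Implicit Types f g : T -> R.

Lemma continuous_fun_mul f g : continuous f -> continuous g -> continuous (fun p => f p * g p).
Proof. by move=> cf cg p; apply: (@continuousM _ _ f g p); [exact: cf|exact: cg]. Qed.

Lemma continuous_fun_add f g : continuous f -> continuous g -> continuous (fun p => f p + g p).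
Proof. by move=> cf cg p; apply: (@continuousD _ _ _ f g p); [exact: cf|exact: cg]. Qed.

Lemma continuous_fun_sub f g : continuous f -> continuous g -> continuous (fun p => f p - g p).
Proof. by move=> cf cg p; apply: (@continuousB _ _ _ f g p); [exact: cf|exact: cg]. Qed.

Lemma continuous_fun_cst (c : R) : continuous (fun _ : T => c).
Proof. by move=> p; exact: cst_continuous. Qed.

End continuity.

(** * The maximum principle *)

Section one_variable_tests.
Context {R : realType}.
Implicit Types (f g : R -> R) (t d : R).

Lemma dnbhs0_ex (P : set R) : (\forall h \near (0 : R)^', P h) ->
  exists2 r : R, 0 < r & forall h, h != 0 -> `|h| < r -> P h.
Proof.
rewrite near_withinE => /nbhs_ballP[r r0 H]; exists r => // h h0 hr; apply: (H h) => //.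
by rewrite -ball_normE /= sub0r normrN.
Qed.

Lemma left_max_derive_ge0 f t d (c : R) : c < t -> is_derive t (1 : R) f d ->
  (forall s, c <= s <= t -> f s <= f t) -> 0 <= d.
Proof.
move=> ct /is_derive_quotient H fmax; rewrite leNgt; apply/negP => d0.
have /cvgrPdist_lt/(_ (- d)) := H; rewrite oppr_gt0 => /(_ d0) /dnbhs0_ex[r r0 H1].
pose k := Num.min (r / 2) (t - c).
have k0 : 0 < k by rewrite lt_min divr_gt0// subr_gt0.
have kr : k < r by apply: (@le_lt_trans _ _ (r / 2)); [rewrite ge_min lexx|lra].
have kc : k <= t - c by rewrite ge_min lexx orbT.
have := H1 (- k); rewrite oppr_eq0 gt_eqF// normrN gtr0_norm// => /(_ isT kr).
have fk : f (t - k) <= f t by apply: fmax; lra.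
have q0 : 0 <= (- k)^-1 * (f (t - k) - f t).
  by rewrite invrN mulNr -mulrN mulr_ge0 ?invr_ge0 ?(ltW k0)// oppr_ge0 subr_le0.
by rewrite ltr_norml => /andP[+ _]; lra.
Qed.

(** A positive derivative of [g] at its zero 0 would make [g] positive just to the right, and [f]
    would increase there. Continuity of the second derivative does not enter. *)
Lemma max_second_derivative f g (d : R) (e : R) : 0 < e ->
  (forall h : R, `|h| < e -> f h <= f 0) -> (forall h : R, `|h| < e -> is_derive h (1 : R) f (g h)) ->
  is_derive (0 : R) (1 : R) g d -> g 0 = 0 /\ d <= 0.
Proof.
move=> e0 fmax df dg.
have in_e h : h \in `](- e), e[ -> `|h| < e by rewrite in_itv /= ltr_norml.
have ee : - e <= e by lra.
have g0 : g 0 = 0.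
  have := @derive1_at_max R f (- e) e 0 ee (fun t te => @ex_derive _ _ _ _ _ _ _ (df t (in_e t te))).
  rewrite in_itv /= oppr_lt0 e0 => /(_ isT (fun t te => fmax t (in_e t te)))[_ E1].
  have h0 : `|0 : R| < e by rewrite normr0.
  by have [_ E2] := df 0 h0; rewrite -E2 E1.
split=> //; rewrite leNgt; apply/negP => d0.
have /cvgrPdist_lt/(_ d d0)/dnbhs0_ex[r r0 H1] := is_derive_quotient dg.
pose k := Num.min (r / 2) (e / 2).
have k0 : 0 < k by rewrite lt_min !divr_gt0.
have kr : k < r by apply: (@le_lt_trans _ _ (r / 2)); [rewrite ge_min lexx|lra].
have ke : k < e by apply: (@le_lt_trans _ _ (e / 2)); [rewrite ge_min lexx orbT|lra].
have gpos h : 0 < h -> h <= k -> 0 < g h.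
  move=> h0 hk; have := H1 h; rewrite gt_eqF// gtr0_norm// add0r g0 subr0 => /(_ isT (le_lt_trans hk kr)).
  rewrite ltr_norml => /andP[_ q].
  have : 0 < h^-1 * g h by lra.
  by rewrite pmulr_rgt0// invr_gt0.
have dfk h : 0 <= h <= k -> is_derive h (1 : R) f (g h).
  by move=> /andP[h0 hk]; apply: df; rewrite ger0_norm//; exact: le_lt_trans ke.
have [||c] := @MVT R f g 0 k k0.
- by move=> h; rewrite in_itv /= => /andP[h0 hk]; apply: dfk; rewrite !ltW.
- apply: derivable_within_continuous => h; rewrite in_itv /= => hk.
  by have [] := dfk h hk.
rewrite in_itv /= => /andP[c0 ck] E.
have := fmax k; rewrite gtr0_norm// => /(_ ke).
have : 0 < g c * (k - 0) by rewrite subr0 mulr_gt0// gpos// ltW.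
by rewrite -E; lra.
Qed.

End one_variable_tests.

(** * Penalization and the maximum principle on unbounded domains *)

Section touching.
Context {R : realType} {n : nat}.
Implicit Types (x y : 'rV[R]_n) (s t K T M e B : R) (v : 'rV[R]_n -> R -> R) (i : 'I_n).

Lemma dotv_ge0 x : 0 <= dotv x x.
Proof. by apply: sumr_ge0 => i _; rewrite -expr2 sqr_ge0. Qed.

Lemma sqr_coord_le x i : x 0 i ^+ 2 <= dotv x x.
Proof.
rewrite /dotv (bigD1 i)//= -expr2 lerDl.
by apply: sumr_ge0 => j _; rewrite -expr2 sqr_ge0.
Qed.

Lemma sqr_norm_le x : `|x| ^+ 2 <= dotv x x.
Proof.
have [->|x0] := eqVneq x 0; first by rewrite normr0 expr0n; exact: dotv_ge0.
have x1 : mx_norm x != 0 by apply: contra x0 => /eqP/mx_norm_eq0->.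
have [[i j] /= E] := mx_norm_neq0 x1.
rewrite [X in X ^+ 2]E (ord1 i) real_normK ?num_real//; exact: sqr_coord_le.
Qed.

Lemma dotv_line x i (h : R) : dotv (x + h *: ei i) (x + h *: ei i) = dotv x x + 2 * h * x 0 i + h ^+ 2.
Proof.
rewrite /dotv (bigD1 i)//= [in RHS](bigD1 i)//= !mxE !eqxx mulr1.
rewrite [in LHS](eq_bigr (fun j => x 0 j * x 0 j)); first by ring.
by move=> j ji; rewrite !mxE eqxx (negbTE ji) mulr0 addr0.
Qed.

Definition strip T := [set p : 'rV[R]_n * R | 0 <= p.2 <= T].

Definition penalty e K x t := e * expR (K * t) * (1 + dotv x x).

Lemma continuous_dotv : continuous (fun x : 'rV[R]_n => dotv x x).
Proof.
move=> x; apply: continuous_sum_at => i.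
by apply: continuousM; exact: coord_continuous.
Qed.

Lemma continuous_penalty e K : continuous (fun p : 'rV[R]_n * R => penalty e K p.1 p.2).
Proof.
apply: continuous_fun_mul.
  apply: continuous_fun_mul; first exact: continuous_fun_cst.
  move=> p; apply: (@continuous_comp _ _ _ (fun p : 'rV[R]_n * R => K * p.2) expR); last exact: continuous_expR.
  by apply: (@continuous_fun_mul _ _ (fun=> K)); [exact: continuous_fun_cst|move=> q; exact: cvg_snd].
apply: continuous_fun_add; first exact: continuous_fun_cst.
by move=> p; apply: (@continuous_comp _ _ _ fst (fun x => dotv x x)); [exact: cvg_fst|exact: continuous_dotv].
Qed.

(** A bounded function on an unbounded domain need not attain its supremum. After subtraction of a
    quadratically growing penalty a maximum over a compact set is global. *)
Lemma touching T M K v (Dm : set 'rV[R]_n) x0 t0 : 0 <= K -> closed Dm ->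
  {within strip T, continuous (fun p => v p.1 p.2)} ->
  (forall x t, Dm x -> 0 <= t <= T -> v x t <= M) ->
  Dm x0 -> 0 <= t0 <= T -> 0 < v x0 t0 ->
  exists e x1 t1, [/\ 0 < e, Dm x1, 0 <= t1 <= T, penalty e K x1 t1 < v x1 t1 &
    forall x t, Dm x -> 0 <= t <= T -> v x t - penalty e K x t <= v x1 t1 - penalty e K x1 t1].
Proof.
move=> K0 cD cv vM D0 t0T v0.
have P0 : 0 < expR (K * t0) * (1 + dotv x0 x0).
  by rewrite mulr_gt0 ?expR_gt0// ltr_pwDl// dotv_ge0.
(* The penalty takes half of the positive value at (x0, t0), so the maximum stays positive. *)
pose e := v x0 t0 / (2 * (expR (K * t0) * (1 + dotv x0 x0))).
have e0 : 0 < e by rewrite divr_gt0// mulr_gt0.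
have M0 : 0 < M by exact: lt_le_trans (vM _ _ D0 t0T).
(* For |x| > rho >= 1 the penalty is at least e |x|^2 >= e |x| > M, so the difference is negative
   there. *)
pose rho := M / e + 1.
pose A := (Dm `&` [set x | `|x| <= rho]) `*` `[0, T].
have cA : compact A.
  apply: compact_setX; last exact: segment_compact.
  apply: bounded_closed_compact.
    by exists rho; split; [exact: num_real|move=> r rr x [_ /=] xr; exact: le_trans (ltW rr)].
  apply: closedI => //.
  apply: (@preimage_closed _ _ (@Num.norm _ 'rV[R]_n) [set y | y <= rho]); last exact: closed_le.
  by move=> x _; exact: norm_continuous.
pose Phi (p : 'rV[R]_n * R) := v p.1 p.2 - penalty e K p.1 p.2.
have cPhi : {within A, continuous Phi}.
  apply: (@continuous_subspaceW _ _ A (strip T)).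
    by move=> [x t] [_ /=]; rewrite in_itv.
  apply: (@continuous_fun_sub _ (subspace (strip T))); first exact: cv.
  move=> p; apply: (@continuous_subspaceT _ _ (strip T) (fun p => penalty e K p.1 p.2)).
  exact: continuous_penalty.
have Phi0 : 0 < Phi (x0, t0).
  have -> : Phi (x0, t0) = v x0 t0 / 2; last by rewrite divr_gt0.
  rewrite /Phi /penalty /= /e; field.
  by rewrite !gt_eqF ?expR_gt0// ltr_pwDl// dotv_ge0.
have far x t : Dm x -> 0 <= t <= T -> rho < `|x| -> Phi (x, t) < 0.
  move=> Dx tT xr; rewrite subr_lt0 /=; apply: le_lt_trans (vM x t Dx tT) _.
  have x1 : 1 <= `|x| by apply: le_trans (ltW xr); rewrite /rho lerDr divr_ge0// ltW.
  apply: (@lt_le_trans _ _ (e * `|x|)).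
    by rewrite mulrC -ltr_pdivrMr//; apply: lt_trans xr; rewrite /rho ltrDl.
  rewrite /penalty -mulrA ler_wpM2l ?(ltW e0)//.
  apply: (@le_trans _ _ (`|x| ^+ 2)); first by rewrite expr2 ler_peMr.
  apply: le_trans (sqr_norm_le x) _; apply: (@le_trans _ _ (1 + dotv x x)); first by rewrite lerDr.
  rewrite ler_peMl ?addr_ge0 ?dotv_ge0//.
  by rewrite -expR0 ler_expR mulr_ge0//; case/andP: tT.
have A0 : A (x0, t0).
  split=> /=; last by rewrite in_itv.
  split=> //=; rewrite leNgt; apply/negP => /(far _ _ D0 t0T); have := Phi0; lra.
have [[x1 t1] /set_mem A1 max1] := compact_EVT_max (ex_intro _ _ A0) cA cPhi.
exists e, x1, t1; case: A1 => -[/= D1 x1r]; rewrite in_itv /= => t1T.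
have P1 : Phi (x0, t0) <= Phi (x1, t1) by apply: max1; exact/mem_set.
split=> //; first by rewrite -subr_gt0; exact: lt_le_trans P1.
move=> x t Dx tT; have [xr|xr] := leP `|x| rho.
  by apply: (max1 (x, t)); apply/mem_set; split=> //=; rewrite in_itv.
by apply: le_trans (ltW (far x t Dx tT xr)) _; exact: ltW (lt_le_trans Phi0 P1).
Qed.

Lemma is_derive_penalty_time e K x t : is_derive t (1 : R) (penalty e K x) (K * penalty e K x t).
Proof. by rewrite /penalty; apply: is_derive_eq; rewrite /GRing.scale /=; ring. Qed.

Lemma is_derive_penalty_line e K x t i (h : R) :
  is_derive h (1 : R) (fun h => penalty e K (x + h *: ei i) t) (e * expR (K * t) * 2 * (x 0 i + h)).
Proof.
have -> : (fun h => penalty e K (x + h *: ei i) t) =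
  fun h => e * expR (K * t) * (1 + (dotv x x + 2 * h * x 0 i + h ^+ 2)).
  by apply/funext => k; rewrite /penalty dotv_line.
by apply: is_derive_eq; rewrite /GRing.scale /=; ring.
Qed.

(** The derivatives are explicit data and only the pure second ones occur: this is all that the test
    at a maximum sees, and it is easy to verify for barriers, rotated solutions and functions of
    doubled variables. *)
Definition C21 T (v vt : 'rV[R]_n -> R -> R) (v1 v2 : 'I_n -> 'rV[R]_n -> R -> R) :=
  [/\ {within strip T, continuous (fun p => v p.1 p.2)},
      forall x t, 0 < t <= T -> is_derive t 1 (v x) (vt x t),
      forall i x t, 0 < t <= T -> is_derive x (ei i) (v ^~ t) (v1 i x t)
    & forall i x t, 0 < t <= T -> is_derive x (ei i) (v1 i ^~ t) (v2 i x t)].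

(* At a maximum of [v - penalty e K] the time derivative of [v] is at least
   [K * penalty], and a large [K] outweighs the drift acting on the penalty. *)
Lemma maximum_principle T B M v vt (v1 v2 : 'I_n -> 'rV[R]_n -> R -> R) (b : 'I_n -> 'rV[R]_n -> R) (Dm : set 'rV[R]_n) :
  C21 T v vt v1 v2 -> closed Dm -> (forall i x, `|b i x| <= B) ->
  (forall x t, Dm x -> 0 <= t <= T -> v x t <= M) ->
  (forall x, Dm x -> v x 0 <= 0) ->
  (forall x t, Dm x -> 0 < t <= T -> 0 < v x t -> nbhs x Dm) ->
  (forall x t, Dm x -> 0 < t <= T -> 0 < v x t ->
     vt x t <= \sum_i v2 i x t + \sum_i b i x * v1 i x t) ->
  forall x t, Dm x -> 0 <= t <= T -> v x t <= 0.
Proof.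
move=> [cv dvt dv1 dv2] cD bB vM v0 Dint ineq x0 t0 D0 t0T; rewrite leNgt; apply/negP => v0t0.
have nB0 : 0 <= n%:R * B.
  rewrite mulr_natl -[X in _ *+ X](card_ord n) -sumr_const.
  by apply: sumr_ge0 => i _; exact: le_trans (bB i 0).
have n0 : 0 <= n%:R :> R by [].
(* 2 n is the Laplacian of |x|^2, n B pays for the drift through 2 |x_i| <= 1 + |x|^2, and the last
   1 makes the inequality strict. *)
pose K := 2 * n%:R + n%:R * B + 1.
have K0 : 0 <= K by rewrite /K; lra.
have [e [x [t [e0 Dx tT Pv mx]]]] := touching K0 cD cv vM D0 t0T v0t0.
have P0 : 0 < penalty e K x t.
  by rewrite /penalty !mulr_gt0 ?expR_gt0// ltr_pwDl// dotv_ge0.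
have vp : 0 < v x t by exact: lt_trans Pv.
have tp : 0 < t <= T.
  case/andP: tT => + ->; rewrite le_eqVlt => /orP[/eqP t00|->//].
  by move: vp; rewrite -t00 ltNge v0.
have /andP[t_gt0 t_le] := tp.
have Et : K * penalty e K x t <= vt x t.
  have d1 := dvt x t tp; have d2 := is_derive_penalty_time e K x t.
  have d3 : is_derive t (1 : R) (fun s => v x s - penalty e K x s) (vt x t - K * penalty e K x t).
    exact: is_derive_eq.
  have := left_max_derive_ge0 t_gt0 d3; rewrite subr_ge0; apply.
  by move=> s /andP[s0 st]; apply: mx => //; rewrite s0 (le_trans st).
pose E := e * expR (K * t); have E0 : 0 < E by rewrite mulr_gt0 ?expR_gt0.
have sp i : v1 i x t = E * 2 * x 0 i /\ v2 i x t <= E * 2.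
  have [r r0 Hr] : exists2 r : R, 0 < r & forall h, `|h| < r -> Dm (x + h *: ei i).
    have c0 : x + h *: ei i @[h --> (0 : R)] --> x.
      rewrite -[X in _ --> X]addr0 -(scale0r (ei i)).
      by apply: cvgD; [exact: cvg_cst|apply: cvgZr_tmp; exact: cvg_id].
    have /nbhs_ballP[r r0 H] : \forall h \near (0 : R), Dm (x + h *: ei i) by apply: c0; exact: (Dint x t Dx tp vp).
    by exists r => // h hr; apply: (H h); rewrite -ball_normE /= sub0r normrN.
  have dl (h : R) : is_derive h (1 : R) (fun h => v (x + h *: ei i) t - penalty e K (x + h *: ei i) t)
      (v1 i (x + h *: ei i) t - E * 2 * (x 0 i + h)).
    have d1 : is_derive h (1 : R) (fun h => v (x + h *: ei i) t) (v1 i (x + h *: ei i) t).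
      by apply/(@is_derive_line _ _ _ (v ^~ t)); exact: dv1.
    have d2 := is_derive_penalty_line e K x t i h.
    exact: is_derive_eq.
  have dg : is_derive (0 : R) (1 : R) (fun h => v1 i (x + h *: ei i) t - E * 2 * (x 0 i + h)) (v2 i x t - E * 2).
    have d1 : is_derive (0 : R) (1 : R) (fun h => v1 i (x + h *: ei i) t) (v2 i x t).
      by apply/(@is_derive_line _ _ _ (v1 i ^~ t)); rewrite scale0r addr0; exact: dv2.
    by apply: is_derive_eq; rewrite /GRing.scale /=; ring.
  have hm (h : R) : `|h| < r ->
      v (x + h *: ei i) t - penalty e K (x + h *: ei i) t <= v (x + 0 *: ei i) t - penalty e K (x + 0 *: ei i) t.
    by rewrite scale0r addr0 => hr; apply: mx => //; exact: Hr.
  have := max_second_derivative r0 hm (fun h _ => dl h) dg.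
  by rewrite scale0r !addr0 subr_le0 => -[/eqP]; rewrite subr_eq0 => /eqP.
have S2 : \sum_i v2 i x t <= n%:R * (E * 2).
  rewrite mulr_natl -[X in _ *+ X]card_ord -sumr_const.
  by apply: ler_sum => i _; case: (sp i).
have S1 : \sum_i b i x * v1 i x t <= n%:R * (B * (E * (1 + dotv x x))).
  rewrite mulr_natl -[X in _ *+ X]card_ord -sumr_const.
  apply: ler_sum => i _; have [-> _] := sp i.
  apply: le_trans (ler_norm _) _; rewrite normrM; apply: ler_pM => //.
  rewrite -mulrA normrM gtr0_norm// ler_wpM2l ?(ltW E0)//.
  have := sqr_coord_le x i; rewrite -[X in X <= _]real_normK ?num_real// => h.
  by rewrite normrM ger0_norm//; have := sqr_ge0 (1 - `|x 0 i|); lra.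
have := ineq x t Dx tp vp; move: Et; rewrite /penalty -/E => Et.
have r0 := dotv_ge0 x.
suff : n%:R * (E * 2) + n%:R * (B * (E * (1 + dotv x x))) < K * (E * (1 + dotv x x)) by lra.
have -> : K * (E * (1 + dotv x x)) = n%:R * (E * 2) * (1 + dotv x x) + n%:R * (B * (E * (1 + dotv x x))) + E * (1 + dotv x x).
  by rewrite /K; ring.
have EP : 0 < E * (1 + dotv x x) by rewrite mulr_gt0// ltr_pwDl.
have : 0 <= n%:R * (E * 2) * dotv x x by rewrite !mulr_ge0// ltW.
by lra.
Qed.

End touching.

(** * Existence *)

Section geometric_limits.
Context {R : realType}.
Implicit Types (x y C : R) (u : nat -> R).

Lemma le_geometric x y C : (forall k : nat, x <= y + C / 2 ^+ k) -> x <= y.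
Proof.
move=> H; apply/ler_addgt0Pr => e e0.
have C1 : 0 < `|C| + 1 by rewrite ltr_wpDl.
have eC : 0 < e / (`|C| + 1) by rewrite divr_gt0.
have [k Hk] := ltr_add_invr eC.
move: Hk; rewrite add0r => Hk.
apply: le_trans (H k) _; rewrite lerD2l.
apply: (@le_trans _ _ ((`|C| + 1) * k.+1%:R^-1)).
  apply: (@le_trans _ _ (`|C| / 2 ^+ k)); first by rewrite ler_wpM2r ?invr_ge0 ?exprn_ge0// ler_norm.
  apply: ler_pM; rewrite ?invr_ge0 ?exprn_ge0 ?lerDl//.
  rewrite lef_pV2 ?posrE ?exprn_gt0// -natrX ler_nat; exact: ltn_expl.
by rewrite mulrC -ler_pdivlMr// ltW.
Qed.

(** The intervals of radius 2 C / 2^k about [u k] are nested, so the supremum of their left ends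
    lies in all of them. *)
Lemma geometric_cauchy u C : (forall k, `|u k.+1 - u k| <= C / 2 ^+ k) ->
  exists l, forall k, `|u k - l| <= 2 * C / 2 ^+ k.
Proof.
move=> H; pose r k := 2 * C / 2 ^+ k; pose lo k := u k - r k; pose hi k := u k + r k.
have rS k : r k = 2 * r k.+1 by rewrite /r exprS; field; rewrite expf_neq0.
have rC k : C / 2 ^+ k = r k.+1 by rewrite /r exprS; field; rewrite expf_neq0.
have r0 k : 0 <= r k.+1 by rewrite -rC; exact: le_trans (H k).
have {}r0 k : 0 <= r k by rewrite rS mulr_ge0.
have loS k : lo k <= lo k.+1.
  by have := H k; rewrite rC ler_norml /lo => /andP[]; have := rS k; lra.
have hiS k : hi k.+1 <= hi k.
  by have := H k; rewrite rC ler_norml /hi => /andP[]; have := rS k; lra.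
have lom k j : lo k <= lo (k + j)%N by elim: j => [|j IH]; [rewrite addn0|rewrite addnS; exact: le_trans (loS _)].
have him k j : hi (k + j)%N <= hi k by elim: j => [|j IH]; [rewrite addn0|rewrite addnS; exact: le_trans (hiS _) _].
have lh k j : lo k <= hi j.
  apply: le_trans (lom k j) _; apply: le_trans (_ : hi (k + j)%N <= _).
    by rewrite /lo /hi; have := r0 (k + j)%N; lra.
  by rewrite addnC; exact: him.
have ub : has_ubound (range lo) by exists (hi 0%N) => _ [k _ <-].
exists (sup (range lo)) => k; rewrite -/(r k) ler_distl; apply/andP; split.
  have : sup (range lo) <= hi k by apply: ge_sup; [exists (lo 0%N), 0%N|move=> _ [j _ <-]; exact: lh].
  by rewrite /hi; lra.
have : lo k <= sup (range lo) by apply: ub_le_sup => //; exists k.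
by rewrite /lo; lra.
Qed.

End geometric_limits.

Section joint_bounds.
Context {R : realType} {n : nat}.
Variable a : R.
Hypothesis a01 : 0 < a < 1.
Implicit Types (x y z : 'rV[R]_n) (f : 'rV[R]_n -> R) (g : 'rV[R]_n -> R -> R) (s t T N H L c : R).

Lemma row_coord_sum z : z = \sum_i z 0 i *: ei i.
Proof.
apply/rowP => j; rewrite summxE (bigD1 j)//= big1 ?mxE ?eqxx ?mulr1 ?addr0// => i ij.
by rewrite !mxE eqxx eq_sym (negbTE ij) mulr0.
Qed.

(** The increment is performed one coordinate at a time. *)
Lemma chol_dist H f x z c : chol a H f -> (forall i, `|z 0 i| <= c) -> 0 <= H ->
  `|f (x + z) - f x| <= n%:R * (H * c `^ a).
Proof.
move=> Hf zc H0; have /andP[a0 a1] := a01.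
have key (s : seq 'I_n) y : `|f (y + \sum_(i <- s) z 0 i *: ei i) - f y| <= (size s)%:R * (H * c `^ a).
  elim: s y => [|i s IH] y; first by rewrite big_nil addr0 subrr normr0 mul0r.
  rewrite big_cons addrA /=; have := IH (y + z 0 i *: ei i); have := Hf y i (z 0 i).
  have : H * `|z 0 i| `^ a <= H * c `^ a.
    rewrite ler_wpM2l//; apply: ge0_ler_powR; rewrite ?nnegrE ?(ltW a0)//.
    exact: le_trans (zc i).
  rewrite -natr1 mulrDl mul1r => h1 h2 h3.
  by apply: le_trans (ler_distD (f (y + z 0 i *: ei i)) _ _) _; apply: lerD => //; exact: le_trans h1.
have := key (index_enum 'I_n) x; rewrite -row_coord_sum.
by rewrite [index_enum _]unlock -enumT size_enum_ord.
Qed.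

Lemma src_dist N H L g x z s t c : src a N H L g -> (forall i, `|z 0 i| <= c) -> 0 <= H -> 0 <= s -> 0 <= t ->
  `|g (x + z) s - g x t| <= n%:R * (H * c `^ a) + L * `|s - t| `^ (a / 2).
Proof.
move=> [Ha Ht] zc H0 s0 t0; apply: le_trans (ler_distD (g x s) _ _) _; apply: lerD; last exact: Ht.
have [_ Hs] := Ha s s0; exact: (@chol_dist H (g ^~ s) x z c Hs zc H0).
Qed.

Lemma powR_small (e q : R) : 0 < q -> 0 < e -> exists2 r : R, 0 < r & forall h, 0 <= h <= r -> h `^ q <= e.
Proof.
move=> q0 e0; exists (e `^ q^-1); first by rewrite powR_gt0.
move=> h /andP[h0 hr]; apply: (@le_trans _ _ ((e `^ q^-1) `^ q)).
  by apply: ge0_ler_powR; rewrite ?nnegrE ?(ltW q0)// powR_ge0.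
by rewrite -powRrM mulVf ?gt_eqF// powRr1// ltW.
Qed.

Lemma coord_le_norm x i : `|x 0 i| <= `|x|.
Proof.
rewrite [leRHS]/Num.norm /= mx_normrE; apply/bigmax_geP; right => /=.
by exists (ord0, i).
Qed.

Lemma src_continuous N H L g T : src a N H L (fun x t => g x (Num.min t T)) ->
  {within strip T, continuous (fun p => g p.1 p.2)}.
Proof.
move=> Hg; have /andP[a0 a1] := a01.
have a20 : 0 < a / 2 by rewrite divr_gt0.
have {}Hg := src_le Hg (lexx N) (ler_norm H) (ler_norm L).
apply/subspace_continuousP => p /= pT; apply/cvgrPdist_le => e e0.
pose c1 := e / 2 / (n%:R * `|H| + 1); pose c2 := e / 2 / (`|L| + 1).
have nH : 0 <= n%:R * `|H| by rewrite mulr_ge0.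
have c10 : 0 < c1 by rewrite !divr_gt0// ltr_wpDl.
have c20 : 0 < c2 by rewrite !divr_gt0// ltr_wpDl.
have [r1 r10 H1] := powR_small a0 c10; have [r2 r20 H2] := powR_small a20 c20.
rewrite near_withinE; near=> q => qT.
have q1 : `|p.1 - q.1| <= r1.
  by near: q; apply: (@cvgr_dist_le _ _ _ (nbhs p) _ fst p.1) => //; exact: cvg_fst.
have q2 : `|p.2 - q.2| <= r2.
  by near: q; apply: (@cvgr_dist_le _ _ _ (nbhs p) _ snd p.2) => //; exact: cvg_snd.
case/andP: pT => p0 pT; case/andP: qT => q0 qT.
have := src_dist q.1 (z := p.1 - q.1) (s := p.2) (t := q.2) Hg (fun i => coord_le_norm _ i) (normr_ge0 _) p0 q0.
rewrite !(min_l _) // (addrC q.1) subrK => /le_trans; apply.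
rewrite [leRHS]splitr; apply: lerD.
  apply: (@le_trans _ _ (n%:R * `|H| * c1)).
    by rewrite mulrA ler_wpM2l//; apply: H1; rewrite normr_ge0.
  by rewrite /c1 mulrCA ler_piMr ?divr_ge0 ?(ltW e0)// ler_pdivrMr ?mul1r ?lerDl// ltr_wpDl.
apply: (@le_trans _ _ (`|L| * c2)).
  by rewrite ler_wpM2l//; apply: H2; rewrite normr_ge0.
by rewrite /c2 mulrCA ler_piMr ?divr_ge0 ?(ltW e0)// ler_pdivrMr ?mul1r ?lerDl// ltr_wpDl.
Unshelve. all: by end_near. Qed.

(** The constants do not depend on T, so bounds obtained from representations on bounded intervals
    become bounds on all times. *)
Lemma src_of_local N H L g : (forall T, 0 <= T -> exists2 k, src a N H L k & forall x t, 0 <= t <= T -> k x t = g x t) ->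
  src a N H L g.
Proof.
move=> loc; split=> [s s0|x s s' s0 s'0].
  have [k [/(_ s s0)[k1 k2] _] E] := loc s s0.
  have sT : 0 <= s <= s by rewrite s0 lexx.
  by split=> [x|x i h]; rewrite -!E.
have T0 : 0 <= Num.max s s' by rewrite le_max s0.
have [k [_ K1] E] := loc _ T0; have := K1 x _ _ s0 s'0.
by rewrite !E// ?s0 ?s'0 /= le_max lexx ?orbT.
Qed.

Lemma src_limit N H L (k : nat -> 'rV[R]_n -> R -> R) g (C : R) :
  (forall m, src a N H L (k m)) -> (forall m x t, 0 <= t -> `|k m x t - g x t| <= C / 2 ^+ m) ->
  src a N H L g.
Proof.
move=> Hk lim.
have key (u v : R) (um vm : nat -> R) B : (forall m, `|um m - u| <= C / 2 ^+ m) -> (forall m, `|vm m - v| <= C / 2 ^+ m) ->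
    (forall m, `|um m - vm m| <= B) -> `|u - v| <= B.
  move=> Hu Hv Hm; apply: (@le_geometric _ _ _ (2 * C)) => m.
  have -> : u - v = (um m - vm m) + (- (um m - u) + (vm m - v)) by ring.
  apply: le_trans (ler_normD _ _) _; apply: lerD; first exact: Hm.
  apply: le_trans (ler_normD _ _) _; rewrite normrN -mulrA mulr_natl mulr2n; exact: lerD.
split=> [s s0|x s s' s0 s'0]; last first.
  by apply: (key _ _ (fun m => k m x s) (fun m => k m x s')) => m; rewrite ?lim//; case: (Hk m) => _; exact.
have C0 : 0 <= C by have := lim 0%N 0 0 (lexx _); rewrite expr0 divr1; exact: le_trans.
split=> [x|x i h].
  rewrite -[g x s]subr0; apply: (key _ _ (fun m => k m x s) (fun=> 0)) => m; rewrite ?lim//.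
    by rewrite subrr normr0 divr_ge0// exprn_ge0.
  by rewrite subr0; case: (Hk m) => /(_ s s0)[].
by apply: (key _ _ (fun m => k m (x + h *: ei i) s) (fun m => k m x s)) => m; rewrite ?lim//; case: (Hk m) => /(_ s s0)[].
Qed.

End joint_bounds.

(** * The fixed point for the gradient *)

Section picard.
Context {R : realType} {n : nat}.
Variables (a B Hb F Hf lam : R) (b : 'I_n -> 'rV[R]_n -> R) (f : 'rV[R]_n -> R).
Hypothesis a01 : 0 < a < 1.
Hypothesis Hbb : forall i, adm a B Hb (b i).
Hypothesis Hff : adm a F Hf f.
Hypothesis lam0 : 0 < lam.
Hypothesis B0 : 0 <= B.
Hypothesis Hb0 : 0 <= Hb.
Hypothesis Hf0 : 0 <= Hf.
Let kap : R := @KV R n lam 1 (1 / 2).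
Let kh : R := @KH R n a lam 1 (1 / 2).
Hypothesis small : n%:R * B * kap <= 1 / 2.
Implicit Types (x : 'rV[R]_n) (t s N H L : R) (i j : 'I_n) (p : 'I_n -> 'rV[R]_n -> R -> R).

Let half01 : 0 < (1 / 2 : R) < 1.
Proof. by lra. Qed.
Let kap0 : 0 <= kap. Proof. by rewrite /kap; apply: KV_ge0. Qed.
Let kh0 : 0 <= kh. Proof. by rewrite /kh; apply: KH_ge0. Qed.
Let F0 : 0 <= F. Proof. by case: Hff => /(_ 0) + _; exact: le_trans. Qed.

(** The source of the damped equation when [p] stands for the gradient of the unknown. *)
Definition G p x t := \sum_j b j x * p j x t + expR (- (lam * t)) * f x.

Lemma expRN_src : src a 1 0 (lam + 1) (fun (_ : 'rV[R]_n) t => expR (- (lam * t))).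
Proof.
have /andP[a0 a1] := a01.
have lam0' := ltW lam0.
have e1 t : 0 <= t -> 0 <= expR (- (lam * t)) <= 1.
  by move=> t0; rewrite expR_ge0 expRN_le1// mulr_ge0.
apply: src_time => [t t0|s t s0 t0]; first by have /andP[e0 e2] := e1 t t0; rewrite ger0_norm.
have dist1 : `|expR (- (lam * s)) - expR (- (lam * t))| <= 1.
  by have := e1 s s0; have := e1 t t0; rewrite ler_norml; lra.
apply: (@powR_interp R _ _ _ _ _ 1) => //; [by rewrite divr_gt0|by lra|].
move=> _; rewrite powRr1//.
have mono u v : 0 <= u -> u <= v -> `|expR (- (lam * v)) - expR (- (lam * u))| <= lam * (v - u).
  move=> u0 uv; apply: (@mvt_le R (fun t => expR (- (lam * t))) (fun t => - lam * expR (- (lam * t))) u v lam uv).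
    by move=> r _; apply: is_derive_eq; rewrite /GRing.scale /=; ring.
  move=> r /andP[ur _]; have /andP[h0 h1] := e1 r (le_trans u0 ur).
  by rewrite normrM normrN (gtr0_norm lam0) (ger0_norm h0) ler_piMr.
case: (leP s t) => st; first by rewrite distrC (distrC s) (@ger0_norm _ (t - s)) ?subr_ge0//; exact: mono.
by rewrite (@gtr0_norm _ (s - t)) ?subr_gt0//; apply: mono => //; exact: ltW.
Qed.

Definition GH N H := n%:R * (B * H + Hb * N) + Hf.
Definition GL L := n%:R * (B * L) + (lam + 1) * F.

Lemma src_G N H L p : (forall i, src a N H L (p i)) -> src a (n%:R * (B * N) + F) (GH N H) (GL L) (G p).
Proof.
move=> Hp.
have S1 := src_sum (fun i => src_mul (src_static (Hbb i)) (Hp i)).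
have S2 := src_mul expRN_src (src_static Hff).
apply: src_le (src_add S1 S2) _ _ _; rewrite /GH /GL; lra.
Qed.

Lemma V1_contract N H L N' H' L' g k i c x t : src a N H L g -> src a N' H' L' k -> 0 <= t ->
  (forall y s, 0 <= s -> `|g y s - k y s| <= c) -> `|V lam [:: i] g x t - V lam [:: i] k x t| <= kap * c.
Proof.
move=> Hg Hk t0 Hc; rewrite -(V_sub a01 lam0 x Hg Hk t0)//.
have Hd : src a c (H + H') (L + L') (fun y s => g y s - k y s).
  case: Hg Hk => Ha Ht [Ha' Ht']; split=> [s s0|y s s' s0 s'0].
    by apply: adm_sub (Ha s s0) (Ha' s s0) _ => y; exact: Hc.
  have -> : g y s - k y s - (g y s' - k y s') = (g y s - g y s') - (k y s - k y s') by ring.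
  by rewrite mulrDl; apply: le_trans (ler_normB _ _) _; apply: lerD; [exact: Ht|exact: Ht'].
by case: (src_V1 a01 lam0 Hd i) => /(_ t t0)[+ _] _; exact.
Qed.

(** The ball of radius 2 kap F is invariant: kap (n B N1 + F) <= N1 / 2 + kap F = N1. The Hölder
    constants [H1] depend only on the sup bound of the source, hence stay fixed along the iteration
    without any smallness. *)
Let N1 := 2 * kap * F.
Let M1 := n%:R * (B * N1) + F.
Let H1 := kh * M1.

Let N10 : 0 <= N1. Proof. by rewrite /N1; nonneg. Qed.
Let M10 : 0 <= M1. Proof. by rewrite /M1; nonneg. Qed.
Let H10 : 0 <= H1. Proof. by rewrite /H1; nonneg. Qed.

Lemma GH_ge0 N H : 0 <= N -> 0 <= H -> 0 <= GH N H.
Proof. by move=> h1 h2; rewrite /GH; nonneg. Qed.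

Lemma GL_ge0 L : 0 <= L -> 0 <= GL L.
Proof. by move=> h; have lam0' := ltW lam0; rewrite /GL; nonneg. Qed.

Fixpoint iterate (k : nat) : 'I_n -> 'rV[R]_n -> R -> R :=
  if k is k'.+1 then fun i => V lam [:: i] (G (iterate k')) else fun _ _ _ => 0.

Lemma src_V1_G p : (forall i, src a N1 H1 H1 (p i)) -> forall i, src a N1 H1 H1 (V lam [:: i] (G p)).
Proof.
move=> Hp i; apply: src_le (src_V1 a01 lam0 (src_G Hp) i) _ _ _ => //.
rewrite -/kap mulrDr /N1; have -> : kap * (n%:R * (B * (2 * kap * F))) = (n%:R * B * kap) * (2 * kap * F) by ring.
have : n%:R * B * kap * (2 * kap * F) <= 1 / 2 * (2 * kap * F) by rewrite ler_wpM2r// nonneg.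
by lra.
Qed.

Lemma src_iterate k i : src a N1 H1 H1 (iterate k i).
Proof.
elim: k i => [|k IH] i; last exact: src_V1_G.
split=> [s _|x s s' _ _]; first split=> [x|x j h]; rewrite ?subrr normr0//; nonneg.
Qed.

Lemma iterate_dist k i x t : 0 <= t -> `|iterate k.+1 i x t - iterate k i x t| <= 2 * N1 / 2 ^+ k.
Proof.
elim: k i x t => [|k IH] i x t t0.
  rewrite expr0 divr1; apply: le_trans (ler_normB _ _) _.
  rewrite [leRHS]mulr_natl mulr2n; apply: lerD.
    by case: (src_iterate 1 i) => /(_ t t0)[+ _] _; exact.
  by rewrite normr0.
have Gd y s : 0 <= s -> `|G (iterate k.+1) y s - G (iterate k) y s| <= n%:R * B * (2 * N1 / 2 ^+ k).
  move=> s0; have -> : G (iterate k.+1) y s - G (iterate k) y s = \sum_j b j y * (iterate k.+1 j y s - iterate k j y s).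
    rewrite /G opprD addrACA subrr addr0 -sumrB; apply: eq_bigr => j _.
    by rewrite -mulrBr.
  apply: le_trans (ler_norm_sum _ _ _) _.
  rewrite -mulrA mulr_natl -[X in _ *+ X]card_ord -sumr_const; apply: ler_sum => j _.
  by rewrite normrM; apply: ler_pM => //; [case: (Hbb j) => + _; exact|exact: IH].
apply: le_trans (V1_contract i x (src_G (src_iterate k.+1)) (src_G (src_iterate k)) t0 Gd) _.
have -> : kap * (n%:R * B * (2 * N1 / 2 ^+ k)) = (n%:R * B * kap) * (2 * N1 / 2 ^+ k) by ring.
have q0 : 0 <= 2 * N1 / 2 ^+ k by rewrite divr_ge0 ?exprn_ge0// mulr_ge0.
apply: le_trans (ler_wpM2r q0 small) _.
by rewrite exprS le_eqVlt; apply/orP; left; apply/eqP; field; rewrite expf_neq0.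
Qed.

Lemma picard : exists p N H L, [/\ 0 <= N, 0 <= H, 0 <= L, (forall i, src a N H L (p i))
  & forall i x t, 0 <= t -> p i x t = V lam [:: i] (G p) x t].
Proof.
(* The condition on [t] is placed under the existential so that choice yields a total function. *)
have lim i x t : exists l, 0 <= t -> forall k, `|iterate k i x t - l| <= 2 * (2 * N1) / 2 ^+ k.
  have [t0|t0] := leP 0 t; last by exists 0.
  have [l Hl] := geometric_cauchy (fun k => iterate_dist k i x t0).
  by exists l.
pose p i x t := projT1 (cid (lim i x t)).
have Hp i k x t : 0 <= t -> `|iterate k i x t - p i x t| <= 2 * (2 * N1) / 2 ^+ k.
  by move=> t0; rewrite /p; case: cid => l /= /(_ t0)/(_ k).
have Sp i : src a N1 H1 H1 (p i).
  exact: src_limit (fun k => src_iterate k i) (fun k x t => @Hp i k x t).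
exists p, N1, H1, H1; split=> // i x t t0.
apply/eqP; rewrite -subr_eq0 -normr_le0; apply: (@le_geometric _ _ _ (2 * (2 * (2 * N1)))) => k.
rewrite add0r.
have Gd y s : 0 <= s -> `|G (iterate k) y s - G p y s| <= n%:R * B * (2 * (2 * N1) / 2 ^+ k).
  move=> s0; have -> : G (iterate k) y s - G p y s = \sum_j b j y * (iterate k j y s - p j y s).
    rewrite /G opprD addrACA subrr addr0 -sumrB; apply: eq_bigr => j _.
    by rewrite -mulrBr.
  apply: le_trans (ler_norm_sum _ _ _) _.
  rewrite -mulrA mulr_natl -[X in _ *+ X]card_ord -sumr_const; apply: ler_sum => j _.
  by rewrite normrM; apply: ler_pM => //; [case: (Hbb j) => + _; exact|exact: Hp].
have d1 := V1_contract i x (src_G (src_iterate k)) (src_G Sp) t0 Gd.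
have d2 := Hp i k.+1 x t t0.
have q0 : 0 <= 2 * (2 * N1) / 2 ^+ k by apply: divr_ge0; rewrite ?exprn_ge0//; apply: mulr_ge0 => //; exact: mulr_ge0.
have d3 : kap * (n%:R * B * (2 * (2 * N1) / 2 ^+ k)) <= 1 / 2 * (2 * (2 * N1) / 2 ^+ k).
  by apply: le_trans (_ : (n%:R * B * kap) * (2 * (2 * N1) / 2 ^+ k) <= _); [rewrite le_eqVlt; apply/orP; left; apply/eqP; ring|exact: ler_wpM2r].
have d4 : 2 * (2 * N1) / 2 ^+ k.+1 = 1 / 2 * (2 * (2 * N1) / 2 ^+ k).
  by rewrite exprS; field; rewrite expf_neq0.
have -> : p i x t - V lam [:: i] (G p) x t = - (iterate k.+1 i x t - p i x t) + (iterate k.+1 i x t - V lam [:: i] (G p) x t) by ring.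
apply: le_trans (ler_normD _ _) _; rewrite normrN; move: d1 d2 d3; rewrite d4 /= => d1 d2 d3.
have -> : 2 * (2 * (2 * N1)) / 2 ^+ k = 1 / 2 * (2 * (2 * N1) / 2 ^+ k) + 1 / 2 * (2 * (2 * N1) / 2 ^+ k) + 2 * (2 * N1) / 2 ^+ k.
  by field; rewrite expf_neq0.
by have := lerD d2 (le_trans d1 d3); lra.
Qed.

End picard.

Section frozen.
Context {R : realType} {n : nat}.
Variable a : R.
Hypothesis a01 : 0 < a < 1.
Implicit Types (x : 'rV[R]_n) (s t T N H L : R) (i : 'I_n).

Lemma min_dist s t T : `|Num.min s T - Num.min t T| <= `|s - t|.
Proof.
rewrite !minElt; case: (ltP s T) => h1; case: (ltP t T) => h2.
- by [].
- by rewrite !ler0_norm; lra.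
- by rewrite !ger0_norm; lra.
- by rewrite subrr normr0.
Qed.

Lemma src_frozen N H L T (k : 'rV[R]_n -> R -> R) : 0 <= T -> 0 <= L -> (forall t, 0 <= t <= T -> adm a N H (k ^~ t)) ->
  (forall x s t, 0 <= s <= T -> 0 <= t <= T -> `|k x s - k x t| <= L * `|s - t|) ->
  src a N H (L + 2 * N) (fun x t => k x (Num.min t T)).
Proof.
move=> T0 L0 Ha Ht; have /andP[a0 a1] := a01.
have m0 t : 0 <= t -> 0 <= Num.min t T <= T by move=> t0; rewrite le_min t0 T0 ge_min lexx orbT.
split=> [s s0|x s s' s0 s'0]; first exact/Ha/m0.
have B t : 0 <= t -> `|k x (Num.min t T)| <= N by move=> /m0/Ha[+ _]; exact.
have N0 : 0 <= N by exact: le_trans (B 0 (lexx _)).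
apply: (@powR_interp R _ _ _ _ _ 1) => //; [by nonneg|by rewrite divr_gt0|by lra| |].
  by move=> _; rewrite powRr1//; apply: le_trans (Ht x _ _ (m0 s s0) (m0 s' s'0)) _; rewrite ler_wpM2l// min_dist.
by apply: le_trans (ler_normB _ _) _; rewrite mulr_natl mulr2n lerD// B.
Qed.

Lemma C21_lin T (v vt v' vt' : 'rV[R]_n -> R -> R) (v1 v2 v1' v2' : 'I_n -> 'rV[R]_n -> R -> R) (c c' : R) :
  C21 T v vt v1 v2 -> C21 T v' vt' v1' v2' ->
  C21 T (fun x t => c * v x t + c' * v' x t) (fun x t => c * vt x t + c' * vt' x t)
    (fun i x t => c * v1 i x t + c' * v1' i x t) (fun i x t => c * v2 i x t + c' * v2' i x t).
Proof.
move=> [cv dt d1 d2] [cv' dt' d1' d2']; split.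
- apply: (@continuous_fun_add _ (subspace (strip T)) (fun p => c * v p.1 p.2) (fun p => c' * v' p.1 p.2)).
    by apply: (@continuous_fun_mul _ (subspace (strip T)) (fun=> c)); [exact: continuous_fun_cst|exact: cv].
  by apply: (@continuous_fun_mul _ (subspace (strip T)) (fun=> c')); [exact: continuous_fun_cst|exact: cv'].
- move=> x t tT; have h1 := dt x t tT; have h2 := dt' x t tT.
  by apply: is_derive_eq; rewrite /GRing.scale /=; ring.
- move=> i x t tT; have h1 := d1 i x t tT; have h2 := d1' i x t tT.
  by apply: is_derive_eq; rewrite /GRing.scale /=; ring.
- move=> i x t tT; have h1 := d2 i x t tT; have h2 := d2' i x t tT.
  by apply: is_derive_eq; rewrite /GRing.scale /=; ring.
Qed.

Lemma C21_cst T (c : R) : C21 T (fun (_ : 'rV[R]_n) _ => c) (fun _ _ => 0) (fun _ _ _ => 0) (fun _ _ _ => 0).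
Proof.
split=> [p|x t _|i x t _|i x t _]; [exact: continuous_fun_cst|exact: is_derive_cst|exact: is_derive_cst|exact: is_derive_cst].
Qed.

Lemma is_derive_unique_eq (V : normedModType R) (f g : V -> R) (x v : V) d e :
  is_derive x v f d -> is_derive x v g e -> f = g -> d = e.
Proof. by move=> [_ <-] [_ <-] ->. Qed.

(** Absorption: the supremum satisfies sup <= K + sup / 2. Finiteness comes from [M], which
    disappears from the conclusion; this is how a bound depending on the time interval becomes
    independent of it. *)
Lemma bound_halving (J : Type) (P : J -> Prop) (f : J -> R) (K M : R) :
  (forall j, P j -> f j <= M) ->
  (forall c, (forall j, P j -> f j <= c) -> forall j, P j -> f j <= K + c / 2) -> forall j, P j -> f j <= 2 * K.
Proof.
move=> fM half i Pi; pose E := [set f j | j in P].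
have ubE : has_ubound E by exists M => _ [j Pj <-]; exact: fM.
have fs j : P j -> f j <= sup E by move=> Pj; apply: ub_le_sup => //; exists j.
have : sup E <= K + sup E / 2.
  by apply: ge_sup; [exists (f i), i|move=> _ [j Pj <-]; exact: (half _ fs)].
by have := fs i Pi; lra.
Qed.

End frozen.

Section potential_C21.
Context {R : realType} {n : nat}.
Variables (a lam N H L : R) (g : 'rV[R]_n -> R -> R).
Hypothesis a01 : 0 < a < 1.
Hypothesis lam0 : 0 < lam.
Hypothesis Hg : src a N H L g.
Hypothesis H0 : 0 <= H.
Hypothesis L0 : 0 <= L.

Lemma src_V_nil_frozen T : 0 <= T -> src a (@DC R n 0 * N * T) (@KV R n lam 1 (1 / 2) * N + 2 * (@DC R n 0 * N * T))
  (@CW R n a lam N H T + 2 * (@DC R n 0 * N * T)) (fun x t => V lam [::] g x (Num.min t T)).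
Proof.
move=> T0; apply: src_frozen => //; first exact: (CW_ge0 a01 lam0 Hg).
- by move=> t tT; exact: (V_nil_adm a01 lam0 Hg H0).
- by move=> x s t sT tT; exact: (V_nil_lipschitz a01 lam0 Hg).
Qed.

Lemma C21_V T : 0 <= T -> C21 T (V lam [::] g) (VW lam g) (fun i => V lam [:: i] g) (fun i => V lam [:: i; i] g).
Proof.
move=> T0; split=> [|x t /andP[t0 _]|i x t /andP[t0 _]|i x t /andP[t0 _]].
- exact: (src_continuous a01 (src_V_nil_frozen T0)).
- by apply: time_quotient_is_derive => //; apply: (V_time_quotient a01 lam0 Hg) => //; exact: ltW.
- by apply: (is_derive_V a01 lam0 Hg) => //; exact: ltW.
- by apply: (is_derive_V a01 lam0 Hg) => //; exact: ltW.
Qed.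

End potential_C21.

(** * From the fixed point to bounds uniform in time *)

Section existence.
Context {R : realType} {n : nat}.
Variables (a B Hb F Hf lam : R) (b : 'I_n -> 'rV[R]_n -> R) (f : 'rV[R]_n -> R).
Hypothesis a01 : 0 < a < 1.
Hypothesis Hbb : forall i, adm a B Hb (b i).
Hypothesis Hff : adm a F Hf f.
Hypothesis lam0 : 0 < lam.
Hypothesis B0 : 0 <= B.
Hypothesis Hb0 : 0 <= Hb.
Hypothesis Hf0 : 0 <= Hf.
Hypothesis small : n%:R * B * @KV R n lam 1 (1 / 2) <= 1 / 2.
Variables (N0 : R) (u0 : 'rV[R]_n -> R) (d1 : 'I_n -> 'rV[R]_n -> R) (d2 : 'I_n -> 'I_n -> 'rV[R]_n -> R).
Variables (F1 : R).
Hypothesis u0_le : forall x, `|u0 x| <= N0.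
Hypothesis d1_le : forall i x, `|d1 i x| <= F1.
Hypothesis Hd1 : forall i x, is_derive x (ei i) u0 (d1 i x).
Hypothesis Hd2 : forall i j x, is_derive x (ei j) (d1 i) (d2 i j x).
Hypothesis fE : forall x, f x = \sum_i d2 i i x + \sum_i b i x * d1 i x.
Implicit Types (x : 'rV[R]_n) (t s T : R) (i j : 'I_n).

Variables (p : 'I_n -> 'rV[R]_n -> R -> R) (Np Hp Lp : R).
Hypothesis Np0 : 0 <= Np.
Hypothesis Hp0 : 0 <= Hp.
Hypothesis Lp0 : 0 <= Lp.
Hypothesis src_p : forall i, src a Np Hp Lp (p i).
Hypothesis pE : forall i x t, 0 <= t -> p i x t = V lam [:: i] (G lam b f p) x t.

Let g := G lam b f p.
Let Ng := n%:R * (B * Np) + F.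
Let Hg := @GH R n B Hb Hf Np Hp.
Let Lg := @GL R n B F lam Lp.
Let F0 : 0 <= F. Proof. by case: Hff => /(_ 0) + _; exact: le_trans. Qed.
Let N00 : 0 <= N0. Proof. exact: le_trans (u0_le 0). Qed.
Let Ng0 : 0 <= Ng. Proof. by rewrite /Ng; nonneg. Qed.
Let Hg0 : 0 <= Hg. Proof. by apply: GH_ge0. Qed.
Let Lg0 : 0 <= Lg. Proof. exact: (GL_ge0 Hff lam0 B0 Lp0). Qed.
Let src_g : src a Ng Hg Lg g. Proof. exact: src_G. Qed.

Let E t := expR (lam * t).
Let w := V lam [::] g.
(** The undamped potential, equal to u - u0. Its bounds inherited from [picard] still carry the
    factor exp (lam t). *)
Definition wt x t := E t * w x t.
Definition gradw i x t := E t * p i x t.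
Definition hessw i j x t := E t * V lam [:: j; i] g x t.
Definition ut x t := u0 x + wt x t.

Lemma wt0 x : wt x 0 = 0. Proof. by rewrite /wt /w V0 mulr0. Qed.

Lemma is_derive_wt i x t : 0 <= t -> is_derive x (ei i) (wt ^~ t) (gradw i x t).
Proof.
move=> t0; have := is_derive_V a01 lam0 src_g Hg0 x i (isT : (size [::] <= 1)%N) t0; rewrite -(pE i x t0) => h.
by apply: is_derive_eq; rewrite /GRing.scale /= /gradw; ring.
Qed.

Lemma is_derive_gradw i j x t : 0 <= t -> is_derive x (ei j) (gradw i ^~ t) (hessw i j x t).
Proof.
move=> t0; have h := is_derive_V a01 lam0 src_g Hg0 x j (isT : (size [:: i] <= 1)%N) t0.
have -> : gradw i ^~ t = fun x => E t * V lam [:: i] g x t by apply/funext => y; rewrite /gradw pE.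
by apply: is_derive_eq; rewrite /GRing.scale /= /hessw; ring.
Qed.

Definition wtt x t := \sum_i hessw i i x t + \sum_i b i x * gradw i x t + f x.

Lemma time_quotient_wt x t : 0 <= t -> time_quotient wt x t --> wtt x t.
Proof.
move=> t0; have dE : is_derive t (1 : R) E (lam * E t).
  by rewrite /E; apply: is_derive_eq; rewrite /GRing.scale /=; ring.
have qE := @is_derive_time_quotient R n (fun _ t => E t) x t _ dE.
have := time_quotientM t0 (is_derive_continuous dE) qE (V_time_quotient a01 lam0 src_g Hg0 Lg0 (x := x) t0).
congr (_ --> _); rewrite /VW /wtt /hessw /gradw -mulr_sumr.
have -> : \sum_i b i x * (E t * p i x t) = E t * \sum_j b j x * p j x t.
  by rewrite mulr_sumr; apply: eq_bigr => i _; rewrite mulrCA.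
have Eg : E t * g x t = E t * (\sum_j b j x * p j x t) + f x.
  by rewrite /g /G mulrDr mulrA -expRD subrr expR0 mul1r.
have K (e A l v c : R) : e * (A - l * v + c) + l * e * v = e * A + e * c by ring.
by rewrite -[RHS]addrA -Eg; exact: K.
Qed.

Lemma E_le T t : 0 <= t <= T -> 0 <= E t <= E T.
Proof. by move=> /andP[t0 tT]; rewrite expR_ge0 ler_expR ler_pM2l. Qed.

Lemma src_E T : 0 <= T -> src a (E T) 0 (lam * E T + 2 * E T) (fun (_ : 'rV[R]_n) t => E (Num.min t T)).
Proof.
move=> T0; have ET0 : 0 <= E T by exact: expR_ge0.
have lam0' := ltW lam0.
apply: (@src_frozen R n a a01 (E T) 0 (lam * E T) T (fun _ t => E t)) => //; first by nonneg.
  move=> t tT; split=> [x|x i h]; last by rewrite subrr normr0 mul0r.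
  by have /andP[h1 h2] := E_le tT; rewrite ger0_norm.
move=> x s t sT tT; wlog st : s t sT tT / s <= t.
  by move=> W; case: (leP s t) => [|/ltW] st; [exact: W|rewrite distrC (distrC s); exact: W].
rewrite distrC (distrC s) (@ger0_norm _ (t - s)) ?subr_ge0//.
apply: (@mvt_le R E (fun t => lam * E t)) => // r /andP[sr rt].
  by rewrite /E; apply: is_derive_eq; rewrite /GRing.scale /=; ring.
have /andP[h1 h2] : 0 <= E r <= E T.
  by apply: E_le; case/andP: sT => s0 _; case/andP: tT => _ tT; rewrite (le_trans s0 sr) (le_trans rt tT).
by rewrite normrM !ger0_norm// ler_wpM2l.
Qed.

Lemma src_wt_frozen T : 0 <= T -> exists N H L, [/\ 0 <= N, 0 <= H, 0 <= L & src a N H L (fun x t => wt x (Num.min t T))].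
Proof.
move=> T0; have h := src_mul (src_E T0) (src_V_nil_frozen a01 lam0 src_g Hg0 Lg0 T0).
have h2 := src_le h (ler_norm _) (ler_norm _) (ler_norm _).
by eexists; eexists; eexists; split; [| | |exact: h2].
Qed.

Lemma src_gradw_frozen T : 0 <= T -> exists N H L, [/\ 0 <= N, 0 <= H, 0 <= L & forall i, src a N H L (fun x t => gradw i x (Num.min t T))].
Proof.
move=> T0; have h i := src_mul (src_E T0) (src_freeze a01 T0 (src_p i)).
have h2 i := src_le (h i) (ler_norm _) (ler_norm _) (ler_norm _).
by eexists; eexists; eexists; split; [| | |exact: h2].
Qed.

Lemma C21_wt T : 0 <= T -> C21 T wt wtt gradw (fun i => hessw i i).
Proof.
move=> T0; split=> [|x t /andP[t0 _]|i x t /andP[t0 _]|i x t /andP[t0 _]].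
- by have [N [H [L [_ _ _ h]]]] := src_wt_frozen T0; exact: (src_continuous a01 h).
- by apply: time_quotient_is_derive => //; apply: time_quotient_wt; exact: ltW.
- by apply: is_derive_wt; exact: ltW.
- by apply: is_derive_gradw; exact: ltW.
Qed.

Lemma C21_u0 T : C21 T (fun x _ => u0 x) (fun _ _ => 0) (fun i x _ => d1 i x) (fun i x _ => d2 i i x).
Proof.
split=> [|x t _|i x t _|i x t _]; [|exact: is_derive_cst|exact: Hd1|exact: Hd2].
have : adm a N0 (`|F1| + 2 * N0) u0.
  apply: (adm_of_derive a01 u0_le Hd1) => // i x; exact: le_trans (d1_le i x) (ler_norm _).
by move=> /src_static h; exact: (@src_continuous R n a a01 _ _ _ (fun x _ => u0 x) T h).
Qed.

(** By [fE] the source is exactly what makes u0 + wt solve the homogeneous equation, so the maximum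
    principle applies to it and to its negative; the factor c = 1 or c = -1 treats both at once. *)
Lemma ut_le x t : 0 <= t -> `|ut x t| <= N0.
Proof.
move=> t0; pose T := t.
have [Nw [Hw [Lw [Nw0 _ _ [Hwt _]]]]] := src_wt_frozen t0.
have wT y r : 0 <= r <= T -> `|wt y r| <= Nw.
  by move=> /andP[r0 rT]; have [+ _] := Hwt r r0 => /(_ y); rewrite min_l.
have key (c : R) : c ^+ 2 = 1 -> c * ut x t <= N0.
  move=> c2; have c1 : `|c| = 1.
    by apply/eqP; rewrite -sqrp_eq1 ?normr_ge0// real_normK ?num_real// c2.
  have C := C21_lin c (- N0) (C21_lin 1 1 (C21_u0 T) (C21_wt t0)) (@C21_cst R n T 1).
  have bB i y : `|b i y| <= B by case: (Hbb i) => + _; exact.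
  have le_c (r K : R) : `|r| <= K -> c * r <= K.
    by move=> rK; apply: le_trans (ler_norm _) _; rewrite normrM c1 mul1r.
  have tT : 0 <= t <= T by rewrite t0 lexx.
  have := @maximum_principle R n T B Nw _ _ _ _ b setT C closedT bB _ _ _ _ x t I tT.
  rewrite !mul1r mulr1 subr_le0; apply => //.
  - move=> y r _ rT; rewrite !mul1r mulrDr -addrA.
    have := le_c _ _ (u0_le y); have := le_c _ _ (wT y r rT); lra.
  - by move=> y _; rewrite wt0 mulr0 addr0 mul1r subr_le0; exact: le_c.
  - by move=> y r _ _ _; exact: filterT.
  move=> y r _ _ _.
  have S2 : \sum_i (c * (1 * d2 i i y + 1 * hessw i i y r) + - N0 * 0) = c * (\sum_i d2 i i y + \sum_i hessw i i y r).
    by rewrite -big_split mulr_sumr; apply: eq_bigr => i _ /=; ring.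
  have S1 : \sum_i b i y * (c * (1 * d1 i y + 1 * gradw i y r) + - N0 * 0) = c * (\sum_i b i y * d1 i y + \sum_i b i y * gradw i y r).
    by rewrite -big_split mulr_sumr; apply: eq_bigr => i _ /=; ring.
  by rewrite S1 S2 /wtt fE le_eqVlt; apply/orP; left; apply/eqP; ring.
have e1 : (-1 : R) ^+ 2 = 1 by rewrite sqrrN expr1n.
have k1 := key 1 (expr1n _ _); have k2 := key (-1) e1.
rewrite ler_norml; move: k1 k2; rewrite mul1r mulN1r; lra.
Qed.

Lemma wt_le x t : 0 <= t -> `|wt x t| <= 2 * N0.
Proof.
move=> t0; have -> : wt x t = ut x t - u0 x by rewrite /ut addrC addKr.
by apply: le_trans (ler_normB _ _) _; have := ut_le x t0; have := u0_le x; lra.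
Qed.

(** Adding and subtracting lam wt writes the equation of [wt] in the damped form with this source,
    which no longer contains growing exponentials. It is frozen at [T] to be a source on all
    times. *)
Definition gt T x t := lam * wt x (Num.min t T) + \sum_i b i x * gradw i x (Num.min t T) + f x.

Lemma src_gt T Nw Hw Lw Nq Hq Lq : src a Nw Hw Lw (fun x t => wt x (Num.min t T)) ->
  (forall i, src a Nq Hq Lq (fun x t => gradw i x (Num.min t T))) ->
  src a (lam * Nw + n%:R * (B * Nq) + F) (lam * Hw + n%:R * (B * Hq + Hb * Nq) + Hf) (lam * Lw + n%:R * (B * Lq)) (gt T).
Proof.
move=> hw hq.
have hl : adm a lam 0 (fun _ : 'rV[R]_n => lam).
  by split=> [y|y i h]; [rewrite gtr0_norm|rewrite subrr normr0 mul0r].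
have h := src_add (src_add (src_mul (src_static hl) hw) (src_sum (fun i => src_mul (src_static (Hbb i)) (hq i)))) (src_static Hff).
by apply: src_le h _ _ _; lra.
Qed.

Lemma src_gt_ex T : 0 <= T -> exists N H L, [/\ 0 <= N, 0 <= H, 0 <= L & src a N H L (gt T)].
Proof.
move=> T0; have [Nw [Hw [Lw [_ _ _ hw]]]] := src_wt_frozen T0.
have [Nq [Hq [Lq [_ _ _ hq]]]] := src_gradw_frozen T0.
have h2 := src_le (src_gt hw hq) (ler_norm _) (ler_norm _) (ler_norm _).
by eexists; eexists; eexists; split; [| | |exact: h2].
Qed.

(** The drift term is part of the source, so the difference of the two sides satisfies the damped
    heat equation without drift. Where it is positive, the term with [lam] has the favourable
    sign. *)
Lemma wt_E T x t : 0 <= t <= T -> wt x t = V lam [::] (gt T) x t.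
Proof.
move=> tT; have T0 : 0 <= T by case/andP: tT; exact: le_trans.
have [Nt [Ht [Lt [Nt0 Ht0 Lt0 hgt]]]] := src_gt_ex T0.
have key (c : R) : c ^+ 2 = 1 -> c * wt x t + - c * V lam [::] (gt T) x t <= 0.
  move=> c2; have c1 : `|c| = 1.
    by apply/eqP; rewrite -sqrp_eq1 ?normr_ge0// real_normK ?num_real// c2.
  have C := C21_lin c (- c) (C21_wt T0) (C21_V a01 lam0 hgt Ht0 Lt0 T0).
  have b0 (i : 'I_n) (y : 'rV[R]_n) : `|0 : R| <= 0 by rewrite normr0.
  apply: (@maximum_principle R n T 0 (2 * N0 + @DC R n 0 * Nt * T) _ _ _ _ _ setT C closedT b0 _ _ _ _ x t I tT) => //.
  - move=> y r _ /andP[r0 rT]; apply: le_trans (ler_norm _) _; apply: le_trans (ler_normD _ _) _.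
    rewrite (normrM c) (normrM (- c)) normrN c1 !mul1r; apply: lerD; first exact: wt_le.
    by apply: le_trans (V_nil_le a01 lam0 hgt y r0) _; rewrite ler_wpM2l//; nonneg.
  - by move=> y _; rewrite wt0 V0 !mulr0 addr0.
  - by move=> y r _ _ _; exact: filterT.
  move=> y r _ /andP[r0 rT] pos.
  have S2 : \sum_i (c * hessw i i y r + - c * V lam [:: i; i] (gt T) y r) = c * (\sum_i hessw i i y r) - c * \sum_i V lam [:: i; i] (gt T) y r.
    by rewrite !mulr_sumr -sumrB; apply: eq_bigr => i _; ring.
  have S1 : \sum_(i < n) 0 * (c * gradw i y r + - c * V lam [:: i] (gt T) y r) = 0.
    by rewrite big1// => i _; rewrite mul0r.
  have Eg : gt T y r = lam * wt y r + \sum_i b i y * gradw i y r + f y by rewrite /gt min_l.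
  rewrite S1 S2 /wtt /VW Eg -subr_ge0.
  set A := \sum_i hessw i i y r; set A1 := \sum_i V _ _ _ _ _; set A2 := \sum_i b i y * _.
  set v := V _ _ _ _ _ in pos *.
  have -> : c * A - c * A1 + 0 - (c * (A + A2 + f y) + - c * (A1 - lam * v + (lam * wt y r + A2 + f y))) = lam * (c * wt y r + - c * v) by ring.
  by rewrite mulr_ge0 ?ltW.
have e1 : (-1 : R) ^+ 2 = 1 by rewrite sqrrN expr1n.
have k1 := key 1 (expr1n _ _); have k2 := key (-1) e1.
by apply/eqP; rewrite eq_le; apply/andP; split; lra.
Qed.

Lemma gradw_E T i x t : 0 <= t <= T -> gradw i x t = V lam [:: i] (gt T) x t.
Proof.
move=> tT; have /andP[t0 tT'] := tT; have T0 : 0 <= T by exact: le_trans tT'.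
have [Nt [Ht [Lt [Nt0 Ht0 Lt0 hgt]]]] := src_gt_ex T0.
apply: (is_derive_unique_eq (is_derive_wt i x t0) (is_derive_V a01 lam0 hgt Ht0 x i (isT : (size [::] <= 1)%N) t0)).
by apply/funext => y; exact: wt_E.
Qed.

Lemma hessw_E T i j x t : 0 <= t <= T -> hessw i j x t = V lam [:: j; i] (gt T) x t.
Proof.
move=> tT; have /andP[t0 tT'] := tT; have T0 : 0 <= T by exact: le_trans tT'.
have [Nt [Ht [Lt [Nt0 Ht0 Lt0 hgt]]]] := src_gt_ex T0.
apply: (is_derive_unique_eq (is_derive_gradw i j x t0) (is_derive_V a01 lam0 hgt Ht0 x j (isT : (size [:: i] <= 1)%N) t0)).
by apply/funext => y; exact: gradw_E.
Qed.

Let kap : R := @KV R n lam 1 (1 / 2).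
Let kh : R := @KH R n a lam 1 (1 / 2).
Let half01 : 0 < (1 / 2 : R) < 1. Proof. by lra. Qed.
Let kap0 : 0 <= kap. Proof. by rewrite /kap; apply: KV_ge0. Qed.
Let kh0 : 0 <= kh. Proof. by rewrite /kh; apply: KH_ge0. Qed.

Lemma src_sup N H L N' (k : 'rV[R]_n -> R -> R) : src a N H L k -> (forall x t, 0 <= t -> `|k x t| <= N') -> src a N' H L k.
Proof. by move=> [Ha Ht] kN; split=> // s s0; split=> [x|]; [exact: kN|case: (Ha s s0)]. Qed.

Let Kq := kap * (lam * (2 * N0) + F).

(** By [gradw_E] the gradient is a first derivative of a potential whose source contains the
    gradient itself with a coefficient made at most 1 / 2 by [small]; the rest is bounded by
    [wt_le]. Absorption removes the dependence on t. *)
Lemma gradw_le i x t : 0 <= t -> `|gradw i x t| <= 2 * Kq.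
Proof.
move=> t0; have [Nq [Hq [Lq [Nq0 _ _ hq]]]] := src_gradw_frozen t0.
have [Nt [Ht [Lt [Nt0 Ht0 Lt0 hgt]]]] := src_gt_ex t0.
pose P (m : 'I_n * 'rV[R]_n * R) : Prop := 0 <= m.2 <= t.
have qN m : P m -> `|gradw m.1.1 m.1.2 m.2| <= Nq.
  by move=> /andP[m0 mt]; have [+ _] := hq m.1.1 => /(_ m.2 m0)[/(_ m.1.2) + _]; rewrite min_l.
apply: (@bound_halving R _ P (fun m => `|gradw m.1.1 m.1.2 m.2|) Kq Nq qN _ (i, x, t)); last by rewrite /P /= t0 lexx.
move=> c qc m Pm.
have c0 : 0 <= c by exact: le_trans (qc m Pm).
have gN y r : 0 <= r -> `|gt t y r| <= lam * (2 * N0) + n%:R * (B * c) + F.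
  move=> r0; have m0 : 0 <= Num.min r t <= t by rewrite le_min r0 t0 ge_min lexx orbT.
  apply: le_trans (ler_normD _ _) _; apply: lerD; last by case: Hff => + _; exact.
  apply: le_trans (ler_normD _ _) _; apply: lerD.
    by rewrite normrM gtr0_norm// ler_wpM2l ?(ltW lam0)// wt_le//; case/andP: m0.
  apply: le_trans (ler_norm_sum _ _ _) _.
  rewrite mulr_natl -[X in _ *+ X]card_ord -sumr_const; apply: ler_sum => k _.
  by rewrite normrM; apply: ler_pM => //; [case: (Hbb k) => + _; exact|exact: (qc (k, y, Num.min r t))].
rewrite (gradw_E _ _ Pm); have [Ha _] := src_V1 a01 lam0 (src_sup hgt gN) m.1.1.
have [+ _] := Ha m.2 (proj1 (andP Pm)) => /(_ m.1.2)/le_trans; apply.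
rewrite -/kap; have -> : kap * (lam * (2 * N0) + n%:R * (B * c) + F) = Kq + (n%:R * B * kap) * c by rewrite /Kq; ring.
by rewrite lerD2l; apply: le_trans (ler_wpM2r c0 small) _; lra.
Qed.

Let N2 := lam * (2 * N0) + n%:R * (B * (2 * Kq)) + F.

Lemma src_gradw i : src a (kap * N2) (kh * N2) (kh * N2) (gradw i).
Proof.
apply: src_of_local => T T0; exists (V lam [:: i] (gt T)); last by move=> x t tT; rewrite -gradw_E.
have [Nt [Ht [Lt [Nt0 Ht0 Lt0 hgt]]]] := src_gt_ex T0.
apply: (src_V1 a01 lam0); apply: (src_sup hgt) => y r r0.
have m0 : 0 <= Num.min r T by rewrite le_min r0 T0.
apply: le_trans (ler_normD _ _) _; apply: lerD; last by case: Hff => + _; exact.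
apply: le_trans (ler_normD _ _) _; apply: lerD.
  by rewrite normrM gtr0_norm// ler_wpM2l ?(ltW lam0)// wt_le.
apply: le_trans (ler_norm_sum _ _ _) _.
rewrite mulr_natl -[X in _ *+ X]card_ord -sumr_const; apply: ler_sum => k _.
by rewrite normrM; apply: ler_pM => //; [case: (Hbb k) => + _; exact|exact: gradw_le].
Qed.

Let H2 := lam * (2 * Kq + 2 * (2 * N0)) + n%:R * (B * (kh * N2) + Hb * (kap * N2)) + Hf.

(** Second derivatives see only the spatial Hölder constant of the source, and that of [gt] is
    uniform in T by [gradw_le] (for [wt]) and [src_gradw] (for the gradient): this gives [H2]. *)
Lemma src_hessw i j : src a (@KV R n lam 2 (a / 2) * H2) (@KH R n a lam 2 (a / 2) * H2) (@KH R n a lam 2 (a / 2) * H2) (hessw i j).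
Proof.
have lam0' := ltW lam0.
have Kq0 : 0 <= Kq by rewrite /Kq; nonneg.
have N20 : 0 <= N2 by rewrite /N2; nonneg.
have H20 : 0 <= H2 by rewrite /H2; nonneg.
apply: src_of_local => T T0; exists (V lam [:: j; i] (gt T)); last by move=> x t tT; rewrite -hessw_E.
have [Nw [Hw [Lw [Nw0 Hw0 Lw0 [_ hw]]]]] := src_wt_frozen T0.
have hw' : src a (2 * N0) (2 * Kq + 2 * (2 * N0)) Lw (fun x t => wt x (Num.min t T)).
  split=> // s s0; have m0 : 0 <= Num.min s T by rewrite le_min s0 T0.
  apply: (adm_of_derive a01 (f' := fun k y => gradw k y (Num.min s T))) => //.
  - by move=> y; exact: wt_le.
  - by move=> k y; exact: is_derive_wt.
  - by move=> k y; exact: gradw_le.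
  - by nonneg.
have h := src_gt hw' (fun i => src_freeze a01 T0 (src_gradw i)).
exact: (src_V2 a01 lam0 h).
Qed.

End existence.

(** * Classical solutions *)

Section norms.
Context {R : realType}.

Lemma mx_entry_le m n (M : 'M[R]_(m, n)) i j : `|M i j| <= `|M|.
Proof. by rewrite [leRHS]/Num.norm /= mx_normrE; apply/bigmax_geP; right => /=; exists (i, j). Qed.

Lemma mx_norm_le m n (M : 'M[R]_(m, n)) c : 0 <= c -> (forall i j, `|M i j| <= c) -> `|M| <= c.
Proof. by move=> c0 Mc; rewrite [leLHS]/Num.norm /= mx_normrE; apply/bigmax_leP; split=> // -[i j] _; exact: Mc. Qed.

Lemma enorm_ei n (i : 'I_n) (h : R) : enorm (h *: ei i) = `|h|.
Proof.
rewrite /enorm -[h *: ei i]add0r dotv_line mxE mulr0 addr0.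
by rewrite (_ : dotv 0 0 = 0) ?add0r ?sqrtr_sqr// /dotv big1// => j _; rewrite mxE mul0r.
Qed.

Lemma coord_le_enorm n (x : 'rV[R]_n) i : `|x 0 i| <= enorm x.
Proof. by rewrite /enorm -sqrtr_sqr ler_sqrt ?dotv_ge0// sqr_coord_le. Qed.

Lemma bounded_fun_ex (T : pointedType) (W : normedModType R) (f : T -> W) : bounded_fun f -> exists M, forall x, `|f x| <= M.
Proof.
move=> [M [_ HM]]; exists (M + 1) => x; apply: HM => //; by rewrite ltrDl.
Qed.

End norms.

Section classical.
Context {R : realType} {n : nat}.
Implicit Types (x y : 'rV[R]_n) (s t a G N H L : R) (i j : 'I_n).

(** A working form of bounded solutions with explicit derivatives and a single constant; the
    equation is stated as convergence of the time quotient, including the one-sided one at t = 0.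
    The translations to and from the parabolic Hölder class follow. *)
Definition classical a (b : 'I_n -> 'rV[R]_n -> R) (u : 'rV[R]_n -> R -> R)
    (u1 : 'I_n -> 'rV[R]_n -> R -> R) (u2 : 'I_n -> 'I_n -> 'rV[R]_n -> R -> R) G :=
  [/\ forall i x t, 0 <= t -> is_derive x (ei i) (u ^~ t) (u1 i x t),
      forall i j x t, 0 <= t -> is_derive x (ei j) (u1 i ^~ t) (u2 i j x t),
      forall x t, 0 <= t -> time_quotient u x t --> \sum_i u2 i i x t + \sum_i b i x * u1 i x t,
      forall x t, 0 <= t -> [/\ `|u x t| <= G, forall i, `|u1 i x t| <= G, forall i j, `|u2 i j x t| <= G
        & `|\sum_i u2 i i x t + \sum_i b i x * u1 i x t| <= G]
    & forall i j t, 0 <= t -> chol a G (u2 i j ^~ t)].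

Lemma partial_eq i (f : 'rV[R]_n -> R) x d : is_derive x (ei i) f d -> partial i f x = d.
Proof. by move=> [_ <-]. Qed.

Lemma classical_parabolic a b u u1 u2 N H G :
  0 < a < 1 -> 0 <= H -> (forall i, src a N H H (u1 i)) -> (forall i j, src a N H H (u2 i j)) ->
  src a N H H (fun x t => \sum_i u2 i i x t + \sum_i b i x * u1 i x t) ->
  classical a b u u1 u2 G -> C_2alpha_parabolic a u /\
    forall x t, 0 <= t -> [/\ time_derive u x t = \sum_i u2 i i x t + \sum_i b i x * u1 i x t,
      gradient (u ^~ t) x = \row_i u1 i x t & laplacian (u ^~ t) x = \sum_i u2 i i x t].
Proof.
move=> a01 H0 s1 s2 st [du du1 dut ub _].
have p1 i t : 0 <= t -> partial i (u ^~ t) = u1 i ^~ t.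
  by move=> t0; apply/funext => x; apply: partial_eq; exact: du.
have gE x t : 0 <= t -> gradient (u ^~ t) x = \row_i u1 i x t.
  by move=> t0; apply/rowP => i; rewrite !mxE p1.
have hE x t : 0 <= t -> hessian (u ^~ t) x = \matrix_(i, j) u2 i j x t.
  by move=> t0; apply/matrixP => i j; rewrite !mxE p1//; apply: partial_eq; exact: du1.
have tE x t : 0 <= t -> time_derive u x t = \sum_i u2 i i x t + \sum_i b i x * u1 i x t.
  by move=> t0; apply: time_derive_eq => //; exact: dut.
have G0 : 0 <= G by have [+ _ _ _] := ub 0 0 (lexx _); exact: le_trans.
have hold (g : 'rV[R]_n -> R -> R) : src a N H H g -> forall x y s t, 0 <= s -> 0 <= t ->
    `|g x s - g y t| <= (n%:R * H + H) * (enorm (x - y) `^ a + `|s - t| `^ (a / 2)).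
  move=> sg x y s t s0 t0.
  have := src_dist a01 y (z := x - y) sg (fun i => coord_le_enorm _ i) H0 s0 t0.
  rewrite (addrC y) subrK => /le_trans; apply; rewrite mulrA mulrDr; apply: lerD.
    by rewrite ler_wpM2r ?powR_ge0// lerDl.
  by rewrite ler_wpM2r ?powR_ge0// lerDr mulr_ge0.
split; last first.
  move=> x t t0; split; [exact: tE|exact: gE|].
  by apply: eq_bigr => i _; rewrite p1//; apply: partial_eq; exact: du1.
split.
- move=> t t0 i x; split; first by have [] := du i x t t0.
  by move=> j; rewrite p1//; have [] := du1 i j x t t0.
- by move=> x t t0; apply/cvg_ex; eexists; exact: dut.
- split; exists G => x t t0.
  + by have [] := ub x t t0.
  + by rewrite gE//; apply: mx_norm_le => // i j; rewrite mxE; have [] := ub x t t0.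
  + by rewrite hE//; apply: mx_norm_le => // i j; rewrite mxE; have [] := ub x t t0.
  + by rewrite tE//; have [] := ub x t t0.
- exists (n%:R * H + H) => x y s t s0 t0; rewrite !hE//; apply: mx_norm_le.
    by rewrite mulr_ge0 ?addr_ge0 ?powR_ge0// mulr_ge0.
  by move=> i j; rewrite !mxE; exact: hold.
- by exists (n%:R * H + H) => x y s t s0 t0; rewrite !tE//; exact: (hold _ st).
Qed.

Lemma parabolic_classical a psi u : 0 < a < 1 -> C_2alpha_parabolic a u ->
  (forall x t, 0 <= t -> time_derive u x t = laplacian (u ^~ t) x - dotv (radial_field psi x) (gradient (u ^~ t) x)) ->
  exists G, classical a (fun i x => - radial_field psi x 0 i) u (fun i x t => partial i (u ^~ t) x)
    (fun i j x t => partial j (partial i (u ^~ t)) x) G.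
Proof.
move=> /andP[a0 _] [hp td [[M0 B0] [M1 B1] [M2 B2] [Mt Bt]] [C hC] _] pde.
have E x t : 0 <= t -> \sum_i partial i (partial i (u ^~ t)) x + \sum_i - radial_field psi x 0 i * partial i (u ^~ t) x = time_derive u x t.
  move=> t0; rewrite pde//; congr (_ + _); rewrite -sumrN; apply: eq_bigr => i _.
  by rewrite !mxE mulNr.
exists (`|M0| + `|M1| + `|M2| + `|Mt| + `|C|); split.
- by move=> i x t t0; have [h _] := hp t t0 i x; split.
- by move=> i j x t t0; have [_ h] := hp t t0 i x; exact: DeriveDef (h j) erefl.
- by move=> x t t0; rewrite E//; exact: td.
- move=> x t t0; have q0 := normr_ge0 M0; have q1 := normr_ge0 M1; have q2 := normr_ge0 M2.
  have q3 := normr_ge0 Mt; have q4 := normr_ge0 C.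
  have r0 := ler_norm M0; have r1 := ler_norm M1; have r2 := ler_norm M2; have r3 := ler_norm Mt.
  split.
  + by have := B0 x t t0; lra.
  + move=> i; have := le_trans (mx_entry_le (gradient (u ^~ t) x) 0 i) (B1 x t t0); rewrite mxE; lra.
  + move=> i j; have := le_trans (mx_entry_le (hessian (u ^~ t) x) i j) (B2 x t t0); rewrite mxE; lra.
  + by rewrite E//; have := Bt x t t0; lra.
- move=> i j t t0 x k h.
  have e1 : x + h *: ei k - x = h *: ei k by rewrite addrAC subrr add0r.
  have e2 : `|t - t| = 0 by rewrite subrr normr0.
  have := hC (x + h *: ei k) x t t t0 t0; rewrite e1 e2 enorm_ei.
  have := mx_entry_le (hessian (u ^~ t) (x + h *: ei k) - hessian (u ^~ t) x) i j; rewrite !mxE => h1 h2.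
  apply: le_trans h1 _; apply: le_trans h2 _.
  rewrite powR0 ?addr0 ?gt_eqF ?divr_gt0// ler_wpM2r ?powR_ge0//.
  have q0 := normr_ge0 M0; have q1 := normr_ge0 M1; have q2 := normr_ge0 M2.
  by have q3 := normr_ge0 Mt; have r4 := ler_norm C; lra.
Qed.

Lemma src_common (I1 I2 : Type) a (g1 : I1 -> 'rV[R]_n -> R -> R) (g2 : I2 -> 'rV[R]_n -> R -> R) (g3 : 'rV[R]_n -> R -> R)
    (N1 H1 L1 N2 H2 L2 N3 H3 L3 : R) :
  (forall k, src a N1 H1 L1 (g1 k)) -> (forall k, src a N2 H2 L2 (g2 k)) -> src a N3 H3 L3 g3 ->
  exists N H, [/\ 0 <= H, forall k, src a N H H (g1 k), forall k, src a N H H (g2 k) & src a N H H g3].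
Proof.
move=> h1 h2 h3.
have le3 (x y hessw : R) : [/\ x <= `|x| + `|y| + `|hessw|, y <= `|x| + `|y| + `|hessw| & hessw <= `|x| + `|y| + `|hessw|].
  have := ler_norm x; have := ler_norm y; have := ler_norm hessw.
  by have := normr_ge0 x; have := normr_ge0 y; have := normr_ge0 hessw; split; lra.
have [a1 a2 a3] := le3 N1 N2 N3; have [b1 b2 b3] := le3 H1 H2 H3; have [c1 c2 c3] := le3 L1 L2 L3.
set N := _ + _ in a1 a2 a3; set H := _ + _ in b1 b2 b3; set L := _ + _ in c1 c2 c3.
have H0 : 0 <= H by rewrite /H !addr_ge0.
have L0 : 0 <= L by rewrite /L !addr_ge0.
have hH (x : R) : x <= H -> x <= H + L by move=> /le_trans; apply; rewrite lerDl.
have hL (x : R) : x <= L -> x <= H + L by move=> /le_trans; apply; rewrite lerDr.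
exists N, (H + L); split; first exact: addr_ge0.
- by move=> k; apply: (src_le (h1 k)); [|exact: hH|exact: hL].
- by move=> k; apply: (src_le (h2 k)); [|exact: hH|exact: hL].
by apply: (src_le h3); [|exact: hH|exact: hL].
Qed.

Lemma exists_small_lambda (B : R) : 0 <= B -> exists2 lam : R, 0 < lam & n%:R * B * @KV R n lam 1 (1 / 2) <= 1 / 2.
Proof.
move=> B0; pose c := 8 * (n%:R * B * @DC R n 1) + 1.
have D0 : 0 <= @DC R n 1 by exact/ltW/DC_gt0.
have nBD : 0 <= n%:R * B * @DC R n 1 by nonneg.
have c0 : 0 < c by rewrite /c; lra.
exists (c ^+ 2); first by rewrite exprn_gt0.
rewrite /KV; have -> : (c ^+ 2) `^ (- (1 / 2)) = c^-1.
  by rewrite -powR_mulrn ?(ltW c0)// -powRrM (_ : 2%:R * - (1 / 2) = - 1) ?powR_inv1 ?(ltW c0)//; field.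
rewrite (_ : (1 / 2)^-1 + (1 - 1 / 2)^-1 = 4); last by field; lra.
have -> : n%:R * B * (@DC R n 1 / c * 4) = 4 * (n%:R * B * @DC R n 1) / c by ring.
by rewrite ler_pdivrMr// /c; lra.
Qed.

Theorem exists_classical a (b : 'I_n -> 'rV[R]_n -> R) B Hb (u0 : 'rV[R]_n -> R) :
  0 < a < 1 -> 0 <= B -> 0 <= Hb -> (forall i, adm a B Hb (b i)) -> C_2alpha a u0 ->
  exists u u1 u2 N H G, [/\ 0 <= H, forall i, src a N H H (u1 i), forall i j, src a N H H (u2 i j),
    src a N H H (fun x t => \sum_i u2 i i x t + \sum_i b i x * u1 i x t)
    & classical a b u u1 u2 G /\ forall x, u x 0 = u0 x].
Proof.
move=> a01 B0 Hb0 Hbb [hp /bounded_fun_ex[N0 u0N] /bounded_fun_ex[M1 bg] /bounded_fun_ex[M2 bh] hh].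
pose d1 i := partial i u0; pose d2 i j := partial j (partial i u0).
have Hd1 i x : is_derive x (ei i) u0 (d1 i x) by have [h _] := hp i x; exact: DeriveDef h erefl.
have Hd2 i j x : is_derive x (ei j) (d1 i) (d2 i j x) by have [_ h] := hp i x; exact: DeriveDef (h j) erefl.
have d1N i x : `|d1 i x| <= M1 by have := le_trans (mx_entry_le (gradient u0 x) 0 i) (bg x); rewrite mxE.
have d2N i j x : `|d2 i j x| <= M2 by have := le_trans (mx_entry_le (hessian u0 x) i j) (bh x); rewrite mxE.
have ad1 i : adm a M1 (`|M2| + 2 * M1) (d1 i).
  by apply: (adm_of_derive a01 (d1N i) (Hd2 i)) => // j x; exact: le_trans (d2N i j x) (ler_norm _).
have [H2 H20 ad2] : exists2 H2, 0 <= H2 & forall i j, adm a M2 H2 (d2 i j).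
  case: hh => C HC; exists `|C| => // i j; split=> [|x k h]; first exact: d2N.
  have := mx_entry_le (hessian u0 (x + h *: ei k) - hessian u0 x) i j; rewrite !mxE => /le_trans; apply.
  apply: le_trans (HC _ _) _; rewrite addrAC subrr add0r enorm_ei.
  by rewrite ler_wpM2r ?powR_ge0// ler_norm.
(* Subtracting u0 reduces the problem to zero initial data with this time-independent source. *)
pose f x := \sum_i d2 i i x + \sum_i b i x * d1 i x.
have sf : src a _ _ _ (fun x _ => f x) := src_add (src_sum (fun i => src_static (ad2 i i)))
  (src_sum (fun i => src_mul (src_static (Hbb i)) (src_static (ad1 i)))).
have [Ff [Hf Hf0 Hff]] : exists F, exists2 Hf, 0 <= Hf & adm a F Hf f.
  have [+ _] := src_le sf (lexx _) (ler_norm _) (ler_norm _) => /(_ 0 (lexx _)) h.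
  by eexists; eexists; last exact: h.
have [lam lam0 small] := exists_small_lambda B0.
have [p [Np [Hp [Lp [Np0 Hp0 Lp0 sp pE]]]]] := picard a01 Hbb Hff lam0 B0 small.
have sq i := src_gradw a01 Hbb Hff lam0 B0 Hb0 Hf0 small u0N d1N Hd1 Hd2 (fun=> erefl) Np0 Hp0 Lp0 sp pE i.
have sz i j := src_hessw a01 Hbb Hff lam0 B0 Hb0 Hf0 small u0N d1N Hd1 Hd2 (fun=> erefl) Np0 Hp0 Lp0 sp pE i j.
pose u := ut lam b f u0 p.
pose u1 i x t := d1 i x + gradw lam p i x t.
pose u2 i j x t := d2 i j x + hessw lam b f p i j x t.
have s1 i := src_add (src_static (ad1 i)) (sq i).
have s2 i j := src_add (src_static (ad2 i j)) (sz i j).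
have s3 := src_add (src_sum (fun i => s2 i i)) (src_sum (fun i => src_mul (src_static (Hbb i)) (s1 i))).
have [N [H [H0 t1 t2 t3]]] := @src_common 'I_n ('I_n * 'I_n)%type a u1 (fun k => u2 k.1 k.2) _ _ _ _ _ _ _ _ _ _ s1 (fun k => s2 k.1 k.2) s3.
have N0' : 0 <= N by exact: src_ge0 t3.
pose G := `|N0| + N + H.
have NG : N <= G by rewrite /G -addrA addrCA lerDl addr_ge0.
have HG : H <= G by rewrite /G lerDr addr_ge0.
have uG : N0 <= G by rewrite /G -addrA; apply: le_trans (ler_norm N0) _; rewrite lerDl addr_ge0.
exists u, u1, u2, N, H, G; split; [exact: H0|exact: t1|by move=> i j; exact: (t2 (i, j))|exact: t3|].
split; last by move=> x; rewrite /u /ut wt0 addr0.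
split.
- move=> i x t t0; have h1 := Hd1 i x.
  have h2 := is_derive_wt a01 Hbb Hff lam0 B0 Hb0 Hf0 Np0 Hp0 sp pE i x t0.
  exact: is_derive_eq.
- move=> i j x t t0; have h1 := Hd2 i j x.
  have h2 := is_derive_gradw a01 Hbb Hff lam0 B0 Hb0 Hf0 Np0 Hp0 sp pE i j x t0.
  exact: is_derive_eq.
- move=> x t t0.
  have := time_quotientD t0 (time_quotient_cst x u0 t0) (time_quotient_wt a01 Hbb Hff lam0 B0 Hb0 Hf0 Np0 Hp0 Lp0 sp (x := x) t0).
  congr (_ --> _); rewrite add0r /wtt /u2 /u1 big_split /=.
  have -> : \sum_i b i x * (d1 i x + gradw lam p i x t) = \sum_i b i x * d1 i x + \sum_i b i x * gradw lam p i x t.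
    by rewrite -big_split; apply: eq_bigr => i _; rewrite mulrDr.
  have E (A A1 A2 A3 : R) : A + A1 + (A2 + A3) = A2 + A + (A3 + A1) by ring.
  exact: E.
- move=> x t t0; split.
  + have := ut_le a01 Hbb Hff lam0 B0 Hb0 Hf0 u0N d1N Hd1 Hd2 (fun=> erefl) Np0 Hp0 Lp0 sp pE x t0.
    by move=> h; exact: le_trans h uG.
  + by move=> i; have [/(_ t t0)[/(_ x) h _] _] := t1 i; exact: le_trans h NG.
  + by move=> i j; have [/(_ t t0)[/(_ x) h _] _] := t2 (i, j); exact: le_trans h NG.
  + by have [/(_ t t0)[/(_ x) h _] _] := t3; exact: le_trans h NG.
- move=> i j t t0 x k h; have [/(_ t t0)[_ c] _] := t2 (i, j); apply: le_trans (c x k h) _.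
  by rewrite ler_wpM2r ?powR_ge0.
Qed.

End classical.

(** * Comparison and uniqueness *)

Section comparison.
Context {R : realType} {n : nat}.
Variables (a B : R) (b : 'I_n -> 'rV[R]_n -> R).
Hypothesis a01 : 0 < a < 1.
Hypothesis bB : forall i x, `|b i x| <= B.
Implicit Types (x y z : 'rV[R]_n) (s t T G K : R) (i j : 'I_n).

Definition rhs (w1 : 'I_n -> 'rV[R]_n -> R -> R) (w2 : 'I_n -> 'I_n -> 'rV[R]_n -> R -> R) x t :=
  \sum_i w2 i i x t + \sum_i b i x * w1 i x t.

Lemma classical_adm u u1 u2 G t : classical a b u u1 u2 G -> 0 <= t -> adm a G (G + 2 * G) (u ^~ t).
Proof.
move=> [du _ _ ub _] t0; apply: (adm_of_derive a01 (f' := fun i x => u1 i x t)).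
- by move=> x; have [] := ub x t t0.
- by move=> i x; exact: du.
- by move=> i x; have [] := ub x t t0.
- by have [+ _ _ _] := ub 0 t t0; exact: le_trans.
Qed.

Lemma classical_lipschitz u u1 u2 G x s t : classical a b u u1 u2 G -> 0 <= s -> 0 <= t ->
  `|u x s - u x t| <= G * `|s - t|.
Proof.
move=> [_ _ ut ub _] s0 t0.
have G0 : 0 <= G by have [+ _ _ _] := ub 0 t t0; exact: le_trans.
apply: (@time_lipschitz R n u x (rhs u1 u2 x) G (Num.max s t) G0); rewrite ?s0 ?t0 ?le_max ?lexx ?orbT//.
  by move=> r /andP[r0 _]; exact: ut.
by move=> r /andP[r0 _]; have [] := ub x r r0.
Qed.

Lemma classical_C21 u u1 u2 G T : 0 <= T -> classical a b u u1 u2 G -> C21 T u (rhs u1 u2) u1 (fun i => u2 i i).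
Proof.
move=> T0 C; have [du du1 dut ub _] := C.
have G0 : 0 <= G by have [+ _ _ _] := ub 0 0 (lexx _); exact: le_trans.
split=> [|x t /andP[t0 _]|i x t /andP[t0 _]|i x t /andP[t0 _]].
- apply: (@src_continuous R n a a01 G (G + 2 * G) (G + 2 * G)); apply: src_frozen => //.
    by move=> t /andP[t0 _]; exact: classical_adm C t0.
  by move=> x s t /andP[s0 _] /andP[t0 _]; exact: classical_lipschitz C s0 t0.
- by apply: time_quotient_is_derive => //; apply: dut; exact: ltW.
- by apply: du; exact: ltW.
- by apply: du1; exact: ltW.
Qed.

(** The factor c makes upper and lower bounds one statement, with c = -1 and c = 1. The differential
    inequality is demanded only where w exceeds c u, so a barrier may fail it where it is
    nonpositive. *)
Lemma classical_comparison u u1 u2 G T (w wt : 'rV[R]_n -> R -> R) (w1 w2 : 'I_n -> 'rV[R]_n -> R -> R) (c M : R) :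
  classical a b u u1 u2 G -> C21 T w wt w1 w2 -> (forall x t, 0 <= t <= T -> w x t <= M) ->
  (forall x, w x 0 <= c * u x 0) ->
  (forall x t, 0 < t <= T -> c * u x t < w x t -> wt x t <= \sum_i w2 i x t + \sum_i b i x * w1 i x t) ->
  forall x t, 0 <= t <= T -> w x t <= c * u x t.
Proof.
move=> Cu Cw wM w0 wle x t tT; have T0 : 0 <= T by case/andP: tT; exact: le_trans.
have C := C21_lin 1 (- c) Cw (classical_C21 T0 Cu).
have := @maximum_principle R n T B (M + `|c| * G) _ _ _ _ b setT C closedT bB _ _ _ _ x t I tT.
rewrite mul1r mulNr subr_le0; apply.
- move=> y s _ sT; rewrite mul1r; apply: lerD; first exact: wM.
  apply: le_trans (ler_norm _) _; rewrite normrM normrN ler_wpM2l//.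
  by case: Cu => _ _ _ + _ => /(_ y s (proj1 (andP sT)))[].
- by move=> y _; rewrite mul1r mulNr subr_le0.
- by move=> *; exact: filterT.
move=> y s _ sT; rewrite !mul1r mulNr subr_gt0 => /(wle y s sT) h.
rewrite (eq_bigr (fun i => w2 i y s + (- c) * u2 i i y s)); last by move=> i _; rewrite mul1r.
rewrite [X in _ <= _ + X](eq_bigr (fun i => b i y * w1 i y s + (- c) * (b i y * u1 i y s))); last first.
  by move=> i _; rewrite mul1r; ring.
rewrite !big_split /= -!mulr_sumr /rhs; move: h.
set A := \sum_i w2 i y s; set A1 := \sum_i b i y * w1 i y s; set A2 := \sum_i u2 i i y s; set A3 := \sum_i b i y * _.
lra.
Qed.

Lemma classical_le u u1 u2 G K x t : classical a b u u1 u2 G -> (forall x, u x 0 <= K) -> 0 <= t -> u x t <= K.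
Proof.
move=> C u0 t0; have tT : 0 <= t <= t by rewrite t0 lexx.
suff : - K <= -1 * u x t by rewrite mulN1r lerN2.
apply: (@classical_comparison u u1 u2 G t _ _ _ _ (-1) (- K) C (@C21_cst R n t (- K)) _ _ _ x t tT) => //.
  by move=> y; rewrite mulN1r lerN2.
by move=> y s _ _; rewrite !big1 ?addr0// => i _; rewrite mulr0.
Qed.

Lemma classical_ge u u1 u2 G K x t : classical a b u u1 u2 G -> (forall x, K <= u x 0) -> 0 <= t -> K <= u x t.
Proof.
move=> C u0 t0; have tT : 0 <= t <= t by rewrite t0 lexx.
rewrite -[leRHS]mul1r.
apply: (@classical_comparison u u1 u2 G t _ _ _ _ 1 K C (@C21_cst R n t K) _ _ _ x t tT) => //.
  by move=> y; rewrite mul1r.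
by move=> y s _ _; rewrite !big1 ?addr0// => i _; rewrite mulr0.
Qed.

Lemma classical_mono u u1 u2 G v v1 v2 G' x t : classical a b u u1 u2 G -> classical a b v v1 v2 G' ->
  (forall x, u x 0 <= v x 0) -> 0 <= t -> u x t <= v x t.
Proof.
move=> Cu Cv uv t0; have tT : 0 <= t <= t by rewrite t0 lexx.
rewrite -[leRHS]mul1r.
apply: (@classical_comparison v v1 v2 G' t _ _ _ _ 1 G Cv (classical_C21 t0 Cu) _ _ _ x t tT) => //.
  move=> y s /andP[s0 _]; apply: le_trans (ler_norm _) _.
  by case: Cu => _ _ _ + _ => /(_ y s s0)[].
by move=> y; rewrite mul1r.
Qed.

Lemma classical_unique u u1 u2 G v v1 v2 G' x t : classical a b u u1 u2 G -> classical a b v v1 v2 G' ->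
  (forall x, u x 0 = v x 0) -> 0 <= t -> u x t = v x t.
Proof.
move=> Cu Cv uv t0; apply/eqP; rewrite eq_le; apply/andP; split.
  by apply: (classical_mono x Cu Cv) => // y; rewrite uv.
by apply: (classical_mono x Cv Cu) => // y; rewrite uv.
Qed.

(** The increments admissible at time t for the shifted function are among those admissible at time
    T + t for [u], so the limit of the quotient is inherited, also at t = 0. *)
Lemma classical_shift u u1 u2 G T : 0 <= T -> classical a b u u1 u2 G ->
  classical a b (fun x t => u x (T + t)) (fun i x t => u1 i x (T + t)) (fun i j x t => u2 i j x (T + t)) G.
Proof.
move=> T0 [du du1 dut ub uc]; split.
- by move=> i x t t0; apply: du; exact: addr_ge0.
- by move=> i j x t t0; apply: du1; exact: addr_ge0.
- move=> x t t0 P /(dut x (T + t) (addr_ge0 T0 t0)); rewrite /nbhs /= /within /= => HP.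
  by apply: (@filterS _ (0 : R)^' _ _ _ _ HP) => h H th; rewrite /preimage /= addrA; apply: H; rewrite /= -addrA addr_ge0.
- by move=> x t t0; apply: ub; exact: addr_ge0.
- by move=> i j t t0; apply: uc; exact: addr_ge0.
Qed.

Lemma classical_opp_cst u u1 u2 G (c : R) : classical a b u u1 u2 G ->
  classical a b (fun x t => c - u x t) (fun i x t => - u1 i x t) (fun i j x t => - u2 i j x t) (`|c| + G).
Proof.
move=> [du du1 dut ub uc]; split.
- move=> i x t t0; have h := du i x t t0.
  by apply: is_derive_eq; rewrite ?add0r ?sub0r.
- move=> i j x t t0; have h := du1 i j x t t0.
  by apply: is_derive_eq.
- move=> x t t0.
  have h0 := @time_quotient_cst R n x t (fun=> -1) t0.
  have cc : {for t, continuous (fun _ : R => -1 : R)} by exact: cst_continuous.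
  have h1 := time_quotientM t0 cc h0 (dut x t t0).
  have := time_quotientD t0 (@time_quotient_cst R n x t (fun=> c) t0) h1.
  rewrite add0r mul0r addr0 mulN1r opprD -!sumrN.
  rewrite (_ : (fun y s => c + -1 * u y s) = fun y s => c - u y s); last first.
    by apply/funext => y; apply/funext => s; rewrite mulN1r.
  rewrite [X in _ --> _ + X -> _](eq_bigr (fun i => b i x * - u1 i x t))//.
  by move=> i _; rewrite mulrN.
- have G0 : 0 <= G by have [+ _ _ _] := ub 0 0 (lexx _); exact: le_trans.
  have c0 := normr_ge0 c.
  move=> x t t0; have [h0 h1 h2 h3] := ub x t t0; split.
  + by apply: le_trans (ler_normB _ _) _; rewrite lerD2l.
  + by move=> i; rewrite normrN; apply: le_trans (h1 i) _; lra.
  + by move=> i j; rewrite normrN; apply: le_trans (h2 i j) _; lra.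
  + rewrite sumrN [X in _ + X](eq_bigr (fun i => - (b i x * u1 i x t))); last by move=> i _; rewrite mulrN.
    by rewrite sumrN -opprD normrN; apply: le_trans h3 _; lra.
- move=> i j t t0 x k h; rewrite -opprD normrN; apply: le_trans (uc i j t t0 x k h) _.
  by rewrite ler_wpM2r ?powR_ge0// lerDr.
Qed.

End comparison.

(** * Barriers and strict positivity *)

Section barrier.
Context {R : realType} {n : nat}.
Implicit Types (x y z : 'rV[R]_n) (s t : R) (i j : 'I_n).
Variables (A K r0 v : R) (z : 'rV[R]_n).

Definition bs x t := (r0 + v * t) ^+ 2 - dotv (x - z) (x - z).
(** A subsolution candidate, positive exactly on a ball about [z] whose radius grows with speed [v]
    when A > 0. It is a polynomial in the coordinates, hence smooth everywhere, and nonpositive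
    outside the ball, so it needs no truncation. *)
Definition bw x t := A * expR (- (K * t)) * bs x t ^+ 3.
Definition bwt x t := A * expR (- (K * t)) * (6 * bs x t ^+ 2 * (r0 + v * t) * v - K * bs x t ^+ 3).
Definition bw1 i x t := A * expR (- (K * t)) * (- (6 * bs x t ^+ 2 * (x - z) 0 i)).
Definition bw2 i x t := A * expR (- (K * t)) * (24 * bs x t * (x - z) 0 i ^+ 2 - 6 * bs x t ^+ 2).

Lemma is_derive_coordinate (f : 'rV[R]_n -> R) x i d :
  is_derive (0 : R) (1 : R) (fun h => f (x + h *: ei i)) d -> is_derive x (ei i) f d.
Proof. by move=> /is_derive_line; rewrite scale0r addr0. Qed.

Lemma bs_line x t i (h : R) : bs (x + h *: ei i) t = (r0 + v * t) ^+ 2 - (dotv (x - z) (x - z) + 2 * h * (x - z) 0 i + h ^+ 2).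
Proof. by rewrite /bs addrAC dotv_line. Qed.

Lemma coord_line x i (h : R) : (x + h *: ei i - z) 0 i = (x - z) 0 i + h.
Proof. by rewrite !mxE !eqxx mulr1 addrAC. Qed.

Lemma C21_barrier T : C21 T bw bwt bw1 bw2.
Proof.
split.
- apply: continuous_subspaceT.
  have cs : continuous (fun p : 'rV[R]_n * R => bs p.1 p.2).
    have c1 : continuous (fun p : 'rV[R]_n * R => r0 + v * p.2).
      apply: continuous_fun_add; first exact: continuous_fun_cst.
      by apply: continuous_fun_mul; [exact: continuous_fun_cst|move=> q; exact: cvg_snd].
    apply: continuous_fun_sub; first exact: continuous_fun_mul.
    move=> p; apply: (@continuous_comp _ _ _ (fun p : 'rV[R]_n * R => p.1 - z) (fun x => dotv x x)).
      by apply: cvgB; [exact: cvg_fst|exact: cvg_cst].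
    exact: continuous_dotv.
  apply: continuous_fun_mul; last by rewrite (_ : (fun p => _) = fun p : 'rV[R]_n * R => bs p.1 p.2 * (bs p.1 p.2 * bs p.1 p.2)) //; do 2 apply: continuous_fun_mul => //.
  apply: continuous_fun_mul; first exact: continuous_fun_cst.
  move=> p; apply: (@continuous_comp _ _ _ (fun p : 'rV[R]_n * R => - (K * p.2)) expR); last exact: continuous_expR.
  apply: cvgN; apply: cvgM; [exact: cvg_cst|exact: cvg_snd].
- move=> x t _; rewrite /bw /bwt /bs; apply: is_derive_eq; rewrite /GRing.scale /=; ring.
- move=> i x t _; apply: is_derive_coordinate.
  rewrite (_ : (fun h => _) = fun h : R => A * expR (- (K * t)) * ((r0 + v * t) ^+ 2 - (dotv (x - z) (x - z) + 2 * h * (x - z) 0 i + h ^+ 2)) ^+ 3).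
    by rewrite /bw1 /bs; apply: is_derive_eq; rewrite /GRing.scale /=; ring.
  by apply/funext => h; rewrite /bw bs_line.
- move=> i x t _; apply: is_derive_coordinate.
  rewrite (_ : (fun h => _) = fun h : R => A * expR (- (K * t)) * (- (6 * ((r0 + v * t) ^+ 2 - (dotv (x - z) (x - z) + 2 * h * (x - z) 0 i + h ^+ 2)) ^+ 2 * ((x - z) 0 i + h)))).
    by rewrite /bw2 /bs; apply: is_derive_eq; rewrite /GRing.scale /=; ring.
  by apply/funext => h; rewrite /bw1 bs_line coord_line.
Qed.

End barrier.

Section positivity.
Context {R : realType} {n : nat}.
Implicit Types (x y z : 'rV[R]_n) (s t : R) (i j : 'I_n).

(* The constants are those for which [K s^2 - (M + 24) s + 24 r0^2] is a square. *)
Lemma spreading (a B r0 rho d T : R) : 0 < a < 1 -> 0 <= B -> 0 < r0 -> 0 <= rho -> 0 < d -> 0 < T ->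
  exists2 c : R, 0 < c & forall (b : 'I_n -> 'rV[R]_n -> R) u u1 u2 G z y,
    (forall i x, `|b i x| <= B) -> classical a b u u1 u2 G -> (forall x, 0 <= u x 0) ->
    (forall x, dotv (x - z) (x - z) <= r0 ^+ 2 -> d <= u x 0) -> dotv (y - z) (y - z) <= rho ^+ 2 -> c <= u y T.
Proof.
move=> a01 B0 r00 rho0 d0 T0.
(* With this speed the radius grows from r0 to r0 + rho in time T. The margin R1^2 - rho^2 >= r0^2
   then bounds the barrier below on the ball of radius rho. *)
pose v := rho / T; pose R1 := r0 + rho.
pose M := 6 * R1 * v + 6 * n%:R + 6 * (n%:R * (B * (1 + R1 ^+ 2))) + 24.
(* [A] makes the initial barrier at most d. [K] makes 24 r0^2 - M s + K s^2 nonnegative for all s: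
   near the edge of the ball the gradient part of the Laplacian of the cube dominates, inside it the
   exponential decay does. *)
pose K := M ^+ 2 / (96 * r0 ^+ 2); pose A := d / r0 ^+ 6.
have v0 : 0 <= v by rewrite divr_ge0// ltW.
have A0 : 0 < A by rewrite divr_gt0// exprn_gt0.
have Ad : A * (r0 ^+ 2) ^+ 3 = d by rewrite -exprM /A divfK// expf_neq0// gt_eqF.
have K0 : 0 <= K by rewrite /K divr_ge0 ?sqr_ge0// mulr_ge0// sqr_ge0.
have Kq (s : R) : 0 <= 24 * r0 ^+ 2 - M * s + K * s ^+ 2.
  have -> : 24 * r0 ^+ 2 - M * s + K * s ^+ 2 = (48 * r0 ^+ 2 - M * s) ^+ 2 / (96 * r0 ^+ 2).
    by rewrite /K; field; rewrite gt_eqF.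
  by rewrite divr_ge0 ?sqr_ge0// mulr_ge0// sqr_ge0.
clearbody A K.
exists (A * expR (- (K * T)) * (r0 ^+ 2) ^+ 3) => [|b u u1 u2 G z y bB C u0 ud yz].
  apply: mulr_gt0; last by do 2 apply: exprn_gt0.
  by apply: mulr_gt0 => //; exact: expR_gt0.
have up x t : 0 <= t -> 0 <= u x t by move=> t0; exact: (classical_ge a01 bB x C).
have TT : 0 <= T <= T by rewrite lexx ltW.
have cube (c s : R) : 0 <= c -> s <= 0 -> c * s ^+ 3 <= 0.
  by move=> c0 s0; apply: mulr_ge0_le0 => //; rewrite exprS; apply: mulr_le0_ge0 => //; exact: sqr_ge0.
pose w := bw A K r0 v z.
have RT : r0 + v * T = R1 by rewrite /v divfK// gt_eqF.
have Rle t : 0 <= t <= T -> r0 <= r0 + v * t <= R1.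
  by move=> /andP[t0 tT]; rewrite lerDl mulr_ge0//= -RT lerD2l ler_wpM2l.
have E1 t : 0 <= t -> expR (- (K * t)) <= 1 by move=> t0; apply: expRN_le1; rewrite mulr_ge0.
apply: (@le_trans _ _ (w y T)).
  rewrite /w /bw ler_wpM2l//; first by rewrite mulr_ge0 ?expR_ge0 ?(ltW A0).
  apply: lerXn2r; rewrite ?nnegrE ?sqr_ge0//.
    by rewrite /bs RT subr_ge0; apply: le_trans yz _; apply: lerXn2r; rewrite ?nnegrE /R1; lra.
  rewrite /bs RT lerBrDl; apply: le_trans (lerD yz (lexx _)) _.
  have -> : R1 ^+ 2 = rho ^+ 2 + r0 ^+ 2 + 2 * (r0 * rho) by rewrite /R1; ring.
  by rewrite lerDl; nonneg.
rewrite -[leRHS]mul1r.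
apply: (@classical_comparison R n a B b a01 bB u u1 u2 G T w _ _ _ 1 (A * (R1 ^+ 2) ^+ 3) C (@C21_barrier R n A K r0 v z T) _ _ _ y T TT).
- move=> x t tT; have /andP[t0 _] := tT; have /andP[h1 h2] := Rle t tT.
  rewrite /w /bw; have [s0|s0] := leP 0 (bs r0 v z x t); last first.
    apply: (@le_trans _ _ 0).
      by apply: cube; [rewrite mulr_ge0 ?expR_ge0 ?(ltW A0)|exact: ltW].
    by apply: mulr_ge0; [exact: ltW|apply: exprn_ge0; exact: sqr_ge0].
  apply: ler_pM; rewrite ?mulr_ge0 ?expR_ge0 ?(ltW A0) ?exprn_ge0//.
    by rewrite ler_piMr ?(ltW A0)// E1.
  apply: lerXn2r; rewrite ?nnegrE ?sqr_ge0// /bs.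
  apply: (@le_trans _ _ ((r0 + v * t) ^+ 2)); first by rewrite gerBl dotv_ge0.
  by apply: lerXn2r; rewrite ?nnegrE//; lra.
- move=> x; rewrite mul1r /w /bw mulr0 oppr0 expR0 mulr1 /bs mulr0 addr0.
  have [h|h] := leP (dotv (x - z) (x - z)) (r0 ^+ 2); last first.
    by apply: le_trans (u0 x); apply: cube; [exact: ltW|rewrite subr_le0 ltW].
  apply: le_trans (ud x h); apply: (@le_trans _ _ (A * (r0 ^+ 2) ^+ 3)).
    rewrite ler_wpM2l ?(ltW A0)//; apply: lerXn2r; rewrite ?nnegrE ?sqr_ge0 ?subr_ge0//.
    by rewrite gerBl dotv_ge0.
  by rewrite Ad.
move=> x t tT; have /andP[t0 t1] := tT; rewrite mul1r => h.
have w0 : 0 < w x t by apply: le_lt_trans h; exact/up/ltW.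
have tT' : 0 <= t <= T by rewrite t1 ltW.
have /andP[R0 RR] := Rle t tT'; set r := r0 + v * t in R0 RR.
have E0 : 0 < A * expR (- (K * t)) by rewrite mulr_gt0 ?expR_gt0.
have s0 : 0 < bs r0 v z x t.
  move: w0; rewrite /w /bw pmulr_rgt0//; rewrite exprS; case: (ltrgtP (bs r0 v z x t) 0) => // [s0|->].
    by rewrite nmulr_rgt0// ltNge sqr_ge0.
  by rewrite mul0r ltxx.
rewrite /bwt /bw1 /bw2.
set E := A * expR _ in E0 *; set s := bs _ _ _ _ _ in s0 *.
have rE : dotv (x - z) (x - z) = r ^+ 2 - s by rewrite /s /bs -/r; ring.
clearbody E s.
have S2 : \sum_i E * (24 * s * (x - z) 0 i ^+ 2 - 6 * s ^+ 2) = E * (24 * s * (r ^+ 2 - s) - n%:R * (6 * s ^+ 2)).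
  rewrite -mulr_sumr sumrB -mulr_sumr sumr_const card_ord -[_ *+ n]mulr_natl -rE /dotv.
  by congr (E * (_ * _ - _)).
have r0' := dotv_ge0 (x - z).
have S1 : - (E * (6 * s ^+ 2 * (n%:R * (B * (1 + R1 ^+ 2))))) <= \sum_i b i x * (E * - (6 * s ^+ 2 * (x - z) 0 i)).
  have -> : E * (6 * s ^+ 2 * (n%:R * (B * (1 + R1 ^+ 2)))) = \sum_(i < n) E * (6 * s ^+ 2) * (B * (1 + R1 ^+ 2)).
    by rewrite sumr_const card_ord -[RHS]mulr_natl; ring.
  rewrite lerNl -sumrN.
  apply: ler_sum => i _.
  have -> : - (b i x * (E * - (6 * s ^+ 2 * (x - z) 0 i))) = E * (6 * s ^+ 2) * (b i x * (x - z) 0 i) by ring.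
  apply: ler_wpM2l; first by apply: mulr_ge0; [exact: ltW|rewrite mulr_ge0// sqr_ge0].
  apply: le_trans (ler_norm _) _.
  rewrite normrM; apply: ler_pM => //.
  have := sqr_coord_le (x - z) i; rewrite rE -[X in X <= _]real_normK ?num_real// => q.
  have : r ^+ 2 <= R1 ^+ 2 by apply: lerXn2r; rewrite // nnegrE (le_trans (ltW r00))// (le_trans R0).
  by have := sqr_ge0 (1 - `|(x - z) 0 i|); nra.
apply: le_trans (lerD (lexx _) S1); rewrite S2 -/r.
rewrite [leRHS](_ : _ = E * (s * (24 * r ^+ 2 - s * (M - 6 * R1 * v)))); last by rewrite /M; ring.
rewrite [leLHS](_ : _ = E * (s * (6 * s * (r * v) - K * s ^+ 2))); last by ring.
apply: ler_wpM2l; first exact: ltW.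
apply: ler_wpM2l; first exact: ltW.
have q1 := Kq s.
have q2 : r0 ^+ 2 <= r ^+ 2 by apply: lerXn2r; rewrite // nnegrE ?(le_trans _ R0)// ltW.
have q3 : r * v <= R1 * v by rewrite ler_wpM2r.
have q4 : s * (r * v) <= s * (R1 * v) by rewrite ler_wpM2l// ltW.
by clearbody M; lra.
Qed.

(** By continuity the initial value exceeds half of its value at [z] on a small ball, and
    [spreading] carries positivity from there to any point in any positive time. *)
Lemma classical_pos a B (b : 'I_n -> 'rV[R]_n -> R) u u1 u2 G : 0 < a < 1 -> 0 <= B -> (forall i x, `|b i x| <= B) ->
  classical a b u u1 u2 G -> (forall x, 0 <= u x 0) -> (exists x, u x 0 <> 0) -> forall x t, 0 < t -> 0 < u x t.
Proof.
move=> a01 B0 bB C u0 [z uz] x t t0; have /andP[a0 a1] := a01.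
have d0 : 0 < u z 0 by rewrite lt_neqAle u0 andbT eq_sym; apply/eqP.
have [_ Hc] := classical_adm a01 C (lexx 0).
have G0 : 0 <= G + 2 * G by have [_ _ _ + _] := C => /(_ 0 0 (lexx _))[h _ _ _]; have := le_trans (normr_ge0 _) h; lra.
pose H := n%:R * (G + 2 * G) + 1; have H0 : 0 < H by rewrite ltr_wpDl// mulr_ge0.
have e0 : 0 < u z 0 / 2 / H by rewrite !divr_gt0.
have [r r0 Hr] := powR_small a0 e0.
have d20 : 0 < u z 0 / 2 by rewrite divr_gt0.
pose rho := Num.sqrt (dotv (x - z) (x - z)).
have [c c0 sp] := spreading a01 B0 r0 (sqrtr_ge0 (dotv (x - z) (x - z))) d20 t0.
apply: lt_le_trans c0 (sp b u u1 u2 G z x bB C u0 _ _); last by rewrite sqr_sqrtr// dotv_ge0.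
move=> y yr.
have yr' i : `|(y - z) 0 i| <= r.
  have := le_trans (sqr_coord_le (y - z) i) yr; rewrite -[X in X <= _]real_normK ?num_real//.
  by rewrite ler_pXn2r// nnegrE ltW.
have := @chol_dist R n a a01 _ (u ^~ 0) z (y - z) r Hc yr' G0.
have -> : z + (y - z) = y by rewrite addrC subrK.
move=> h.
have : n%:R * ((G + 2 * G) * r `^ a) <= u z 0 / 2.
  apply: (@le_trans _ _ (n%:R * (G + 2 * G) * (u z 0 / 2 / H))).
    by rewrite mulrA ler_wpM2l ?mulr_ge0//; apply: Hr; rewrite lexx ltW.
  by rewrite mulrCA ler_piMr ?(ltW d20)// ler_pdivrMr// mul1r /H lerDl.
by move: h; rewrite ler_norml => /andP[h _] h2; lra.
Qed.

End positivity.

(** * Symmetry *)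

Section directional.
Context {R : realType} {n : nat}.
Variable a : R.
Hypothesis a01 : 0 < a < 1.
Implicit Types (x y w : 'rV[R]_n) (h c D H : R) (i j : 'I_n).

(** Hölder partial derivatives imply differentiability in every direction: h w is traversed along
    the axes, each leg is estimated by the mean value inequality, and the partial derivatives vary
    little because [D] bounds the distance of all intermediate points from [x]. *)
Lemma is_derive_direction (f : 'rV[R]_n -> R) (g : 'I_n -> 'rV[R]_n -> R) H x w :
  (forall i y, is_derive y (ei i) f (g i y)) -> (forall i, chol a H (g i)) -> 0 <= H ->
  is_derive x w f (\sum_i w 0 i * g i x).
Proof.
move=> fg gH H0; have /andP[a0 a1] := a01.
have wc i : `|w 0 i| <= `|w| by exact: mx_entry_le.
pose N := n%:R * `|w|; have N0 : 0 <= N by rewrite mulr_ge0.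
apply: (@remainder_is_derive R _ f x w _ (n%:R * (`|w| * (n%:R * (H * N `^ a)))) 1 a ltr01 a0) => h h1.
have key (s : seq 'I_n) D y : (forall j, `|(y - x) 0 j| + (size s)%:R * (`|h| * `|w|) <= D) ->
   `|f (y + \sum_(i <- s) (h * w 0 i) *: ei i) - f y - h * \sum_(i <- s) w 0 i * g i x|
     <= (size s)%:R * (`|h| * `|w| * (n%:R * (H * D `^ a))).
  elim: s y => [|i s IH] y yD; first by rewrite !big_nil addr0 mulr0 subrr subr0 normr0 mul0r.
  have D0 : 0 <= D.
    by apply: le_trans (yD i); rewrite addr_ge0// mulr_ge0// mulr_ge0.
  rewrite !big_cons addrA; set y' := y + (h * w 0 i) *: ei i.
  have hy' j : `|(y' - x) 0 j| <= `|(y - x) 0 j| + `|h| * `|w|.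
    have -> : (y' - x) 0 j = (y - x) 0 j + (h * w 0 i) * (j == i)%:R.
      by rewrite /y' !mxE eqxx /= addrAC.
    apply: le_trans (ler_normD _ _) _; rewrite lerD2l !normrM.
    apply: (@le_trans _ _ (`|h| * `|w 0 i|)); last by rewrite ler_wpM2l.
    by case: (j == i); rewrite ?normr1 ?mulr1// normr0 mulr0 mulr_ge0.
  have st : `|f y' - f y - h * (w 0 i * g i x)| <= `|h| * `|w| * (n%:R * (H * D `^ a)).
    have d1 (r : R) : is_derive r (1 : R) (fun r => f (y + r *: ei i) - r * g i x) (g i (y + r *: ei i) - g i x).
      have d0 : is_derive r (1 : R) (fun r => f (y + r *: ei i)) (g i (y + r *: ei i)) by apply/is_derive_line.
      by apply: is_derive_eq; rewrite /GRing.scale /=; ring.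
    have := @mvt_norm R _ _ (h * w 0 i) (n%:R * (H * D `^ a)) (fun r _ => d1 r).
    rewrite scale0r addr0 mul0r subr0 -/y' => HM.
    have -> : f y' - f y - h * (w 0 i * g i x) = f y' - h * w 0 i * g i x - f y by ring.
    apply: le_trans (HM _) _; last first.
      rewrite mulrC; apply: ler_wpM2r; first by rewrite !mulr_ge0// powR_ge0.
      by rewrite normrM ler_wpM2l.
    move=> r rh.
    have -> : y + r *: ei i = x + (y + r *: ei i - x) by rewrite [RHS]addrC subrK.
    apply: (@chol_dist R n a a01 H (g i) x (y + r *: ei i - x) D (gH i) _ H0) => j.
    have -> : (y + r *: ei i - x) 0 j = (y - x) 0 j + r * (j == i)%:R.
      by rewrite !mxE eqxx /= addrAC.
    apply: le_trans (ler_normD _ _) _; apply: le_trans (yD j); rewrite lerD2l /= normrM.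
    apply: (@le_trans _ _ (`|h| * `|w|)).
      apply: (@le_trans _ _ `|r|); first by case: (j == i); rewrite ?normr1 ?mulr1// normr0 mulr0.
      by apply: le_trans rh _; rewrite normrM ler_wpM2l.
    by rewrite -natr1 mulrDl mul1r lerDr mulr_ge0// mulr_ge0.
  have h2 : `|f (y' + \sum_(i <- s) (h * w 0 i) *: ei i) - f y' - h * \sum_(i <- s) w 0 i * g i x|
     <= (size s)%:R * (`|h| * `|w| * (n%:R * (H * D `^ a))).
    apply: IH => j; apply: le_trans (yD j); rewrite /= -natr1 mulrDl mul1r.
    by have := hy' j; lra.
  rewrite /= -natr1 mulrDl mul1r [leRHS]addrC.
  have -> : f (y' + \sum_(j <- s) (h * w 0 j) *: ei j) - f y - h * (w 0 i * g i x + \sum_(j <- s) w 0 j * g j x) =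
     (f y' - f y - h * (w 0 i * g i x)) + (f (y' + \sum_(i <- s) (h * w 0 i) *: ei i) - f y' - h * \sum_(i <- s) w 0 i * g i x) by ring.
  by apply: le_trans (ler_normD _ _) _; exact: lerD.
have hw : h *: w = \sum_i (h * w 0 i) *: ei i.
  by rewrite [in LHS](row_coord_sum w) scaler_sumr; apply: eq_bigr => i _; rewrite scalerA.
have sz : size (index_enum 'I_n) = n by rewrite [index_enum _]unlock -enumT size_enum_ord.
have := key (index_enum 'I_n) (N * `|h|) x; rewrite -hw sz => /(_ _)/le_trans; apply.
  by move=> j; rewrite subrr mxE normr0 add0r /N -mulrA (mulrC `|w|).
rewrite powRM ?normr_ge0// le_eqVlt; apply/orP; left; apply/eqP; ring.
Qed.

End directional.

Section rotation.
Context {R : realType} {n : nat}.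
Variables (a B : R) (b : 'I_n -> 'rV[R]_n -> R).
Hypothesis a01 : 0 < a < 1.
Hypothesis bB : forall i x, `|b i x| <= B.
Hypothesis b_equivariant : forall (Q : 'M[R]_n) x j, Q *m Q^T = 1%:M -> b j (x *m Q) = \sum_i b i x * Q i j.
Implicit Types (x y : 'rV[R]_n) (t : R) (i j : 'I_n).

Lemma is_derive_mulmx (Q : 'M[R]_n) (f : 'rV[R]_n -> R) x i d :
  is_derive (x *m Q) (row i Q) f d -> is_derive x (ei i) (fun x => f (x *m Q)) d.
Proof.
move=> H; apply: is_derive_coordinate.
rewrite (_ : (fun h => _) = fun h : R => f (x *m Q + h *: row i Q)).
  by apply/is_derive_line; rewrite scale0r addr0.
by apply/funext => h; rewrite mulmxDl -scalemxAl -rowE.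
Qed.

(** The rotated function solves the same equation. One inequality is enough, since the transpose of
    [Q] is orthogonal as well and gives the other. *)
Lemma classical_rot_le u u1 u2 G (Q : 'M[R]_n) x t : classical a b u u1 u2 G -> Q *m Q^T = 1%:M ->
  (forall x, u (x *m Q) 0 = u x 0) -> 0 <= t -> u (x *m Q) t <= u x t.
Proof.
move=> C QQ u0 t0; have [du du1 dut ub uc] := C.
have G0 : 0 <= G by have [+ _ _ _] := ub 0 0 (lexx _); exact: le_trans.
pose w y s := u (y *m Q) s.
pose w1 i y s := \sum_j Q i j * u1 j (y *m Q) s.
pose w2 i y s := \sum_j Q i j * (\sum_k Q i k * u2 j k (y *m Q) s).
have c1 s : 0 <= s -> forall j, chol a (G + 2 * G) (u1 j ^~ s).
  move=> s0 j; have [] // : adm a G (G + 2 * G) (u1 j ^~ s).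
  apply: (adm_of_derive a01 (f' := fun k y => u2 j k y s)) => //.
  - by move=> y; have [_ + _ _] := ub y s s0.
  - by move=> k y; exact: du1.
  - by move=> k y; have [_ _ + _] := ub y s s0.
have dw i y s : 0 <= s -> is_derive y (ei i) (w ^~ s) (w1 i y s).
  move=> s0; apply: (@is_derive_mulmx Q (u ^~ s)).
  have := @is_derive_direction R n a a01 (u ^~ s) (fun j y => u1 j y s) (G + 2 * G) (y *m Q) (row i Q) (fun j y => du j y s s0) (c1 s s0).
  rewrite (eq_bigr (fun j => Q i j * u1 j (y *m Q) s)); last by move=> j _; rewrite mxE.
  by apply; lra.
have dw1 i y s : 0 <= s -> is_derive y (ei i) (w1 i ^~ s) (w2 i y s).
  move=> s0.
  have dj j : is_derive y (ei i) (fun y => Q i j * u1 j (y *m Q) s) (Q i j * (\sum_k Q i k * u2 j k (y *m Q) s)).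
    have d0 : is_derive y (ei i) (fun y => u1 j (y *m Q) s) (\sum_k Q i k * u2 j k (y *m Q) s).
      apply: (@is_derive_mulmx Q (u1 j ^~ s)).
      have := @is_derive_direction R n a a01 (u1 j ^~ s) (fun k y => u2 j k y s) G (y *m Q) (row i Q) (fun k y => du1 j k y s s0) (fun k => uc j k s s0) G0.
      by rewrite (eq_bigr (fun k => Q i k * u2 j k (y *m Q) s))// => k _; rewrite mxE.
    by apply: is_derive_eq; rewrite /GRing.scale /=; ring.
  rewrite /w1 (_ : (fun y0 => _) = \sum_j (fun y => Q i j * u1 j (y *m Q) s)); first exact: is_derive_sum.
  by apply/funext => y'; rewrite fct_sumE.
have w1_le i y s : 0 <= s -> `|w1 i y s| <= \sum_k \sum_j `|Q k j| * G.
  move=> s0; apply: le_trans (ler_norm_sum _ _ _) _; rewrite [X in _ <= X](bigD1 i)//= -[X in X <= _]addr0; apply: lerD.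
    by apply: ler_sum => j _; rewrite normrM ler_wpM2l//; have [] := ub (y *m Q) s s0.
  by apply: sumr_ge0 => k _; apply: sumr_ge0 => j _; rewrite mulr_ge0.
have CQ : C21 t w (fun y s => rhs b u1 u2 (y *m Q) s) w1 w2.
  split=> [|y s /andP[s0 _]|i y s /andP[s0 _]|i y s /andP[s0 _]].
  - apply: (@src_continuous R n a a01); apply: (@src_frozen R n a a01 G _ G) => //.
      move=> s /andP[s0 _]; apply: (adm_of_derive a01 (f' := fun i y => w1 i y s)).
      + by move=> y; have [] := ub (y *m Q) s s0.
      + by move=> i y; exact: dw.
      + by move=> i y; exact: w1_le.
      + by apply: sumr_ge0 => k _; apply: sumr_ge0 => j _; rewrite mulr_ge0.
    by move=> y s r /andP[s0 _] /andP[r0 _]; exact: (classical_lipschitz _ C).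
  - by apply: (@time_quotient_is_derive R n u (y *m Q)) => //; apply: dut; exact: ltW.
  - by apply: dw; exact: ltW.
  - by apply: dw1; exact: ltW.
have tt : 0 <= t <= t by rewrite t0 lexx.
rewrite -[leRHS]mul1r.
apply: (@classical_comparison R n a B b a01 bB u u1 u2 G t w _ w1 w2 1 G C CQ _ _ _ x t tt).
- by move=> y s /andP[s0 _]; apply: le_trans (ler_norm _) _; have [] := ub (y *m Q) s s0.
- by move=> y; rewrite mul1r /w u0.
move=> y s _ _; rewrite le_eqVlt; apply/orP; left; apply/eqP; rewrite /rhs; congr (_ + _).
  (* Orthonormality of the columns is what makes the trace of the Hessian invariant. *)
  have QTQ j k : \sum_i Q i j * Q i k = (j == k)%:R.
    have /matrixP/(_ j k) := mulmx1C QQ; rewrite !mxE => <-.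
    by apply: eq_bigr => i _; rewrite mxE.
  rewrite /w2 exchange_big /=.
  transitivity (\sum_j \sum_k (j == k)%:R * u2 j k (y *m Q) s).
    by apply: eq_bigr => j _; rewrite (bigD1 j)//= eqxx mul1r big1 ?addr0// => k /negbTE; rewrite eq_sym => ->; rewrite mul0r.
  apply: eq_bigr => j _.
  transitivity (\sum_i \sum_k Q i j * Q i k * u2 j k (y *m Q) s).
    by rewrite exchange_big; apply: eq_bigr => k _; rewrite -mulr_suml QTQ.
  by apply: eq_bigr => i _; rewrite mulr_sumr; apply: eq_bigr => k _; rewrite mulrA.
transitivity (\sum_j \sum_i b i y * Q i j * u1 j (y *m Q) s).
  by apply: eq_bigr => j _; rewrite b_equivariant// mulr_suml.
rewrite exchange_big; apply: eq_bigr => i _; rewrite /w1 mulr_sumr.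
by apply: eq_bigr => j _; rewrite mulrA.
Qed.

Lemma classical_rot u u1 u2 G t : classical a b u u1 u2 G -> rot_symmetric (u ^~ 0) -> 0 <= t -> rot_symmetric (u ^~ t).
Proof.
move=> C u0 t0 Q x QQ; apply/eqP; rewrite eq_le (classical_rot_le x C QQ)//=; last by move=> y; exact: u0.
have QTQ : Q^T *m Q^T^T = 1%:M by rewrite trmxK; exact: mulmx1C.
have := classical_rot_le (x *m Q) C QTQ (fun y => u0 _ y QTQ) t0.
by rewrite -mulmxA QQ mulmx1.
Qed.

End rotation.

Section reflection.
Context {R : realType} {n : nat}.
Implicit Types (x y : 'rV[R]_n) (f : 'rV[R]_n -> R).

Lemma dotvE x y : dotv x y = (x *m y^T) 0 0.
Proof. by rewrite mxE; apply: eq_bigr => i _; rewrite mxE. Qed.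

Lemma dotvC x y : dotv x y = dotv y x.
Proof. by apply: eq_bigr => i _; rewrite mulrC. Qed.

Lemma dotvDl x y z : dotv (x + y) z = dotv x z + dotv y z.
Proof. by rewrite -big_split; apply: eq_bigr => i _; rewrite mxE mulrDl. Qed.

Lemma dotvZl c x y : dotv (c *: x) y = c * dotv x y.
Proof. by rewrite mulr_sumr; apply: eq_bigr => i _; rewrite mxE mulrA. Qed.

Lemma dotvBl x y z : dotv (x - y) z = dotv x z - dotv y z.
Proof. by rewrite dotvDl -scaleN1r dotvZl mulN1r. Qed.

Lemma dotvDr x y z : dotv z (x + y) = dotv z x + dotv z y.
Proof. by rewrite !(dotvC z) dotvDl. Qed.

Lemma dotvZr c x y : dotv y (c *: x) = c * dotv y x.
Proof. by rewrite !(dotvC y) dotvZl. Qed.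

Lemma dotv_eq0 x : dotv x x = 0 -> x = 0.
Proof.
move=> h; apply/eqP; rewrite -normr_eq0; have := sqr_norm_le x; rewrite h => q.
by rewrite -sqrf_eq0 eq_le q sqr_ge0.
Qed.

(* The reflection in the hyperplane orthogonal to [x - y] exchanges [x] and [y]. *)
Lemma rot_symmetric_eq f x y : rot_symmetric f -> dotv x x = dotv y y -> f x = f y.
Proof.
move=> frot xy; have [->//|nxy] := eqVneq x y.
pose w := x - y; pose c := 2 / dotv w w.
have w0 : dotv w w != 0 by apply: contra nxy => /eqP/dotv_eq0/eqP; rewrite subr_eq0.
pose Q : 'M[R]_n := 1%:M - c *: (w^T *m w).
have QT : Q^T = Q by rewrite /Q linearB linearZ /= trmx1 trmx_mul trmxK.
have ww : w *m w^T = (dotv w w)%:M by rewrite [LHS]mx11_scalar -dotvE.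
have QQ : Q *m Q^T = 1%:M.
  have PP : w^T *m w *m (w^T *m w) = dotv w w *: (w^T *m w).
    by rewrite mulmxA -(mulmxA _ w) ww mul_mx_scalar -scalemxAl.
  rewrite QT /Q; set P := w^T *m w in PP *.
  rewrite mulmxBr mulmx1 mulmxBl mul1mx -scalemxAr -scalemxAl PP !scalerA.
  have -> : c * c * dotv w w = c + c by rewrite /c; field.
  by rewrite scalerDl opprB addrK subrK.
rewrite -(frot Q y QQ); congr f.
rewrite /Q mulmxBr mulmx1 -scalemxAr mulmxA.
have -> : y *m w^T = (dotv y w)%:M by rewrite [LHS]mx11_scalar -dotvE.
rewrite mul_scalar_mx scalerA.
have -> : c * dotv y w = - 1.
  have yw : dotv w w = - 2 * dotv y w.
    by rewrite /w !(dotvC _ (x - y)) !dotvBl !(dotvC _ (x - y)) !dotvBl xy (dotvC y x); ring.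
  by move: w0; rewrite /c yw mulf_eq0 negb_or => /andP[_ h]; field.
by rewrite scaleN1r opprK /w addrC subrK.
Qed.

(** By symmetry [y] may be replaced by the point of the same length on the ray through [x]. *)
Lemma rot_symmetric_radial f x y : rot_symmetric f -> radially_decreasing f -> dotv y y <= dotv x x -> f x <= f y.
Proof.
move=> frot fdec yx; have [x0|x0] := eqVneq (dotv x x) 0.
  have y0 : dotv y y = 0 by apply/eqP; rewrite eq_le dotv_ge0 andbT -x0.
  by rewrite (dotv_eq0 x0) (dotv_eq0 y0).
pose l := Num.sqrt (dotv y y / dotv x x).
have xp : 0 < dotv x x by rewrite lt_neqAle eq_sym x0 dotv_ge0.
have l1 : l <= 1 by rewrite -sqrtr1 ler_sqrt// ler_pdivrMr// mul1r.
rewrite (@rot_symmetric_eq f y (l *: x) frot).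
  by rewrite -[X in f X <= _]scale1r; apply: fdec => //; exact: sqrtr_ge0.
rewrite dotvZl dotvC dotvZl mulrA -expr2 sqr_sqrtr ?divfK//.
by rewrite divr_ge0 ?dotv_ge0.
Qed.

End reflection.

Lemma continuous_nonexpansive (R : realType) (V W : normedModType R) (f : V -> W) :
  (forall x y, `|f x - f y| <= `|x - y|) -> continuous f.
Proof.
move=> H x; apply/cvgrPdist_le => e e0; near=> y.
by apply: le_trans (H x y) _; near: y; apply: cvgr_dist_le.
Unshelve. all: by end_near. Qed.

(** * Radial monotonicity in doubled variables *)

Section radial.
Context {R : realType} {n : nat}.
Variables (a B : R) (b : 'I_n -> 'rV[R]_n -> R).
Hypothesis a01 : 0 < a < 1.
Hypothesis bB : forall i x, `|b i x| <= B.
Implicit Types (x y : 'rV[R]_n) (t : R) (i j : 'I_n).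

(* [u x - u y] solves a parabolic equation in the variable [(x, y)] on [|y| < |x|]
   and vanishes on [|x| = |y|]. *)
Lemma classical_radial u u1 u2 G x y t : classical a b u u1 u2 G -> (forall t, 0 <= t -> rot_symmetric (u ^~ t)) ->
  radially_decreasing (u ^~ 0) -> 0 <= t -> dotv y y <= dotv x x -> u x t <= u y t.
Proof.
move=> C rot dec t0 yx; have [du du1 dut ub uc] := C.
have G0 : 0 <= G by have [+ _ _ _] := ub 0 0 (lexx _); exact: le_trans.
pose l (X : 'rV[R]_(n + n)) := lsubmx X; pose r (X : 'rV[R]_(n + n)) := rsubmx X.
pose Dm : set 'rV[R]_(n + n) := [set X | dotv (r X) (r X) <= dotv (l X) (l X)].
pose v X s := u (l X) s - u (r X) s.
pose v1 (k : 'I_(n + n)) X s := match fintype.split k with inl j => u1 j (l X) s | inr j => - u1 j (r X) s end.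
pose v2 (k : 'I_(n + n)) X s := match fintype.split k with inl j => u2 j j (l X) s | inr j => - u2 j j (r X) s end.
pose b' (k : 'I_(n + n)) X := match fintype.split k with inl j => b j (l X) | inr j => b j (r X) end.
have ll X j h : l (X + h *: ei (lshift n j)) = l X + h *: ei j.
  by apply/rowP => k; rewrite !mxE eqxx eq_lshift.
have rl X j h : r (X + h *: ei (lshift n j)) = r X.
  by apply/rowP => k; rewrite !mxE eqxx eq_rlshift mulr0 addr0.
have lr X j h : l (X + h *: ei (rshift n j)) = l X.
  by apply/rowP => k; rewrite !mxE eqxx eq_lrshift mulr0 addr0.
have rr X j h : r (X + h *: ei (rshift n j)) = r X + h *: ei j.
  by apply/rowP => k; rewrite !mxE eqxx eq_rshift.
have cl : continuous l.
  apply: continuous_nonexpansive => X Y; apply: mx_norm_le => // i j.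
  by rewrite -linearB mxE; exact: mx_entry_le.
have cr : continuous r.
  apply: continuous_nonexpansive => X Y; apply: mx_norm_le => // i j.
  by rewrite -linearB mxE; exact: mx_entry_le.
have cg : continuous (fun X => dotv (r X) (r X) - dotv (l X) (l X)).
  apply: continuous_fun_sub => X.
    by apply: (@continuous_comp _ _ _ r (fun x => dotv x x)); [exact: cr|exact: continuous_dotv].
  by apply: (@continuous_comp _ _ _ l (fun x => dotv x x)); [exact: cl|exact: continuous_dotv].
have dline (f : 'rV[R]_n -> R) x' j d : is_derive x' (ei j) f d -> is_derive (0 : R) (1 : R) (fun h : R => f (x' + h *: ei j)) d.
  by move=> h; apply/is_derive_line; rewrite scale0r addr0.
have dv k X s : 0 <= s -> is_derive X (ei k) (v ^~ s) (v1 k X s).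
  move=> s0; apply: is_derive_coordinate; rewrite /v1 -{1}(splitK k); case: (fintype.split k) => j /=.
    rewrite (_ : (fun h => _) = fun h : R => u (l X + h *: ei j) s - u (r X) s).
      have h1 := dline _ _ _ _ (du j (l X) s s0).
      by apply: is_derive_eq; rewrite subr0.
    by apply/funext => h; rewrite /v ll rl.
  rewrite (_ : (fun h => _) = fun h : R => u (l X) s - u (r X + h *: ei j) s).
    have h1 := dline _ _ _ _ (du j (r X) s s0).
    have h2 : is_derive (0 : R) (1 : R) (fun _ : R => u (l X) s) 0 by exact: is_derive_cst.
    by have := is_deriveB h2 h1; rewrite sub0r.
  by apply/funext => h; rewrite /v lr rr.
have CV : C21 t v (fun X s => rhs b u1 u2 (l X) s - rhs b u1 u2 (r X) s) v1 v2.
  have Cu := classical_C21 a01 t0 C; split=> [|X s st|k X s /andP[s0 _]|k X s /andP[s0 _]].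
  - apply: (@src_continuous R (n + n) a a01); apply: (@src_frozen R (n + n) a a01 (G + G) _ (G + G)); rewrite ?addr_ge0//.
      move=> s /andP[s0 _]; apply: (@adm_of_derive R (n + n) a a01 _ G _ (fun k X => v1 k X s)) => //.
      + move=> X; apply: le_trans (ler_normB _ _) _; apply: lerD; first by have [] := ub (l X) s s0.
        by have [] := ub (r X) s s0.
      + by move=> k X; exact: dv.
      + move=> k X; rewrite /v1; case: (fintype.split k) => j; rewrite ?normrN.
          by have [_ + _ _] := ub (l X) s s0.
        by have [_ + _ _] := ub (r X) s s0.
    move=> X s s' /andP[s0 _] /andP[s'0 _]; rewrite mulrDl.
    have -> : v X s - v X s' = (u (l X) s - u (l X) s') - (u (r X) s - u (r X) s') by rewrite /v; ring.
    by apply: le_trans (ler_normB _ _) _; apply: lerD; exact: (classical_lipschitz _ C).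
  - have [_ dt _ _] := Cu; have h1 := dt (l X) s st; have h2 := dt (r X) s st.
    exact: is_derive_eq.
  - by apply: dv; exact: ltW.
  - apply: is_derive_coordinate; rewrite /v1 /v2; have := splitK k; case: (fintype.split k) => j /= kE.
      rewrite (_ : (fun h => _) = fun h : R => u1 j (l X + h *: ei j) s).
        exact: dline (du1 j j (l X) s (ltW s0)).
      by apply/funext => h; rewrite -kE ll.
    rewrite (_ : (fun h => _) = fun h : R => - u1 j (r X + h *: ei j) s).
      have h1 := dline _ _ _ _ (du1 j j (r X) s (ltW s0)).
      exact: is_derive_eq.
    by apply/funext => h; rewrite -kE rr.
have cDm : closed Dm.
  rewrite (_ : Dm = (fun X => dotv (r X) (r X) - dotv (l X) (l X)) @^-1` [set z | z <= 0]).
    by apply: preimage_closed; [move=> X _; exact: cg|exact: closed_le].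
  by apply/seteqP; split=> Y /=; rewrite subr_le0.
have b'B k X : `|b' k X| <= B by rewrite /b'; case: (fintype.split k) => j; exact: bB.
have tt : 0 <= t <= t by rewrite t0 lexx.
pose X := row_mx x y.
have lX : l X = x by rewrite /l row_mxKl.
have rX : r X = y by rewrite /r row_mxKr.
rewrite -subr_le0 -{1}lX -rX -/(v X t).
apply: (@maximum_principle R (n + n) t B (2 * G) v _ v1 v2 b' Dm CV cDm b'B _ _ _ _ X t _ tt).
- move=> Y s _ /andP[s0 _]; apply: le_trans (ler_norm _) _; apply: le_trans (ler_normB _ _) _.
  rewrite mulr_natl mulr2n; apply: lerD; first by have [] := ub (l Y) s s0.
  by have [] := ub (r Y) s s0.
- move=> Y DY; rewrite /v subr_le0; exact: (rot_symmetric_radial (rot 0 (lexx _))).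
- move=> Y s DY /andP[s0 _] vp.
  (* On |x| = |y| the difference vanishes by symmetry, so where it is positive the point is interior
     to the domain; this replaces a boundary condition. *)
  have : dotv (r Y) (r Y) < dotv (l Y) (l Y).
    rewrite lt_neqAle DY andbT; apply/eqP => E.
    by move: vp; rewrite /v (rot_symmetric_eq (rot s (ltW s0)) E) subrr ltxx.
  rewrite -subr_lt0 => h; have := @cvgr_lt _ _ _ _ _ _ (cg Y) _ h => /(_ _) H.
  by apply: filterS H => Z; rewrite /= subr_lt0 => /ltW.
- move=> Y s _ _ _; rewrite le_eqVlt; apply/orP; left; apply/eqP.
  have sl i : fintype.split (lshift n i) = inl i := unsplitK (inl i).
  have sr i : fintype.split (rshift n i) = inr i := unsplitK (inr i).
  have e1 : \sum_i v2 (lshift n i) Y s = \sum_i u2 i i (l Y) s by apply: eq_bigr => i _; rewrite /v2 sl.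
  have e2 : \sum_i v2 (rshift n i) Y s = - \sum_i u2 i i (r Y) s.
    by rewrite -sumrN; apply: eq_bigr => i _; rewrite /v2 sr.
  have e3 : \sum_i b' (lshift n i) Y * v1 (lshift n i) Y s = \sum_i b i (l Y) * u1 i (l Y) s.
    by apply: eq_bigr => i _; rewrite /b' /v1 sl.
  have e4 : \sum_i b' (rshift n i) Y * v1 (rshift n i) Y s = - \sum_i b i (r Y) * u1 i (r Y) s.
    by rewrite -sumrN; apply: eq_bigr => i _; rewrite /b' /v1 sr mulrN.
  rewrite /rhs !big_split_ord /= e1 e2 e3 e4; ring.
by rewrite /Dm /= lX rX.
Qed.

End radial.

(** * The weighted mass along an axis *)

Section segments.
Context {R : realType}.
Local Notation mu := (@lebesgue_measure R).
Implicit Types (f g F : R -> R) (c d r x : R).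

Lemma integrable_segment f c d : (forall s, c <= s <= d -> {for s, continuous f}) -> mu.-integrable `[c, d] (EFin \o f).
Proof.
move=> cf; apply: continuous_compact_integrable; first exact: segment_compact.
by apply: continuous_in_subspaceT => s; rewrite inE /= in_itv /=; exact: cf.
Qed.

Lemma Rintegral_FTC2 f F c d : c < d -> (forall s, c <= s <= d -> {for s, continuous f}) ->
  (forall s, c <= s <= d -> is_derive s (1 : R) F (f s)) -> \int[mu]_(s in `[c, d]) f s = F d - F c.
Proof. by move=> cd cf dF; rewrite /Rintegral (FTC2_segment cd cf dF). Qed.

Lemma is_derive_primitive f r : continuous f -> 0 < r -> is_derive r (1 : R) (fun r => \int[mu]_(s in `[0, r]) f s) (f r).
Proof.
move=> cf r0; have rr : r < r + 1 by rewrite ltrDl.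
have If : mu.-integrable `[0, r + 1] (EFin \o f) by apply: integrable_segment => s _; exact: cf.
have [d1 d2] := continuous_FTC1_closed rr If r0 (cf r).
by apply: DeriveDef; [exact: d1|move: d2; rewrite derive1E].
Qed.

(** The profile psi is determined by the continuous field only for positive radii; its value at 0 is
    arbitrary and does not affect the integral. *)
Lemma Rintegral_eq_off0 f g r : 0 <= r -> continuous f -> (forall s, 0 < s -> g s = f s) ->
  \int[mu]_(s in `[0, r]) g s = \int[mu]_(s in `[0, r]) f s.
Proof.
move=> r0 cf fg.
have If : mu.-integrable `]0, r] (EFin \o f).
  have h : mu.-integrable `[0, r] (EFin \o f) by apply: integrable_segment => s _; exact: cf.
  by apply: integrableS h => //; apply: subset_itvr; rewrite bnd_simp.
have Ig : mu.-integrable `]0, r] (EFin \o g).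
  apply: eq_integrable If => // s; rewrite inE /= in_itv /= => /andP[s0 _].
  by rewrite /= fg.
rewrite -!Rintegral_itv_obnd_cbnd//; apply: eq_Rintegral => s; rewrite inE /= in_itv /= => /andP[s0 _].
exact: fg.
Qed.

Lemma liminf_gt_ex (f : R -> R) (c : R) : (c%:E < limf_einf (fun r => (f r)%:E) (pinfty_nbhs R))%E ->
  exists2 k, c < k & exists A : R, forall r, A < r -> k <= f r.
Proof.
rewrite limf_einfE => /ereal_sup_gt[_ [A [M [_ HM]] <-]] cA.
have inf_le r : M < r -> (ereal_inf ((fun r => (f r)%:E) @` A) <= (f r)%:E)%E.
  by move=> Mr; apply: ereal_inf_lbound; exists r => //; exact: HM.
case E : (ereal_inf ((fun r => (f r)%:E) @` A)) cA => [k| |] cA.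
- exists k; first by rewrite -lte_fin.
  by exists M => r /inf_le; rewrite E lee_fin.
- by have := inf_le (M + 1); rewrite E ltrDl => /(_ ltr01); rewrite leye_eq.
- by move: cA; rewrite ltNge leNye.
Qed.

Lemma le_Rintegral_segment f g c d : (forall s, c <= s <= d -> {for s, continuous f}) ->
  (forall s, c <= s <= d -> {for s, continuous g}) -> (forall s, c <= s <= d -> f s <= g s) ->
  \int[mu]_(s in `[c, d]) f s <= \int[mu]_(s in `[c, d]) g s.
Proof.
move=> cf cg fg; apply: le_Rintegral; [exact: measurable_itv|exact: integrable_segment|exact: integrable_segment|].
by move=> s /=; rewrite in_itv /=; exact: fg.
Qed.

Lemma Rintegral_cst_segment (k : R) c d : c <= d -> \int[mu]_(s in `[c, d]) k = k * (d - c).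
Proof.
move=> cd; rewrite Rintegral_cst//; congr (_ * _).
have := @lebesgue_measure_itv R `[c, d]; rewrite /= lte_fin => h.
transitivity (fine (if c < d then (d%:E - c%:E)%E else 0%E)); first by congr fine; exact: h.
by case: ltP => [//|dc]; rewrite (_ : d = c) ?subrr//; apply/eqP; rewrite eq_le cd dc.
Qed.

End segments.

(** * The weight and its integrability *)

Section weight.
Context {R : realType}.
Local Notation mu := (@lebesgue_measure R).
Variables (n : nat) (phi : R -> R).
Hypothesis n1 : (1 <= n)%N.
Hypothesis cphi : continuous phi.
Implicit Types (r s : R).

Definition Phi r := \int[mu]_(s in `[0, r]) phi s.
(** r^(n-1) exp (- Phi r) for r > 0, the integrating factor of the radial operator; in this form its
    logarithmic derivative is visibly (n - 1) / r - phi r. *)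
Definition weight r := expR ((n%:R - 1) * ln r - Phi r).

Lemma weight_gt0 r : 0 < weight r. Proof. exact: expR_gt0. Qed.

Lemma is_derive_weight r : 0 < r -> is_derive r (1 : R) weight (weight r * ((n%:R - 1) / r - phi r)).
Proof.
move=> r0; have h1 := is_derive1_ln r0; have h2 := is_derive_primitive cphi r0.
have h3 : is_derive r (1 : R) (fun r => (n%:R - 1) * ln r - Phi r) ((n%:R - 1) / r - phi r).
  by apply: is_derive_eq; rewrite /GRing.scale /=; ring.
have := @is_derive1_comp R expR (fun r => (n%:R - 1) * ln r - Phi r) r _ _ (is_derive_expR _) h3.
by rewrite /weight.
Qed.

(** Phi r >= k ln r leaves the exponent (n - 1 - k) ln r, and with eta = k - n > 0 this is a power
    strictly below -1. The radius |A| + 2 guarantees ln r > 0. *)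
Lemma weight_tail : (exists2 k : R, n%:R < k & exists A : R, forall r, A < r -> k <= (ln r)^-1 * Phi r) ->
  exists2 eta : R, 0 < eta & exists2 A : R, 1 < A & forall r, A <= r -> weight r <= expR (- ((1 + eta) * ln r)).
Proof.
move=> [k nk [A HA]]; exists (k - n%:R); first by rewrite subr_gt0.
exists (`|A| + 2); first by rewrite ltr_wpDl// ltrDr.
move=> r Ar; have r1 : 1 < r by apply: lt_le_trans Ar; rewrite ltr_wpDl// ltrDr.
have lr : 0 < ln r by rewrite ln_gt0.
rewrite ler_expR; have := HA r; have : A < r by apply: lt_le_trans Ar; have := ler_norm A; lra.
move=> Ar' /(_ Ar'); rewrite mulrC ler_pdivlMr// => h; lra.
Qed.

Lemma weight_small (eta A e : R) : 0 < eta -> 1 < A -> (forall r, A <= r -> weight r <= expR (- ((1 + eta) * ln r))) ->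
  0 < e -> exists2 r, A <= r & weight r <= e.
Proof.
move=> eta0 A1 H e0; pose r := Num.max A (e^-1).
have r1 : 1 < r by rewrite lt_max A1.
have r0 : 0 < r by exact: lt_trans r1.
exists r; first by rewrite le_max lexx.
apply: le_trans (H r _) _; first by rewrite le_max lexx.
apply: (@le_trans _ _ (expR (- ln r))).
  by rewrite ler_expR lerN2 ler_peMl ?lerDl ?(ltW eta0)// ltW// ln_gt0.
rewrite expRN lnK ?posrE//.
by rewrite -[e in leRHS]invrK lef_pV2 ?posrE ?invr_gt0// le_max lexx orbT.
Qed.

(** Beyond A the weight is compared with s^(-1-eta), whose primitive - s^(-eta) / eta contributes at
    most 1 / eta. *)
Lemma weight_mass (eta A : R) : 0 < eta -> 1 < A -> (forall r, A <= r -> weight r <= expR (- ((1 + eta) * ln r))) ->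
  exists2 P : R, 0 < P & forall r, 1 < r -> \int[mu]_(s in `[1, r]) weight s <= P.
Proof.
move=> eta0 A1 H.
have cw s : 0 < s -> {for s, continuous weight} by move=> /is_derive_weight; exact: is_derive_continuous.
pose Q r := \int[mu]_(s in `[1, r]) weight s.
have Qmono r r' : 1 <= r -> r <= r' -> Q r <= Q r'.
  move=> r1 rr'; rewrite /Q.
  have I s : 1 <= s -> mu.-integrable `[1, s] (EFin \o weight).
    by move=> s1; apply: integrable_segment => x /andP[x1 _]; apply: cw; exact: lt_le_trans x1.
  rewrite -subr_ge0 Rintegral_itvB ?bnd_simp ?I ?(le_trans r1)//.
  by apply: Rintegral_ge0 => s _; exact/ltW/weight_gt0.
have tail r : A < r -> Q r <= Q A + eta^-1.
  move=> Ar; have rr : r < r + 1 by rewrite ltrDl.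
  have Ir : mu.-integrable `[1, r] (EFin \o weight).
    by apply: integrable_segment => x /andP[x1 _]; apply: cw; exact: lt_le_trans x1.
  rewrite -lerBlDl Rintegral_itvB ?bnd_simp ?(ltW A1) ?(ltW Ar)//.
  have pos s : A <= s -> 0 < s by move=> h; exact: lt_trans (lt_le_trans A1 h).
  pose T s := expR (- ((1 + eta) * ln s)).
  have dl s : A <= s <= r -> is_derive s (1 : R) (fun s => - (eta^-1 * expR (- (eta * ln s)))) (T s).
    move=> /andP[/pos s0 _]; have h1 := is_derive1_ln s0.
    have h2 : is_derive s (1 : R) (fun s => - (eta * ln s)) (- (eta / s)).
      by apply: is_derive_eq; rewrite /GRing.scale /=; ring.
    have h3 := @is_derive1_comp R expR (fun s => - (eta * ln s)) s _ _ (is_derive_expR _) h2.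
    have -> : T s = - (eta^-1 * (expR (- (eta * ln s)) * - (eta / s))).
      rewrite /T mulrDl mul1r opprD expRD (expRN (ln s)) lnK ?posrE//; field.
      by rewrite !gt_eqF.
    by apply: is_derive_eq; rewrite /GRing.scale /=; ring.
  have cT s : A <= s <= r -> {for s, continuous T}.
    move=> /andP[/pos s0 _]; have h1 := is_derive1_ln s0.
    have h2 : is_derive s (1 : R) (fun s => - ((1 + eta) * ln s)) (- ((1 + eta) / s)).
      by apply: is_derive_eq; rewrite /GRing.scale /=; ring.
    exact: is_derive_continuous (@is_derive1_comp R expR (fun s => - ((1 + eta) * ln s)) s _ _ (is_derive_expR _) h2).
  apply: (@le_trans _ _ (\int[mu]_(s in `[A, r]) T s)).
    rewrite Rintegral_itv_obnd_cbnd; last first.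
      apply: integrableS Ir => //; apply: subset_itvr; rewrite bnd_simp; exact: ltW.
    apply: le_Rintegral_segment => // s /andP[As sr]; [|by rewrite H//].
    by apply: cw; exact: pos.
  rewrite (Rintegral_FTC2 Ar cT dl) opprK addrC lerBlDr.
  apply: (@le_trans _ _ eta^-1); last by rewrite lerDl mulr_ge0 ?expR_ge0// invr_ge0 ltW.
  rewrite ler_piMr ?invr_ge0 ?(ltW eta0)// expRN_le1// mulr_ge0 ?(ltW eta0)// ltW// ln_gt0//.
exists (Q (A + 1) + eta^-1 + 1) => [|r r1].
  have : 0 <= Q (A + 1) by apply: Rintegral_ge0 => s _; exact/ltW/weight_gt0.
  by have : 0 < eta^-1 by [rewrite invr_gt0]; lra.
have QA : Q A <= Q (A + 1) by apply: Qmono; lra.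
have e0 : 0 < eta^-1 by rewrite invr_gt0.
rewrite -/(Q r); have [rA|Ar] := leP r A.
  by have := Qmono r A (ltW r1) rA; clearbody Q; lra.
by have := tail r Ar; clearbody Q; lra.
Qed.

End weight.

Lemma mean_value_lower {R : realDomainType} (m1 m2 x y g d : R) : 0 <= d -> m2 - m1 = (x - y) * d -> y <= 0 -> - g <= x ->
  m1 - g * d <= m2.
Proof.
move=> d0 /eqP; rewrite subr_eq => /eqP -> y0 gx.
have : 0 <= (x - y + g) * d by apply: mulr_ge0 => //; lra.
by rewrite !mulrDl; lra.
Qed.

(** * Flux and mass on the axis *)

Section radial_mass.
Context {R : realType} {n : nat}.
Local Notation mu := (@lebesgue_measure R).
Variables (a G L : R) (b : 'I_n -> 'rV[R]_n -> R) (phi : R -> R) (j : 'I_n).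
Variables (u : 'rV[R]_n -> R -> R) (u1 : 'I_n -> 'rV[R]_n -> R -> R) (u2 : 'I_n -> 'I_n -> 'rV[R]_n -> R -> R).
Hypothesis a01 : 0 < a < 1.
Hypothesis C : classical a b u u1 u2 G.
Hypothesis u_rot : forall t, 0 <= t -> rot_symmetric (u ^~ t).
Hypothesis u_rad : forall x y t, 0 <= t -> dotv y y <= dotv x x -> u x t <= u y t.
Hypothesis rhs_hoelder : forall x s t, 0 <= s -> 0 <= t -> `|rhs b u1 u2 x s - rhs b u1 u2 x t| <= L * `|s - t| `^ (a / 2).
Hypothesis L0 : 0 <= L.
Hypothesis cphi : continuous phi.
Hypothesis bphi : forall r, b j (r *: ei j) = - phi r.
Implicit Types (x y : 'rV[R]_n) (r s t : R) (i : 'I_n).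

Let G0 : 0 <= G.
Proof. by case: C => _ _ _ + _ => /(_ 0 0 (lexx _))[+ _ _ _]; exact: le_trans. Qed.

Let u1_chol i t : 0 <= t -> chol a (G + 2 * G) (u1 i ^~ t).
Proof.
move=> t0; case: C => _ du1 _ ub _.
have [] // : adm a G (G + 2 * G) (u1 i ^~ t).
apply: (adm_of_derive a01 (f' := fun k y => u2 i k y t)) => //.
- by move=> y; have [_ + _ _] := ub y t t0.
- by move=> k y; exact: du1.
- by move=> k y; have [_ _ + _] := ub y t t0.
Qed.

(* [s |-> u (x + s tau)] is even for [tau] tangent to the sphere through [x]. *)
Lemma gradient_radial i x t : 0 <= t -> x 0 j * u1 i x t = x 0 i * u1 j x t.
Proof.
move=> t0; have [->//|ij] := eqVneq i j.
pose tau := x 0 j *: ei i - x 0 i *: ei j : 'rV[R]_n.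
have GG : 0 <= G + 2 * G by have := G0; lra.
have [du _ _ _ _] := C.
have dd w := @is_derive_direction R n a a01 (u ^~ t) (fun k y => u1 k y t) (G + 2 * G) x w
  (fun k y => du k y t t0) (fun k => u1_chol k t0) GG.
have dsum : \sum_k tau 0 k * u1 k x t = x 0 j * u1 i x t - x 0 i * u1 j x t.
  rewrite (bigD1 i)//= (bigD1 j) 1?eq_sym//= big1 ?addr0.
    by rewrite /tau !mxE !eqxx (negbTE ij) eq_sym (negbTE ij) !mulr1 !mulr0 subr0 sub0r mulNr.
  by move=> k /andP[ki kj]; rewrite /tau !mxE !eqxx (negbTE ki) (negbTE kj) !mulr0 subrr mul0r.
have d1 := dd tau; rewrite dsum in d1.
have d2 := dd (- tau).
have d2sum : \sum_k (- tau) 0 k * u1 k x t = - (x 0 j * u1 i x t - x 0 i * u1 j x t).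
  by rewrite -dsum -sumrN; apply: eq_bigr => k _; rewrite mxE mulNr.
rewrite d2sum in d2.
have xt : dotv x tau = 0.
  rewrite /dotv (bigD1 i)//= (bigD1 j) 1?eq_sym//= big1 ?addr0.
    by rewrite /tau !mxE !eqxx (negbTE ij) eq_sym (negbTE ij) !mulr1 !mulr0 subr0 sub0r; ring.
  by move=> k /andP[ki kj]; rewrite /tau !mxE !eqxx (negbTE ki) (negbTE kj) !mulr0 subrr mulr0.
clearbody tau.
have even : (fun s : R => u (x + s *: tau) t) = (fun s : R => u (x + s *: (- tau)) t).
  apply/funext => s; apply: (rot_symmetric_eq (u_rot t0)).
  have E s' : dotv (x + s' *: tau) (x + s' *: tau) = dotv x x + s' * s' * dotv tau tau.
    by rewrite !(dotvDl, dotvDr, dotvZl, dotvZr) (dotvC tau x) xt; ring.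
  by rewrite scalerN -scaleNr !E mulrNN.
have e1 : is_derive (0 : R) (1 : R) (fun s : R => u (x + s *: tau) t) (x 0 j * u1 i x t - x 0 i * u1 j x t).
  by apply/(@is_derive_line _ _ _ (u ^~ t)); rewrite scale0r addr0.
have e2 : is_derive (0 : R) (1 : R) (fun s : R => u (x + s *: (- tau)) t) (- (x 0 j * u1 i x t - x 0 i * u1 j x t)).
  by apply/(@is_derive_line _ _ _ (u ^~ t)); rewrite scale0r addr0.
by have := is_derive_unique_eq e1 e2 even; lra.
Qed.

Lemma axis_coord r i : (r *: ei j : 'rV[R]_n) 0 i = r * (i == j)%:R.
Proof. by rewrite !mxE eqxx. Qed.

Lemma tangential_gradient r i t : 0 < r -> 0 <= t -> i != j -> u1 i (r *: ei j) t = 0.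
Proof.
move=> r0 t0 ij; have := gradient_radial i (r *: ei j) t0.
rewrite !axis_coord eqxx (negbTE ij) mulr1 mulr0 mul0r => /eqP.
by rewrite mulf_eq0 gt_eqF//= => /eqP.
Qed.

(** At r e_j + h e_i the identity [gradient_radial] reads r u_i = h u_j; it is differentiated at h =
    0. *)
Lemma tangential_hessian r i t : 0 < r -> 0 <= t -> i != j -> u2 i i (r *: ei j) t = u1 j (r *: ei j) t / r.
Proof.
move=> r0 t0 ij; have [_ du1 _ _ _] := C; set x := r *: ei j : 'rV[R]_n.
have dl k : is_derive (0 : R) (1 : R) (fun h : R => u1 k (x + h *: ei i) t) (u2 k i x t).
  by apply/(@is_derive_line _ _ _ (u1 k ^~ t)); rewrite scale0r addr0; exact: du1.
have di := dl i; have dj := dl j.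
have e1 : is_derive (0 : R) (1 : R) (fun h : R => r * u1 i (x + h *: ei i) t) (r * u2 i i x t).
  by apply: is_derive_eq; rewrite /GRing.scale /=; ring.
have e2 : is_derive (0 : R) (1 : R) (fun h : R => h * u1 j (x + h *: ei i) t) (u1 j x t).
  have -> : u1 j x t = 0 * u2 j i x t + u1 j (x + (0 : R) *: ei i) t * 1 by rewrite scale0r addr0; ring.
  exact: (is_deriveM (is_derive_id (0 : R) (1 : R)) dj).
have E : (fun h : R => r * u1 i (x + h *: ei i) t) = (fun h : R => h * u1 j (x + h *: ei i) t).
  apply/funext => h; have := gradient_radial i (x + h *: ei i) t0.
  rewrite !mxE !eqxx /= (negbTE ij) eq_sym (negbTE ij) !mulr1 !mulr0 addr0 add0r; exact.
by rewrite -(is_derive_unique_eq e1 e2 E) mulrC mulKf// gt_eqF.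
Qed.

Let W r t := u (r *: ei j) t.
Let Wr r t := u1 j (r *: ei j) t.
Let F r t := rhs b u1 u2 (r *: ei j) t.

(** The n - 1 tangential second derivatives produce the term (n - 1) / r, and the drift acts only
    radially because tangential first derivatives vanish on the axis. *)
Lemma rhs_axis r t : 0 < r -> 0 <= t -> F r t = u2 j j (r *: ei j) t + ((n%:R - 1) / r - phi r) * Wr r t.
Proof.
move=> r0 t0; rewrite /F /rhs (bigD1 j)//= [X in _ + X](bigD1 j)//= bphi.
rewrite [X in _ + (_ + X)]big1 ?addr0; last by move=> i ij; rewrite tangential_gradient// mulr0.
rewrite (eq_bigr (fun=> Wr r t / r)); last by move=> i ij; rewrite tangential_hessian.
rewrite sumr_const.
have -> : #|(fun i : 'I_n => i != j)| = n.-1 by rewrite cardC1 card_ord.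
have n0 : (0 < n)%N by case: n j => // -[].
rewrite -[_ *+ n.-1]mulr_natl -subn1 natrB//.
have E (A c d w v : R) : A + (c - d) * (w / v) + - phi r * w = A + ((c - d) / v - phi r) * w by ring.
exact: E.
Qed.

Lemma axis_line (f : 'rV[R]_n -> R) r d : is_derive (r *: ei j) (ei j) f d -> is_derive r (1 : R) (fun r => f (r *: ei j)) d.
Proof.
move=> h; have -> : (fun r : R => f (r *: ei j)) = (fun r : R => f (0 + r *: ei j)) by apply/funext => s; rewrite add0r.
by apply/is_derive_line; rewrite add0r.
Qed.

Lemma is_derive_W r t : 0 <= t -> is_derive r (1 : R) (W ^~ t) (Wr r t).
Proof. by move=> t0; apply: (@axis_line (u ^~ t)); case: C => + _ _ _ _; exact. Qed.

Lemma is_derive_Wr r t : 0 <= t -> is_derive r (1 : R) (Wr ^~ t) (u2 j j (r *: ei j) t).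
Proof. by move=> t0; apply: (@axis_line (u1 j ^~ t)); case: C => _ + _ _ _; exact. Qed.

Lemma Wr_le0 r t : 0 < r -> 0 <= t -> Wr r t <= 0.
Proof.
move=> r0 t0; rewrite leNgt; apply/negP => d0.
have /cvgrPdist_lt/(_ _ d0)/dnbhs0_ex[e e0 H] := is_derive_quotient (is_derive_W r t0).
pose k := e / 2; have k0 : 0 < k by rewrite divr_gt0.
have := H k; rewrite gt_eqF// gtr0_norm// => /(_ isT); rewrite /k => /(_ _) h.
have {}h : `|Wr r t - k^-1 * (W (r + k) t - W r t)| < Wr r t by apply: h; lra.
have : W (r + k) t <= W r t.
  apply: u_rad => //; rewrite !dotvZl !dotvZr !mulrA -!expr2.
  rewrite ler_wpM2r ?dotv_ge0//; apply: lerXn2r; rewrite ?nnegrE ?lerDl ?addr_ge0// ltW//.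
move=> Wk; have : k^-1 * (W (r + k) t - W r t) <= 0 by rewrite mulr_ge0_le0 ?invr_ge0 ?(ltW k0)// subr_le0.
by move: h; rewrite ltr_norml; lra.
Qed.

Let p := @weight R n phi.

Lemma continuous_F r t : 0 < r -> 0 <= t -> {for r, continuous (F ^~ t)}.
Proof.
move=> r0 t0.
have cu2 : continuous (fun r : R => u2 j j (r *: ei j) t).
  have [a0 _] := andP a01; case: C => _ _ _ _ uc.
  apply: (@hoelder_continuous R _ G a a0) => x y.
  have := uc j j t t0 (y *: ei j) j (x - y); rewrite -scalerDl (addrC y) subrK; exact.
have cE : {for r, continuous (fun r => u2 j j (r *: ei j) t + ((n%:R - 1) / r - phi r) * Wr r t)}.
  apply: continuousD; first exact: cu2.
  apply: continuousM; last exact: is_derive_continuous (is_derive_Wr r t0).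
  apply: continuousB; last exact: cphi.
  by apply: cvgMl_tmp; apply: inv_continuous; rewrite gt_eqF.
suff : F s t @[s --> r] --> F r t by [].
have -> : F r t = u2 j j (r *: ei j) t + ((n%:R - 1) / r - phi r) * Wr r t by exact: rhs_axis.
apply: cvg_trans cE; apply: near_eq_cvg; near=> s; rewrite /= rhs_axis//.
by near: s; exact: lt_nbhsr.
Unshelve. all: by end_near. Qed.

(** Multiplied by the integrating factor, the radial operator is the derivative of p Wr. *)
Lemma flux r R' t : 0 < r -> r < R' -> 0 <= t -> \int[mu]_(s in `[r, R']) (p s * F s t) = p R' * Wr R' t - p r * Wr r t.
Proof.
move=> r0 rR t0.
have pos s : r <= s <= R' -> 0 < s by case/andP => h _; exact: lt_le_trans h.
apply: (@Rintegral_FTC2 R (fun s => p s * F s t) (fun s => p s * Wr s t)) => [//|s /pos s0|s /pos s0].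
  by apply: continuousM; [exact: is_derive_continuous (is_derive_weight n cphi s0)|exact: continuous_F].
have h1 := is_derive_weight n cphi s0; have h2 := is_derive_Wr s t0.
by apply: is_derive_eq; rewrite /GRing.scale /= rhs_axis// /p; ring.
Qed.

(** The remainder is uniform in x thanks to the Hölder continuity of the time derivative, so in
    [mass_derive] it may be integrated against the weight. *)
Lemma time_increment x s h : 0 < s -> `|h| < s -> `|u x (s + h) - u x s - h * rhs b u1 u2 x s| <= L * (`|h| * `|h| `^ (a / 2)).
Proof.
move=> s0 hs; have [_ _ ut _ _] := C; have /andP[a0 _] := a01.
pose f k := u x (s + k) - k * rhs b u1 u2 x s.
have df (k : R) : `|k| <= `|h| -> is_derive k (1 : R) f (rhs b u1 u2 x (s + k) - rhs b u1 u2 x s).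
  move=> kh; have sk : 0 < s + k by move: kh; rewrite ler_norml; lra.
  have h1 := time_quotient_is_derive sk (ut x _ (ltW sk)).
  have h2 : is_derive k (1 : R) (fun k : R => s + k) 1.
    by have := is_deriveD (is_derive_cst s k (1 : R)) (is_derive_id k (1 : R)); rewrite add0r.
  have h3 := @is_derive1_comp R (u x) (fun k => s + k) k _ _ h1 h2.
  rewrite mulr1 in h3.
  have h4 : is_derive k (1 : R) (fun k => k * rhs b u1 u2 x s) (rhs b u1 u2 x s).
    by apply: is_derive_eq; rewrite /GRing.scale /=; ring.
  exact: (is_deriveB h3 h4).
have := @mvt_norm R f _ h (L * `|h| `^ (a / 2)) df.
rewrite /f addr0 mul0r subr0 => H.
have -> : u x (s + h) - u x s - h * rhs b u1 u2 x s = u x (s + h) - h * rhs b u1 u2 x s - u x s by ring.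
apply: le_trans (H _) _; last by rewrite le_eqVlt; apply/orP; left; apply/eqP; ring.
move=> k kh; have sk : 0 <= s + k by move: kh; rewrite ler_norml; lra.
apply: le_trans (rhs_hoelder x sk (ltW s0)) _; rewrite ler_wpM2l// addrAC subrr add0r.
by apply: ge0_ler_powR; rewrite ?nnegrE ?divr_ge0// ltW.
Qed.

Lemma continuous_W r t : 0 <= t -> {for r, continuous (W ^~ t)}.
Proof. by move=> t0; exact: is_derive_continuous (is_derive_W r t0). Qed.

Lemma continuous_p r : 0 < r -> {for r, continuous p}.
Proof. by move=> r0; exact: is_derive_continuous (is_derive_weight n cphi r0). Qed.

Lemma mass_derive r s : 1 < r -> 0 < s ->
  is_derive s (1 : R) (fun s => \int[mu]_(q in `[1, r]) (p q * W q s)) (p r * Wr r s - p 1 * Wr 1 s).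
Proof.
move=> r1 s0; have /andP[a0 _] := a01.
have a20 : 0 < a / 2 by rewrite divr_gt0.
have s20 : 0 < s / 2 by rewrite divr_gt0.
have pos q : 1 <= q <= r -> 0 < q by case/andP => h _; exact: lt_le_trans h.
have r1' : 1 <= r by exact: ltW.
rewrite -(flux ltr01 r1 (ltW s0)).
pose P := \int[mu]_(q in `[1, r]) p q.
apply: (@remainder_is_derive R R _ s 1 _ (L * P) (s / 2) (a / 2) s20 a20) => h hs.
have hs' : `|h| < s by apply: le_lt_trans hs _; lra.
have sh0 : 0 <= s + h by move: hs'; rewrite ltr_norml; lra.
have -> : s + h *: (1 : R) = s + h by rewrite [h *: _]mulr1.
have cp q : 1 <= q <= r -> {for q, continuous p} by move=> /pos; exact: continuous_p.
have cW t q : 0 <= t -> 1 <= q <= r -> {for q, continuous (fun q => p q * W q t)}.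
  by move=> t0 qr; apply: continuousM; [exact: cp|exact: continuous_W].
have cF q : 1 <= q <= r -> {for q, continuous (fun q => p q * F q s)}.
  by move=> qr; apply: continuousM; [exact: cp|apply: continuous_F; [exact: pos|exact: ltW]].
have I1 : mu.-integrable `[1, r] (EFin \o (fun q => p q * W q (s + h))) by apply: integrable_segment => q; exact: cW.
have I2 : mu.-integrable `[1, r] (EFin \o (fun q => p q * W q s)) by apply: integrable_segment => q; exact/cW/ltW.
have I3 : mu.-integrable `[1, r] (EFin \o (fun q => p q * F q s)) by apply: integrable_segment => q; exact: cF.
rewrite -RintegralZl// -!RintegralB//; last 2 first.
- exact: integrableB_real.
- exact: integrableZ_real.
pose c := L * (`|h| * `|h| `^ (a / 2)).
have c0 : 0 <= c by rewrite /c; nonneg.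
have -> : L * P * (`|h| * `|h| `^ (a / 2)) = \int[mu]_(q in `[1, r]) (c * p q).
  by rewrite RintegralZl//; [rewrite /c /P; ring|exact: integrable_segment].
apply: (@le_trans _ _ (\int[mu]_(q in `[1, r]) `|p q * W q (s + h) - p q * W q s - h * (p q * F q s)|)).
  apply: le_normr_Rintegral => //; apply: integrableB_real => //; last exact: integrableZ_real.
  exact: integrableB_real.
have cpp q : 1 <= q <= r -> {for q, continuous (fun q => c * p q)}.
  by move=> qr; apply: cvgMl_tmp; exact: cp.
apply: le_Rintegral_segment => // q qr.
  apply: continuous_comp; last exact: norm_continuous.
  apply: continuousB; last by apply: cvgMl_tmp; exact: cF.
  by apply: continuousB; apply: cW => //; exact: ltW.
have -> : p q * W q (s + h) - p q * W q s - h * (p q * F q s) = p q * (W q (s + h) - W q s - h * F q s) by ring.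
rewrite normrM gtr0_norm ?weight_gt0// mulrC ler_wpM2r ?(ltW (weight_gt0 _ _ _))//.
exact: time_increment.
Qed.

(** By monotonicity Wr <= 0, so the inner boundary r = 1 can only add mass; what is lost at the
    outer end is at most the weight there times the gradient bound G per unit of time. *)
Lemma mass_lower r t : 1 < r -> 1 <= t ->
  \int[mu]_(q in `[1, r]) (p q * W q 1) - p r * G * (t - 1) <= \int[mu]_(q in `[1, r]) (p q * W q t).
Proof.
move=> r1; rewrite le_eqVlt => /orP[/eqP<-|t1]; first by rewrite subrr mulr0 subr0.
have t0 : 0 < t by exact: lt_trans t1.
have dM s (s1 : 1 <= s) := mass_derive r1 (lt_le_trans ltr01 s1).
have [||c] := @MVT R (fun s => \int[mu]_(q in `[1, r]) (p q * W q s)) (fun s => p r * Wr r s - p 1 * Wr 1 s) 1 t t1.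
- by move=> s; rewrite in_itv /= => /andP[s1 _]; apply: dM; exact: ltW.
- apply: derivable_within_continuous => s; rewrite in_itv /= => /andP[s1 _].
  by have [] := dM s s1.
rewrite in_itv /= => /andP[c1 ct] E.
have c0 : 0 <= c by exact: le_trans (ltW c1).
have h1 : p 1 * Wr 1 c <= 0 by rewrite mulr_ge0_le0 ?(ltW (weight_gt0 _ _ _))// Wr_le0.
have h2 : - (p r * G) <= p r * Wr r c.
  rewrite -mulrN ler_wpM2l ?(ltW (weight_gt0 _ _ _))//.
  by case: C => _ _ _ /(_ (r *: ei j) c c0)[_ /(_ j) + _ _] _; rewrite ler_norml => /andP[].
by apply: mean_value_lower E h1 h2; rewrite subr_ge0 ltW.
Qed.

(** The mass at time t is at most u 0 t times the total weight P, and at least the mass at time 1 up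
    to the outer flux, which vanishes along suitable radii. *)
Lemma sup_bounded_below : (forall x t, 0 < t -> 0 < u x t) ->
  (exists2 k : R, n%:R < k & exists A : R, forall r, A < r -> k <= (ln r)^-1 * Phi phi r) ->
  exists2 c : R, 0 < c & forall t, 1 <= t -> c <= u 0 t.
Proof.
move=> upos hk; have [eta eta0 [A A1 HA]] := weight_tail hk.
have [P P0 HP] := weight_mass cphi eta0 A1 HA.
have pos q r : 1 <= q <= r -> 0 < q by case/andP => h _; exact: lt_le_trans h.
have cW t r q : 0 <= t -> 1 <= q <= r -> {for q, continuous (fun q => p q * W q t)}.
  by move=> t0 qr; apply: continuousM; [apply: continuous_p; exact: pos qr|exact: continuous_W].
have IW t r : 0 <= t -> mu.-integrable `[1, r] (EFin \o (fun q => p q * W q t)).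
  by move=> t0; apply: integrable_segment => q; exact: cW.
pose M0 := \int[mu]_(q in `[1, A]) (p q * W q 1).
(* The mass is taken at time 1 because the initial value may vanish on [1, A]; a positive minimum on
   this compact interval bounds it below. *)
have M00 : 0 < M0.
  have [q0 q0A qmin] : exists2 q0, 1 <= q0 <= A & forall q, 1 <= q <= A -> p q0 * W q0 1 <= p q * W q 1.
    have cc : {within `[1, A], continuous (fun q => p q * W q 1)}.
      by apply: continuous_in_subspaceT => q; rewrite inE /= in_itv /=; exact: cW.
    have [q0 q0A Hq] := EVT_min (ltW A1) cc; exists q0 => [|q qA]; first by move: q0A; rewrite in_itv.
    by apply: Hq; rewrite in_itv.
  have m0 : 0 < p q0 * W q0 1 by rewrite mulr_gt0 ?weight_gt0// upos.
  apply: (@lt_le_trans _ _ (p q0 * W q0 1 * (A - 1))); first by rewrite mulr_gt0// subr_gt0.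
  rewrite -Rintegral_cst_segment ?(ltW A1)//; apply: le_Rintegral_segment => //.
    by move=> s _; exact: cst_continuous.
  by move=> s; exact: cW.
exists (M0 / P) => [|t t1]; first by rewrite divr_gt0.
have t0 : 0 <= t by exact: le_trans t1.
rewrite ler_pdivrMr//; apply/ler_addgt0Pr => e e0.
have Gt0 : 0 < G * (t - 1) + 1 by rewrite ltr_wpDl// mulr_ge0// subr_ge0.
(* The outer radius depends on t and e: it makes the loss accumulated between times 1 and t at most
   e. The added 1 avoids division by zero. *)
have [r rA rsmall] := weight_small eta0 A1 HA (divr_gt0 e0 Gt0).
have r1 : 1 < r by exact: lt_le_trans rA.
have h1 : M0 <= \int[mu]_(q in `[1, r]) (p q * W q 1).
  rewrite -subr_ge0 Rintegral_itvB ?bnd_simp ?IW ?(ltW A1)//.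
  apply: Rintegral_ge0 => s /=; rewrite in_itv /= => /andP[s1 _].
  by rewrite mulr_ge0 ?(ltW (weight_gt0 _ _ _))// ltW// upos.
have h2 := mass_lower r1 t1.
have h3 : p r * G * (t - 1) <= e.
  have : weight n phi r * (G * (t - 1) + 1) <= e by rewrite -ler_pdivlMr.
  by have := weight_gt0 n phi r; rewrite /p; nra.
have h4 : \int[mu]_(q in `[1, r]) (p q * W q t) <= u 0 t * P.
  apply: (@le_trans _ _ (\int[mu]_(q in `[1, r]) (u 0 t * p q))).
    apply: le_Rintegral_segment => [q|q qr|q _]; first exact: cW.
      by apply: cvgMl_tmp; apply: continuous_p; exact: pos qr.
    rewrite mulrC ler_wpM2r ?(ltW (weight_gt0 _ _ _))//.
    by apply: u_rad => //; rewrite (_ : dotv 0 0 = 0) ?dotv_ge0// /dotv big1// => i _; rewrite mxE mul0r.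
  rewrite RintegralZl//; last by apply: integrable_segment => q qr; apply: continuous_p; exact: pos qr.
  rewrite ler_wpM2l ?HP//; apply: le_trans (_ : 0 <= u 0 t); rewrite ?lexx// ltW// upos//.
  exact: lt_le_trans t1.
by apply: le_trans h1 _; lra.
Qed.

End radial_mass.

(** * Convergence *)

Section asymptotics.
Context {R : realType} {n : nat}.
Variables (a B G c0 : R) (b : 'I_n -> 'rV[R]_n -> R).
Variables (u : 'rV[R]_n -> R -> R) (u1 : 'I_n -> 'rV[R]_n -> R -> R) (u2 : 'I_n -> 'I_n -> 'rV[R]_n -> R -> R).
Hypothesis a01 : 0 < a < 1.
Hypothesis B0 : 0 <= B.
Hypothesis bB : forall i x, `|b i x| <= B.
Hypothesis C : classical a b u u1 u2 G.
Hypothesis u_max : forall x t, 0 <= t -> u x t <= u 0 t.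
Hypothesis c00 : 0 < c0.
Hypothesis u_low : forall t, 1 <= t -> c0 <= u 0 t.
Implicit Types (x y : 'rV[R]_n) (s t e : R).

(** The solution restarted at time s has supremum u 0 s, which the maximum principle preserves as an
    upper bound. *)
Lemma origin_nonincreasing s t : 0 <= s -> s <= t -> u 0 t <= u 0 s.
Proof.
move=> s0 st; have := classical_le a01 bB 0 (classical_shift s0 C) (K := u 0 s) (t := t - s).
rewrite subrKC subr_ge0; apply=> // x.
by rewrite addr0; exact: u_max.
Qed.

Lemma origin_limit : exists l : R, [/\ c0 <= l, forall t, 0 <= t -> l <= u 0 t &
  forall e, 0 < e -> exists2 T, 0 <= T & forall t, T <= t -> u 0 t < l + e].
Proof.
pose S : set R := [set u 0 t | t in [set t : R | 0 <= t]].
have lb t : 0 <= t -> c0 <= u 0 t.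
  move=> t0; have [t1|/ltW t1] := leP 1 t; first exact: u_low.
  by apply: le_trans (u_low (lexx 1)) _; exact: origin_nonincreasing.
have Slb : lbound S c0 by move=> _ [t t0 <-]; exact: lb.
have S0 : S !=set0 by exists (u 0 0); exists 0 => //=.
have hS : has_inf S by split => //; exists c0.
exists (inf S); split.
- exact: lb_le_inf.
- by move=> t t0; apply: ge_inf; [exists c0|exists t].
move=> e e0; have [_ [T T0 <-] HT] := inf_adherent e0 hS.
by exists T => // t Tt; apply: le_lt_trans HT; exact: origin_nonincreasing.
Qed.

(* Where [u 0 t - u] is large near [x], [spreading] makes it bounded below at the
   origin one unit of time later, so that [u 0 (t + 1)] would drop below [l]. *)
Lemma locally_uniform_lower l x e : (forall t, 0 <= t -> l <= u 0 t) ->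
  (forall e, 0 < e -> exists2 T, 0 <= T & forall t, T <= t -> u 0 t < l + e) -> 0 < e ->
  exists2 T, 0 <= T & forall t, T <= t -> l - e <= u x t.
Proof.
move=> ul lu e0; have /andP[a0 _] := a01.
have G0 : 0 <= G + 2 * G.
  by have [_ _ _ + _] := C => /(_ 0 0 (lexx _))[h _ _ _]; have := le_trans (normr_ge0 _) h; lra.
pose H := n%:R * (G + 2 * G) + 1; have H0 : 0 < H by rewrite ltr_wpDl// mulr_ge0.
have e20 : 0 < e / 2 by rewrite divr_gt0.
have [r r0 Hr] := powR_small a0 (divr_gt0 e20 H0).
have [c c_gt0 sp] := @spreading R n a B r _ _ 1 a01 B0 r0 (sqrtr_ge0 (dotv x x)) e20 ltr01.
have [T T0 HT] := lu c c_gt0.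
exists T => // t Tt; rewrite leNgt; apply/negP => ut.
have t0 : 0 <= t by exact: le_trans Tt.
(* u 0 t - u, restarted at time t, is a nonnegative solution. The constant c of [spreading] depends
   neither on this solution nor on t, and has been fixed before T. *)
have Cw := classical_opp_cst (u 0 t) (classical_shift t0 C).
suff : c <= u 0 t - u 0 (t + 1).
  have := HT t Tt; have := ul (t + 1) (addr_ge0 t0 ler01); lra.
apply: (sp b _ _ _ _ x 0 bB Cw) => [y|y yr|].
- by rewrite addr0 subr_ge0; exact: u_max.
- have yr' i : `|(y - x) 0 i| <= r.
    have := le_trans (sqr_coord_le (y - x) i) yr; rewrite -[X in X <= _]real_normK ?num_real//.
    by rewrite ler_pXn2r// nnegrE ltW.
  have [_ Hc] := classical_adm a01 C t0.
  have := @chol_dist R n a a01 _ (u ^~ t) x (y - x) r Hc yr' G0.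
  have -> : x + (y - x) = y by rewrite addrC subrK.
  have h2 : n%:R * ((G + 2 * G) * r `^ a) <= e / 2.
    rewrite mulrA; apply: (@le_trans _ _ (H * r `^ a)); first by rewrite ler_wpM2r ?powR_ge0// /H lerDl.
    by rewrite mulrC -ler_pdivlMr//; apply: Hr; rewrite lexx ltW.
  rewrite addr0 ler_norml => /andP[_ h].
  by have := ul t t0; lra.
by rewrite sqr_sqrtr ?dotv_ge0// sub0r -scaleN1r dotvZl dotvZr; lra.
Qed.

(** The supremum is attained at the origin for all t >= 0, and u x t tends to the same limit l for
    every x; so the infimum on the right is taken over a singleton. *)
Lemma asymptotics : [/\ cvg (sup (range (u ^~ t)) @[t --> +oo]),
    forall x, cvg (u x t @[t --> +oo]),
    lim (sup (range (u ^~ t)) @[t --> +oo]) = inf (range (fun x => lim (u x t @[t --> +oo])))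
  & 0 < inf (range (fun x => lim (u x t @[t --> +oo])))].
Proof.
have [l [c0l ul lu]] := origin_limit.
have cu x : u x t @[t --> +oo] --> l.
  apply/cvgrPdist_le => e e0; have [T T0 HT] := locally_uniform_lower x ul lu e0.
  have [T' T'0 HT'] := lu e e0.
  near=> t; have Tt : T <= t by near: t; apply: nbhs_pinfty_ge; exact: num_real.
  have T't : T' <= t by near: t; apply: nbhs_pinfty_ge; exact: num_real.
  have := HT t Tt; have := HT' t T't; have := u_max x (le_trans T0 Tt); rewrite ler_norml; lra.
have cs : sup (range (u ^~ t)) @[t --> +oo] --> l.
  apply: cvg_trans (cu 0); apply: near_eq_cvg; near=> t.
  have t0 : 0 <= t by near: t; apply: nbhs_pinfty_ge; exact: num_real.
  apply/eqP; rewrite eq_le; apply/andP; split.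
    by apply: ub_le_sup; [exists (u 0 t) => _ [x _ <-]; exact: u_max|exists 0].
  by apply: ge_sup; [exists (u 0 t), 0|move=> _ [x _ <-]; exact: u_max].
have -> : (fun x => lim (u x t @[t --> +oo])) = (fun=> l) by apply/funext => x; exact/cvg_lim.
have -> : range (fun _ : 'rV[R]_n => l) = [set l].
  by apply/seteqP; split => [_ [x _ <-]//|_ ->]; exists 0.
rewrite inf1; split; [by apply/cvg_ex; exists l|by move=> x; apply/cvg_ex; exists l|exact/cvg_lim|exact: lt_le_trans c0l].
Unshelve. all: by end_near. Qed.

End asymptotics.

(** * The radial drift and the conclusion *)

Section drift.
Context {R : realType} {n : nat}.
Implicit Types (x y : 'rV[R]_n) (i j : 'I_n) (psi : R -> R).

Definition drift psi i x : R := - radial_field psi x 0 i.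

Lemma dotv_mulmx (Q : 'M[R]_n) x y : Q *m Q^T = 1%:M -> dotv (x *m Q) (y *m Q) = dotv x y.
Proof.
have E z w : dotv z w = (z *m w^T) 0 0 by rewrite mxE; apply: eq_bigr => i _; rewrite mxE.
by move=> QQ; rewrite !E trmx_mul mulmxA -(mulmxA x) QQ mulmx1.
Qed.

(** Orthogonal maps preserve the length, and the field is a scalar function of the length times
    x. *)
Lemma drift_equivariant psi (Q : 'M[R]_n) x j : Q *m Q^T = 1%:M ->
  drift psi j (x *m Q) = \sum_i drift psi i x * Q i j.
Proof.
move=> QQ; rewrite /drift /radial_field /enorm dotv_mulmx// !mxE !mulr_sumr -sumrN.
by apply: eq_bigr => i _; rewrite !mxE mulNr !mulrA.
Qed.

Lemma drift_axis psi j (r : R) : 0 < r -> radial_field psi (r *: ei j : 'rV[R]_n) 0 j = psi r.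
Proof. by move=> r0; rewrite /radial_field enorm_ei !mxE !eqxx mulr1 gtr0_norm// mulVf ?mulr1// gt_eqF. Qed.

Lemma drift_adm a psi : C_alpha a (fun x : 'rV[R]_n => - radial_field psi x) ->
  exists B Hb : R, [/\ 0 <= B, 0 <= Hb & forall i, adm a B Hb (drift psi i)].
Proof.
move=> [/bounded_fun_ex[B hB] [K hK]].
exists B, `|K|; split=> [||i]; [exact: le_trans (normr_ge0 _) (hB 0)|exact: normr_ge0|].
have E x : drift psi i x = (- radial_field psi x) 0 i by rewrite [in RHS]mxE.
split=> [x|x k h]; first by rewrite E; apply: le_trans (hB x); exact: mx_entry_le.
have := hK (x + h *: ei k) x; rewrite (addrC x) addrK enorm_ei => H.
apply: le_trans (le_trans H _); last by rewrite ler_wpM2r ?powR_ge0// ler_norm.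
rewrite !E; set P := - _; set Q := - radial_field psi x.
by have := mx_entry_le (P - Q) 0 i; rewrite mxE [X in P 0 i + X]mxE.
Qed.

End drift.

Theorem theorem2p2 (R : realType) (n : nat) (hn : (1 <= n)%N)
    (a : R) (ha0 : 0 < a) (ha1 : a < 1)
    (psi : R -> R)
    (hb : C_alpha a (fun x : 'rV[R]_n => - radial_field psi x))
    (hpsi : (n%:R%:E <
      limf_einf
        (fun r : R =>
           ((ln r)^-1 *
             (\int[lebesgue_measure]_(rho in `[0%R, r]) psi rho)%R)%:E)
        (pinfty_nbhs R))%E)
    (u0 : 'rV[R]_n -> R)
    (hu0 : C_2alpha a u0)
    (hu0_ge0 : forall x, 0 <= u0 x)
    (hu0_neq0 : exists x, u0 x <> 0)
    (hu0_rot : rot_symmetric u0)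
    (hu0_dec : radially_decreasing u0) :
  exists u : 'rV[R]_n -> R -> R,
    [/\ positive_solution a psi u0 u,
        forall v : 'rV[R]_n -> R -> R, positive_solution a psi u0 v ->
          forall x t, 0 <= t -> v x t = u x t,
        forall t, 0 <= t -> rot_symmetric (u ^~ t)
      & [/\ cvg (sup (range (u ^~ t)) @[t --> +oo]),
            forall x, cvg (u x t @[t --> +oo]),
            lim (sup (range (u ^~ t)) @[t --> +oo])
              = inf (range (fun x => lim (u x t @[t --> +oo])))
          & 0 < inf (range (fun x => lim (u x t @[t --> +oo])))]].
Proof.
have a01 : 0 < a < 1 by rewrite ha0 ha1.
have [B [Hb [B0 Hb0 badm]]] := drift_adm hb.
have bB (i : 'I_n) (x : 'rV[R]_n) : `|drift psi i x| <= B by have [h _] := badm i; exact: h.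
have [u [u1 [u2 [N [H [G [H0 s1 s2 st [C u_0]]]]]]]] := exists_classical a01 B0 Hb0 badm hu0.
have u_init : u ^~ 0 = u0 by exact/funext.
have rot t : 0 <= t -> rot_symmetric (u ^~ t).
  apply: (classical_rot a01 bB _ C) => [Q x j|]; first exact: drift_equivariant.
  by rewrite u_init.
have rad x y t : 0 <= t -> dotv y y <= dotv x x -> u x t <= u y t.
  by apply: (classical_radial a01 bB C rot); rewrite u_init.
have pos x t : 0 < t -> 0 < u x t.
  apply: (classical_pos a01 B0 bB C) => [y|]; first by rewrite u_0.
  by have [y uy] := hu0_neq0; exists y; rewrite u_0.
have [Cu pde] := classical_parabolic a01 H0 s1 s2 st C.
exists u; split=> //.
- split=> // x t t0; have [-> -> ->] := pde x t t0; congr (_ + _).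
  by rewrite /dotv -sumrN; apply: eq_bigr => i _; rewrite [in RHS]mxE mulNr.
- move=> v [Cv _ pdev v0] x t t0; have [G' C'] := parabolic_classical a01 Cv pdev.
  by apply: (classical_unique a01 bB x C' C) => // y; rewrite u_0.
pose j := Ordinal hn.
(* The odd extension of psi with value 0 at 0: unlike psi it is continuous on the whole line, being
   a component of the field along an axis. *)
pose phi r : R := radial_field psi (r *: ei j : 'rV[R]_n) 0 j.
have cphi : continuous phi.
  apply: (@hoelder_continuous R _ Hb a ha0) => r s; have [_ /(_ (s *: ei j) j (r - s))] := badm j.
  by rewrite -scalerDl (addrC s) subrK /drift -opprD normrN.
(* The maximum with 0 ensures r > 0, where psi and [phi] have the same integral over [0, r]. *)
have h_phi : exists2 k : R, n%:R < k & exists A : R, forall r, A < r -> k <= (ln r)^-1 * Phi phi r.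
  have [k nk [A HA]] := liminf_gt_ex hpsi; exists k => //; exists (Num.max A 0) => r.
  rewrite gt_max => /andP[Ar r0]; have := HA r Ar.
  by rewrite (Rintegral_eq_off0 (f := phi) (ltW r0) cphi)// => s s0; rewrite /phi drift_axis.
have rhs_hoelder x s t : 0 <= s -> 0 <= t ->
    `|rhs (drift psi) u1 u2 x s - rhs (drift psi) u1 u2 x t| <= H * `|s - t| `^ (a / 2).
  by have [_ +] := st; exact.
have [c c0 low] := sup_bounded_below a01 C rot rad rhs_hoelder H0 cphi (fun=> erefl) pos h_phi.
apply: (asymptotics a01 B0 bB C _ c0 low) => x t t0.
by apply: rad => //; rewrite (_ : dotv 0 0 = 0) ?dotv_ge0// /dotv big1// => i _; rewrite mxE mul0r.
Qed.
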